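(* Let $m\ge2$ and consider the continuous balls-in-urns model described in the context, with quantities $L_1(n),\dots,L_m(n)$ of the $m$ different colors present at step $n$. The proportions $(P_1(n),\dots,P_m(n))$ of the different colors present converge almost surely as $n\to\infty$ to a limit $(P_1,\dots,P_m)\sim\mathrm{Dirichlet}(\frac12,\frac12,\dots,\frac12)$. Moreover, conditional on $(P_1,\dots,P_m)$, the indices $I(1),I(2),\dots$ are independent and identically distributed with $$\mathbb P(I(1)=i\mid P_1,\dots,P_m)=P_i,\qquad 1\le i\le m.$$ Finally, conditional on $(P_1,\dots,P_m)$, for each $1\le i\le m$ the sequence of additions to color $i$ (including the initial quantity $L_i(0)$ as its first term) is distributed as the sequence of inter-jump times (the first being measured from $0$) of an inhomogeneous Poisson process on $[0,\infty)$ with rate $t$ at time $t$, rescaled by $\sqrt{P_i}$.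
   Context: The balls-in-urns model. The initial quantities are $(L_1(0),\dots,L_m(0))=C(0)\cdot(P_1(0),\dots,P_m(0))$, where $C(0)^2\sim\mathrm{Gamma}(\frac{m+1}2,\frac12)$ and $(P_1(0),\dots,P_m(0))\sim\mathrm{Dirichlet}(1,\dots,1)$ are independent. ($\mathrm{Gamma}(\alpha,\theta)$ has density $\theta^\alpha x^{\alpha-1}e^{-\theta x}/\Gamma(\alpha)$ on $[0,\infty)$.) For $n\ge0$ write $C(n)=\sum_{i=1}^mL_i(n)$ and $P_i(n)=L_i(n)/C(n)$. Given the process up to step $n$, at step $n+1$ select an index $I(n+1)\in\{1,\dots,m\}$ with $I(n+1)=i$ with conditional probability $P_i(n)$. Independently of $I(n+1)$, sample $A(n+1)>0$ which, conditional on $C(n)=c$, has density in $a>0$ proportional to $(a+c)\exp(-\frac12(a+c)^2+\frac12c^2)$. Both choices depend on the past only through $(L_1(n),\dots,L_m(n))$. Set $L_j(n+1)=L_j(n)+A(n+1)$ if $j=I(n+1)$ and $L_j(n+1)=L_j(n)$ otherwise. The additions to color $i$ are, in order, $L_i(0)$ followed by those $A(n)$, $n\ge1$, with $I(n)=i$. *)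

(* Defs.v *)
From HB Require Import structures.
From mathcomp Require Import all_boot all_order all_algebra.
From mathcomp Require Import all_classical all_reals all_analysis.

Set Implicit Arguments.
Unset Strict Implicit.
Unset Printing Implicit Defensive.

Import Order.TTheory GRing.Theory Num.Theory.
Import numFieldNormedType.Exports.

Local Open Scope classical_set_scope.
Local Open Scope ring_scope.

Section distributions.
Context {d : measure_display} {T : measurableType d} {R : realType}.
Variable P : probability T R.

Definition Gamma_fun (a : R) : R :=
  \int[@lebesgue_measure R]_(x in `]0, +oo[) (x `^ (a - 1) * expR (- x)).

Definition gamma_density (a theta x : R) : R :=
  theta `^ a * x `^ (a - 1) * expR (- theta * x) / Gamma_fun a.

Definition is_gamma (a theta : R) (X : T -> R) : Prop :=
  forall B : set R, measurable B ->
    P (X @^-1` B) =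
    (\int[@lebesgue_measure R]_(x in B `&` `[0%R, +oo[)
       (gamma_density a theta x)%:E)%E.

(* The integral of f over R^k with respect to Lebesgue measure, as an iterated
   integral; a point of R^k is given by its list of coordinates. *)
Fixpoint iterated_integral (k : nat) (f : seq R -> \bar R) : \bar R :=
  if k is k'.+1
  then (\int[@lebesgue_measure R]_x
          iterated_integral k' (fun s => f (x :: s)))%E
  else f [::].

(* For s of size m - 1, the point (s_0, ..., s_(m-2), 1 - sum s): the last
   coordinate is the default value of nth. *)
Definition simplex_point (m : nat) (s : seq R) : m.-tuple R :=
  [tuple nth (1 - \sum_(y <- s) y) s i | i < m].

Definition dirichlet_density (m : nat) (alpha : 'I_m -> R) (x : m.-tuple R) : R :=
  if [forall i, 0 < tnth x i] then
    Gamma_fun (\sum_i alpha i) / (\prod_i Gamma_fun (alpha i)) *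
    \prod_i (tnth x i `^ (alpha i - 1))
  else 0.

(* The density is taken with respect to Lebesgue measure in the first m - 1
   coordinates. *)
Definition is_dirichlet (m : nat) (alpha : 'I_m -> R) (X : T -> m.-tuple R) : Prop :=
  forall B : set (m.-tuple R), measurable B ->
    P (X @^-1` B) =
    iterated_integral m.-1 (fun s =>
      (\1_B (simplex_point m s) *
       dirichlet_density alpha (simplex_point m s))%:E).

Definition independent_rv {d1 d2 : measure_display} {T1 : measurableType d1}
    {T2 : measurableType d2} (X : T -> T1) (Y : T -> T2) : Prop :=
  forall (B1 : set T1) (B2 : set T2), measurable B1 -> measurable B2 ->
    P (X @^-1` B1 `&` Y @^-1` B2) = (P (X @^-1` B1) * P (Y @^-1` B2))%E.

Definition sigma_of {d1 : measure_display} {T1 : measurableType d1}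
    (X : T -> T1) : set (set T) :=
  preimage_set_system setT X measurable.

(* f is a version of the conditional probability P(E | G), where G is a
   sub-sigma-algebra of T. *)
Definition is_cond_prob (G : set (set T)) (E : set T) (f : T -> R) : Prop :=
  (forall B : set R, measurable B -> G (f @^-1` B)) /\
  (forall D : set T, G D -> P (E `&` D) = (\int[P]_(w in D) (f w)%:E)%E).

(* Conditionally on G, the variables X 1, X 2, ... are i.i.d. and take the
   value v with probability p v; X 0 is not part of the sequence. *)
Definition cond_iid (G : set (set T)) (V : Type) (X : nat -> T -> V)
    (p : V -> T -> R) : Prop :=
  forall (J : seq nat), uniq J -> all (leq 1) J -> forall v : nat -> V,
    is_cond_prob G [set w | forall k, k \in J -> X k w = v k]
      (fun w => \prod_(k <- J) p (v k) w).

(* The product sigma-algebra on R^nat. *)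
Definition seq_measurable : set (set (nat -> R)) :=
  <<s [set E | exists (k : nat) (B : set R),
                 measurable B /\ E = [set x | B (x k)]] >>.

End distributions.

Section poisson_process.
Context {d : measure_display} {T : measurableType d} {R : realType}.
Variable Q : probability T R.

(* N t is the number of points in [0, t]; only t >= 0 matters. The nat
   argument of the library's poisson_prob has no effect on its value. *)
Record poisson_process (rate : R -> R) (N : R -> T -> nat) : Prop := {
  pp_measurable : forall (t : R) (k : nat), 0 <= t ->
    measurable [set w | N t w = k] ;
  pp_zero : forall w, N 0 w = 0%N ;
  pp_nondecreasing : forall w (s t : R), 0 <= s -> s <= t -> (N s w <= N t w)%N ;
  pp_right_continuous : forall w (t : R), 0 <= t ->
    \forall s \near t^'+, N s w = N t w ;
  pp_poisson : forall (s t : R) (k : nat), 0 <= s -> s <= t ->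
    Q [set w | (N t w - N s w)%N = k] =
    poisson_prob (\int[@lebesgue_measure R]_(u in `[s, t]) rate u) k [set k] ;
  pp_independent_increments : forall (n : nat) (t : nat -> R) (k : nat -> nat),
    0 <= t 0%N -> (forall j, t j <= t j.+1) ->
    Q [set w | forall j, (j < n)%N -> (N (t j.+1) w - N (t j) w)%N = k j] =
    (\prod_(j < n) Q [set w | (N (t j.+1) w - N (t j) w)%N = k j])%E
}.

(* The (k+1)-st jump time, jumps being counted with their size. *)
Definition jump_time (N : R -> T -> nat) (k : nat) (w : T) : R :=
  inf [set t : R | 0 <= t /\ (k < N t w)%N].

Definition interjump_time (N : R -> T -> nat) (k : nat) (w : T) : R :=
  if k is k'.+1 then jump_time N k w - jump_time N k' w else jump_time N 0 w.

End poisson_process.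

Section urn.
Context {d : measure_display} {T : measurableType d} {R : realType}.
Variable P : probability T R.
Variable m : nat.
(* L i n is the quantity of color i at step n; I n and A n, n >= 1, are the
   index selected and the amount added at step n. I 0 and A 0 are not used. *)
Variables (L : 'I_m -> nat -> {RV P >-> R}) (I : nat -> T -> 'I_m)
  (A : nat -> {RV P >-> R}).

Definition total (n : nat) (w : T) : R := \sum_i L i n w.

Definition proportion (i : 'I_m) (n : nat) (w : T) : R := L i n w / total n w.

Definition proportions (n : nat) (w : T) : m.-tuple R :=
  [tuple proportion i n w | i < m].

(* The sigma-algebra generated by the process up to step n. *)
Definition history (n : nat) : set (set T) :=
  <<s [set E | [\/ exists (i : 'I_m) (B : set R),
                     measurable B /\ E = L i 0%N @^-1` B,
                   exists (k : nat) (i : 'I_m),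
                     (1 <= k <= n)%N /\ E = I k @^-1` [set i] |
                   exists (k : nat) (B : set R),
                     [/\ (1 <= k <= n)%N, measurable B & E = A k @^-1` B]]] >>.

Definition addition_weight (c a : R) : R :=
  (a + c) * expR (- (a + c) ^+ 2 / 2 + c ^+ 2 / 2).

(* The distribution on ]0, +oo[ with density proportional to
   addition_weight c. *)
Definition addition_law (c : R) (B : set R) : R :=
  (\int[@lebesgue_measure R]_(a in B `&` `]0, +oo[) addition_weight c a) /
  (\int[@lebesgue_measure R]_(a in `]0, +oo[) addition_weight c a).

Record urn_model : Prop := {
  urn_index_measurable : forall n i, measurable (I n @^-1` [set i]) ;
  urn_total0_ge0 : forall w, 0 <= total 0 w ;
  urn_total0_law :
    is_gamma P ((m%:R + 1) / 2) (1 / 2) (fun w => total 0 w ^+ 2) ;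
  urn_proportions0_law : is_dirichlet P (fun _ => 1) (proportions 0) ;
  urn_initial_independent : independent_rv P (total 0) (proportions 0) ;
  (* the factorization expresses that I (n+1) and A (n+1) are conditionally
     independent given the history *)
  urn_step_law : forall (n : nat) (i : 'I_m) (B : set R), measurable B ->
    is_cond_prob P (history n) (I n.+1 @^-1` [set i] `&` A n.+1 @^-1` B)
      (fun w => proportion i n w * addition_law (total n w) B) ;
  urn_step : forall (n : nat) (j : 'I_m) w,
    L j n.+1 w = if j == I n.+1 w then L j n w + A n.+1 w else L j n w
}.

(* Term 0 is L i 0; term k >= 1 is A n for the step n at which color i is
   selected for the k-th time, or 0 if there is no such step. *)
Definition additions (i : 'I_m) (k : nat) (w : T) : R :=
  if k is 0 then L i 0%N w
  else xget 0 [set a | exists n : nat,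
         [/\ (1 <= n)%N, I n w = i,
             (\sum_(1 <= l < n.+1) (I l w == i))%N = k & a = A n w]].

End urn.

(* Main.v *)
(** The initial quantities have density proportional to C exp(- C^2 / 2) on the
    orthant. Writing levy s x = s x^(-3/2) exp(- s^2 / (2 x)), the convolution
    identity levy a * levy b = sqrt (2 pi) levy (a + b) makes this density a
    mixture of products of the levy (l_i) (x_i) over the simplex of the x's, in
    which the law of x is Dirichlet(1/2, ..., 1/2). The transitions of the urn act
    on the same mixture: the law of any finite stretch of the urn is a mixture over
    x of i.i.d. selections with law x and independent additions to each color i,
    distributed as the inter-jump times of the Poisson process scaled by
    sqrt (x_i).

    It remains to identify the mixing variable with the limit of the proportions.
    The total C_n has an explicit law, with E C_n^(-4) = O(n^(-2)); this bounds the
    variance of the increments of the proportions and gives convergence along the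
    cubes, then between them. Given an event of the past, the moments of the limit
    are the probabilities of future selections, and they determine its joint law
    with this event. Infinitely many selections of each color then give the law of
    the sequence of additions. *)

Require Import Defs.
From HB Require Import structures.
From mathcomp Require Import all_boot all_order all_algebra.
From mathcomp Require Import all_classical all_reals all_analysis.
From mathcomp Require Import measurable_realfun ring lra zify.
(* Imported again: ssrbool also has a [total]. *)
Import Defs.

Set Implicit Arguments.
Unset Strict Implicit.
Unset Printing Implicit Defensive.

Import Order.TTheory GRing.Theory Num.Theory.
Import numFieldNormedType.Exports.

Local Open Scope classical_set_scope.
Local Open Scope ring_scope.

(** Given x, color i is selected with probability x_i and its quantity then grows by a gap with
    hazard s / x_i at s. The factor x_j of a selection cancels the 1 / x_j of the hazard, so that an
    addition to color j turns the product of the [levy (l_i) (x_i)] into l_j times the same product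
    at the new quantities. The weight of x given the past is therefore this product at the current
    quantities, whatever path led to them, and by convolution its integral over the simplex is a
    constant times c exp (- c ^ 2 / 2), where c is the total. Ratios of these integrals are the
    transition: l_j / c times the density (a + c) exp (- (a + c) ^ 2 / 2 + c ^ 2 / 2). The mixing
    point is not a random variable on the given space: the mixture only yields probabilities of
    events on finitely many steps. The limit thus has to be built path by path, and its law jointly
    with a past event is read off from selections made ever later. The Poisson process is in turn
    known only through its counts, hence the detour by boxes of jump times. *)

(** * Images of densities, generators, Lebesgue measure on tuples *)

Section weighted_law.
Import HBNNSimple.
Local Open Scope ereal_scope.
Context d1 d2 (X : measurableType d1) (Y : measurableType d2) (R : realType).
Variables (mu : {measure set X -> \bar R}) (w : X -> R) (phi : X -> Y).
Hypotheses (w0 : forall x, (0 <= w x)%R) (mw : measurable_fun setT w)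
  (mphi : measurable_fun setT phi).

(* The proofs are arguments only to let the measure instance be inferred. *)
Definition weighted_law of (forall x, (0 <= w x)%R) & measurable_fun setT w &
    measurable_fun setT phi :=
  fun S : set Y => \int[mu]_(x in phi @^-1` S) (w x)%:E.

Let m := weighted_law w0 mw mphi.

Let mpre S : measurable S -> measurable (phi @^-1` S).
Proof. by move=> mS; rewrite -[X in measurable X]setTI; exact: mphi. Qed.

Let mwE : measurable_fun setT (EFin \o w).
Proof. exact/measurable_EFinP. Qed.

Let m0 : m set0 = 0.
Proof. by rewrite /m /weighted_law preimage_set0 integral_set0. Qed.

Let m_ge0 S : 0 <= m S.
Proof. by apply: integral_ge0 => x _; rewrite lee_fin. Qed.

Let m_sigma_additive : semi_sigma_additive m.
Proof.
move=> F mF tF mUF.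
rewrite /m /weighted_law preimage_bigcup ge0_integral_bigcup//.
- apply: is_cvg_ereal_nneg_natsum_cond => n _ _; exact: m_ge0.
- by move=> n; exact: mpre.
- exact: measurable_funTS.
- by move=> x _; rewrite lee_fin.
- apply/trivIsetP => /= i j _ _ ij; rewrite -preimage_setI.
  by move/trivIsetP : tF => /(_ _ _ _ _ ij) ->//; rewrite preimage_set0.
Qed.

HB.instance Definition _ := isMeasure.Build _ _ _ m m0 m_ge0 m_sigma_additive.

(** Most measures compared below are of this kind, density and image at once: an equality between
    integrals of arbitrary nonnegative functions reduces to an equality of two such measures on a
    pi-system. The proof is the usual passage through simple functions and monotone limits. *)
Lemma weighted_law_integral (f : Y -> \bar R) : measurable_fun setT f ->
  (forall y, 0 <= f y) ->
  \int[m]_y f y = \int[mu]_x ((w x)%:E * f (phi x)).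
Proof.
move=> mf f0.
pose f_ := nnsfun_approx measurableT mf.
have mphif n : measurable_fun setT (f_ n \o phi) by exact: measurableT_comp.
transitivity (limn (fun n => \int[m]_y (f_ n y)%:E)).
  rewrite -monotone_convergence//.
  - apply: eq_integral => y _; apply/esym/cvg_lim => //.
    by apply: cvg_nnsfun_approx.
  - by move=> n; exact/measurable_EFinP.
  - by move=> n y _; rewrite lee_fin.
  - by move=> y _ a b ab; rewrite lee_fin; exact/lefP/nd_nnsfun_approx.
transitivity (limn (fun n => \int[mu]_x ((w x)%:E * (f_ n (phi x))%:E))); last first.
  rewrite -monotone_convergence//; first last.
  - move=> x _ a b ab; rewrite lee_wpmul2l// ?lee_fin//.
    exact/lefP/nd_nnsfun_approx.
  - by move=> n x _; rewrite mule_ge0// lee_fin.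
  - by move=> n; apply: emeasurable_funM => //; exact/measurable_EFinP/mphif.
  apply: eq_integral => x _; apply/cvg_lim => //.
  by apply: cvgeZl => //; apply: cvg_nnsfun_approx.
congr (limn _); apply/funext => n.
transitivity (\sum_(k \in range (f_ n))
    \int[mu]_x (k%:E * ((w x)%:E * (\1_((f_ n \o phi) @^-1` [set k]) x)%:E))).
  under eq_integral do rewrite fimfunE -fsumEFin//.
  rewrite ge0_integral_fsum//; last 2 first.
  - by move=> y; exact/measurable_EFinP/measurable_funM.
  - by move=> y x _; rewrite nnfun_muleindic_ge0.
  apply: eq_fsbigr => r /[!inE] -[y _ <-].
  rewrite integralZl_indic_nnsfun// integral_indic//= setIT.
  rewrite ge0_integralZl//.
  - congr (_ * _).
    rewrite [LHS]integral_mkcond; apply: eq_integral => x _.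
    rewrite /patch indicE; case: ifPn => [|] ; rewrite /preimage/= ?inE/= => H.
      by rewrite mule1.
    by rewrite mule0.
  - apply: emeasurable_funM => //; apply/measurable_EFinP.
    by apply: measurable_indic; rewrite -[X in measurable X]setTI; exact: mphif.
  - by move=> x _; rewrite mule_ge0// lee_fin.
  - by rewrite lee_fin.
rewrite -ge0_integral_fsum//.
- apply: eq_integral => x _; rewrite [in RHS]fimfunE -fsumEFin//.
  rewrite ge0_mule_fsumr; last by move=> r; rewrite nnfun_muleindic_ge0.
  by apply: eq_fsbigr => r _; rewrite EFinM muleCA.
- move=> r; apply: emeasurable_funM => //; apply: emeasurable_funM => //.
  apply/measurable_EFinP; apply: measurable_indic.
  by rewrite -[X in measurable X]setTI; exact: mphif.
- move=> r x _; rewrite muleCA mule_ge0// ?lee_fin//.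
  exact: (nnfun_muleindic_ge0 (f_ n) r (phi x)).
Qed.

End weighted_law.

Section eq_finite_measures.
Local Open Scope ereal_scope.

Lemma eq_measure_on_generator d (Y : measurableType d) (R : realType)
    (G : set (set Y)) (m1 m2 : {measure set Y -> \bar R}) :
  measurable = <<s G >> -> setI_closed G -> m1 setT < +oo ->
  m1 setT = m2 setT -> (forall A, G A -> m1 A = m2 A) ->
  forall A, measurable A -> m1 A = m2 A.
Proof.
move=> GE GI m1oo m12 HG A mA.
(* Uniqueness of measures asks for a cover by sets of the generator; adding [setT], of finite mass,
   provides a constant cover. *)
pose G' := G `|` [set setT].
have G'E : measurable = <<s G' >>.
  rewrite eqEsubset; split.
    rewrite GE; apply: sub_smallest2r; first exact: smallest_sigma_algebra.
    by move=> B; left.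
  apply: smallest_sub; first exact: sigma_algebra_measurable.
  move=> B [|->//]; rewrite GE; exact: sub_sigma_algebra.
apply: (measure_unique G' (fun=> setT)) => //.
- move=> B C [GB|->] [GC|->]; rewrite ?setTI ?setIT.
  + by left; exact: GI.
  + by left.
  + by left.
  + by right.
- by move=> n; right.
- by rewrite bigcup_const//; exists 0%N.
- by move=> B [/HG//|->].
Qed.

End eq_finite_measures.

Section lebesgue_tuple.
Local Open Scope ereal_scope.
Context {R : realType}.
Local Notation leb := (@lebesgue_measure R).

Definition cons_pair k (z : R * k.-tuple R) : k.+1.-tuple R :=
  [tuple of z.1 :: z.2].

Lemma measurable_cons_pair k : measurable_fun setT (@cons_pair k).
Proof. by apply: measurable_cons. Qed.

Section step.
Variables (k : nat) (mu : {sigma_finite_measure set (k.-tuple R) -> \bar R}).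

Definition cons_measure := pushforward (leb \x mu) (@cons_pair k).

Let cm0 : cons_measure set0 = 0.
Proof. by rewrite /cons_measure /pushforward preimage_set0 measure0. Qed.

Let cm_ge0 S : 0 <= cons_measure S.
Proof. by rewrite /cons_measure /pushforward. Qed.

Let cm_sigma_additive : semi_sigma_additive cons_measure.
Proof.
move=> F mF tF mUF; rewrite /cons_measure /pushforward preimage_bigcup.
apply: measure_semi_sigma_additive.
- by move=> n; rewrite -[X in measurable X]setTI; exact: measurable_cons_pair.
- apply/trivIsetP => /= i j _ _ ij; rewrite -preimage_setI.
  by move/trivIsetP : tF => /(_ _ _ _ _ ij) ->//; rewrite preimage_set0.
- rewrite -preimage_bigcup -[X in measurable X]setTI.
  exact: measurable_cons_pair.
Qed.

HB.instance Definition _ :=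
  isMeasure.Build _ _ _ cons_measure cm0 cm_ge0 cm_sigma_additive.

Let cm_sigma_finite : sigma_finite setT cons_measure.
Proof.
have /sigma_finiteP[F1 [TF1 ndF1 F1oo]] := sigma_finiteT (@lebesgue_measure R).
have /sigma_finiteP[F2 [TF2 ndF2 F2oo]] := sigma_finiteT mu.
pose F n := F1 n `*` F2 n.
have TF : setT = \bigcup_n F n.
  rewrite -setXTT TF1 TF2 predeqE => -[x y]; split.
    move=> [/= [n _ Fnx] [k' _ Gky]]; exists (maxn n k') => //; split.
    - by move: x Fnx; exact/subsetPset/ndF1/leq_maxl.
    - by move: y Gky; exact/subsetPset/ndF2/leq_maxr.
  by move=> [n _ []/= ? ?]; split; exists n.
have Foo n : measurable (F n) /\ (leb \x mu) (F n) < +oo.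
  have [? ?] := F1oo n; have [? ?] := F2oo n.
  split; first exact: measurableX.
  by rewrite product_measure1E// lte_mul_pinfty// ge0_fin_numE.
pose f (t : k.+1.-tuple R) := (thead t, [tuple of behead t]).
have mf : measurable_fun setT f.
  apply: measurable_fun_pair; last exact: measurable_behead.
  exact: measurable_tnth.
have fK z : f (cons_pair z) = z.
  case: z => a t; rewrite /f /cons_pair/=; congr pair.
  exact: val_inj.
exists (fun n => f @^-1` F n).
  by rewrite -preimage_bigcup -TF.
move=> n; have [mFn Fnoo] := Foo n.
split; first by rewrite -[X in measurable X]setTI; exact: mf.
rewrite /cons_measure /pushforward -comp_preimage.
by rewrite (_ : f \o _ = id)//; apply/funext.
Qed.

HB.instance Definition _ :=
  Measure_isSigmaFinite.Build _ _ _ cons_measure cm_sigma_finite.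

End step.

(** The recursion carries sigma-finiteness along, so that Tonelli applies between a coordinate and a
    tuple and between two tuples. The iterated integral in the definition of the Dirichlet law is
    not given as an integral against a measure. *)
Fixpoint lebesgue_tuple k : {sigma_finite_measure set (k.-tuple R) -> \bar R} :=
  match k with
  | 0 => \d_([tuple] : 0.-tuple R)
  | k'.+1 => cons_measure (lebesgue_tuple k')
  end.

Lemma integral_lebesgue_tuple0 (f : 0.-tuple R -> \bar R) :
  measurable_fun setT f ->
  \int[lebesgue_tuple 0]_t f t = f [tuple].
Proof. by move=> mf; rewrite /= integral_dirac// diracT mul1e. Qed.

Lemma integral_lebesgue_tupleS k (f : k.+1.-tuple R -> \bar R) :
  measurable_fun setT f -> (forall t, 0 <= f t) ->
  \int[lebesgue_tuple k.+1]_t f t =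
  \int[leb]_x \int[lebesgue_tuple k]_t f [tuple of x :: t].
Proof.
move=> mf f0; rewrite /= /cons_measure ge0_integral_pushforward//=; last first.
  exact: measurable_cons_pair.
rewrite preimage_setT fubini_tonelli1//.
by apply: measurableT_comp => //; exact: measurable_cons_pair.
Qed.

Lemma iterated_integralE k (f : seq R -> \bar R) :
  measurable_fun setT (fun t : k.-tuple R => f t) ->
  (forall t : k.-tuple R, 0 <= f t) ->
  iterated_integral k f = \int[lebesgue_tuple k]_t f t.
Proof.
elim: k f => [|k IH] f mf f0; first by rewrite integral_lebesgue_tuple0.
rewrite integral_lebesgue_tupleS//=; apply: eq_integral => x _.
rewrite IH//.
- have : measurable_fun setT (fun t : k.-tuple R => [tuple of x :: t]).
    by apply: measurable_cons.
  by move/(measurableT_comp mf).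
Qed.

End lebesgue_tuple.

(** * Change of variables *)

Section change_of_variables.
Context {R : realType}.
Local Notation leb := (@lebesgue_measure R).

(** Half-open intervals are the pi-system on which measures on the line are compared. Degenerate
    intervals are included because boxes of jump times may have an empty side. *)
Lemma integral_derivative_itv (F f : R -> R) (a b : R) : a <= b ->
  (forall x, a <= x <= b -> is_derive x 1 F (f x)) ->
  (forall x, a <= x <= b -> {for x, continuous f}) ->
  (\int[leb]_(x in `]a, b]) (f x)%:E = (F b - F a)%:E)%E.
Proof.
move=> ab dF cf.
have cF x : a <= x <= b -> {for x, continuous F}.
  by move=> /dF[dFx _]; exact/differentiable_continuous/derivable1_diffP.
move: ab; rewrite le_eqVlt => /orP[/eqP <-|ab].
  by rewrite set_itvoc0 integral_set0 subrr.
have cfw : {within `[a, b], continuous f}.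
  by apply: continuous_in_subspaceT => x; rewrite inE/= in_itv/=; exact: cf.
have mf : measurable_fun `[a, b] f.
  exact: subspace_continuous_measurable_fun.
rewrite integral_itv_obnd_cbnd; last first.
  apply/measurable_EFinP; apply: measurable_funS mf => //.
  by apply: subset_itvr; rewrite bnd_simp.
rewrite (continuous_FTC2 (F := F))//.
- split.
  + move=> x; rewrite in_itv/= => /andP[ax xb].
    by have [] : is_derive x 1 F (f x) by apply: dF; rewrite !ltW.
  + by apply/cvg_at_right_filter/cF; rewrite lexx ltW.
  + by apply/cvg_at_left_filter/cF; rewrite lexx ltW.
- move=> x; rewrite in_itv/= => /andP[ax xb].
  by rewrite derive1E; apply/derive_val; apply: dF; rewrite !ltW.
Qed.

Lemma measurable_ocitvE : @measurable _ R = <<s @ocitv R >>.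
Proof. by []. Qed.

Section increasing.
Variables (phi dphi psi : R -> R) (J I : set R) (c d : R^nat).
Hypotheses (oJ : open J) (iJ : is_interval J).
Hypotheses (phiJ : forall x, J x -> I (phi x)) (psiI : forall y, I y -> J (psi y)).
Hypothesis psiK : forall y, I y -> phi (psi y) = y.
Hypothesis phi_lt : forall x y, J x -> J y -> x < y -> phi x < phi y.
Hypothesis dphiE : forall x, J x -> is_derive x 1 phi (dphi x).
Hypothesis dphi_ge0 : forall x, J x -> 0 <= dphi x.
Hypothesis dphi_cont : forall x, J x -> {for x, continuous dphi}.
Hypotheses (cI : forall n, I (c n)) (dI : forall n, I (d n)).
Hypotheses (iI : is_interval I).
Hypotheses (c_ni : nonincreasing_seq c) (d_nd : nondecreasing_seq d).
Hypothesis cover_I : forall y, I y -> exists n, c n < y <= d n.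

Let mJ : measurable J. Proof. exact: open_measurable. Qed.

Let mphi : measurable_fun J phi.
Proof.
apply: open_continuous_measurable_fun => // x; rewrite inE => /dphiE[+ _].
by move=> dx; exact/differentiable_continuous/derivable1_diffP.
Qed.

Let mdphi : measurable_fun J dphi.
Proof.
by apply: open_continuous_measurable_fun => // x; rewrite inE => /dphi_cont.
Qed.

Let In n := [set` `]c n, d n]].

Let InI n : In n `<=` I.
Proof.
move=> y; rewrite /In/= in_itv/= => /andP[cy yd].
by apply: (iI (cI n) (dI n)); rewrite (ltW cy).
Qed.

Let UIn : \bigcup_n In n = I.
Proof.
apply/seteqP; split=> [y [n _ /InI]//|y /cover_I[n cyd]].
by exists n => //; rewrite /In/= in_itv.
Qed.

Let phiK x : J x -> psi (phi x) = x.
Proof.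
move=> Jx; have [||//] := ltgtP (psi (phi x)) x.
- by move/(phi_lt (psiI (phiJ Jx)) Jx); rewrite psiK ?ltxx//; exact: phiJ.
- by move/(phi_lt Jx (psiI (phiJ Jx))); rewrite psiK ?ltxx//; exact: phiJ.
Qed.

(** A Galois connection: it turns the preimage of a half-open interval into a half-open interval
    with ends given by [psi]. *)
Let phi_lt_psi x y : J x -> I y -> (phi x <= y) = (x <= psi y).
Proof.
move=> Jx Iy; apply/idP/idP.
- apply: contraTT; rewrite -!ltNge => yx.
  by have := phi_lt (psiI Iy) Jx yx; rewrite psiK.
- rewrite le_eqVlt => /orP[/eqP->|]; first by rewrite psiK.
  by move/(phi_lt Jx (psiI Iy)); rewrite psiK// => /ltW.
Qed.

(** [phi] and [dphi] are known to be measurable on J only; the cut-off outside J gives a weight on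
    the whole line, as [weighted_law] requires. *)
Let w (A : set R) := (dphi * \1_(phi @^-1` A)) \_ J.

Let mphiA A : measurable A -> measurable (J `&` phi @^-1` A).
Proof. by move=> mA; exact: mphi. Qed.

Let mw (A : set R) : measurable A -> measurable_fun setT (w A).
Proof.
move=> mA; apply/(measurable_restrictT _ mJ).
apply: measurable_funM => //.
move=> _ Y mY; have := @measurable_indic _ _ R J _ (mphiA mA) mJ Y mY.
congr measurable; apply/seteqP; split => x [Jx]; split => //;
  move: b; rewrite /= !indicE; rewrite in_setI (mem_set Jx) //.
Qed.

Let w_ge0 A x : 0 <= w A x.
Proof.
rewrite /w /patch; case: ifPn => // /[1!inE] Jx.
by rewrite mulr_ge0// dphi_ge0.
Qed.

Let wE (A B : set R) : measurable A -> measurable B ->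
  (\int[leb]_(x in (phi \_ J) @^-1` B) (w A x)%:E =
   \int[leb]_(x in J `&` phi @^-1` (B `&` A)) (dphi x)%:E)%E.
Proof.
move=> mA mB; rewrite integral_mkcond [RHS]integral_mkcond.
apply: eq_integral => x _; rewrite /w /patch /=.
have [/[1!inE] Jx|] := boolP (x \in J); last first.
  move/negP => Jx; rewrite [in RHS]memNset; last by case=> /mem_set.
  by case: ifP.
rewrite !fctE indicE.
have -> : (x \in (fun u : R => if u \in J then phi u else point) @^-1` B) =
    (phi x \in B).
  by apply/idP/idP; rewrite !inE /preimage/= mem_set.
have -> : (x \in phi @^-1` A) = (phi x \in A) by apply/idP/idP; rewrite !inE.
have -> : (x \in J `&` phi @^-1` (B `&` A)) = (phi x \in B) && (phi x \in A).
  by rewrite in_setI mem_set//= -in_setI; apply/idP/idP; rewrite !inE.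
by case: (phi x \in B); case: (phi x \in A); rewrite ?mulr1 ?mulr0.
Qed.

Let mrestr_phi : measurable_fun setT (phi \_ J).
Proof. exact/(measurable_restrictT _ mJ). Qed.

Let m2 (A : set R) (mA : measurable A) :=
  weighted_law leb (w_ge0 A) (mw mA) mrestr_phi.

Let m1_ge0 (A : set R) (x : R) : 0 <= (\1_A x : R).
Proof. by []. Qed.

Let m1_m (A : set R) (mA : measurable A) : measurable_fun setT (\1_A : R -> R).
Proof. exact: measurable_indic. Qed.

Let m1 (A : set R) (mA : measurable A) :=
  weighted_law leb (m1_ge0 A) (m1_m mA) (@measurable_id _ R setT).

Let m1E (A B : set R) (mA : measurable A) (mB : measurable B) :
  m1 mA B = leb (A `&` B).
Proof. by rewrite /m1 /weighted_law integral_indic. Qed.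

Let m12_itv a b n : (\int[leb]_(x in J `&` phi @^-1` (`]a, b] `&` In n)) (dphi x)%:E =
  leb (In n `&` `]a, b]))%E.
Proof.
set a' := Num.max a (c n); set b' := Num.min b (d n).
have E : In n `&` `]a, b] = [set` `]a', b']].
  apply/seteqP; split => x; rewrite /In/= !in_itv/= /a' /b' gt_max le_min.
    by move=> [/andP[-> ->] /andP[-> ->]].
  by move=> /andP[/andP[-> ->] /andP[-> ->]].
rewrite (setIC _ (In n)) E lebesgue_measure_itv/= lte_fin.
case: ltP => [ab|ba]; last first.
  by rewrite set_itv_ge ?bnd_simp -?leNgt// preimage_set0 setI0 integral_set0.
have Ia : I a'.
  apply: (iI (cI n) (dI n)); rewrite le_max lexx orbT/=.
  by rewrite (le_trans (ltW ab))// ge_min lexx orbT.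
have Ib : I b'.
  apply: (iI (cI n) (dI n)); rewrite [X in _ && X]ge_min lexx orbT andbT.
  by rewrite (le_trans _ (ltW ab))// le_max lexx orbT.
have pab : psi a' <= psi b'.
  by rewrite -phi_lt_psi ?psiK// ?ltW//; exact: psiI.
have -> : J `&` phi @^-1` [set` `]a', b']] = [set` `]psi a', psi b']].
  apply/seteqP; split => x /=; rewrite !in_itv/=.
    move=> [Jx /andP[ax xb]]; rewrite -phi_lt_psi// xb andbT.
    by rewrite ltNge -phi_lt_psi// -ltNge.
  move=> /andP[ax xb].
  have Jx : J x by apply: (iJ (psiI Ia) (psiI Ib)); rewrite (ltW ax).
  by split => //; rewrite phi_lt_psi// xb andbT ltNge phi_lt_psi// -ltNge.
have Jin x : psi a' <= x <= psi b' -> J x.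
  by move=> ?; apply: (iJ (psiI Ia) (psiI Ib)).
rewrite (integral_derivative_itv pab (fun x Hx => dphiE (Jin x Hx))
  (fun x Hx => dphi_cont (Jin x Hx))).
by rewrite !psiK// EFinB.
Qed.

Let mIn n : measurable (In n). Proof. exact: measurable_itv. Qed.

Let m12n n A : measurable A -> m1 (mIn n) A = m2 (mIn n) A.
Proof.
apply: (@eq_measure_on_generator _ _ R _ (m1 (mIn n)) (m2 (mIn n)) measurable_ocitvE (@ocitvI R)).
- rewrite -[X in (X < _)%E]/(m1 (mIn n) setT) m1E// setIT /In lebesgue_measure_itv/=.
  by case: ifPn => // _; rewrite -EFinB ltry.
- rewrite -[LHS]/(m1 (mIn n) setT) m1E// setIT.
  rewrite -[RHS]/(m2 (mIn n) setT) /m2 /weighted_law wE// setTI.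
  by rewrite -[in RHS](setIid (In n)) m12_itv setIid.
- move=> _ [[a b] _ <-]; rewrite -[LHS]/(m1 (mIn n) [set` `]a, b]]) m1E//.
  by rewrite -[RHS]/(m2 (mIn n) [set` `]a, b]]) /m2 /weighted_law wE// m12_itv.
Qed.

Let mI : measurable I.
Proof. by rewrite -UIn; exact: bigcup_measurable. Qed.

Let nd_In : {homo In : n m / (n <= m)%N >-> (n <= m)%O}.
Proof.
move=> n m nm; rewrite subsetEset => x; rewrite /In/= !in_itv/= => /andP[cx xd].
by rewrite (le_lt_trans (c_ni nm))// (le_trans xd)// d_nd.
Qed.

Let m12 A : measurable A -> m1 mI A = m2 mI A.
Proof.
move=> mA.
have mIA n : measurable (In n `&` A) by exact: measurableI.
have h1 : m1 (mIn n) A @[n --> \oo] --> m1 mI A.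
  under eq_fun do rewrite m1E//; rewrite m1E// -[X in leb (X `&` _)]UIn setI_bigcupl.
  apply: (@nondecreasing_cvg_mu _ _ _ leb (fun n => In n `&` A)).
  - exact: mIA.
  - exact: (bigcup_measurable (fun n _ => mIA n)).
  - by move=> n m /nd_In; rewrite !subsetEset => H; exact: setSI.
have h2 : m2 (mIn n) A @[n --> \oo] --> m2 mI A.
  rewrite /m2 /weighted_law; under eq_fun do rewrite wE//; rewrite wE//.
  rewrite -[X in A `&` X]UIn setI_bigcupr preimage_bigcup setI_bigcupr.
  apply: ge0_nondecreasing_set_cvg_integral.
  - move=> n m /nd_In; rewrite !subsetEset => H.
    by apply: setIS; apply: preimage_subset; exact: setIS.
  - by move=> n; apply: mphiA; exact: measurableI.
  - move=> n; apply/measurable_EFinP; apply: measurable_funS mdphi => //.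
  - by move=> n x [/dphi_ge0 + _]; rewrite lee_fin.
have -> : m1 mI A = lim (m1 (mIn n) A @[n --> \oo]) by exact/esym/cvg_lim.
under eq_fun do rewrite m12n//.
exact/cvg_lim.
Qed.

(** Lebesgue measure on I and the image under [phi] of the measure with density [dphi] on J agree on
    half-open intervals, by the fundamental theorem of calculus. This gives all Borel subsets of ]c
    n, d n], where both are finite, and then those of I by letting n grow. *)
Lemma change_of_variables (h : R -> \bar R) : measurable_fun setT h ->
  (forall y, 0 <= h y)%E ->
  (\int[leb]_(y in I) h y = \int[leb]_(x in J) (h (phi x) * (dphi x)%:E))%E.
Proof.
move=> mh h0.
transitivity (\int[m1 mI]_y h y)%E.
  rewrite weighted_law_integral// [LHS]integral_mkcond; apply: eq_integral => y _.
  by rewrite epatch_indic muleC.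
transitivity (\int[m2 mI]_y h y)%E.
  by apply: eq_measure_integral => A mA _; exact: m12.
rewrite weighted_law_integral// [RHS]integral_mkcond; apply: eq_integral => x _.
rewrite /w /patch; case: ifPn => [/[1!inE] Jx|_]; last by rewrite mul0e.
rewrite fctE indicE mem_set ?mulr1; last exact: phiJ.
by rewrite muleC.
Qed.

End increasing.

End change_of_variables.

Section change_of_variables_instances.
Context {R : realType}.
Local Notation leb := (@lebesgue_measure R).

Lemma continuous_sqr (f : R -> R) (x : R) : {for x, continuous f} ->
  {for x, continuous (fun x => f x ^+ 2)}.
Proof.
move=> cf; rewrite (_ : (fun _ => _) = f * f); first exact: continuousM.
by apply/funext => y; rewrite expr2.
Qed.

Lemma ge0_integral_affine (k t : R) (h : R -> \bar R) : 0 < k ->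
  measurable_fun setT h -> (forall y, 0 <= h y)%E ->
  (\int[leb]_y h y = \int[leb]_x (h (k * x + t)%R * k%:E))%E.
Proof.
move=> k0 mh h0.
apply: (@change_of_variables _ (fun x => k * x + t) (cst k) (fun y => (y - t) / k)
  setT setT (fun n => - n%:R) (fun n => n%:R)) => //.
- exact: openT.
- by move=> y _; rewrite mulrC divfK ?gt_eqF// subrK.
- by move=> x y _ _ xy; rewrite ltrD2r ltr_pM2l.
- move=> x _; apply: is_derive_eq.
  by rewrite /GRing.scale/= ?mulr1 ?addr0.
- by move=> x _; exact: ltW.
- by move=> x _; exact: cst_continuous.
- by move=> n m nm; rewrite lerN2 ler_nat.
- by move=> n m nm; rewrite ler_nat.
- move=> y _; exists (Num.truncn `|y|).+1.
  have := truncnS_gt `|y|; rewrite ltr_norml => /andP[-> /ltW ->] //.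
Qed.

Lemma ge0_integral_opp (h : R -> \bar R) :
  measurable_fun setT h -> (forall y, 0 <= h y)%E ->
  (\int[leb]_y h (- y)%R = \int[leb]_y h y)%E.
Proof.
move=> mh h0.
have mN : measurable_fun setT (-%R : measurableTypeR R -> measurableTypeR R).
  exact: (@oppr_measurable R setT).
transitivity (\int[pushforward leb (-%R : measurableTypeR R -> measurableTypeR R)]_y h y)%E.
  by rewrite ge0_integral_pushforward// preimage_setT.
by apply: eq_measure_integral => A mA _; exact: lebesgue_measureN.
Qed.

Lemma ge0_integral_square (k : R) (h : R -> \bar R) : 0 < k ->
  measurable_fun setT h -> (forall y, 0 <= h y)%E ->
  (\int[leb]_(y in `]0%R, +oo[) h y =
   \int[leb]_(x in `]0%R, +oo[) (h (k * x ^+ 2)%R * (k * (2 * x))%:E))%E.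
Proof.
move=> k0 mh h0.
apply: (@change_of_variables _ (fun x => k * x ^+ 2) (fun x => k * (2 * x))
  (fun y => Num.sqrt (y / k)) `]0, +oo[ `]0, +oo[
  (fun n => n.+1%:R^-1) (fun n => n.+1%:R)) => //=.
- exact: interval_is_interval.
- by move=> x; rewrite !in_itv/= !andbT => x0; rewrite mulr_gt0// exprn_gt0.
- by move=> x; rewrite !in_itv/= !andbT => x0; rewrite sqrtr_gt0 divr_gt0.
- move=> y; rewrite !in_itv/= !andbT => y0.
  by rewrite sqr_sqrtr ?divr_ge0 ?ltW// mulrC divfK ?gt_eqF.
- move=> x y; rewrite !in_itv/= !andbT => x0 y0 xy.
  by rewrite ltr_pM2l// ltr_pXn2r// nnegrE ltW.
- move=> x _.
  have dx : is_derive x 1 (fun x : R => x ^+ 2) (2 * x).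
    apply: is_derive_eq.
    by rewrite /GRing.scale/= mulr1 mulrDl mul1r.
  by apply: is_derive_eq.
- by move=> x; rewrite !in_itv/= !andbT => x0; rewrite !mulr_ge0// ltW.
- move=> x _; apply: continuousM; first exact: cst_continuous.
  by apply: continuousM; [exact: cst_continuous|].
- by move=> n; rewrite in_itv/= invr_gt0 ltr0n.
- by move=> n; rewrite in_itv/= ltr0n.
- exact: interval_is_interval.
- by move=> n m nm; rewrite lef_pV2 ?posrE ?ltr0n// ler_nat.
- by move=> n m nm; rewrite ler_nat.
- move=> y; rewrite in_itv/= andbT => y0.
  exists (maxn (Num.truncn y) (Num.truncn y^-1)); apply/andP; split.
    rewrite invf_plt ?posrE ?ltr0n//.
    by rewrite (lt_le_trans (truncnS_gt _))// ler_nat ltnS leq_maxr.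
  by rewrite (le_trans (ltW (truncnS_gt _)))// ler_nat ltnS leq_maxl.
Qed.

Lemma ge0_integral_sinh (k : R) (h : R -> \bar R) : 0 < k ->
  measurable_fun setT h -> (forall y, 0 <= h y)%E ->
  (\int[leb]_y h y =
   \int[leb]_x (h (k * (expR x - expR (- x)))%R * (k * (expR x + expR (- x)))%:E))%E.
Proof.
move=> k0 mh h0.
(* The positive root of k (z - 1 / z) = y, where z stands for e^x. *)
pose z (y : R) := (y / k + Num.sqrt ((y / k) ^+ 2 + 4)) / 2.
have D0 y : 0 <= (y / k) ^+ 2 + 4 by rewrite addr_ge0// sqr_ge0.
have z0 y : 0 < z y.
  rewrite divr_gt0// -ltrBlDl sub0r (le_lt_trans (ler_norm _))// normrN.
  by rewrite -sqrtr_sqr ltr_sqrt// ?ltrDl// ltr_wpDl// sqr_ge0.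
apply: (@change_of_variables _ (fun x => k * (expR x - expR (- x)))
  (fun x => k * (expR x + expR (- x))) (fun y => ln (z y))
  setT setT (fun n => - n%:R) (fun n => n%:R)) => //=.
- exact: openT.
- move=> y _; rewrite expRN lnK ?posrE//.
  have zz : z y * z y - 1 = (y / k) * z y.
    rewrite /z; have := sqr_sqrtr (D0 y); set s := Num.sqrt _; set u := y / k.
    by move=> ss; field: ss.
  have -> : z y - (z y)^-1 = y / k.
    by apply: (mulIf (lt0r_neq0 (z0 y))); rewrite mulrBl mulVf ?gt_eqF.
  by rewrite mulrC divfK// gt_eqF.
- move=> x y _ _ xy; rewrite ltr_pM2l// ltrD// ?ltr_expR//.
  by rewrite ltrN2 ltr_expR ltrN2.
- move=> x _.
  have d1 : is_derive x 1 (fun x : R => expR (- x)) (- expR (- x)).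
    apply: (is_derive_eq (is_derive1_comp (f := @expR R) (g := -%R) _ _)).
    by rewrite mulrN1.
  apply: is_derive_eq; rewrite opprK; exact: erefl.
- by move=> x _; rewrite mulr_ge0 ?(ltW k0)// addr_ge0 ?expR_ge0.
- move=> x _; apply: continuousM; first exact: cst_continuous.
  apply: continuousD; first exact: continuous_expR.
  apply: continuous_comp; last exact: continuous_expR.
  exact: oppr_continuous.
- by move=> n m nm; rewrite lerN2 ler_nat.
- by move=> n m nm; rewrite ler_nat.
- move=> y _; exists (Num.truncn `|y|).+1.
  have := truncnS_gt `|y|; rewrite ltr_norml => /andP[-> /ltW ->] //.
Qed.

(** With p = q e^-x, the point y = t / (1 + p ^ 2) runs through ]0, t[ and p ^ 2 = (t - y) / y: the
    variable is the logarithm of the ratio of the two arguments of a convolution at t, up to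
    scale. *)
Lemma ge0_integral_logistic (t q : R) (h : R -> \bar R) : 0 < t -> 0 < q ->
  measurable_fun setT h -> (forall y, 0 <= h y)%E ->
  (\int[leb]_(y in `]0%R, t[) h y =
   \int[leb]_x (h (t / (1 + (q * expR (- x)) ^+ 2))%R *
     (2 * t * (q * expR (- x)) ^+ 2 / (1 + (q * expR (- x)) ^+ 2) ^+ 2)%:E))%E.
Proof.
move=> t0 q0 mh h0.
have p0 x : 0 < 1 + (q * expR (- x)) ^+ 2.
  by rewrite ltr_pwDl// sqr_ge0.
have dp (x : R) : is_derive x 1 (fun x : R => 1 + (q * expR (- x)) ^+ 2)
    (- 2 * (q * expR (- x)) ^+ 2).
  have d1 : is_derive x 1 (fun x : R => expR (- x)) (- expR (- x)).
    apply: (is_derive_eq (is_derive1_comp (f := @expR R) (g := -%R) _ _)).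
    by rewrite mulrN1.
  apply: is_derive_eq; rewrite /GRing.scale/=; ring.
apply: (@change_of_variables _ (fun x => t / (1 + (q * expR (- x)) ^+ 2))
  (fun x => 2 * t * (q * expR (- x)) ^+ 2 / (1 + (q * expR (- x)) ^+ 2) ^+ 2)
  (fun y => - ln (Num.sqrt ((t - y) / y) / q)) setT [set` `]0, t[]
  (fun n => t / n.+3%:R) (fun n => t - t / n.+3%:R)) => //=.
- exact: openT.
- move=> x _; rewrite in_itv/= divr_gt0//= ltr_pdivrMr// ltr_pMr//.
  by rewrite ltrDl exprn_gt0// mulr_gt0// expR_gt0.
- move=> y; rewrite in_itv/= => /andP[y0 yt].
  have s0 : 0 < Num.sqrt ((t - y) / y) by rewrite sqrtr_gt0 divr_gt0// subr_gt0.
  rewrite opprK lnK ?posrE ?divr_gt0// (mulrC q) divfK ?gt_eqF//.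
  rewrite sqr_sqrtr ?divr_ge0 ?subr_ge0 ?ltW//.
  by field; rewrite !gt_eqF//; lra.
- move=> x y _ _ xy; rewrite ltr_pM2l// ltf_pV2 ?posrE// ltrD2l.
  by rewrite ltr_pXn2r ?nnegrE ?mulr_ge0 ?expR_ge0 ?ltW// ltr_pM2l// ltr_expR ltrN2.
- move=> x _; have dV := @is_deriveV R (fun x : R => 1 + (q * expR (- x)) ^+ 2) x _ _
    (lt0r_neq0 (p0 x)) (dp x).
  apply: is_derive_eq.
  by rewrite /GRing.scale/=; field; rewrite gt_eqF.
- by move=> x _; rewrite divr_ge0 ?mulr_ge0 ?exprn_ge0 ?mulr_ge0 ?expR_ge0 ?(ltW t0) ?(ltW q0) ?(ltW (p0 _)).
- move=> x _.
  have cq : {for x, continuous (fun x => (q * expR (- x)) ^+ 2)}.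
    apply: continuous_sqr.
    apply: continuousM; first exact: cst_continuous.
    apply: continuous_comp; last exact: continuous_expR.
    exact: oppr_continuous.
  apply: continuousM.
    by apply: continuousM => //; exact: cst_continuous.
  apply: continuousV; first by rewrite gt_eqF// exprn_gt0.
  apply: continuous_sqr.
  by apply: continuousD => //; exact: cst_continuous.
- move=> n; rewrite in_itv/= divr_gt0//= ltr_pdivrMr// ltr_pMr//.
  by rewrite (_ : 1 = 1%:R)// ltr_nat.
- move=> n; rewrite in_itv/= gtrBl divr_gt0// andbT subr_gt0.
  by rewrite ltr_pdivrMr// ltr_pMr// (_ : 1 = 1%:R)// ltr_nat.
- exact: interval_is_interval.
- by move=> n m nm; rewrite ler_pM2l// lef_pV2 ?posrE ?ltr0n// ler_nat.
- by move=> n m nm; rewrite lerD2l lerN2 ler_pM2l// lef_pV2 ?posrE ?ltr0n// ler_nat.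
- move=> y; rewrite in_itv/= => /andP[y0 yt].
  have ty0 : 0 < t - y by rewrite subr_gt0.
  pose n := maxn (Num.truncn (t / y)) (Num.truncn (t / (t - y))).
  exists n; apply/andP; split.
    rewrite ltr_pdivrMr// mulrC -ltr_pdivrMr// (lt_trans (truncnS_gt _))// ltr_nat.
    by rewrite !ltnS (leq_trans (leq_maxl _ (Num.truncn (t / (t - y)))))// /n -addn2 leq_addr.
  rewrite lerBrDr -lerBrDl ler_pdivrMr// mulrC -ler_pdivrMr//.
  rewrite (le_trans (ltW (truncnS_gt _)))// ler_nat.
  by rewrite !ltnS (leq_trans (leq_maxr (Num.truncn (t / y)) _))// /n -addn2 leq_addr.
Qed.

Lemma integral_gaussian_tail (k l : R) : 0 < k -> 0 <= l ->
  (\int[leb]_(x in `]l, +oo[) (k * x * expR (- (k * x ^+ 2 / 2)))%:E =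
   (expR (- (k * l ^+ 2 / 2)))%:E)%E.
Proof.
move=> k0 l0.
have dx (x : R) : is_derive x 1 (fun x : R => - expR (- (k * x ^+ 2 / 2)))
    (k * x * expR (- (k * x ^+ 2 / 2))).
  have d1 : is_derive x 1 (fun x : R => - (k * x ^+ 2 / 2)) (- (k * x)).
    by apply: is_derive_eq; rewrite /GRing.scale/= mulr1; field.
  have d2 := @is_derive1_comp R expR (fun x : R => - (k * x ^+ 2 / 2)) x _ _
    (is_derive_expR _) d1.
  apply: is_derive_eq; rewrite mulrN opprK mulrC//.
have cf : continuous (fun x : R => k * x * expR (- (k * x ^+ 2 / 2))).
  move=> x; apply: continuousM.
    by apply: continuousM => //; exact: cst_continuous.
  apply: continuous_comp; last exact: continuous_expR.
  apply: continuousN; apply: continuousM; last exact: cst_continuous.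
  apply: continuousM; first exact: cst_continuous.
  exact: continuous_sqr.
have mf : measurable_fun `]l, +oo[
    (fun x : R => (k * x * expR (- (k * x ^+ 2 / 2)))%:E).
  apply/measurable_EFinP; apply: measurable_funTS.
  exact: continuous_measurable_fun cf.
rewrite (integral_itv_obnd_cbnd mf).
rewrite (@ge0_continuous_FTC2y _ _ (fun x : R => - expR (- (k * x ^+ 2 / 2))) _ 0).
- by rewrite EFinN oppeK add0e.
- by move=> x lx; rewrite !mulr_ge0 ?expR_ge0 ?(ltW k0)// (le_trans l0).
- exact: continuous_subspaceT.
- rewrite -oppr0; apply: cvgN.
  apply: (@cvg_comp _ _ _ (fun x : R => k * x ^+ 2 / 2) (fun y => expR (- y)) _ +oo%R);
    last exact: cvgr_expR.
  by apply: gt0_cvgMly => //; apply: gt0_cvgMry => //; exact: cvgr_expr2.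
- by move=> x _; have [] := dx x.
- apply: cvg_at_right_filter.
  have [d _] := dx l.
  have : {for l, continuous (fun x : R => - expR (- (k * x ^+ 2 / 2)))}.
    exact/differentiable_continuous/derivable1_diffP.
  by [].
- by move=> x _; rewrite derive1E; have [_ ->] := dx x.
Qed.

End change_of_variables_instances.

(** * Lévy densities and Gaussian moments *)

Section levy.
Context {R : realType}.
Local Notation leb := (@lebesgue_measure R).

Lemma integral_gauss_half : (\int[leb]_x (expR (- (x ^+ 2 / 2)))%:E = (Num.sqrt (2 * pi))%:E)%E.
Proof.
have k0 : 0 < Num.sqrt 2 :> R by rewrite sqrtr_gt0.
have mg : measurable_fun setT (fun x : R => (expR (- (x ^+ 2 / 2)))%:E).
  apply/measurable_EFinP; apply: measurableT_comp => //.
  apply: measurableT_comp => //; apply: measurable_funM => //.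
rewrite (@ge0_integral_affine _ (Num.sqrt 2) 0)//.
under eq_integral => x _.
  rewrite addr0 exprMn sqr_sqrtr// mulrAC divff// mul1r -[expR _]/(gauss_fun x).
  rewrite muleC; over.
rewrite /= ge0_integralZl//=.
- by rewrite integralT_gauss -EFinM -sqrtrM.
- by apply/measurable_EFinP; exact: measurable_gauss_fun.
- by move=> x _; rewrite lee_fin gauss_fun_ge0.
Qed.

(* Up to the factor 1 / sqrt (2 pi), the density at x of the time at which a
   Brownian motion first reaches s. *)
Definition levy (s x : R) : R :=
  if 0 < x then s * x `^ (- (3 / 2)) * expR (- (s ^+ 2 / (2 * x))) else 0.

Lemma levy_ge0 s x : 0 <= s -> 0 <= levy s x.
Proof.
by move=> s0; rewrite /levy; case: ifP => // x0; rewrite !mulr_ge0 ?powR_ge0 ?expR_ge0.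
Qed.

Lemma measurable_levy : measurable_fun setT (fun z : R * R => levy z.1 z.2).
Proof.
rewrite (_ : (fun _ => _) = fun z : R * R => if 0 < z.2 then
    z.1 * z.2 `^ (- (3 / 2)) * expR (- (z.1 ^+ 2 * (2 * z.2) `^ (-1))) else 0).
  apply: measurable_fun_ifT => //.
    by apply: measurable_fun_ltr => //.
  apply: measurable_funM.
    apply: measurable_funM => //.
    exact: (measurableT_comp (measurable_powR _)).
  apply: measurableT_comp => //; apply: measurableT_comp => //.
  apply: measurable_funM; first by apply: measurable_funX.
  apply: (measurableT_comp (measurable_powR _)).
  by apply: measurable_funM.
apply/funext => z; rewrite /levy; case: ifPn => // z0.
by rewrite powR_inv1// mulr_ge0// ltW.
Qed.

(** The passage time of a Brownian motion at a + b is the passage time at a plus an independent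
    passage time at b. The proof is a direct computation: after the substitution the integrand is a
    combination of e^u g and e^-u g with g even; these two have the same integral, and their sum
    integrates to a Gaussian integral. *)
Lemma levy_convolution (a b t : R) : 0 < a -> 0 < b ->
  (\int[leb]_x (levy a x * levy b (t - x))%:E =
   (Num.sqrt (2 * pi) * levy (a + b) t)%:E)%E.
Proof.
move=> a0 b0.
have [t0|t0] := ltP 0 t; last first.
  rewrite {3}/levy ltNge t0/= mulr0; apply: integral0_eq => x _.
  rewrite /levy subr_gt0; case: ifPn => x0; last by rewrite mul0r.
  by rewrite ltNge (le_trans t0)/= ?mulr0// ltW.
have mh : measurable_fun setT (fun x => (levy a x * levy b (t - x))%:E).
  apply/measurable_EFinP; apply: measurable_funM.
    exact: (measurableT_comp measurable_levy (pair1_measurable a)).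
  apply: (measurableT_comp (f := fun x => levy b x) _ _) => //.
    exact: (measurableT_comp measurable_levy (pair1_measurable b)).
  exact: measurable_funB.
have h0 x : (0 <= (levy a x * levy b (t - x))%:E)%E.
  by rewrite lee_fin mulr_ge0// levy_ge0// ltW.
transitivity (\int[leb]_(x in `]0%R, t[) (levy a x * levy b (t - x))%:E)%E.
  rewrite [RHS]integral_mkcond; apply: eq_integral => x _.
  rewrite patchE; case: ifPn => // /negP; rewrite inE/= in_itv/= => xt.
  rewrite /levy subr_gt0; case: ifPn => x0; last by rewrite mul0r.
  by case: ifPn => // xlt; [exfalso; apply: xt; rewrite x0|rewrite mulr0].
(* With this geometric mean and p = (c / a) e^-u one has a p = c e^-u and b / p = c e^u, which makes
   the exponent even in u. *)
have [c c0 cc] : exists2 c, 0 < c & c ^+ 2 = a * b.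
  exists (Num.sqrt (a * b)); first by rewrite sqrtr_gt0 mulr_gt0.
  by rewrite sqr_sqrtr// mulr_ge0// ltW.
(* Substituting x = t / (1 + p ^ 2) with p = (c / a) e^-u, the exponents add up
   to (a + b) ^ 2 / (2 t) + c ^ 2 (e^u - e^-u) ^ 2 / (2 t). *)
rewrite (@ge0_integral_logistic _ t (c / a))// ?divr_gt0//.
pose g x := expR (- (c ^+ 2 * (expR x - expR (- x)) ^+ 2 / (2 * t))).
pose E := expR (- ((a + b) ^+ 2 / (2 * t))).
have mexpN : measurable_fun setT (fun x : R => expR (- x)).
  exact: measurableT_comp.
have mg : measurable_fun setT g.
  apply: measurableT_comp => //; apply: measurableT_comp => //.
  apply: measurable_funM => //; apply: measurable_funM => //.
  by apply: measurable_funX; exact: measurable_funB.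
have g0 x : 0 <= g x by exact: expR_ge0.
pose K := 2 * c / t ^+ 2 * E.
transitivity (\int[leb]_x (K%:E * ((b * (expR (- x) * g x))%:E + (a * (expR x * g x))%:E)))%E.
  apply: eq_integral => x _; rewrite -EFinD -!EFinM; congr EFin.
  set p := c / a * expR (- x).
  have p0 : 0 < p by rewrite mulr_gt0 ?divr_gt0 ?expR_gt0.
  have q0 : 0 < 1 + p ^+ 2 by rewrite ltr_pwDl// sqr_ge0.
  have p1 : t / (1 + p ^+ 2) > 0 by rewrite divr_gt0.
  have p2 : t - t / (1 + p ^+ 2) = t * p ^+ 2 / (1 + p ^+ 2) by field; rewrite gt_eqF.
  have p3 : t - t / (1 + p ^+ 2) > 0 by rewrite p2 divr_gt0// mulr_gt0// exprn_gt0.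
  rewrite /levy p1 p3 p2.
  have pw : (t / (1 + p ^+ 2)) `^ (- (3 / 2)) * (t * p ^+ 2 / (1 + p ^+ 2)) `^ (- (3 / 2)) =
      ((t * p / (1 + p ^+ 2)) ^+ 3)^-1.
    rewrite -powRM; [|exact: ltW|by rewrite -p2 ltW].
    have u0 : 0 <= t * p / (1 + p ^+ 2) by rewrite ltW// divr_gt0// mulr_gt0.
    rewrite (_ : _ * _ = (t * p / (1 + p ^+ 2)) `^ 2%:R); last first.
      by rewrite powR_mulrn//; field; rewrite gt_eqF.
    rewrite -powRrM mulrN powRN; congr (_^-1).
    by rewrite -powR_mulrn//; congr (_ `^ _); field.
  have ee : expR (- (a ^+ 2 / (2 * (t / (1 + p ^+ 2))))) *
     expR (- (b ^+ 2 / (2 * (t * p ^+ 2 / (1 + p ^+ 2))))) = E * g x.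
    rewrite -expRD /E /g -expRD; congr expR.
    have ->: c ^+ 2 * (expR x - expR (- x)) ^+ 2 = (a * p) ^+ 2 + (b / p) ^+ 2 - 2 * (a * b).
      have e1 : a * p = c * expR (- x) by rewrite /p mulrA (mulrC a) divfK ?gt_eqF.
      have e2 : b / p = c * expR x.
        rewrite /p expRN; apply: (mulIf (lt0r_neq0 (mulr_gt0 a0 c0))).
        have -> : b / (c / a / expR x) * (a * c) = a * (a * b) * expR x.
          by field; rewrite !gt_eqF ?expR_gt0.
        by rewrite -cc; ring.
      rewrite e1 e2 -cc.
      have : expR x * expR (- x) = 1 by rewrite -expRD subrr expR0.
      by move: (expR x) (expR (- x)) => u v uv; ring: uv.
    by field; rewrite !gt_eqF.
  transitivity (a * b * ((t / (1 + p ^+ 2)) `^ (- (3 / 2)) * (t * p ^+ 2 / (1 + p ^+ 2)) `^ (- (3 / 2)))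
     * (expR (- (a ^+ 2 / (2 * (t / (1 + p ^+ 2))))) *
     expR (- (b ^+ 2 / (2 * (t * p ^+ 2 / (1 + p ^+ 2)))))) * (2 * t * p ^+ 2 / (1 + p ^+ 2) ^+ 2)).
    ring.
  rewrite pw ee /K.
  have -> : expR x = (c / a) / p by rewrite /p expRN; field; rewrite !gt_eqF ?expR_gt0.
  have -> : expR (- x) = p * a / c by rewrite /p; field; rewrite !gt_eqF.
  transitivity (2 * E * g x / t ^+ 2 * (c ^+ 2 / p + a * b * p)).
    by rewrite cc; field; rewrite !gt_eqF.
  by field; rewrite !gt_eqF.
have mSm : measurable_fun setT (fun x : R => (expR (- x) * g x)%:E).
  by apply/measurable_EFinP; exact: measurable_funM.
have mSp : measurable_fun setT (fun x : R => (expR x * g x)%:E).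
  by apply/measurable_EFinP; exact: measurable_funM.
have Sm0 x : (0 <= (expR (- x) * g x)%:E)%E by rewrite lee_fin mulr_ge0// expR_ge0.
have Sp0 x : (0 <= (expR x * g x)%:E)%E by rewrite lee_fin mulr_ge0// expR_ge0.
have SS : (\int[leb]_x (expR (- x) * g x)%:E = \int[leb]_x (expR x * g x)%:E)%E.
  rewrite -(ge0_integral_opp mSm Sm0); apply: eq_integral => x _.
  by rewrite /g opprK -[(expR (- x) - _) ^+ 2]sqrrN opprB.
have k0 : 0 < c / Num.sqrt (2 * t) by rewrite divr_gt0// sqrtr_gt0 mulr_gt0.
set S := (\int[leb]_x (expR x * g x)%:E)%E in SS.
(* As e^u + e^-u is the derivative of e^u - e^-u, this sum is a Gaussian integral in the variable
   e^u - e^-u, up to scale. *)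
have S2 : (S + S = (Num.sqrt pi * Num.sqrt (2 * t) / c)%:E)%E.
  rewrite -{1}SS -ge0_integralD//.
  have mgauss : measurable_fun setT (fun x : R => (gauss_fun x)%:E).
    by apply/measurable_EFinP; exact: measurable_gauss_fun.
  have gauss0 (x : R) : (0 <= (gauss_fun x)%:E)%E by rewrite lee_fin gauss_fun_ge0.
  have := ge0_integral_sinh k0 mgauss gauss0.
  rewrite integralT_gauss.
  set G := (X in _ = X -> _).
  have -> : G = (\int[leb]_x ((c / Num.sqrt (2 * t))%:E *
      ((expR (- x) * g x)%:E + (expR x * g x)%:E)))%E.
    apply: eq_integral => x _; rewrite -EFinD -!EFinM; congr EFin.
    rewrite mulrCA; congr (_ * _).
    rewrite -mulrDl mulrC addrC; congr (_ * _).
    have t2 : Num.sqrt (2 * t) ^+ 2 = 2 * t by rewrite sqr_sqrtr// mulr_ge0// ltW.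
    rewrite /gauss_fun /g !exprMn exprVn t2.
    by congr (expR (- _)); rewrite mulrAC.
  rewrite ge0_integralZl//.
  - move=> H.
    transitivity ((c / Num.sqrt (2 * t))^-1%:E * ((c / Num.sqrt (2 * t))%:E *
      \int[leb]_x ((expR (- x) * g x)%:E + (expR x * g x)%:E)))%E.
      by rewrite muleA -EFinM mulVf ?gt_eqF// mul1e.
    by rewrite -H -EFinM invf_div mulrC mulrA.
  - exact: emeasurable_funD.
  - by move=> x _; exact: adde_ge0.
  - by rewrite lee_fin ltW.
have Sfin : S \is a fin_num.
  have S0 : (0 <= S)%E by exact: integral_ge0.
  rewrite ge0_fin_numE// (@le_lt_trans _ _ (S + S)%E)// ?leeDl// S2 ltry//.
rewrite ge0_integralZl//; first last.
- by rewrite lee_fin /K !mulr_ge0 ?invr_ge0 ?exprn_ge0 ?expR_ge0 ?ltW.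
- by move=> x _; rewrite -EFinD lee_fin addr_ge0// mulr_ge0 ?mulr_ge0 ?expR_ge0 ?ltW.
- by apply: emeasurable_funD; under eq_fun do rewrite EFinM; exact: measurable_funeM.
rewrite ge0_integralD//; first last.
- by under eq_fun do rewrite EFinM; exact: measurable_funeM.
- by move=> x _; rewrite lee_fin mulr_ge0 ?mulr_ge0 ?expR_ge0 ?ltW.
- by under eq_fun do rewrite EFinM; exact: measurable_funeM.
- by move=> x _; rewrite lee_fin mulr_ge0 ?mulr_ge0 ?expR_ge0 ?ltW.
under eq_integral do rewrite EFinM.
under [X in (_ * (_ + X))%E]eq_integral do rewrite EFinM.
rewrite !ge0_integralZl ?lee_fin ?ltW//.
rewrite SS -/S; move: S2; rewrite -(fineK Sfin) -EFinD => -[S2].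
rewrite -[LHS]/((K * (b * fine S + a * fine S))%:E); congr EFin.
have -> : fine S = Num.sqrt pi * Num.sqrt (2 * t) / (2 * c).
  transitivity ((fine S + fine S) / 2); first by field.
  by rewrite S2; field; rewrite gt_eqF.
rewrite /K /levy t0 /E.
have -> : t `^ (- (3 / 2)) = (t * Num.sqrt t)^-1.
  rewrite powRN; congr (_^-1); rewrite (_ : 3 / 2 = 1 + 2^-1); last by field.
  by rewrite powRD ?gt_eqF ?implybT// powRr1 ?ltW// powR12_sqrt ?ltW.
rewrite !sqrtrM//.
have tt : Num.sqrt t * Num.sqrt t = t by rewrite -expr2 sqr_sqrtr// ltW.
have st0 : 0 < Num.sqrt t by rewrite sqrtr_gt0.
move: (Num.sqrt t) st0 tt => st st0 tt; rewrite -tt.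
by move: (expR _) => e; field; rewrite !gt_eqF.
Qed.

End levy.

Section gaussian_moments.
Context {R : realType}.
Local Notation leb := (@lebesgue_measure R).

Definition gauss_moment (k : nat) : \bar R :=
  (\int[leb]_(x in `]0%R, +oo[) (x ^+ k * expR (- (x ^+ 2 / 2)))%:E)%E.

Lemma measurable_gauss_moment k :
  measurable_fun setT (fun x : R => (x ^+ k * expR (- (x ^+ 2 / 2)))%:E).
Proof.
apply/measurable_EFinP; apply: measurable_funM; first exact: measurable_funX.
apply: measurableT_comp => //; apply: measurableT_comp => //.
by apply: measurable_funM => //; exact: measurable_funX.
Qed.

Lemma gauss_moment0 : gauss_moment 0 = (Num.sqrt (2 * pi) / 2)%:E.
Proof.
have H := @ge0_symfun_integralT R (fun x => expR (- (x ^+ 2 / 2))).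
have e0 (x : R) : 0 <= expR (- (x ^+ 2 / 2)) by exact: expR_ge0.
have ec : continuous (fun x : R => expR (- (x ^+ 2 / 2))).
  move=> x; apply: continuous_comp; last exact: continuous_expR.
  apply: continuousN; apply: continuousM; last exact: cst_continuous.
  exact: continuous_sqr.
have es : (fun x : R => expR (- (x ^+ 2 / 2))) =1 (fun x => expR (- (x ^+ 2 / 2))) \o -%R.
  by move=> x /=; rewrite sqrrN.
have := H e0 ec es; rewrite integral_gauss_half.
have mf : measurable_fun ([set` `]0%R, +oo[] : set R) (fun x : R => (expR (- (x ^+ 2 / 2)))%:E).
  apply: measurable_funTS; have := measurable_gauss_moment 0.
  by under eq_fun do rewrite expr0 mul1r.
have -> : [set x : R | 0 <= x] = [set` `[0%R, +oo[].
  by apply/seteqP; split => x /=; rewrite in_itv/= andbT.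
rewrite -(integral_itv_obnd_cbnd mf) => E.
have -> : gauss_moment 0 = (\int[leb]_(x in `]0%R, +oo[) (expR (- (x ^+ 2 / 2)))%:E)%E.
  by apply: eq_integral => x _; rewrite expr0 mul1r.
rewrite EFinM E muleAC -[2%E]/(2%:E) -EFinM divff// mul1e//.
Qed.

Lemma gauss_moment1 : gauss_moment 1 = 1%:E.
Proof.
have := @integral_gaussian_tail R 1 0 ltr01 (lexx _).
rewrite expr0n/= mulr0 mul0r oppr0 expR0 => <-.
by apply: eq_integral => x _; rewrite !mul1r expr1.
Qed.

(** Integration by parts, done as a Tonelli exchange on the region 0 < y < x: the integral of (k +
    1) y^k in y gives x^(k + 1), the integral of x exp (- x^2 / 2) in x gives exp (- y^2 / 2). *)
Lemma gauss_momentSS k :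
  gauss_moment k.+2 = (k.+1%:R%:E * gauss_moment k)%E.
Proof.
pose f (z : R * R) : \bar R :=
  ((if (0 < z.2) && (z.2 < z.1) then 1 else 0) *
   (k.+1%:R * z.2 ^+ k * (z.1 * expR (- (z.1 ^+ 2 / 2)))))%:E.
have mf : measurable_fun setT f.
  apply/measurable_EFinP; apply: measurable_funM.
    apply: measurable_fun_ifT => //; apply: measurable_and.
      by apply: measurable_fun_ltr.
    by apply: measurable_fun_ltr.
  apply: measurable_funM.
    by apply: measurable_funM => //; apply: measurable_funX.
  apply: measurable_funM => //.
  apply: measurableT_comp => //; apply: measurableT_comp => //.
  by apply: measurable_funM => //; apply: measurable_funX.
have f0 z : (0 <= f z)%E.
  rewrite /f lee_fin; case: ifPn => [/andP[z2 z1]|_]; last by rewrite mul0r.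
  have z10 := lt_trans z2 z1.
  by rewrite mul1r !mulr_ge0 ?expR_ge0 ?exprn_ge0// ltW.
have tailE (y : R) : 0 < y -> (\int[leb]_(x in `]y, +oo[) (x * expR (- (x ^+ 2 / 2)))%:E =
    (expR (- (y ^+ 2 / 2)))%:E)%E.
  move=> y0; have := @integral_gaussian_tail R 1 y ltr01 (ltW y0).
  by rewrite mul1r => <-; apply: eq_integral => x _; rewrite !mul1r.
transitivity (\int[leb]_x \int[leb]_y f (x, y))%E.
  rewrite /gauss_moment integral_mkcond; apply: eq_integral => x _.
  rewrite patchE; case: ifPn => [|/negP].
    rewrite inE/= in_itv/= andbT => x0.
    transitivity (\int[leb]_(y in `]0%R, x[)
      ((x * expR (- (x ^+ 2 / 2)))%:E * (k.+1%:R * y ^+ k)%:E))%E; last first.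
      rewrite [LHS]integral_mkcond; apply: eq_integral => y _; rewrite patchE /f.
      case: ifPn => [|/negP]; rewrite inE/= in_itv/= => H.
        by rewrite H mul1r -EFinM mulrC.
      by rewrite ifF ?mul0r//; apply/negP.
    have mp : measurable_fun `]0%R, x[ (fun y : R => (k.+1%:R * y ^+ k)%:E).
      apply/measurable_EFinP; apply: measurable_funM => //.
    rewrite ge0_integralZl//; first last.
    - by rewrite lee_fin mulr_ge0 ?expR_ge0// ltW.
    - move=> y /=; rewrite in_itv/= => /andP[y0 _].
      by rewrite lee_fin mulr_ge0// exprn_ge0// ltW.
    rewrite (integral_itv_bndo_bndc mp).
    have dy (y : R) : is_derive y 1 (fun y : R => y ^+ k.+1) (k.+1%:R * y ^+ k).
      have := @is_deriveX R R id k.+1 y 1 1 (is_derive_id _ _).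
      rewrite exprfctE => dX; apply: (is_derive_eq dX).
      by rewrite /GRing.scale/= mulr1.
    have cy (y : R) : {for y, continuous (fun y : R => k.+1%:R * y ^+ k)}.
      by apply: continuousM; [exact: cst_continuous|exact: exprn_continuous].
    rewrite (integral_derivative_itv (ltW x0) (fun y _ => dy y) (fun y _ => cy y)).
    rewrite expr0n/= subr0 -EFinM; congr EFin; rewrite !exprS; ring.
  rewrite inE/= in_itv/= andbT => x0.
  rewrite integral0_eq// => y _; rewrite /f ifF ?mul0r//.
  by apply/negP => /andP[y0 /(lt_trans y0)].
rewrite (@fubini_tonelli _ _ _ _ _ leb leb f mf f0).
rewrite /gauss_moment -ge0_integralZl//; first last.
- by move=> x /=; rewrite in_itv/= andbT => x0; rewrite lee_fin mulr_ge0 ?expR_ge0// exprn_ge0// ltW.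
- by apply: measurable_funTS; exact: measurable_gauss_moment.
rewrite [RHS]integral_mkcond; apply: eq_integral => y _.
rewrite patchE; case: ifPn => [|/negP]; rewrite inE/= in_itv/= andbT => y0; last first.
  rewrite integral0_eq// => x _; rewrite /f ifF ?mul0r//.
  by apply/negP => /andP[].
rewrite -EFinM mulrA [in RHS]EFinM -tailE//.
rewrite -ge0_integralZl//; first last.
- by rewrite lee_fin mulr_ge0// exprn_ge0// ltW.
- move=> x /=; rewrite in_itv/= andbT => yx.
  by rewrite lee_fin mulr_ge0 ?expR_ge0// ltW// (lt_trans y0).
- apply: measurable_funTS.
  have := measurable_gauss_moment 1; by under eq_fun do rewrite expr1.
rewrite [RHS]integral_mkcond; apply: eq_integral => x _; rewrite patchE /f/= y0/=.
case: ifPn => [|/negP] yx.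
  by rewrite mem_set ?mul1r// ?EFinM//= in_itv/= yx.
by rewrite memNset ?mul0r//= in_itv/= andbT.
Qed.

Lemma gauss_moment_fin k : gauss_moment k \is a fin_num.
Proof.
suff : gauss_moment k \is a fin_num /\ gauss_moment k.+1 \is a fin_num by case.
elim: k => [|k [H1 H2]]; first by rewrite gauss_moment0 gauss_moment1.
by split => //; rewrite gauss_momentSS fin_numM.
Qed.

Definition Mgauss k : R := fine (gauss_moment k).

Lemma MgaussE k : gauss_moment k = (Mgauss k)%:E.
Proof. by rewrite fineK// gauss_moment_fin. Qed.

Lemma Mgauss0 : Mgauss 0 = Num.sqrt (2 * pi) / 2.
Proof. by rewrite /Mgauss gauss_moment0. Qed.

Lemma Mgauss1 : Mgauss 1 = 1.
Proof. by rewrite /Mgauss gauss_moment1. Qed.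

Lemma MgaussSS k : Mgauss k.+2 = k.+1%:R * Mgauss k.
Proof. by rewrite /Mgauss gauss_momentSS MgaussE. Qed.

Lemma Mgauss_gt0 k : 0 < Mgauss k.
Proof.
suff : 0 < Mgauss k /\ 0 < Mgauss k.+1 by case.
elim: k => [|k [H1 H2]]; last by split => //; rewrite MgaussSS mulr_gt0.
by rewrite Mgauss0 Mgauss1 divr_gt0 ?sqrtr_gt0 ?mulr_gt0 ?pi_gt0.
Qed.

(** Legendre's duplication formula at half-integers, in terms of Gaussian moments. *)
Lemma Mgauss_duplication k : Mgauss k * Mgauss k.+1 = Mgauss 0 * k`!%:R.
Proof.
elim: k => [|k IH]; first by rewrite Mgauss1 fact0.
by rewrite MgaussSS mulrCA (mulrC _ (Mgauss k)) IH factS natrM mulrCA.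
Qed.

Lemma Mgauss_odd k : Mgauss (k.*2.+1) = 2 ^+ k * k`!%:R.
Proof.
elim: k => [|k IH]; first by rewrite Mgauss1 mul1r fact0.
rewrite doubleS MgaussSS IH factS natrM exprS -addn1 -addn1 -addnA -mul2n.
by rewrite natrD natrM -natr1; ring.
Qed.

(** The model involves Gamma at half-integers only; the substitution y = x^2 / 2 turns these values
    into Gaussian moments, the natural constants for the laws of the totals. *)
Lemma Gamma_funE k : Gamma_fun ((k%:R + 1) / 2) = 2 `^ ((1 - k%:R) / 2) * Mgauss k.
Proof.
rewrite /Gamma_fun /Rintegral /Mgauss.
have k0 : 0 < 2^-1 :> R by [].
pose h (y : R) := (y `^ ((k%:R + 1) / 2 - 1) * expR (- y))%:E.
have mh : measurable_fun setT h.
  apply/measurable_EFinP; apply: measurable_funM; first exact: measurable_powR.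
  exact: measurableT_comp.
have h0 y : (0 <= h y)%E by rewrite lee_fin mulr_ge0 ?powR_ge0 ?expR_ge0.
rewrite (ge0_integral_square k0 mh h0).
rewrite -[RHS]/(fine ((2 `^ ((1 - k%:R) / 2))%:E * (fine (gauss_moment k))%:E)).
rewrite fineK ?gauss_moment_fin// /gauss_moment -ge0_integralZl//; first last.
- move=> x /=; rewrite in_itv/= andbT => x0.
  by rewrite lee_fin mulr_ge0 ?expR_ge0// exprn_ge0// ltW.
- by apply: measurable_funTS; exact: measurable_gauss_moment.
congr fine; apply: eq_integral => x; rewrite inE/= in_itv/= andbT => x0.
rewrite /h -!EFinM; congr EFin.
have -> : 2^-1 * (2 * x) = x by rewrite mulrA mulVf// mul1r.
have -> : 2^-1 * x ^+ 2 = x ^+ 2 / 2 by rewrite mulrC.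
rewrite mulrAC mulrA; congr (_ * _).
rewrite powRM ?sqr_ge0//.
have -> : (x ^+ 2) `^ ((k%:R + 1) / 2 - 1) = x `^ (k%:R - 1).
  rewrite -[x ^+ 2]powR_mulrn ?ltW// -powRrM; congr (_ `^ _); by field.
have -> : (2^-1 : R) `^ ((k%:R + 1) / 2 - 1) = 2 `^ ((1 - k%:R) / 2).
  transitivity ((2 `^ (-1)) `^ ((k%:R + 1) / 2 - 1) : R); first by rewrite powR_inv1.
  by rewrite -powRrM; congr (_ `^ _); field.
rewrite mulrAC mulrC; congr (_ * _).
rewrite -[X in _ * X](powRr1 (ltW x0)) -powRD; last first.
  by rewrite [x == 0]gt_eqF ?implybT.
by rewrite subrK powR_mulrn// ltW.
Qed.

Lemma Gamma_fun1 : Gamma_fun (1 : R) = 1.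
Proof.
have := Gamma_funE 1; rewrite (_ : (1%:R + 1) / 2 = 1); last by field.
by rewrite subrr mul0r powRr0 mul1r Mgauss1.
Qed.

Lemma Gamma_fun_nat k : Gamma_fun (k.+1%:R : R) = k`!%:R.
Proof.
have := Gamma_funE k.*2.+1.
have -> : (k.*2.+1%:R + 1) / 2 = k.+1%:R :> R.
  by rewrite -!natr1 -mul2n natrM; field.
move=> ->; rewrite Mgauss_odd mulrA (_ : _ * 2 ^+ k = 1) ?mul1r//.
rewrite -powR_mulrn// -powRD; last by rewrite [2 == 0]gt_eqF ?implybT.
by rewrite (_ : _ + _ = 0) ?powRr0// -natr1 -mul2n natrM; field.
Qed.

Lemma Gamma_fun_half : Gamma_fun (1 / 2 : R) = Num.sqrt 2 * Mgauss 0.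
Proof.
have := Gamma_funE 0; rewrite add0r => ->; congr (_ * _).
by rewrite subr0 mul1r powR12_sqrt.
Qed.

(** On the right stands the constant that comes out of the mixture for m + 1 colors: m! / M_(m + 1)
    is the constant of the density of the initial quantities, and each of the m convolutions
    contributes a factor sqrt (2 pi). *)
Lemma dirichlet_half_const m :
  Gamma_fun (m.+1%:R / 2 : R) / Gamma_fun (1 / 2) ^+ m.+1 =
  m`!%:R / Mgauss m.+1 / Num.sqrt (2 * pi) ^+ m.
Proof.
have M0 := Mgauss_gt0 0; have M1 := Mgauss_gt0 m.+1.
have := Gamma_funE m; rewrite natr1 => ->; rewrite Gamma_fun_half.
have -> : Num.sqrt (2 * pi) = 2 * Mgauss 0 by rewrite Mgauss0; field.
have -> : m`!%:R = Mgauss m * Mgauss m.+1 / Mgauss 0.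
  by rewrite Mgauss_duplication mulrC mulrA mulVf ?mul1r// gt_eqF.
rewrite !exprMn.
have -> : 2 `^ ((1 - m%:R) / 2) = Num.sqrt 2 ^+ m.+1 / 2 ^+ m :> R.
  rewrite -powR12_sqrt// -powR_mulrn ?powR_ge0// -powRrM -powR_mulrn//.
  rewrite -powRN -powRD; last by rewrite [2 == 0]gt_eqF ?implybT.
  congr (_ `^ _).
  by rewrite -natr1; field.
have s2 : 0 < Num.sqrt 2 :> R by rewrite sqrtr_gt0.
rewrite [Mgauss 0 ^+ m.+1]exprS; field; rewrite !gt_eqF//= ?exprn_gt0//.
Qed.

(** The density of the chi law with j + 1 degrees of freedom. The initial total has this law when j
    is the number of colors. *)
Definition radial (j : nat) (c : R) : R :=
  if 0 < c then c ^+ j * expR (- (c ^+ 2 / 2)) / Mgauss j else 0.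

Lemma radial_ge0 j c : 0 <= radial j c.
Proof.
rewrite /radial; case: ifPn => // c0; apply: divr_ge0; last exact/ltW/Mgauss_gt0.
by apply: mulr_ge0; [apply: exprn_ge0; exact: ltW|exact: expR_ge0].
Qed.

End gaussian_moments.

Section product_integrals.
Context {R : realType}.
Local Notation leb := (@lebesgue_measure R).
Local Notation lebn := (@lebesgue_tuple R).
Local Open Scope ereal_scope.

Lemma emeasurable_prod d (T : measurableType d) (I : Type) (s : seq I)
    (f : I -> T -> \bar R) : (forall i, measurable_fun setT (f i)) ->
  measurable_fun setT (fun t => \prod_(i <- s) f i t).
Proof.
move=> mf; elim: s => [|i s IH].
  rewrite (_ : (fun _ => _) = cst 1); first exact: measurable_cst.
  by apply/funext => t; rewrite big_nil.
by under eq_fun do rewrite big_cons; exact: emeasurable_funM.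
Qed.

Lemma integral_lebesgue_tuple_prod m (h : 'I_m -> R -> \bar R) :
  (forall i, measurable_fun setT (h i)) -> (forall i x, 0 <= h i x) ->
  \int[lebn m]_t (\prod_(i < m) h i (tnth t i)) = \prod_(i < m) \int[leb]_x h i x.
Proof.
elim: m h => [|m IH] h mh h0.
  rewrite integral_lebesgue_tuple0 ?big_ord0//.
  by apply: emeasurable_prod => -[].
have mP k (g : 'I_k -> R -> \bar R) : (forall i, measurable_fun setT (g i)) ->
    measurable_fun setT (fun t : k.-tuple R => \prod_(i < k) g i (tnth t i)).
  move=> mg; apply: emeasurable_prod => i.
  exact: (measurableT_comp (mg i) (measurable_tnth i)).
have P0 k (g : 'I_k -> R -> \bar R) t : (forall i x, 0 <= g i x) ->
    0 <= \prod_(i < k) g i (t i).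
  by move=> g0; apply: prode_ge0.
rewrite integral_lebesgue_tupleS//; first last.
- by move=> t; exact: (P0 _ h (tnth t)).
- exact: mP.
rewrite [RHS]big_ord_recl -ge0_integralZr//; first last.
- by apply: prode_ge0 => i _; exact: integral_ge0.
- exact: mh.
apply: eq_integral => x _; rewrite -IH//.
rewrite -ge0_integralZl//.
- apply: eq_integral => t _; rewrite [LHS]big_ord_recl tnth0; congr (_ * _).
  by apply: eq_bigr => i _; rewrite tnthS.
- exact: (mP _ (fun i => h (lift ord0 i))).
- by move=> t _; exact: (P0 _ (fun i => h (lift ord0 i)) (tnth t)).
Qed.

Lemma measurable_nth_tuple k (f : k.-tuple R -> R) i : measurable_fun setT f ->
  measurable_fun setT (fun s : k.-tuple R => nth (f s) s i).
Proof.
move=> mf; have [ik|ki] := ltnP i k.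
  rewrite (_ : (fun _ => _) = (@tnth k R)^~ (Ordinal ik)); first exact: measurable_tnth.
  by apply/funext => s; rewrite (tnth_nth (f s)).
rewrite (_ : (fun _ => _) = f)//; apply/funext => s.
by rewrite nth_default// size_tuple.
Qed.

Lemma measurable_sum_tuple k :
  measurable_fun setT (fun s : k.-tuple R => (\sum_(y <- s) y)%R).
Proof.
under eq_fun do rewrite big_tuple; apply: measurable_sum => i.
exact: measurable_tnth.
Qed.

Lemma measurable_simplex_point m :
  measurable_fun setT (fun s : m.-1.-tuple R => simplex_point m s).
Proof.
apply/measurable_fun_tnthP => i; rewrite /comp/=.
under eq_fun do rewrite tnth_mktuple.
apply: measurable_nth_tuple; apply: measurable_funB => //.
exact: measurable_sum_tuple.
Qed.

Lemma measurable_levy1 (a : R) : measurable_fun setT (levy a).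
Proof. exact: (measurableT_comp measurable_levy (pair1_measurable a)). Qed.

(** The last coordinate is the default value of [nth], as in [simplex_point], which is the case t =
    1. A general t serves the induction, where the first coordinate is subtracted from it. *)
Lemma levy_convolution_iter k (l : nat -> R) (t : R) : (forall i, 0 < l i)%R ->
  \int[lebn k]_s (\prod_(i < k.+1) (levy (l i) (nth (t - \sum_(y <- s) y)%R s i))%:E) =
  (Num.sqrt (2 * pi) ^+ k * levy (\sum_(i < k.+1) l i) t)%R%:E.
Proof.
have mG j (l' : nat -> R) (t' : R) : measurable_fun setT (fun s : j.-tuple R =>
    (\prod_(i < j.+1) (levy (l' i) (nth (t' - \sum_(y <- s) y)%R s i))%:E)).
  apply: emeasurable_prod => i; apply/measurable_EFinP.
  apply: (measurableT_comp (measurable_levy1 _)).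
  apply: measurable_nth_tuple; apply: measurable_funB => //.
  exact: measurable_sum_tuple.
elim: k l t => [|k IH] l t l0.
  rewrite integral_lebesgue_tuple0//.
  by rewrite !big_ord_recl !big_ord0 mule1 addr0 mul1r big_nil subr0.
rewrite integral_lebesgue_tupleS//; last first.
  by move=> s; apply: prode_ge0 => i _; rewrite lee_fin levy_ge0// ltW.
transitivity (\int[leb]_x ((Num.sqrt (2 * pi) ^+ k)%:E *
    (levy (l 0%N) x * levy (\sum_(i < k.+1) l i.+1)%R (t - x)%R)%:E)).
  apply: eq_integral => x _.
  have IHE := IH (l \o S) (t - x)%R (fun i => l0 i.+1).
  have -> : (Num.sqrt (2 * pi) ^+ k)%:E *
      (levy (l 0%N) x * levy (\sum_(i < k.+1) l i.+1)%R (t - x)%R)%:E =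
      (levy (l 0%N) x)%:E * \int[lebn k]_s
        \prod_(i < k.+1) (levy ((l \o S) i) (nth (t - x - \sum_(y <- s) y)%R s i))%:E.
    by rewrite IHE -!EFinM mulrCA.
  rewrite -ge0_integralZl//; first last.
  - by rewrite lee_fin levy_ge0// ltW.
  - move=> s _; apply: prode_ge0 => i _; rewrite lee_fin levy_ge0//.
    exact/ltW/l0.
  - exact: (mG k (l \o S)).
  apply: eq_integral => s _; rewrite big_ord_recl/=; congr (_ * _).
  by apply: eq_bigr => i _ /=; rewrite big_cons opprD addrA.
have sl0 : (0 < \sum_(i < k.+1) l i.+1)%R.
  rewrite big_ord_recl ltr_pwDl// sumr_ge0// => i _; exact: ltW.
rewrite ge0_integralZl//; first last.
- by move=> x _; rewrite lee_fin mulr_ge0// levy_ge0// ltW.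
- apply/measurable_EFinP; apply: measurable_funM; first exact: measurable_levy1.
  by apply: (measurableT_comp (measurable_levy1 _)); exact: measurable_funB.
rewrite levy_convolution// -EFinM mulrA -exprSr.
by rewrite [in RHS]big_ord_recl.
Qed.

End product_integrals.

Section measurable_inverse.
Context {R : realType}.

Lemma measurable_inv : measurable_fun setT (fun x : R => x^-1).
Proof.
rewrite (_ : (fun _ => _) = fun x : R => if 0 < x then x `^ (-1) else
    if x < 0 then - ((- x) `^ (-1)) else 0).
  apply: measurable_fun_ifT; [exact: measurable_fun_ltr|exact: measurable_powR|].
  apply: measurable_fun_ifT => //; first exact: measurable_fun_ltr.
  by apply: measurableT_comp => //; apply: (measurableT_comp (measurable_powR _)).
apply/funext => x; case: ltgtP => [x0|x0|<-]; last by rewrite invr0.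
  by rewrite powR_inv1// ltW.
by rewrite powR_inv1 ?oppr_ge0 1?ltW// invrN opprK.
Qed.

End measurable_inverse.

(** * Laws of successive gaps given the mixing point *)

Section chains.
Context {R : realType}.
Local Notation leb := (@lebesgue_measure R).
Local Open Scope ereal_scope.

Section generic.
Variables c w b : R -> R -> R.

(** The common shape of [chain] and [levy_chain], so that positivity and measurability are proved
    once: [c] weighs the level before a step, [w] the level after it and [b] the final level. *)
Fixpoint weighted_chain (Bs : seq (set R)) (x l : R) : \bar R :=
  if Bs is B :: Bs' then
    (c x l)%:E * \int[leb]_(a in `]0%R, +oo[)
      ((\1_B a * w x (l + a))%R%:E * weighted_chain Bs' x (l + a)%R)
  else (b x l)%:E.

Hypothesis c0 : forall x l, (0 < x -> 0 <= l -> 0 <= c x l)%R.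
Hypothesis w0 : forall x l, (0 < x -> 0 <= l -> 0 <= w x l)%R.
Hypothesis b0 : forall x l, (0 < x -> 0 <= l -> 0 <= b x l)%R.
Hypothesis mc : measurable_fun setT (fun z : R * R => c z.1 z.2).
Hypothesis mw : measurable_fun setT (fun z : R * R => w z.1 z.2).
Hypothesis mb : measurable_fun setT (fun z : R * R => b z.1 z.2).

Lemma weighted_chain_ge0 x Bs l : (0 < x)%R -> (0 <= l)%R ->
  0 <= weighted_chain Bs x l.
Proof.
move=> x0; elim: Bs l => [|B Bs IH] l l0 /=; first by rewrite lee_fin b0.
rewrite mule_ge0 ?lee_fin ?c0//; apply: integral_ge0 => a /=.
rewrite in_itv/= andbT => a0.
have la0 : (0 <= l + a)%R by rewrite addr_ge0// ltW.
by rewrite mule_ge0 ?IH// lee_fin mulr_ge0// w0.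
Qed.

Let guard (f : R -> R -> \bar R) (z : R * R) : \bar R :=
  if (0 < z.1)%R && (0 <= z.2)%R then f z.1 z.2 else 0.

Let measurable_guard (f : R -> R -> \bar R) :
  measurable_fun setT (fun z : R * R => f z.1 z.2) -> measurable_fun setT (guard f).
Proof.
move=> mf; apply: measurable_fun_ifT => //.
by apply: measurable_and; [exact: measurable_fun_ltr|exact: measurable_fun_ler].
Qed.

(** The guard keeps to the domain where the nested integrands are nonnegative; there Tonelli's
    theorem gives the measurability of the inner integral in (x, l). *)
Lemma measurable_weighted_chain Bs : (forall B, B \in Bs -> measurable B) ->
  measurable_fun setT (fun z : R * R =>
    if (0 < z.1)%R && (0 <= z.2)%R then weighted_chain Bs z.1 z.2 else 0).
Proof.
elim: Bs => [|B Bs IH] mB /=.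
  by apply: (measurable_guard (f := fun x l => (b x l)%:E)); exact/measurable_EFinP.
have {}IH := IH (fun C hC => mB C (mem_behead (s := B :: Bs) hC)).
have mB' : measurable B by apply: mB; rewrite mem_head.
pose F (z : (R * R) * R) : \bar R :=
  if (0 < z.2)%R && ((0 < z.1.1)%R && (0 <= z.1.2)%R) then
   (\1_B z.2 * w z.1.1 (z.1.2 + z.2))%R%:E *
     guard (fun x l => weighted_chain Bs x l) (z.1.1, (z.1.2 + z.2)%R)
  else 0.
have mg : measurable_fun setT (fun z : R * R * R => (z.1.1, (z.1.2 + z.2)%R)).
  apply: measurable_fun_pair; first exact: measurableT_comp.
  by apply: measurable_funD => //; exact: measurableT_comp.
have mF : measurable_fun setT F.
  apply: measurable_fun_ifT => //.
    apply: measurable_and; first exact: measurable_fun_ltr.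
    apply: measurable_and.
      by apply: measurable_fun_ltr => //; exact: measurableT_comp.
    by apply: measurable_fun_ler => //; exact: measurableT_comp.
  apply: emeasurable_funM; last exact: (measurableT_comp IH mg).
  apply/measurable_EFinP; apply: measurable_funM.
    by apply: measurableT_comp => //; exact: measurable_indic.
  exact: (measurableT_comp mw mg).
have F0 z : 0 <= F z.
  rewrite /F; case: ifPn => // /and3P[z0 z1 z2].
  have zz : (0 <= z.1.2 + z.2)%R by rewrite addr_ge0// ltW.
  rewrite mule_ge0 ?lee_fin ?mulr_ge0 ?w0//.
  by rewrite /guard/= z1 zz/= weighted_chain_ge0.
have mFF := @measurable_fun_fubini_tonelli_F _ _ _ _ _ leb F mF F0.
rewrite (_ : (fun _ => _) = fun z : R * R =>
    guard (fun x l => (c x l)%:E) z * fubini_F leb F z); last first.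
  apply/funext => -[x l]; rewrite /guard /=; case: ifPn => [/andP[x0 l0]|_].
    congr (_ * _); rewrite /fubini_F [LHS]integral_mkcond.
    apply: eq_integral => a _; rewrite patchE /F/= l0 x0/= andbT.
    have -> : (a \in `]0%R, +oo[%classic) = (0 < a)%R.
      by apply/idP/idP; rewrite inE/= in_itv/= andbT.
    by case: ifPn => // a0; rewrite /guard/= x0/= addr_ge0// ltW.
  by rewrite mul0e.
apply: emeasurable_funM => //.
by apply: measurable_guard; exact/measurable_EFinP.
Qed.

Lemma measurable_weighted_chain_step (Bs : seq (set R)) (x l : R) (B : set R) : (0 < x)%R -> (0 <= l)%R ->
  measurable B -> (forall B, B \in Bs -> measurable B) ->
  measurable_fun ([set` `]0%R, +oo[] : set R) (fun a : R =>
    (\1_B a * w x (l + a))%R%:E * weighted_chain Bs x (l + a)%R).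
Proof.
move=> x0 l0 mB mBs.
have mla : measurable_fun setT (fun a : R => (x, (l + a)%R)).
  by apply: measurable_fun_pair => //; exact: measurable_funD.
apply: (eq_measurable_fun (fun a : R => (\1_B a * w x (l + a))%R%:E *
    guard (weighted_chain Bs) (x, (l + a)%R))).
  move=> a; rewrite inE/= in_itv/= andbT => a0.
  by rewrite /guard/= x0/= addr_ge0// ltW.
apply: measurable_funTS; apply: emeasurable_funM.
  apply/measurable_EFinP; apply: measurable_funM; first exact: measurable_indic.
  exact: (measurableT_comp mw mla).
exact: (measurableT_comp (measurable_weighted_chain mBs) mla).
Qed.

End generic.

Definition chain_base (x l : R) : R := expR (- (l ^+ 2 / (2 * x))).

(* For a process with hazard rate s / x at s that is alive at l, chain Bs x l is
   e ^ (- l ^ 2 / (2 x)) times the probability that its next gaps fall in Bs.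
   levy_chain is l x ^ (size Bs - 3 / 2) times it: in this form the powers of
   x match those of the selection probabilities. *)
Definition chain : seq (set R) -> R -> R -> \bar R :=
  weighted_chain (fun _ _ => 1%R) (fun x l => l / x)%R chain_base.

Definition levy_chain : seq (set R) -> R -> R -> \bar R :=
  weighted_chain (fun _ l => l) (fun _ _ => 1%R) (fun x l => levy l x).

Let div0 (x l : R) : (0 < x -> 0 <= l -> 0 <= l / x)%R.
Proof. by move=> x0 l0; rewrite divr_ge0// ltW. Qed.

Let base0 (x l : R) : (0 < x -> 0 <= l -> 0 <= chain_base x l)%R.
Proof. by move=> _ _; exact: expR_ge0. Qed.

Let mdiv : measurable_fun setT (fun z : R * R => z.2 / z.1)%R.
Proof.
apply: measurable_funM => //.
exact: (measurableT_comp measurable_inv).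
Qed.

Let mbase : measurable_fun setT (fun z : R * R => chain_base z.1 z.2).
Proof.
apply: measurableT_comp => //; apply: measurableT_comp => //.
apply: measurable_funM; first exact: measurable_funX.
by apply: (measurableT_comp measurable_inv); exact: measurable_funM.
Qed.

Lemma chain_ge0 (Bs : seq (set R)) (x l : R) : (0 < x)%R -> (0 <= l)%R -> 0 <= chain Bs x l.
Proof. exact: weighted_chain_ge0. Qed.

Lemma levy_chain_ge0 (Bs : seq (set R)) (x l : R) : (0 <= l)%R -> 0 <= levy_chain Bs x l.
Proof.
move=> l0; have [x0|x0] := ltP 0%R x.
  by apply: weighted_chain_ge0 => // ? ? _ ?; exact: levy_ge0.
have -> : levy_chain Bs x l = 0 => //.
rewrite /levy_chain; elim: Bs l {l0} => [|B Bs IH] l /=.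
  by rewrite /levy ltNge x0.
by rewrite integral0_eq ?mule0// => a _; rewrite IH mule0.
Qed.

Lemma levy_chain_neg Bs x l : (x <= 0)%R -> levy_chain Bs x l = 0.
Proof.
move=> x0; rewrite /levy_chain; elim: Bs l => [|B Bs IH] l /=.
  by rewrite /levy ltNge x0.
by rewrite integral0_eq ?mule0// => a _; rewrite IH mule0.
Qed.

Lemma measurable_chain (Bs : seq (set R)) : (forall B, B \in Bs -> measurable B) ->
  measurable_fun setT (fun z : R * R =>
    if (0 < z.1)%R && (0 <= z.2)%R then chain Bs z.1 z.2 else 0).
Proof.
apply: measurable_weighted_chain => //.
Qed.

Lemma measurable_levy_chain (Bs : seq (set R)) : (forall B, B \in Bs -> measurable B) ->
  measurable_fun setT (fun z : R * R =>
    if (0 < z.1)%R && (0 <= z.2)%R then levy_chain Bs z.1 z.2 else 0).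
Proof.
apply: measurable_weighted_chain => //; first by move=> ? ? _ ?; exact: levy_ge0.
  exact: measurable_snd.
have ms : measurable_fun setT (fun z : R * R => (z.2, z.1)).
  exact: measurable_fun_pair.
by have := measurableT_comp measurable_levy ms.
Qed.

(** A step of [chain] brings the hazard (l + a) / x where [levy_chain] brings the factor l + a at
    the next level, hence one power of x per step. *)
Lemma levy_chainE (x : R) (Bs : seq (set R)) (l : R) : (0 < x)%R -> (0 <= l)%R ->
  (forall B, B \in Bs -> measurable B) ->
  levy_chain Bs x l =
  (l * (x ^+ size Bs * x `^ (- (3 / 2))))%R%:E * chain Bs x l.
Proof.
move=> x0; elim: Bs l => [|B Bs IH] l l0 mB; rewrite /levy_chain /chain/=.
  by rewrite /levy x0 mul1r -EFinM.
have mBs C : C \in Bs -> measurable C.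
  by move=> hC; apply: mB; rewrite in_cons hC orbT.
have mB' : measurable B by apply: mB; rewrite mem_head.
rewrite mul1e EFinM -muleA; congr (_ * _).
rewrite -ge0_integralZl//; first last.
- by rewrite lee_fin mulr_ge0 ?powR_ge0 ?exprn_ge0// ltW.
- move=> a /=; rewrite in_itv/= andbT => a0.
  have la0 : (0 <= l + a)%R by rewrite addr_ge0// ltW.
  by rewrite mule_ge0 ?chain_ge0// lee_fin mulr_ge0// divr_ge0// ltW.
- by apply: measurable_weighted_chain_step.
apply: eq_integral => a; rewrite inE/= in_itv/= andbT => a0.
have la0 : (0 <= l + a)%R by rewrite addr_ge0// ltW.
rewrite mulr1 -/(levy_chain Bs x (l + a)%R) -/(chain Bs x (l + a)%R) IH//.
rewrite !muleA -!EFinM; congr (_%:E * _).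
by rewrite exprS; field; rewrite gt_eqF.
Qed.

(** The initial quantity is integrated out as a first gap starting from 0, which is why it is the
    first addition. The power x^(-1/2) is the one in the density of Dirichlet(1/2, ..., 1/2); the
    power [size Bs] accounts for the selections of the color. *)
Lemma integral_levy_chain (x : R) (Bs : seq (set R)) (B : set R) : (0 < x)%R -> measurable B ->
  (forall B, B \in Bs -> measurable B) ->
  \int[leb]_(l in `]0%R, +oo[) ((\1_B l)%:E * levy_chain Bs x l) =
  (x ^+ (size Bs) * x `^ (- (1 / 2)))%R%:E * chain (B :: Bs) x 0.
Proof.
move=> x0 mB mBs; rewrite /chain/= mul1e -ge0_integralZl//; first last.
- by rewrite lee_fin mulr_ge0 ?powR_ge0 ?exprn_ge0// ltW.
- move=> a /=; rewrite in_itv/= andbT => a0; rewrite add0r.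
  rewrite mule_ge0// ?lee_fin ?mulr_ge0 ?invr_ge0 ?(ltW a0) ?(ltW x0)//.
  by apply: chain_ge0 => //; exact: ltW.
- by apply: measurable_weighted_chain_step.
apply: eq_integral => a; rewrite inE/= in_itv/= andbT => a0; rewrite add0r.
rewrite levy_chainE ?ltW// -/(chain Bs x a) !muleA -!EFinM; congr (_%:E * _).
have -> : (x `^ (- (1 / 2)) = x `^ (- (3 / 2)) * x)%R.
  rewrite -[X in (_ `^ _ * X)%R](powRr1 (ltW x0)) -powRD; last first.
    by rewrite [(x == 0)%R]gt_eqF ?implybT.
  by congr (_ `^ _)%R; field.
by field; rewrite gt_eqF.
Qed.

Lemma chain_setT (x l : R) : (0 < x)%R -> (0 <= l)%R ->
  chain [:: setT] x l = (chain_base x l)%:E.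
Proof.
move=> x0 l0; rewrite /chain/= mul1e.
have k0 : (0 < x^-1)%R by rewrite invr_gt0.
have := integral_gaussian_tail k0 l0.
have -> : (x^-1 * l ^+ 2 / 2 = l ^+ 2 / (2 * x))%R by field; rewrite gt_eqF.
move=> <-; rewrite integral_mkcond [RHS]integral_mkcond.
rewrite [RHS](@ge0_integral_affine _ 1 l)//; first last.
- move=> y; rewrite patchE; case: ifPn => // /[1!inE]/=; rewrite in_itv/= andbT => ly.
  by rewrite lee_fin !mulr_ge0 ?expR_ge0 ?invr_ge0 ?(ltW x0) ?(le_trans l0 (ltW ly)).
- apply/(measurable_restrictT _ _).1 => //.
  apply/measurable_EFinP; apply: measurable_funTS; apply: measurable_funM.
    by apply: measurable_funM.
  apply: measurableT_comp => //; apply: measurableT_comp => //.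
  by apply: measurable_funM => //; apply: measurable_funM => //.
apply: eq_integral => a _; rewrite mule1 mul1r !patchE.
have -> : (a \in `]0%R, +oo[%classic) = (0 < a)%R.
  by apply/idP/idP; rewrite inE/= in_itv/= andbT.
have -> : ((a + l)%R \in `]l, +oo[%classic) = (0 < a)%R.
  by apply/idP/idP; rewrite inE/= in_itv/= andbT ltrDr.
case: ifPn => // a0; rewrite indicT mul1r -EFinM /chain_base; congr EFin.
rewrite (addrC a) (mulrC _ (l + a)%R); congr (_ * expR (- _))%R.
by field; rewrite gt_eqF.
Qed.

(** The law of one gap has mass 1, by the Gaussian tail in [chain_setT], so leaving the last gaps
    free changes nothing. This makes laws of stretches of different lengths consistent. *)
Lemma chain_cat_setT (x l : R) (Bs : seq (set R)) k : (0 < x)%R -> (0 <= l)%R ->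
  chain (Bs ++ nseq k setT) x l = chain Bs x l.
Proof.
move=> x0; elim: Bs l => [|B Bs IH] l l0.
  elim: k l l0 => // k IH l l0; rewrite -[RHS](chain_setT x0 l0).
  rewrite /chain/= -/(chain _ _ _); congr (_ * _); apply: eq_integral => a.
  rewrite inE/= in_itv/= andbT => a0; rewrite -/(chain (nseq k setT) x (l + a)%R) IH//.
  by rewrite addr_ge0// ltW.
rewrite /chain/=; congr (_ * _); apply: eq_integral => a.
rewrite inE/= in_itv/= andbT => a0; congr (_ * _).
by rewrite -/(chain _ x (l + a)%R) IH// addr_ge0// ltW.
Qed.

End chains.

(** * The urn as a Dirichlet mixture *)

Lemma measurable_preimage d1 d2 (X : measurableType d1) (Y : measurableType d2)
    (f : X -> Y) (B : set Y) : measurable_fun setT f -> measurable B ->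
  measurable (f @^-1` B).
Proof. by move=> mf mB; rewrite -[X in measurable X]setTI; exact: mf. Qed.

Lemma mem_pos (R : realType) (a : R) : (a \in (`]0%R, +oo[%classic : set R)) = (0 < a).
Proof. by apply/idP/idP; rewrite inE/= in_itv/= andbT. Qed.

Section urn_basics.
Context {d : measure_display} {T : measurableType d} {R : realType}.
Variable P : probability T R.
Variable m : nat.
Variables (L : 'I_m -> nat -> {RV P >-> R}) (I : nat -> T -> 'I_m)
  (A : nat -> {RV P >-> R}).
Hypothesis hmodel : urn_model L I A.
Local Notation leb := (@lebesgue_measure R).
Local Notation C := (total L).

Definition history_generator (n : nat) : set (set T) :=
  [set E | [\/ exists (i : 'I_m) (B : set R),
                     measurable B /\ E = L i 0%N @^-1` B,
                   exists (k : nat) (i : 'I_m),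
                     (1 <= k <= n)%N /\ E = I k @^-1` [set i] |
                   exists (k : nat) (B : set R),
                     [/\ (1 <= k <= n)%N, measurable B & E = A k @^-1` B]]].

(** The history is a measurable type of its own, so that being determined by the first n steps is
    plain measurability from it. *)
Definition history_type (n : nat) := g_sigma_algebraType (history_generator n).

Lemma measurable_history n E : history L I A n E -> measurable E.
Proof.
move: E; apply: smallest_sub; first exact: sigma_algebra_measurable.
move=> E [[i [B [mB ->]]]|[k [i [_ ->]]]|[k [B [_ mB ->]]]].
- by rewrite -[X in measurable X]setTI; exact: measurable_funP.
- exact: urn_index_measurable hmodel k i.
- by rewrite -[X in measurable X]setTI; exact: measurable_funP.
Qed.

Lemma measurable_to_history n : measurable_fun setT (fun w : T => w : history_type n).
Proof. by move=> _ E mE; rewrite setTI; exact: (measurable_history mE). Qed.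

Lemma history_fun d' (U : measurableType d') n (f : T -> U) :
  measurable_fun setT (f : history_type n -> U) -> measurable_fun setT f.
Proof.
move=> mf _ B mB; rewrite setTI; apply: (@measurable_history n).
by have := mf measurableT B mB; rewrite setTI.
Qed.

Lemma history_index n k i : (1 <= k <= n)%N -> history L I A n (I k @^-1` [set i]).
Proof. by move=> kn; apply: sub_sigma_algebra; apply: Or32; exists k, i. Qed.

Lemma history_addition n k : (1 <= k <= n)%N ->
  measurable_fun setT (A k : history_type n -> R).
Proof.
move=> kn _ B mB; rewrite setTI.
by apply: sub_sigma_algebra; apply: Or33; exists k, B.
Qed.

Lemma history_quantity n k j : (k <= n)%N ->
  measurable_fun setT (L j k : history_type n -> R).
Proof.
elim: k => [_|k IH kn].
  by move=> _ B mB; rewrite setTI; apply: sub_sigma_algebra; apply: Or31; exists j, B.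
have -> : (L j k.+1 : T -> R) =
    (fun w => if j == I k.+1 w then L j k w + A k.+1 w else L j k w).
  by apply/funext => w; exact: (urn_step hmodel).
apply: measurable_fun_ifT.
- apply: (@measurable_fun_bool _ _ _ _ true).
  rewrite setTI (_ : _ @^-1` _ = I k.+1 @^-1` [set j]).
    exact: history_index.
  by apply/seteqP; split => w /=; [move/eqP => ->|move=> ->; rewrite eqxx].
- by apply: measurable_funD; [apply: IH; exact: ltnW|exact: history_addition].
- by apply: IH; exact: ltnW.
Qed.

Lemma history_total n k : (k <= n)%N -> measurable_fun setT (C k : history_type n -> R).
Proof. by move=> kn; apply: measurable_sum => i; exact: history_quantity. Qed.

Lemma history_proportion n k j : (k <= n)%N ->
  measurable_fun setT (proportion L j k : history_type n -> R).
Proof.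
move=> kn; apply: measurable_funM; first exact: history_quantity.
by apply: (measurableT_comp measurable_inv); exact: history_total.
Qed.

Lemma history_mono n k E : (k <= n)%N -> history L I A k E -> history L I A n E.
Proof.
move=> kn; move: E; apply: smallest_sub; first exact: smallest_sigma_algebra.
move=> E HE; apply: sub_sigma_algebra; case: HE.
- by move=> H; apply: Or31.
- move=> [l [i [/andP[l1 lk] ->]]]; apply: Or32; exists l, i.
  by rewrite l1 (leq_trans lk).
- move=> [l [B [/andP[l1 lk] mB ->]]]; apply: Or33; exists l, B.
  by rewrite l1 (leq_trans lk).
Qed.

Definition positive_at (n : nat) : set T := [set w | forall j, 0 < L j n w].

Lemma measurable_total n : measurable_fun setT (C n).
Proof. by apply: (@history_fun _ _ n); exact: history_total. Qed.

Lemma measurable_proportion j n : measurable_fun setT (proportion L j n).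
Proof. by apply: (@history_fun _ _ n); exact: history_proportion. Qed.

Lemma measurable_proportions n : measurable_fun setT (proportions L n).
Proof.
apply/measurable_fun_tnthP => i; rewrite /comp/=.
by under eq_fun do rewrite tnth_mktuple; exact: measurable_proportion.
Qed.

Lemma history_positive_at n : history L I A n (positive_at n).
Proof.
rewrite (_ : positive_at n = \bigcap_(j in [set: 'I_m]) (L j n @^-1` `]0, +oo[)).
  apply: (@fin_bigcap_measurable _ (history_type n)) => // j _.
  by have := history_quantity j (leqnn n) measurableT (measurable_itv `]0%R, +oo[); rewrite setTI.
apply/seteqP; split => w /= H j; first by move=> _; rewrite /= in_itv/= andbT; exact: H.
by have := H j Logic.I; rewrite /= in_itv/= andbT.
Qed.

(* addition_weight is extended by 0 outside the domain where it is nonnegative. *)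
Definition guarded_weight (c a : R) : R :=
  if (0 < c) && (0 < a) then addition_weight c a else 0.

Lemma guarded_weight_ge0 c a : 0 <= guarded_weight c a.
Proof.
rewrite /guarded_weight; case: ifPn => // /andP[c0 a0].
by rewrite mulr_ge0 ?expR_ge0// addr_ge0// ltW.
Qed.

Lemma measurable_guarded_weight :
  measurable_fun setT (fun z : R * R => guarded_weight z.1 z.2).
Proof.
apply: measurable_fun_ifT => //.
  by apply: measurable_and; exact: measurable_fun_ltr.
apply: measurable_funM; first exact: measurable_funD.
apply: measurableT_comp => //; apply: measurable_funD.
  apply: measurable_funM => //; apply: measurableT_comp => //.
  by apply: measurable_funX; exact: measurable_funD.
by apply: measurable_funM => //; exact: measurable_funX.
Qed.

(** When a has density (a + c) exp (- y) with y = ((a + c)^2 - c^2) / 2, the variable y is standard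
    exponential. The case k = 1 normalizes this density; k = 1 / 2 gives the exponential moment that
    bounds the variance of a step. The integral is the mass of one free gap from c at x = 1 / k. *)
Lemma integral_guarded_weight_exp c k : 0 < c -> 0 < k ->
  (\int[leb]_(a in `]0%R, +oo[)
     ((a + c) * expR (- (k * ((a + c) ^+ 2 - c ^+ 2) / 2)))%:E = (k^-1)%:E)%E.
Proof.
move=> c0 k0.
have := @chain_setT R k^-1 c; rewrite invr_gt0 => /(_ k0 (ltW c0)).
rewrite /chain/= mul1e => H.
transitivity ((k^-1 * expR (k * c ^+ 2 / 2))%:E * (chain_base k^-1 c)%:E)%E; last first.
  rewrite -[LHS]/((k^-1 * expR (k * c ^+ 2 / 2) * chain_base k^-1 c)%:E) /chain_base.
  by rewrite -mulrA -expRD (_ : _ + _ = 0) ?expR0 ?mulr1//; field; rewrite gt_eqF.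
rewrite -H -ge0_integralZl//; first last.
- by rewrite lee_fin mulr_ge0 ?expR_ge0// invr_ge0 ltW.
- move=> a /=; rewrite in_itv/= andbT => a0; rewrite -EFinM lee_fin.
  by rewrite !mulr_ge0 ?expR_ge0// ?addr_ge0 ?invr_ge0 ?ltW// invr_gt0.
- apply: measurable_funTS; apply: emeasurable_funM; apply/measurable_EFinP.
    apply: measurable_funM; first exact: measurable_indic.
    by apply: measurable_funM => //; exact: measurable_funD.
  apply: measurableT_comp => //; apply: measurableT_comp => //.
  apply: measurableT_comp => //; apply: measurable_funM => //.
  exact: (measurable_funD (f := cst c) (g := id)).
apply: eq_integral => a _; rewrite indicT mul1r -!EFinM invrK; congr EFin.
rewrite /chain_base.
have -> : - ((c + a) ^+ 2 / (2 * k^-1)) = - (k * (c + a) ^+ 2 / 2).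
  by field; rewrite gt_eqF.
have -> : - (k * ((a + c) ^+ 2 - c ^+ 2) / 2) = k * c ^+ 2 / 2 + - (k * (c + a) ^+ 2 / 2).
  by field.
by rewrite expRD; field; rewrite gt_eqF.
Qed.

Lemma measurable_guarded_weight1 c : measurable_fun setT (guarded_weight c).
Proof. exact: (measurableT_comp measurable_guarded_weight (pair1_measurable c)). Qed.

Lemma integral_guarded_weight c : 0 < c ->
  (\int[leb]_a (guarded_weight c a)%:E = 1)%E.
Proof.
move=> c0; have := @integral_guarded_weight_exp c 1 c0 ltr01; rewrite invr1 => <-.
rewrite [RHS]integral_mkcond; apply: eq_integral => a _; rewrite patchE mem_pos.
rewrite /guarded_weight c0/=; case: ifPn => // a0.
by congr ((_ * expR _)%:E); field.
Qed.

Lemma addition_lawE (c : R) (B : set R) : 0 < c -> measurable B ->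
  (addition_law c B)%:E = (\int[leb]_(a in B) (guarded_weight c a)%:E)%E.
Proof.
move=> c0 mB.
have E B' : (\int[leb]_(a in B' `&` `]0%R, +oo[) (addition_weight c a)%:E =
    \int[leb]_(a in B') (guarded_weight c a)%:E)%E.
  rewrite integral_mkcond [RHS]integral_mkcond; apply: eq_integral => a _.
  rewrite !patchE /guarded_weight c0/= in_setI mem_pos.
  by case: (_ \in B') => //=; case: ifP.
have E1 : (\int[leb]_(a in `]0%R, +oo[) (addition_weight c a)%:E = 1)%E.
  by rewrite -[X in integral _ X _]setTI E integral_guarded_weight.
rewrite /addition_law /Rintegral E1 /= divr1 E fineK//.
rewrite ge0_fin_numE; last by apply: integral_ge0 => a _; rewrite lee_fin guarded_weight_ge0.
apply: (@le_lt_trans _ _ 1%E); last exact: ltry.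
rewrite -(integral_guarded_weight c0); apply: ge0_subset_integral => //.
- by apply/measurable_EFinP; exact: measurable_guarded_weight1.
- by move=> a _; rewrite lee_fin guarded_weight_ge0.
Qed.

Lemma addition_law_npos c : addition_law c (`]-oo, 0] : set R) = 0.
Proof.
rewrite /addition_law (_ : _ `&` _ = set0) ?Rintegral_set0 ?mul0r//.
by apply/seteqP; split => // a [/=]; rewrite !in_itv/= andbT leNgt => /negP.
Qed.

Lemma measurable_index n j : measurable (I n @^-1` [set j]).
Proof. exact: urn_index_measurable hmodel n j. Qed.

Lemma addition_npos_null n : P (A n.+1 @^-1` `]-oo, 0]) = 0%E.
Proof.
have mB : measurable (A n.+1 @^-1` (`]-oo, 0] : set R)).
  by rewrite -[X in measurable X]setTI; exact: measurable_funP.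
rewrite (_ : _ @^-1` _ = \bigcup_(i in [set: 'I_m]) (I n.+1 @^-1` [set i] `&` A n.+1 @^-1` `]-oo, 0])); last first.
  by apply/seteqP; split => w /=; [move=> Aw; exists (I n.+1 w)|move=> [i _ []]].
rewrite measure_fin_bigcup//; first last.
- by move=> i _; apply: measurableI => //; exact: measurable_index.
- by apply/trivIsetP => i j _ _ ij; apply/seteqP; split => // w [[/= E1 _] [/= E2 _]]; move/eqP: ij; rewrite -E1 -E2.
  exact: finite_finset.
rewrite fsbig1// => i _.
have mB0 : measurable (`]-oo, 0] : set R) by [].
have [_ /(_ setT)] := urn_step_law hmodel n i mB0; rewrite setIT => E.
rewrite [LHS]E; first by rewrite integral0_eq// => w _; rewrite addition_law_npos mulr0.
exact: (@measurableT _ (history_type n)).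
Qed.

Lemma total_neq0_ae : P [set w | C 0 w = 0] = 0%E.
Proof.
rewrite (_ : [set w | _] = (fun w => C 0 w ^+ 2) @^-1` [set 0]); last first.
  by apply/seteqP; split => w /=; [move=> ->; rewrite expr0n|move/eqP; rewrite sqrf_eq0 => /eqP].
rewrite (urn_total0_law hmodel)// (_ : _ `&` _ = [set 0]) ?integral_set1//.
by apply/seteqP; split => x; [case|move=> /= ->; split => //; rewrite /= in_itv/= lexx].
Qed.

Definition simplex_interior : set (m.-tuple R) := [set x | forall i, 0 < tnth x i].

Lemma measurable_simplex_interior : measurable simplex_interior.
Proof.
rewrite (_ : simplex_interior = \bigcap_(j in [set: 'I_m]) ((@tnth m R)^~ j @^-1` `]0, +oo[)).
  apply: fin_bigcap_measurable => // j _.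
  by have := @measurable_tnth _ R m j measurableT _ (measurable_itv `]0%R, +oo[); rewrite setTI.
apply/seteqP; split => w /= H j; first by move=> _; rewrite /= in_itv/= andbT; exact: H.
by have := H j Logic.I; rewrite /= in_itv/= andbT.
Qed.

Lemma dirichlet_density_ge0 (alpha : 'I_m -> R) x : 0 <= dirichlet_density alpha x.
Proof.
rewrite /dirichlet_density; case: ifPn => // /forallP x0.
have G0 a : 0 <= Gamma_fun a :> R.
  rewrite /Gamma_fun /Rintegral fine_ge0//; apply: integral_ge0 => y _.
  by rewrite lee_fin mulr_ge0 ?powR_ge0 ?expR_ge0.
by rewrite !mulr_ge0 ?invr_ge0 ?prodr_ge0// => i _; rewrite ?G0 ?powR_ge0.
Qed.

Lemma measurable_dirichlet_density (alpha : 'I_m -> R) :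
  measurable_fun setT (dirichlet_density alpha).
Proof.
have mI : measurable_fun setT (fun x : m.-tuple R => [forall i, 0 < tnth x i]).
  apply: (@measurable_fun_bool _ _ _ _ true).
  rewrite setTI (_ : _ @^-1` _ = simplex_interior); first exact: measurable_simplex_interior.
  by apply/seteqP; split => x /= /forallP.
apply: measurable_fun_ifT => //; apply: measurable_funM => //.
apply: measurable_prod => i _; exact: (measurableT_comp (measurable_powR _) (measurable_tnth i)).
Qed.

Lemma is_dirichlet_integral (alpha : 'I_m -> R) (X : T -> m.-tuple R)
    (f : m.-tuple R -> \bar R) :
  is_dirichlet P alpha X -> measurable_fun setT X -> measurable_fun setT f ->
  (forall x, 0 <= f x)%E ->
  (\int[P]_w f (X w) = \int[lebesgue_tuple m.-1]_s
     ((dirichlet_density alpha (simplex_point m s))%:E * f (simplex_point m s)))%E.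
Proof.
move=> dX mX mf f0.
have w0 s : 0 <= dirichlet_density alpha (simplex_point m s) by exact: dirichlet_density_ge0.
have mw : measurable_fun setT (fun s : m.-1.-tuple R =>
    dirichlet_density alpha (simplex_point m s)).
  exact: (measurableT_comp (@measurable_dirichlet_density alpha) (@measurable_simplex_point R m)).
rewrite -(weighted_law_integral (lebesgue_tuple m.-1) w0 mw (@measurable_simplex_point R m))//.
have -> : (\int[P]_w f (X w) = \int[pushforward P X]_y f y)%E.
  by rewrite ge0_integral_pushforward// preimage_setT.
apply: eq_measure_integral => S mS _.
rewrite [LHS]dX// iterated_integralE//; first last.
- by move=> t; rewrite lee_fin mulr_ge0.
- apply/measurable_EFinP; apply: measurable_funM => //.
  by apply: (measurableT_comp (measurable_indic mS)); exact: measurable_simplex_point.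
rewrite /= /weighted_law [RHS]integral_mkcond; apply: eq_integral => s _.
rewrite patchE indicE.
rewrite (_ : (s \in _ @^-1` S) = (simplex_point m s \in S)); last by apply/idP/idP; rewrite !inE.
by case: ifP => _; rewrite ?mul1r ?mul0r.
Qed.

Lemma proportions0_pos_null : P (proportions L 0 @^-1` ~` simplex_interior) = 0%E.
Proof.
rewrite (urn_proportions0_law hmodel); last by apply: measurableC; exact: measurable_simplex_interior.
have E s : (\1_(~` simplex_interior) (simplex_point m s) *
    dirichlet_density (fun=> 1) (simplex_point m s))%:E = 0%E.
  rewrite /dirichlet_density; case: ifPn => [/forallP H|]; last by rewrite mulr0.
  by rewrite indicE memNset ?mul0r//=; exact.
under eq_fun do rewrite E.
by elim: m.-1 => //= k ->; rewrite integral0.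
Qed.

(** Strict positivity comes from the laws alone: the Gamma law does not charge 0, the Dirichlet
    density vanishes off the interior of the simplex, and the law of an addition gives no mass to
    ]-oo, 0]. *)
Lemma not_positive_at_null n : P (~` positive_at n) = 0%E.
Proof.
have mpos k : measurable (~` positive_at k).
  exact/measurableC/(measurable_history (@history_positive_at k)).
have mC : measurable [set w | C 0 w = 0].
  exact: (measurable_preimage (@measurable_total 0) (measurable_set1 0)).
have mQ : measurable (proportions L 0 @^-1` ~` simplex_interior).
  apply: (measurable_preimage (@measurable_proportions 0)).
  by apply: measurableC; exact: measurable_simplex_interior.
elim: n => [|n IH]; apply/eqP; rewrite -measure_le0.
  apply: (@le_trans _ _ (P ([set w | C 0 w = 0] `|` proportions L 0 @^-1` ~` simplex_interior))).
    apply: le_measure; rewrite ?inE//; first exact: measurableU.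
    move=> w /= Hw; have [C0|C0] := eqVneq (C 0 w) 0; [by left|right => H; apply: Hw => j].
    have Cp : 0 < C 0 w by rewrite lt_neqAle eq_sym C0 (urn_total0_ge0 hmodel).
    have := H j; rewrite tnth_mktuple /proportion => /(mulr_gt0 Cp).
    by rewrite mulrCA divff// mulr1.
  by rewrite [leLHS](measureU0 mC mQ proportions0_pos_null) [leLHS]total_neq0_ae.
apply: (@le_trans _ _ (P (~` positive_at n `|` A n.+1 @^-1` `]-oo, 0]))).
  apply: le_measure; rewrite ?inE//.
  - apply: measurableU => //.
    by rewrite -[X in measurable X]setTI; exact: measurable_funP.
  - move=> w /= Hw; apply: contrapT => /not_orP[/contrapT H] HA; apply: Hw => j.
    rewrite (urn_step hmodel); case: ifP => // _.
    by rewrite addr_gt0//; move/negP : HA; rewrite /= in_itv/= -ltNge.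
have mA : measurable (A n.+1 @^-1` (`]-oo, 0] : set R)).
  exact: measurable_preimage.
by rewrite [leLHS](measureU0 (mpos n) mA (addition_npos_null n)) [leLHS]IH.
Qed.

(** The proportion, cut off on a null event so as to lie in [0, 1] at every point: Tonelli and the
    weighted laws need weights that are nonnegative everywhere. *)
Definition selection_weight (j : 'I_m) n w : R := \1_(positive_at n) w * proportion L j n w.

Lemma selection_weight_ge0 j n w : 0 <= selection_weight j n w.
Proof.
rewrite /selection_weight indicE; case: (boolP (_ \in _)) => [|_]; last by rewrite mul0r.
rewrite inE => H; rewrite mul1r divr_ge0//; first exact/ltW/H.
by apply: sumr_ge0 => i _; exact/ltW/H.
Qed.

Lemma history_selection_weight j n k : (k <= n)%N ->
  measurable_fun setT (selection_weight j k : history_type n -> R).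
Proof.
move=> kn; apply: measurable_funM; last exact: history_proportion.
apply: measurable_indic.
exact: (history_mono kn (@history_positive_at k)).
Qed.

Lemma ae_positive_at n : {ae P, forall w, positive_at n w}.
Proof.
exists (~` positive_at n); split => //; last exact: not_positive_at_null.
exact/measurableC/(measurable_history (@history_positive_at n)).
Qed.

Lemma positive_total n w : positive_at n w -> 0 < C n w.
Proof.
move=> H; rewrite /total (bigD1 (I 0 w))//= ltr_pwDl// ?sumr_ge0// => i _; exact/ltW/H.
Qed.

Lemma measurable_weight_average n (f : history_type n * R -> \bar R) :
  measurable_fun setT f -> (forall z, 0 <= f z)%E ->
  measurable_fun setT (fun w : history_type n =>
    \int[leb]_a ((guarded_weight (C n w) a)%:E * f (w, a)))%E.
Proof.
move=> mf f0.
pose g (z : history_type n * measurableTypeR R) : \bar R :=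
  ((guarded_weight (C n z.1) z.2)%:E * f (z.1, z.2))%E.
have mg : measurable_fun setT g.
  apply: emeasurable_funM; last first.
    apply: (measurableT_comp mf); exact: measurable_fun_pair.
  apply/measurable_EFinP.
  have mp : measurable_fun setT (fun z : history_type n * measurableTypeR R => (C n z.1, z.2 : R)).
    apply: measurable_fun_pair => //.
    exact: (measurableT_comp (@history_total n n (leqnn n))).
  exact: (measurableT_comp measurable_guarded_weight mp).
have g0 z : (0 <= g z)%E by rewrite mule_ge0// lee_fin guarded_weight_ge0.
exact: (@measurable_fun_fubini_tonelli_F _ _ _ _ _ leb g mg g0).
Qed.

(** The model gives the law of a step on rectangles, an event of the history times a Borel set of
    additions. These form a pi-system that generates the product of the two sigma-algebras, and both
    sides are integrals of [f] against a weighted law on that product. *)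
Lemma step_integral n j (f : history_type n * R -> \bar R) :
  measurable_fun setT f -> (forall z, 0 <= f z)%E ->
  (\int[P]_w ((\1_(I n.+1 @^-1` [set j]) w)%:E * f (w, A n.+1 w)) =
   \int[P]_w ((selection_weight j n w)%:E *
     \int[leb]_a ((guarded_weight (C n w) a)%:E * f (w, a))))%E.
Proof.
have mpair : measurable_fun setT (fun w : T => (w : history_type n, A n.+1 w)).
  apply: measurable_fun_pair => //; exact: measurable_to_history.
have mind : measurable_fun setT (\1_(I n.+1 @^-1` [set j]) : T -> R).
  exact/measurable_indic/measurable_index.
have ind0 w : (0 <= \1_(I n.+1 @^-1` [set j]) w :> R) by rewrite indicE.
pose W (z : T * measurableTypeR R) : R := selection_weight j n z.1 * guarded_weight (C n z.1) z.2.
have W0 z : 0 <= W z by rewrite mulr_ge0 ?selection_weight_ge0 ?guarded_weight_ge0.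
have msw : measurable_fun setT (selection_weight j n).
  by apply: (@history_fun _ _ n); exact: history_selection_weight.
have mW : measurable_fun setT W.
  apply: measurable_funM; first exact: (measurableT_comp msw).
  have mp : measurable_fun setT (fun z : T * measurableTypeR R => (C n z.1, z.2 : R)).
    apply: measurable_fun_pair => //.
    exact: (measurableT_comp (measurable_total n)).
  exact: (measurableT_comp measurable_guarded_weight mp).
have mid : measurable_fun setT (fun z : T * measurableTypeR R => (z.1 : history_type n, z.2 : R)).
  apply: measurable_fun_pair => //.
  move=> _ B mB; rewrite setTI.
  have := @measurable_fst _ _ T (measurableTypeR R) measurableT B (measurable_history mB).
  by rewrite setTI.
have HW (g : history_type n * R -> \bar R) : measurable_fun setT g -> (forall z, 0 <= g z)%E ->
    (\int[weighted_law (P \x leb)%E W0 mW mid]_z g z = \int[P]_w ((selection_weight j n w)%:E *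
     \int[leb]_a ((guarded_weight (C n w) a)%:E * g (w, a))))%E.
  move=> mg g0; rewrite weighted_law_integral//.
  rewrite fubini_tonelli1//; first last.
  - by move=> z; rewrite mule_ge0// lee_fin.
  - by apply: emeasurable_funM; [exact/measurable_EFinP|exact: (measurableT_comp mg mid)].
  apply: eq_integral => w _; rewrite -ge0_integralZl//.
  - by apply: eq_integral => a _; rewrite /W/= EFinM muleA.
  - apply: emeasurable_funM.
      apply/measurable_EFinP; exact: measurable_guarded_weight1.
    exact: (measurableT_comp mg (pair1_measurable (w : history_type n))).
  - by move=> a _; rewrite mule_ge0// lee_fin guarded_weight_ge0.
  - by rewrite lee_fin selection_weight_ge0.
move=> mf f0; rewrite -HW// -(weighted_law_integral P ind0 mind mpair)//.
apply: eq_measure_integral => S mS _; move: S mS.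
have mwB B : measurable B -> measurable_fun setT (fun w : T =>
    (\int[leb]_(a in B) (guarded_weight (C n w) a)%:E)%E).
  move=> mB; apply: (@history_fun _ _ n).
  have := @measurable_weight_average n (fun z => (\1_B z.2)%:E).
  rewrite (_ : (fun w => _) = fun w : history_type n =>
      (\int[leb]_(a in B) (guarded_weight (C n w) a)%:E)%E); last first.
    apply/funext => w; rewrite [RHS]integral_mkcond; apply: eq_integral => a _.
    by rewrite patchE indicE; case: ifP; rewrite ?mule1 ?mule0.
  apply; last by move=> z; rewrite lee_fin indicE.
  by apply/measurable_EFinP; apply: (measurableT_comp (measurable_indic mB)).
have HDB (D : set (history_type n)) (B : set R) : measurable D -> measurable B ->
    weighted_law P ind0 mind mpair (D `*` B) = weighted_law (P \x leb)%E W0 mW mid (D `*` B).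
  move=> mD mB.
  have mD' : measurable (D : set T) by exact: (measurable_history mD).
  have [mb Hs] := urn_step_law hmodel n j mB.
  have mDB : measurable (D `*` B) by exact: measurableX.
  transitivity (P ((I n.+1 @^-1` [set j] `&` A n.+1 @^-1` B) `&` D)).
    rewrite /weighted_law integral_indic//; first last.
    - exact: measurable_index.
    - exact: (measurable_preimage mpair mDB).
    by congr (P _); apply/seteqP; split => w /=; tauto.
  rewrite Hs//.
  transitivity (\int[P]_w ((\1_D w)%:E * ((selection_weight j n w)%:E *
      \int[leb]_(a in B) (guarded_weight (C n w) a)%:E)))%E.
    rewrite integral_mkcond; apply: ae_eq_integral => //.
    - apply/(measurable_restrictT _ _).1 => //; apply/measurable_EFinP/measurable_funTS.
      by apply: (@history_fun _ _ n) => _ Z mZ; rewrite setTI; exact: mb.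
    - apply: emeasurable_funM; first exact/measurable_EFinP/measurable_indic.
      by apply: emeasurable_funM; [exact/measurable_EFinP|exact: mwB].
    apply: filterS (ae_positive_at n) => w pw _.
    rewrite patchE indicE; case: ifPn => wD; rewrite ?mul0e// mul1e.
    rewrite EFinM addition_lawE//; last by apply: positive_total.
    by rewrite /selection_weight indicE mem_set// mul1r.
  transitivity (\int[weighted_law (P \x leb)%E W0 mW mid]_z (\1_(D `*` B) z)%:E)%E; last first.
    by rewrite integral_indic// setIT.
  rewrite HW; first last.
  - by move=> z; rewrite lee_fin indicE.
  - exact/measurable_EFinP/measurable_indic.
  apply: eq_integral => w _; rewrite muleCA; congr (_ * _)%E.
  rewrite [in LHS]integral_mkcond -ge0_integralZl//; first last.
  - by move=> a _; rewrite patchE; case: ifP => //; rewrite lee_fin guarded_weight_ge0.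
  - apply/(measurable_restrictT _ _).1 => //; apply/measurable_EFinP/measurable_funTS.
    exact: measurable_guarded_weight1.
  apply: eq_integral => a _; rewrite patchE !indicE in_setX/=.
  by case: (w \in D); case: (a \in B); rewrite ?(mule1,mule0,mul1e,mul0e).
apply: (@eq_measure_on_generator _ _ _ [set A `*` B | A in measurable & B in measurable]).
- exact: measurable_prod_measurableType.
- move=> X Y /= [D1 mD1 [B1 mB1 <-]] [D2 mD2 [B2 mB2 <-]].
  exists (D1 `&` D2); first exact: measurableI.
  by exists (B1 `&` B2); [exact: measurableI|rewrite setXI].
- rewrite /= /weighted_law preimage_setT integral_indic//; last exact: measurable_index.
  apply: (le_lt_trans (probability_le1 _ _)); last exact: ltry.
  by apply: measurableI => //; exact: measurable_index.
- by rewrite -setXTT; exact: HDB.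
- by move=> X [D mD [B mB <-]]; exact: HDB.
Qed.

End urn_basics.

Section tuple_integrals.
Context {R : realType}.

Lemma measurable_sqrt : measurable_fun setT (Num.sqrt : R -> R).
Proof. by apply: continuous_measurable_fun; exact: sqrt_continuous. Qed.

Local Notation leb := (@lebesgue_measure R).
Local Notation lebn := (@lebesgue_tuple R).
Local Open Scope ereal_scope.

Lemma nth_rcons_last (x x0 : R) s i : (i <= size s)%N ->
  nth x0 (rcons s x) i = nth x s i.
Proof.
rewrite nth_rcons leq_eqVlt => /orP[/eqP->|si]; first by rewrite ltnn eqxx nth_default.
by rewrite si; exact: set_nth_default.
Qed.

Lemma sum_rcons k (l : k.-tuple R) (x : R) :
  (\sum_i tnth [tuple of rcons l x] i = \sum_(y <- l) y + x)%R.
Proof.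
rewrite -(big_tuple _ _ [tuple of rcons l x] xpredT id)/= -cats1 big_cat/=.
by rewrite big_seq1.
Qed.

Lemma measurable_rcons k d (X : measurableType d) (f : X -> k.-tuple R) (g : X -> R) :
  measurable_fun setT f -> measurable_fun setT g ->
  measurable_fun setT (fun x => [tuple of rcons (f x) (g x)]).
Proof.
move=> mf mg; apply/measurable_fun_tnthP => i; rewrite /comp/=.
have ik : (i <= k)%N by rewrite -ltnS.
have [jk|kj] := ltnP i k.
  rewrite (_ : (fun _ => _) = (fun x => tnth (f x) (Ordinal jk))).
    exact: (measurableT_comp (measurable_tnth _)).
  apply/funext => x; rewrite (tnth_nth (g x)) nth_rcons_last ?size_tuple//.
  by rewrite (tnth_nth (g x)).
rewrite (_ : (fun _ => _) = g)//.
apply/funext => x; rewrite (tnth_nth (g x)) nth_rcons_last ?size_tuple//.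
by rewrite nth_default// size_tuple.
Qed.

Lemma measurable_tuple_map k (c : R) :
  measurable_fun setT (fun t : k.-tuple R => [tuple of map ( *%R c) t]).
Proof.
apply/measurable_fun_tnthP => i; rewrite /comp/=.
under eq_fun do rewrite tnth_map; apply: measurable_funM => //.
exact: measurable_tnth.
Qed.

(** [lebesgue_tuple] grows at the front, whereas the dependent coordinate of [simplex_point] is the
    last one. *)
Lemma integral_lebesgue_tuple_rcons k (f : k.+1.-tuple R -> \bar R) :
  measurable_fun setT f -> (forall t, 0 <= f t) ->
  \int[lebn k.+1]_t f t =
  \int[lebn k]_t \int[leb]_x f [tuple of rcons t x].
Proof.
elim: k f => [|k IH] f mf f0.
  rewrite integral_lebesgue_tupleS// integral_lebesgue_tuple0//.
    apply: eq_integral => x _; rewrite integral_lebesgue_tuple0.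
      by congr f; exact: val_inj.
    by apply: (measurableT_comp mf); exact: measurable_cons.
  move=> _ B mB; rewrite setTI; case: (pselect (([tuple] : 0.-tuple R) \in
    (fun t : 0.-tuple R => \int[leb]_x f [tuple of rcons t x]) @^-1` B)) => h.
    rewrite (_ : _ @^-1` _ = setT)//; apply/seteqP; split => // t _.
    by rewrite (tuple0 t); rewrite inE in h.
  rewrite (_ : _ @^-1` _ = set0)//; apply/seteqP; split => // t Bt.
  by apply: h; rewrite inE -(tuple0 t).
rewrite integral_lebesgue_tupleS//.
have mg : measurable_fun setT (fun z : k.+1.-tuple R * measurableTypeR R => f [tuple of rcons z.1 z.2]).
  by apply: (measurableT_comp mf); exact: measurable_rcons.
have := measurable_fun_fubini_tonelli_F (m2 := leb) _ mg (fun z => f0 _).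
move=> mF.
rewrite [RHS]integral_lebesgue_tupleS//; last first.
  by move=> t; apply: integral_ge0.
apply: eq_integral => x _.
have mfx : measurable_fun setT (fun t : k.+1.-tuple R => f [tuple of x :: t]).
  by apply: (measurableT_comp mf); exact: measurable_cons.
rewrite (IH (fun t => f [tuple of x :: t]) mfx (fun=> f0 _)).
apply: eq_integral => t _; apply: eq_integral => y _.
by congr f; exact: val_inj.
Qed.

Lemma integral_lebesgue_tuple_scale k (c : R) (f : k.-tuple R -> \bar R) :
  (0 < c)%R -> measurable_fun setT f -> (forall t, 0 <= f t) ->
  \int[lebn k]_t f t =
  (c ^+ k)%:E * \int[lebn k]_t f [tuple of map ( *%R c) t].
Proof.
move=> c0; elim: k f => [|k IH] f mf f0.
  rewrite !integral_lebesgue_tuple0//; last first.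
    by apply: (measurableT_comp mf); exact: measurable_tuple_map.
  by rewrite mul1e; congr f; exact: val_inj.
have mfx x : measurable_fun setT (fun t : k.-tuple R => f [tuple of x :: t]).
  by apply: (measurableT_comp mf); exact: measurable_cons.
have mfc : measurable_fun setT (fun t : k.+1.-tuple R => f [tuple of map ( *%R c) t]).
  by apply: (measurableT_comp mf); exact: measurable_tuple_map.
rewrite integral_lebesgue_tupleS// integral_lebesgue_tupleS//.
have mg : measurable_fun setT (fun z : measurableTypeR R * k.-tuple R => f [tuple of z.1 :: z.2]).
  by apply: (measurableT_comp mf); exact: measurable_cons.
have mG := measurable_fun_fubini_tonelli_F (m2 := lebn k) _ mg (fun z => f0 _).
have mfc2 : measurable_fun setT (fun z : measurableTypeR R * k.-tuple R => f [tuple of map ( *%R c) [tuple of z.1 :: z.2]]).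
  by apply: (measurableT_comp mfc); exact: measurable_cons.
have mGc := measurable_fun_fubini_tonelli_F (m2 := lebn k) _ mfc2 (fun z => f0 _).
rewrite (ge0_integral_affine (k := c) 0 c0)//; last first.
  by move=> y; exact: integral_ge0.
rewrite -ge0_integralZl//; first last.
- by rewrite lee_fin exprn_ge0// ltW.
- by move=> x _; exact: integral_ge0.
apply: eq_integral => x _; rewrite addr0 IH// muleAC exprSr EFinM.
congr (_ * _); apply: eq_integral => t _.
by congr f; exact: val_inj.
Qed.

End tuple_integrals.

(** * Density of the initial quantities *)

Section initial_law.
Context {d : measure_display} {T : measurableType d} {R : realType}.
Variable P : probability T R.
Variable k : nat.
Variables (L : 'I_k.+2 -> nat -> {RV P >-> R}) (I : nat -> T -> 'I_k.+2)
  (A : nat -> {RV P >-> R}).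
Hypothesis hmodel : urn_model L I A.
Local Notation leb := (@lebesgue_measure R).
Local Notation lebn := (@lebesgue_tuple R).
Local Notation C := (total L).

Lemma integral_total0 (h : R -> \bar R) : measurable_fun setT h -> (forall c, 0 <= h c)%E ->
  (\int[P]_w h (C 0 w) = \int[leb]_c ((radial k.+2 c)%:E * h c))%E.
Proof.
move=> mh h0.
set a : R := (k.+2%:R + 1) / 2.
have a1 : 1 < a by rewrite /a ltr_pdivlMr// mul1r natr1 ltr_nat.
have G0 : 0 < Gamma_fun a.
  by rewrite /a Gamma_funE mulr_gt0 ?powR_gt0 ?Mgauss_gt0.
pose g (y : R) : R := if 0 < y then gamma_density a (1 / 2) y else 0.
have g0 y : 0 <= g y.
  rewrite /g; case: ifPn => // y0.
  by rewrite /gamma_density !mulr_ge0 ?powR_ge0 ?expR_ge0// invr_ge0 ltW.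
have mg : measurable_fun setT g.
  apply: measurable_fun_ifT => //; first exact: measurable_fun_ltr.
  apply: measurable_funM => //; apply: measurable_funM.
    by apply: measurable_funM => //; exact: measurable_powR.
  by apply: measurableT_comp => //; exact: measurable_funM.
have mid : measurable_fun setT (@id R) by [].
have mC2 : measurable_fun setT (fun w => C 0 w ^+ 2).
  by apply: measurable_funX; exact: (measurable_total hmodel).
have mhs : measurable_fun setT (fun y : R => h (Num.sqrt y)).
  apply: (measurableT_comp mh).
  exact: measurable_sqrt.
transitivity (\int[pushforward P (fun w => C 0 w ^+ 2)%R]_y h (Num.sqrt y))%E.
  rewrite ge0_integral_pushforward// preimage_setT; apply: eq_integral => w _ /=.
  by rewrite sqrtr_sqr ger0_norm// (urn_total0_ge0 hmodel).
transitivity (\int[weighted_law leb g0 mg mid]_y h (Num.sqrt y))%E.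
  apply: eq_measure_integral => S mS _.
  rewrite [LHS](urn_total0_law hmodel)// /= /weighted_law [LHS]integral_mkcond [RHS]integral_mkcond.
  apply: eq_integral => y _; rewrite !patchE in_setI (_ : id @^-1` S = S)//.
  case: (y \in S) => //=; rewrite (_ : (y \in _) = (0 <= y)); last first.
    by apply/idP/idP; rewrite inE/= in_itv/= andbT.
  rewrite /g le_eqVlt; case: eqVneq => [<-/=|] //=; last by case: ifP.
  by rewrite ltxx /gamma_density powR0 ?mulr0 ?mul0r// subr_eq0 gt_eqF.
rewrite (weighted_law_integral leb g0 mg mid mhs (fun y => h0 _)).
transitivity (\int[leb]_(y in `]0%R, +oo[) ((g y)%:E * h (Num.sqrt y)))%E.
  rewrite [RHS]integral_mkcond; apply: eq_integral => y _.
  by rewrite patchE mem_pos /g; case: ifP; rewrite ?mul0e.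
rewrite (ge0_integral_square ltr01)//; first last.
- by move=> y; rewrite mule_ge0// lee_fin.
- by apply: emeasurable_funM => //; exact/measurable_EFinP.
rewrite integral_mkcond; apply: eq_integral => c _; rewrite patchE mem_pos /radial.
case: ifPn => c0; last by rewrite mul0e.
rewrite mul1r sqrtr_sqr ger0_norm ?ltW// muleAC; congr (_ * _)%E.
rewrite -EFinM; congr EFin; rewrite /g exprn_gt0// /gamma_density -/a.
rewrite {1}/a Gamma_funE.
have -> : (c ^+ 2) `^ (a - 1) = c ^+ k.+1.
  rewrite -powR_mulrn ?ltW// -powRrM -powR_mulrn ?ltW//; congr (_ `^ _).
  by rewrite /a; field.
have -> : (1 / 2) `^ a = 2 `^ ((1 - k.+2%:R) / 2) / 2 :> R.
  have two0 : (2 : R) != 0 by [].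
  rewrite mul1r -(@powR_inv1 _ 2)// -powRrM mulN1r -powRD; last by apply/implyP => _.
  by rewrite powR_inv1//; congr (_ `^ _); rewrite /a; field.
have -> : - (1 / 2) * c ^+ 2 = - (c ^+ 2 / 2) by field.
have p0 : 2 `^ ((1 - k.+2%:R) / 2) != 0 :> R by rewrite gt_eqF// powR_gt0.
rewrite mul1r (exprS _ k.+1); field.
by rewrite p0 gt_eqF ?Mgauss_gt0.
Qed.

(** The Jacobian c^(k + 1) of the dilation of the simplex by c reduces the power c^(k + 2) of the
    chi density to the single factor c; (k + 1)! is the uniform density on the simplex. *)
Definition initial_density (l : k.+2.-tuple R) : R :=
  if [forall i, 0 < tnth l i] then
    k.+1`!%:R / Mgauss k.+2 * (\sum_i tnth l i) * expR (- ((\sum_i tnth l i) ^+ 2 / 2))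
  else 0.

Lemma initial_density_ge0 l : 0 <= initial_density l.
Proof.
rewrite /initial_density; case: ifPn => // /forallP l0.
rewrite !mulr_ge0 ?invr_ge0 ?expR_ge0 ?(ltW (Mgauss_gt0 _))//.
by apply: sumr_ge0 => i _; exact: ltW.
Qed.

Lemma measurable_tuple_total n : measurable_fun setT (fun l : n.-tuple R => \sum_i tnth l i).
Proof. by apply: measurable_sum => i; exact: measurable_tnth. Qed.

Lemma measurable_forall_pos n : measurable_fun setT (fun x : n.-tuple R => [forall i, 0 < tnth x i]).
Proof.
apply: (@measurable_fun_bool _ _ _ _ true).
rewrite setTI (_ : _ @^-1` _ = @simplex_interior R n); first exact: measurable_simplex_interior.
by apply/seteqP; split => x /= /forallP.
Qed.

Lemma measurable_initial_density : measurable_fun setT initial_density.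
Proof.
have mS := measurable_tuple_total (n := k.+2).
apply: measurable_fun_ifT => //; first exact: measurable_forall_pos.
apply: measurable_funM; first exact: measurable_funM.
apply: measurableT_comp => //; apply: measurableT_comp => //; apply: measurable_funM => //.
exact: measurable_funX.
Qed.

Definition initial_quantities w : k.+2.-tuple R := [tuple L i 0%N w | i < k.+2].

Lemma measurable_initial_quantities : measurable_fun setT initial_quantities.
Proof.
apply/measurable_fun_tnthP => i; rewrite /comp/=.
rewrite (_ : (fun _ => _) = L i 0%N); first exact: measurable_funP.
by apply/funext => w; rewrite tnth_mktuple.
Qed.

Let scale c (x : k.+2.-tuple R) := [tuple c * tnth x i | i < k.+2].

Let measurable_scale : measurable_fun setT (fun z : R * k.+2.-tuple R => scale z.1 z.2).
Proof.
apply/measurable_fun_tnthP => i; rewrite /comp/=.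
under eq_fun do rewrite tnth_mktuple; apply: measurable_funM => //.
by apply: (measurableT_comp (measurable_tnth i)).
Qed.

Let prod_law (F : R * k.+2.-tuple R -> \bar R) : measurable_fun setT F -> (forall z, 0 <= F z)%E ->
  (\int[P]_w F (C 0 w, proportions L 0 w) = \int[P]_w \int[P]_w' F (C 0 w, proportions L 0 w'))%E.
Proof.
move=> mF F0.
have mC : measurable_fun setT (C 0) := @measurable_total _ _ _ _ _ _ _ _ hmodel 0.
have mp : measurable_fun setT (proportions L 0) := @measurable_proportions _ _ _ _ _ _ _ _ hmodel 0.
pose C' : {mfun T >-> R} := HB.pack (C 0) (isMeasurableFun.Build _ _ _ _ (C 0) mC).
pose p' : {mfun T >-> k.+2.-tuple R} := HB.pack (proportions L 0) (isMeasurableFun.Build _ _ _ _ (proportions L 0) mp).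
have mCp : measurable_fun setT (fun w => (C' w, p' w)) by exact: measurable_fun_pair.
transitivity (\int[pushforward P (fun w => (C' w, p' w))]_z F z)%E.
  by rewrite ge0_integral_pushforward// preimage_setT.
transitivity (\int[(distribution P C' \x distribution P p')%E]_z F z)%E.
  apply: eq_measure_integral => S mS _; apply/esym.
  apply: product_measure_unique mS => A' B' mA' mB'.
  exact: (urn_initial_independent hmodel mA' mB').
rewrite fubini_tonelli1// ge0_integral_pushforward//; last first.
- by move=> c _; apply: integral_ge0.
- exact: measurable_fun_fubini_tonelli_F.
rewrite preimage_setT; apply: eq_integral => w _ /=; rewrite /fubini_F.
rewrite ge0_integral_pushforward// ?preimage_setT//.
by apply: (measurableT_comp mF); exact: measurable_fun_pair.
Qed.

Let simplex_scale (c : R) (l : k.+1.-tuple R) : 0 < c ->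
  scale c (simplex_point k.+2 [tuple of map ( *%R c^-1) l]) = [tuple of rcons l (c - \sum_(y <- l) y)].
Proof.
move=> c0; apply: eq_from_tnth => i; rewrite !tnth_mktuple.
rewrite (tnth_nth 0) nth_rcons_last ?size_tuple//; last by rewrite -ltnS.
have [il|il] := ltnP i (size l).
  rewrite (nth_map 0)// mulrA divff ?gt_eqF// mul1r; exact: set_nth_default.
rewrite !nth_default ?size_map// big_map -mulr_sumr mulrBr mulr1 mulrA divff ?gt_eqF//.
by rewrite mul1r.
Qed.

Let density_scale (c : R) (x : k.+2.-tuple R) : 0 < c ->
  dirichlet_density (fun=> 1) x = if [forall i, 0 < tnth (scale c x) i] then k.+1`!%:R else 0.
Proof.
move=> c0; rewrite /dirichlet_density.
have -> : [forall i, 0 < tnth (scale c x) i] = [forall i, 0 < tnth x i].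
  by apply: eq_forallb => i; rewrite tnth_mktuple pmulr_rgt0.
case: ifP => // _; rewrite sumr_const card_ord Gamma_fun_nat.
rewrite !big1 ?divr1 ?mulr1// => i _; first by rewrite subrr powRr0.
by rewrite Gamma_fun1.
Qed.

Lemma initial_law (F : k.+2.-tuple R -> \bar R) :
  measurable_fun setT F -> (forall l, 0 <= F l)%E ->
  (\int[P]_w F (initial_quantities w) =
   \int[lebn k.+2]_l ((initial_density l)%:E * F l))%E.
Proof.
move=> mF F0.
have mG : measurable_fun setT (fun z : R * k.+2.-tuple R => F (scale z.1 z.2)).
  exact: (measurableT_comp mF measurable_scale).
transitivity (\int[P]_w F (scale (C 0 w) (proportions L 0 w)))%E.
  apply: ae_eq_integral => //.
  - by apply: (measurableT_comp mF); exact: measurable_initial_quantities.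
  - have mq : measurable_fun setT (fun w => (C 0 w, proportions L 0 w)).
      apply: measurable_fun_pair.
        exact: (@measurable_total _ _ _ _ _ _ _ _ hmodel 0).
      exact: (@measurable_proportions _ _ _ _ _ _ _ _ hmodel 0).
    exact: (measurableT_comp mG mq).
  apply: filterS (ae_positive_at hmodel 0) => w pw _; congr F.
  apply: eq_from_tnth => i; rewrite !tnth_mktuple /proportion mulrC divfK//.
  by rewrite gt_eqF//; exact: positive_total pw.
rewrite (prod_law (F := fun z => F (scale z.1 z.2)))//.
pose D c := (\int[lebn k.+1]_s ((dirichlet_density (fun=> 1) (simplex_point k.+2 s))%:E *
    F (scale c (simplex_point k.+2 s))))%E.
have mD : measurable_fun setT D.
  pose g (z : R * k.+1.-tuple R) := ((dirichlet_density (fun=> 1) (simplex_point k.+2 z.2))%:E *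
    F (scale z.1 (simplex_point k.+2 z.2)))%E.
  have msp : measurable_fun setT (fun z : R * k.+1.-tuple R => simplex_point k.+2 z.2).
    exact: (measurableT_comp (@measurable_simplex_point R k.+2)).
  apply: (@measurable_fun_fubini_tonelli_F _ _ _ _ _ (lebn k.+1) g).
    apply: emeasurable_funM.
      apply/measurable_EFinP.
      exact: (measurableT_comp (@measurable_dirichlet_density _ _ (fun=> 1)) msp).
    have mq : measurable_fun setT (fun z : R * k.+1.-tuple R => (z.1, simplex_point k.+2 z.2)).
      exact: measurable_fun_pair.
    exact: (measurableT_comp mG mq).
  by move=> z; rewrite mule_ge0// lee_fin dirichlet_density_ge0.
have D0 c : (0 <= D c)%E.
  by apply: integral_ge0 => s _; rewrite mule_ge0// lee_fin dirichlet_density_ge0.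
transitivity (\int[P]_w D (C 0 w))%E.
  apply: eq_integral => w _.
  rewrite (is_dirichlet_integral (f := fun x => F (scale (C 0 w) x))
    (urn_proportions0_law hmodel))//.
    exact: (@measurable_proportions _ _ _ _ _ _ _ _ hmodel 0).
  exact: (measurableT_comp mG (pair1_measurable (C 0 w))).
rewrite integral_total0//.
pose Psi (l : k.+2.-tuple R) := ((initial_density l)%:E * F l)%E.
have mPsi : measurable_fun setT Psi.
  by apply: emeasurable_funM => //; apply/measurable_EFinP; exact: measurable_initial_density.
have Psi0 l : (0 <= Psi l)%E by rewrite mule_ge0// lee_fin initial_density_ge0.
have mshift : measurable_fun setT (fun z : measurableTypeR R * k.+1.-tuple R =>
    Psi [tuple of rcons z.2 ((z.1 : R) - \sum_(y <- z.2) y)]).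
  apply: (measurableT_comp mPsi); apply: measurable_rcons => //.
  apply: measurable_funB => //.
  exact: (measurableT_comp (@measurable_sum_tuple R k.+1)).
(* The simplex is dilated by c. After an exchange of the integrals, the translation that replaces c
   by the last coordinate leads to Lebesgue measure on the orthant. *)
transitivity (\int[leb]_c \int[lebn k.+1]_l Psi [tuple of rcons l (c - \sum_(y <- l) y)%R])%E.
  apply: eq_integral => c _; rewrite /radial; case: ltP => c0; last first.
    rewrite mul0e integral0_eq// => l _; rewrite /Psi /initial_density.
    case: ifPn => [/forallP H|]; last by rewrite mul0e.
    suff : 0 < c by rewrite ltNge c0.
    have : 0 < \sum_(i < k.+2) tnth [tuple of rcons l (c - \sum_(y <- l) y)] i.
      by rewrite big_ord_recl ltr_pwDl// sumr_ge0// => i _; exact: ltW.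
    by rewrite sum_rcons addrCA subrr addr0.
  rewrite /D (integral_lebesgue_tuple_scale (c := c^-1)) ?invr_gt0//; first last.
  - by move=> s; rewrite mule_ge0// lee_fin dirichlet_density_ge0.
  - apply: emeasurable_funM.
      apply/measurable_EFinP.
      exact: (measurableT_comp (@measurable_dirichlet_density _ _ (fun=> 1)) (@measurable_simplex_point R k.+2)).
    have mq : measurable_fun setT (fun s : k.+1.-tuple R => (c, simplex_point k.+2 s)).
      by apply: measurable_fun_pair => //; exact: (@measurable_simplex_point R k.+2).
    exact: (measurableT_comp mG mq).
  rewrite muleA -EFinM -ge0_integralZl//; first last.
  - have := radial_ge0 k.+2 c; rewrite /radial c0 lee_fin => /mulr_ge0; apply.
    by apply: exprn_ge0; rewrite invr_ge0 ltW.
  - by move=> s _; rewrite mule_ge0// lee_fin dirichlet_density_ge0.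
  - have mm := @measurable_tuple_map R k.+1 c^-1.
    have msm : measurable_fun setT (fun s : k.+1.-tuple R => simplex_point k.+2 [tuple of map ( *%R c^-1) s]).
      exact: (measurableT_comp (@measurable_simplex_point R k.+2) mm).
    apply: emeasurable_funM.
      apply/measurable_EFinP.
      exact: (measurableT_comp (@measurable_dirichlet_density _ _ (fun=> 1)) msm).
    have mq : measurable_fun setT (fun s : k.+1.-tuple R =>
        (c, simplex_point k.+2 [tuple of map ( *%R c^-1) s])).
      exact: measurable_fun_pair.
    exact: (measurableT_comp mG mq).
  apply: eq_integral => l _; rewrite (density_scale _ c0) (simplex_scale _ c0) /Psi /initial_density.
  rewrite muleA -EFinM; congr (_ * _)%E; congr EFin.
  case: ifPn => _; last by rewrite mulr0.
  rewrite sum_rcons addrCA subrr addr0 exprS exprVn; field.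
  by rewrite !gt_eqF ?exprn_gt0 ?Mgauss_gt0.
rewrite (@fubini_tonelli _ _ _ _ _ leb (lebn k.+1) _ mshift (fun z => Psi0 _)).
rewrite (integral_lebesgue_tuple_rcons mPsi Psi0); apply: eq_integral => l _.
have mr : measurable_fun setT (fun x : R => Psi [tuple of rcons l (x - \sum_(y <- l) y)]).
  exact: (measurableT_comp mshift (pair2_measurable l)).
rewrite [LHS](ge0_integral_affine (k := 1) (\sum_(y <- l) y))//=.
apply: eq_integral => x _; rewrite mule1 mul1r; congr Psi.
by apply: val_inj => /=; rewrite addrK.
Qed.

End initial_law.

(** * The transitions of the urn on the mixture *)

Section mixture_kernel.
Context {R : realType}.
Variable k : nat.
Local Notation m := k.+2.
Local Notation leb := (@lebesgue_measure R).
Local Notation lebn := (@lebesgue_tuple R).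
Local Open Scope ereal_scope.

Definition selected (j : 'I_m) (st : seq ('I_m * set R)) : seq (set R) :=
  [seq p.2 | p <- st & p.1 == j].

Definition measurable_steps (st : seq ('I_m * set R)) : Prop :=
  forall p, p \in st -> measurable p.2.

Lemma measurable_selected j st : measurable_steps st ->
  forall B, B \in selected j st -> measurable B.
Proof.
move=> mst B /mapP[p]; rewrite mem_filter => /andP[_ pst] ->; exact: mst.
Qed.

Definition guarded_levy_chain (Bs : seq (set R)) (z : R * R) : \bar R :=
  if (0 < z.1)%R && (0 <= z.2)%R then levy_chain Bs z.1 z.2 else 0.

Lemma guarded_levy_chain_ge0 Bs z : 0 <= guarded_levy_chain Bs z.
Proof.
by rewrite /guarded_levy_chain; case: ifPn => // /andP[_ z0]; exact: levy_chain_ge0.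
Qed.

Lemma guarded_levy_chain_pos Bs x l : (0 <= l)%R -> guarded_levy_chain Bs (x, l) = levy_chain Bs x l.
Proof.
move=> l0; rewrite /guarded_levy_chain/= l0 andbT; case: ltP => // x0.
by rewrite levy_chain_neg.
Qed.

(** No Dirichlet density appears: together with the past of the urn it is absorbed in the functions
    [levy] at the quantities l. *)
Definition mixture_integral (st : seq ('I_m * set R)) (l : m.-tuple R) : \bar R :=
  \int[lebn k.+1]_s
    \prod_(i < m) guarded_levy_chain (selected i st) (tnth (simplex_point m s) i, tnth l i).

Definition mixture_const : R := (Num.sqrt (2 * pi) ^- k.+1)%R.

(* For the urn with quantities l, the probability that the next steps are st. *)
Definition mixture_kernel (st : seq ('I_m * set R)) (l : m.-tuple R) : \bar R :=
  if [forall i, (0 < tnth l i)%R] then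
    (expR ((\sum_i tnth l i) ^+ 2 / 2) / (\sum_i tnth l i) * mixture_const)%R%:E *
      mixture_integral st l
  else 0.

Lemma mixture_const_ge0 : (0 <= mixture_const)%R.
Proof. by rewrite invr_ge0 exprn_ge0. Qed.

Lemma measurable_mixture_integrand st d (X : measurableType d) (f : X -> k.+1.-tuple R)
    (g : X -> m.-tuple R) : measurable_steps st ->
  measurable_fun setT f -> measurable_fun setT g ->
  measurable_fun setT (fun z => \prod_(i < m)
    guarded_levy_chain (selected i st) (tnth (simplex_point m (f z)) i, tnth (g z) i)).
Proof.
move=> mst mf mg; apply: emeasurable_prod => i.
have mh : measurable_fun setT (fun z => (tnth (simplex_point m (f z)) i, tnth (g z) i)).
  apply: measurable_fun_pair; last exact: (measurableT_comp (measurable_tnth i) mg).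
  have msf : measurable_fun setT (fun z => simplex_point m (f z)).
    exact: (measurableT_comp (@measurable_simplex_point R m) mf).
  exact: (measurableT_comp (measurable_tnth i) msf).
exact: (measurableT_comp (measurable_levy_chain (measurable_selected mst)) mh).
Qed.

Lemma mixture_integrand_ge0 st (x l : m.-tuple R) :
  0 <= \prod_(i < m) guarded_levy_chain (selected i st) (tnth x i, tnth l i).
Proof. by apply: prode_ge0 => i _; exact: guarded_levy_chain_ge0. Qed.

Lemma mixture_kernel_ge0 st l : 0 <= mixture_kernel st l.
Proof.
rewrite /mixture_kernel; case: ifPn => // /forallP l0.
rewrite mule_ge0//; last by apply: integral_ge0 => s _; exact: mixture_integrand_ge0.
rewrite lee_fin !mulr_ge0 ?expR_ge0 ?mixture_const_ge0// invr_ge0.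
by apply: sumr_ge0 => i _; exact: ltW.
Qed.

Lemma measurable_mixture_kernel st : measurable_steps st ->
  measurable_fun setT (mixture_kernel st).
Proof.
move=> mst; apply: measurable_fun_ifT => //; first exact: measurable_forall_pos.
apply: emeasurable_funM.
  have mS := @measurable_tuple_total R m.
  apply/measurable_EFinP; apply: measurable_funM => //; apply: measurable_funM.
    apply: measurableT_comp => //; apply: measurable_funM => //; exact: measurable_funX.
  exact: (measurableT_comp measurable_inv mS).
pose f (z : m.-tuple R * k.+1.-tuple R) := \prod_(i < m)
  guarded_levy_chain (selected i st) (tnth (simplex_point m z.2) i, tnth z.1 i).
have mf : measurable_fun setT f by exact: measurable_mixture_integrand.
have f0 z : 0 <= f z by exact: mixture_integrand_ge0.
exact: (@measurable_fun_fubini_tonelli_F _ _ _ _ _ (lebn k.+1) f mf f0).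
Qed.

(** By convolution the integral over the simplex is proportional to [levy] of the total c at 1, that
    is to c exp (- c^2 / 2); the prefactor of the kernel is its inverse. *)
Lemma mixture_kernel_nil l : (forall i, 0 < tnth l i)%R -> mixture_kernel [::] l = 1.
Proof.
move=> l0; rewrite /mixture_kernel (introT forallP)//.
have C0 : (0 < \sum_i tnth l i)%R.
  by rewrite big_ord_recl ltr_pwDl// sumr_ge0// => i _; exact: ltW.
have lE : (\sum_(i < m) tnth l i = \sum_(i < m) nth 1 l i)%R.
  by apply: eq_bigr => i _; exact: tnth_nth.
have -> : mixture_integral [::] l =
    (Num.sqrt (2 * pi) ^+ k.+1 * levy (\sum_i tnth l i) 1)%R%:E.
  rewrite lE -levy_convolution_iter; last first.
    move=> i; have [il|il] := ltnP i m; last by rewrite nth_default ?size_tuple.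
    by have := l0 (Ordinal il); rewrite (tnth_nth 1%R).
  apply: eq_integral => s _; apply: eq_bigr => i _.
  rewrite guarded_levy_chain_pos ?ltW// /levy_chain/=.
  by rewrite tnth_mktuple (tnth_nth 1%R).
rewrite -EFinM /mixture_const /levy ltr01 powR1 mulr1 mulr1 -[RHS]/(1%R%:E); congr EFin.
rewrite expRN; set c := (\sum_i _)%R; set e := expR _; set q := (_ ^+ _)%R.
by field; rewrite !gt_eqF ?expR_gt0// exprn_gt0// sqrtr_gt0 mulr_gt0// pi_gt0.
Qed.

Definition add_at (j : 'I_m) (a : R) (l : m.-tuple R) : m.-tuple R :=
  [tuple if j == i then (tnth l i + a)%R else tnth l i | i < m].

Lemma sum_add_at j a l : (\sum_i tnth (add_at j a l) i = \sum_i tnth l i + a)%R.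
Proof.
rewrite (bigD1 j)//= [in RHS](bigD1 j)//= tnth_mktuple eqxx -addrA [RHS]addrAC -addrA.
congr (_ + (_ + _))%R.
by apply: eq_bigr => i ij; rewrite tnth_mktuple eq_sym (negbTE ij).
Qed.

Lemma measurable_add_at j d (X : measurableType d) (f : X -> m.-tuple R) (a : X -> R) :
  measurable_fun setT f -> measurable_fun setT a ->
  measurable_fun setT (fun x => add_at j (a x) (f x)).
Proof.
move=> mf ma; apply/measurable_fun_tnthP => i; rewrite /comp/=.
have mfi := measurableT_comp (measurable_tnth i) mf.
under eq_fun do rewrite tnth_mktuple.
by case: eqVneq => _; [exact: measurable_funD|exact: mfi].
Qed.

(** The one-step equation of the urn holds for the mixture. The factor (a + c) exp (- (a + c)^2 / 2
    + c^2 / 2) trades the prefactor at the total c + a for the exponential of the prefactor at c,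
    and l_j / c supplies its 1 / c together with the factor l_j with which the chain of color j
    opens. *)
Lemma mixture_kernel_cons j B st l : measurable B -> measurable_steps st ->
  (forall i, 0 < tnth l i)%R ->
  (tnth l j / (\sum_i tnth l i))%R%:E * \int[leb]_a ((guarded_weight (\sum_i tnth l i) a)%:E *
    ((\1_B a)%:E * mixture_kernel st (add_at j a l))) =
  mixture_kernel ((j, B) :: st) l.
Proof.
move=> mB mst l0; set c := (\sum_i tnth l i)%R.
have c0 : (0 < c)%R.
  by rewrite /c big_ord_recl ltr_pwDl// sumr_ge0// => i _; exact: ltW.
have al0 a i : (0 < a)%R -> (0 < tnth (add_at j a l) i)%R.
  by move=> a0; rewrite tnth_mktuple; case: ifP => // _; rewrite addr_gt0.
rewrite /mixture_kernel (introT forallP)// -/c.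
pose h (a : R) (s : k.+1.-tuple R) : \bar R := ((\1_B a * (if (0 < a)%R then 1 else 0))%R%:E *
  \prod_(i < m) guarded_levy_chain (selected i st) (tnth (simplex_point m s) i, tnth (add_at j a l) i)).
have h0 a s : 0 <= h a s.
  rewrite mule_ge0 ?mixture_integrand_ge0// lee_fin mulr_ge0 ?indicE//.
  by case: ifP.
have mh : measurable_fun setT (fun z : measurableTypeR R * k.+1.-tuple R => h z.1 z.2).
  apply: emeasurable_funM.
    apply/measurable_EFinP; apply: measurable_funM.
      exact: (measurableT_comp (measurable_indic mB)).
    apply: measurable_fun_ifT => //; exact: measurable_fun_ltr.
  apply: measurable_mixture_integrand => //; apply: measurable_add_at => //.
transitivity ((tnth l j / c * (expR (c ^+ 2 / 2) * mixture_const))%R%:E *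
    \int[leb]_a \int[lebn k.+1]_s h a s).
  rewrite [in RHS]EFinM -[in RHS]muleA; congr (_ * _).
  rewrite -ge0_integralZl//; first last.
  - by rewrite lee_fin mulr_ge0 ?expR_ge0 ?mixture_const_ge0.
  - by move=> a _; exact: integral_ge0.
  - exact: (@measurable_fun_fubini_tonelli_F _ _ _ _ _ (lebn k.+1) _ mh (fun z => h0 z.1 z.2)).
  apply: eq_integral => a _; rewrite /guarded_weight c0/=; case: ifPn => a0; last first.
    rewrite mul0e integral0_eq ?mule0// => s _.
    by rewrite /h (negbTE a0) mulr0 mul0e.
  rewrite /h a0 (introT forallP)//; last by move=> i; exact: al0.
  rewrite sum_add_at -/c ge0_integralZl//; first last.
  - by move=> s _; exact: mixture_integrand_ge0.
  - exact: measurable_mixture_integrand.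
  rewrite -/(mixture_integral st (add_at j a l)) !muleA; congr (_ * _).
  rewrite -!EFinM; congr EFin; rewrite /addition_weight expRD (addrC a) mulNr expRN.
  have ca0 : (0 < c + a)%R by rewrite addr_gt0.
  by field; rewrite !gt_eqF ?expR_gt0.
(* At a fixed point of the simplex the addition affects the factor of color j only. *)
rewrite (fubini_tonelli (m1 := leb) (m2 := lebn k.+1) _ mh (fun z => h0 z.1 z.2))/=.
have -> : (tnth l j / c * (expR (c ^+ 2 / 2) * mixture_const))%R =
    (expR (c ^+ 2 / 2) / c * mixture_const * tnth l j)%R by ring.
rewrite EFinM -muleA; congr (_ * _); rewrite -ge0_integralZl//; first last.
- by rewrite lee_fin ltW.
- by move=> s _; exact: integral_ge0.
- exact: (@measurable_fun_fubini_tonelli_G _ _ _ _ _ leb _ mh (fun z => h0 z.1 z.2)).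
apply: eq_integral => s _.
set x := simplex_point m s.
set rest := \prod_(i < m | i != j) guarded_levy_chain (selected i st) (tnth x i, tnth l i).
have rest0 : 0 <= rest by apply: prode_ge0 => i _; exact: guarded_levy_chain_ge0.
rewrite [RHS](bigD1 j)//= [X in _ = _ * X](_ : _ = rest); last first.
  by apply: eq_bigr => i ij; rewrite /selected/= eq_sym (negbTE ij).
rewrite {1}/selected/= eqxx/= -/(selected j st).
rewrite guarded_levy_chain_pos ?ltW// /levy_chain/= -/levy_chain -muleA; congr (_ * _).
have -> : \int[leb]_(a in `]0%R, +oo[) ((\1_B a * 1)%:E *
      levy_chain (selected j st) (tnth x j) (tnth l j + a)%R) =
    \int[leb]_a ((\1_B a * (if (0 < a)%R then 1 else 0))%R%:E *
      guarded_levy_chain (selected j st) (tnth x j, (tnth l j + a)%R)).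
  rewrite integral_mkcond; apply: eq_integral => a _; rewrite patchE mem_pos.
  case: ifP => a0; last by rewrite mulr0 mul0e.
  by rewrite guarded_levy_chain_pos// addr_ge0// ltW.
rewrite -ge0_integralZr//; first last.
- move=> a _; rewrite mule_ge0 ?guarded_levy_chain_ge0// lee_fin mulr_ge0 ?indicE//.
  by case: ifP.
- apply: emeasurable_funM.
    apply/measurable_EFinP; apply: measurable_funM; first exact: measurable_indic.
    by apply: measurable_fun_ifT => //; exact: measurable_fun_ltr.
  have mp : measurable_fun setT (fun a : R => (tnth x j, (tnth l j + a)%R)).
    by apply: measurable_fun_pair => //; exact: measurable_funD.
  exact: (measurableT_comp (measurable_levy_chain (measurable_selected mst)) mp).
apply: eq_integral => a _; rewrite /h -muleA; congr (_ * _).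
rewrite (bigD1 j)//= [tnth (add_at j a l) j]tnth_mktuple eqxx; congr (_ * _).
by apply: eq_bigr => i ij; rewrite [tnth (add_at _ _ _) _]tnth_mktuple eq_sym (negbTE ij).
Qed.

(** The prefactor of the kernel cancels the initial density up to a constant. At a fixed point of
    the simplex the quantities then separate by color and [integral_levy_chain] applies to each; the
    powers x_i^(-1/2) and [dirichlet_half_const] make up the Dirichlet density. *)
Lemma integral_initial_mixture (B0 : 'I_m -> set R) (st : seq ('I_m * set R)) :
  (forall i, measurable (B0 i)) -> measurable_steps st ->
  \int[lebn m]_l ((initial_density l)%:E *
    ((\prod_i \1_(B0 i) (tnth l i))%:E * mixture_kernel st l)) =
  \int[lebn k.+1]_s ((dirichlet_density (fun=> 1 / 2)%R (simplex_point m s))%:E *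
    \prod_(i < m) ((tnth (simplex_point m s) i ^+ size (selected i st))%:E *
      chain (B0 i :: selected i st) (tnth (simplex_point m s) i) 0)).
Proof.
move=> mB0 mst.
pose K : R := (k.+1`!%:R / Mgauss m)%R.
have K0 : (0 <= K)%R by rewrite divr_ge0 ?(ltW (Mgauss_gt0 _)).
pose G (x : m.-tuple R) (i : 'I_m) (y : R) : \bar R :=
  (\1_(B0 i) y * (if (0 < y)%R then 1 else 0))%R%:E *
  guarded_levy_chain (selected i st) (tnth x i, y).
have G0 x i y : 0 <= G x i y.
  rewrite mule_ge0 ?guarded_levy_chain_ge0// lee_fin mulr_ge0 ?indicE//.
  by case: ifP.
have mG d (X : measurableType d) (f : X -> m.-tuple R) (g : X -> R) i :
    measurable_fun setT f -> measurable_fun setT g ->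
    measurable_fun setT (fun z => G (f z) i (g z)).
  move=> mf mg; apply: emeasurable_funM.
    apply/measurable_EFinP; apply: measurable_funM.
      exact: (measurableT_comp (measurable_indic (mB0 i))).
    by apply: measurable_fun_ifT => //; exact: measurable_fun_ltr.
  have mp : measurable_fun setT (fun z => (tnth (f z) i, g z)).
    by apply: measurable_fun_pair => //; exact: (measurableT_comp (measurable_tnth i) mf).
  exact: (measurableT_comp (measurable_levy_chain (measurable_selected mst)) mp).
pose h (l : m.-tuple R) (s : k.+1.-tuple R) := (K * mixture_const)%:E *
  \prod_(i < m) G (simplex_point m s) i (tnth l i).
have Kc0 : 0 <= (K * mixture_const)%:E by rewrite lee_fin mulr_ge0 ?mixture_const_ge0.
have PG0 (x l : m.-tuple R) : 0 <= \prod_(i < m) G x i (tnth l i) by apply: prode_ge0.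
have h0 l s : 0 <= h l s by rewrite mule_ge0.
have mh : measurable_fun setT (fun z : m.-tuple R * k.+1.-tuple R => h z.1 z.2).
  apply: emeasurable_funM => //; apply: emeasurable_prod => i; apply: mG.
    exact: (measurableT_comp (@measurable_simplex_point R m)).
  exact: (measurableT_comp (measurable_tnth i)).
transitivity (\int[lebn m]_l \int[lebn k.+1]_s h l s).
  apply: eq_integral => l _; rewrite /initial_density /mixture_kernel.
  case: ifPn => [/forallP l0|].
    have C0 : (0 < \sum_i tnth l i)%R.
      by rewrite big_ord_recl ltr_pwDl// sumr_ge0// => i _; exact: ltW.
    rewrite /mixture_integral !muleA -!EFinM -ge0_integralZl//; first last.
    - rewrite lee_fin !mulr_ge0 ?expR_ge0 ?invr_ge0 ?mixture_const_ge0 ?(ltW C0) ?(ltW (Mgauss_gt0 _))//.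
      by apply: prodr_ge0 => i _; rewrite indicE.
    - by move=> s _; exact: mixture_integrand_ge0.
    - exact: measurable_mixture_integrand.
    apply: eq_integral => s _; rewrite /h.
    rewrite [X in _ = _ * X](_ : _ = (\prod_(i < m) (\1_(B0 i) (tnth l i))%:E) *
      \prod_(i < m) guarded_levy_chain (selected i st) (tnth (simplex_point m s) i, tnth l i)); last first.
      by rewrite -big_split/=; apply: eq_bigr => i _; rewrite /G l0 mulr1.
    rewrite prodEFin muleA -EFinM; congr (_%:E * _).
    rewrite expRN -/K; set P := (\prod_(i < m) _)%R.
    set c := (\sum_i _)%R in C0 *; set e := expR _.
    by field; rewrite !gt_eqF ?expR_gt0.
  rewrite negb_forall => /existsP[i /negbTE li].
  rewrite mul0e integral0_eq// => s _; rewrite /h (bigD1 i)//= /G li mulr0 mul0e mul0e mule0 //.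
rewrite (fubini_tonelli (m1 := lebn m) (m2 := lebn k.+1) _ mh (fun z => h0 z.1 z.2)).
apply: eq_integral => s _; set x := simplex_point m s.
transitivity (\int[lebn m]_l ((K * mixture_const)%:E * \prod_(i < m) G x i (tnth l i))).
  by [].
have mPG : measurable_fun setT (fun l : m.-tuple R => \prod_(i < m) G x i (tnth l i)).
  apply: emeasurable_prod => i; exact: (mG _ _ _ _ i (measurable_cst x) (measurable_tnth i)).
rewrite (ge0_integralZl (lebn m) measurableT mPG (fun l _ => PG0 x l) Kc0).
have mGx i : measurable_fun setT (G x i) := mG _ _ _ _ i (measurable_cst x) (@measurable_id _ _ setT).
rewrite (integral_lebesgue_tuple_prod mGx (G0 x)).
rewrite /dirichlet_density.
case: ifPn => [/forallP x0|]; last first.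
  rewrite negb_forall => /existsP[i]; rewrite -leNgt => xi.
  rewrite mul0e (bigD1 i)//= integral0_eq ?mul0e ?mule0// => y _.
  by rewrite /G /guarded_levy_chain/= [(0 < tnth x i)%R]ltNge xi mule0.
have -> : \prod_(i < m) \int[leb]_y G x i y =
    \prod_(i < m) ((tnth x i `^ (- (1 / 2)))%R%:E * ((tnth x i ^+ size (selected i st))%:E *
      chain (B0 i :: selected i st) (tnth x i) 0)).
  apply: eq_bigr => i _; rewrite muleA -EFinM mulrC.
  rewrite -integral_levy_chain//; last exact: measurable_selected.
  rewrite [RHS]integral_mkcond; apply: eq_integral => y _; rewrite patchE mem_pos /G.
  by case: ifP => y0; rewrite ?mulr0 ?mul0e// mulr1 guarded_levy_chain_pos// ltW.
rewrite big_split/= muleA prodEFin -EFinM; congr (_%:E * _).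
have := @dirichlet_half_const R k.+1.
have -> : (\sum_(i < m) 1 / 2 = k.+2%:R / 2 :> R)%R.
  by rewrite sumr_const card_ord mul1r mulr_natl.
rewrite prodr_const card_ord => ->.
by congr (_ * _)%R; apply: eq_bigr => i _; congr (_ `^ _)%R; field.
Qed.

End mixture_kernel.

Section mixture.
Context {d : measure_display} {T : measurableType d} {R : realType}.
Variable P : probability T R.
Variable k : nat.
Local Notation m := k.+2.
Variables (L : 'I_m -> nat -> {RV P >-> R}) (I : nat -> T -> 'I_m)
  (A : nat -> {RV P >-> R}).
Hypothesis hmodel : urn_model L I A.
Local Notation leb := (@lebesgue_measure R).
Local Notation lebn := (@lebesgue_tuple R).
Local Notation C := (total L).
Local Notation history_type := (history_type L I A).
Local Open Scope ereal_scope.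

Definition quantities n w : m.-tuple R := [tuple L i n w | i < m].

Lemma history_quantities n : measurable_fun setT (quantities n : history_type n -> m.-tuple R).
Proof.
apply/measurable_fun_tnthP => i.
rewrite (_ : _ \o _ = L i n); first exact: (history_quantity hmodel i (leqnn n)).
by apply/funext => w; rewrite /= tnth_mktuple.
Qed.

Lemma quantities_step n w : quantities n.+1 w = add_at (I n.+1 w) (A n.+1 w) (quantities n w).
Proof.
by apply: eq_from_tnth => i; rewrite !tnth_mktuple (urn_step hmodel) eq_sym.
Qed.

Lemma sum_quantities n w : (\sum_i tnth (quantities n w) i = C n w)%R.
Proof. by apply: eq_bigr => i _; rewrite tnth_mktuple. Qed.

Fixpoint step_event n (st : seq ('I_m * set R)) : set T :=
  if st is (j, B) :: st' then
    I n.+1 @^-1` [set j] `&` A n.+1 @^-1` B `&` step_event n.+1 st'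
  else setT.

Lemma measurable_step_event n st : measurable_steps st -> measurable (step_event n st).
Proof.
elim: st n => [|[j B] st IH] n mst //=.
have mB : measurable B by apply: (mst (j, B)); rewrite mem_head.
apply: measurableI.
  apply: measurableI; first exact: (measurable_index hmodel).
  exact: measurable_preimage.
by apply: IH => p pst; apply: mst; rewrite in_cons pst orbT.
Qed.

Lemma measurable_quantities n : measurable_fun setT (quantities n).
Proof. exact: (history_fun hmodel (@history_quantities n)). Qed.

Lemma measurable_kernel_quantities st n : measurable_steps st ->
  measurable_fun setT (fun w => mixture_kernel st (quantities n w)).
Proof.
by move=> mst; exact: (measurableT_comp (measurable_mixture_kernel mst) (@measurable_quantities n)).
Qed.

(** Induction on the future steps: the first of them is moved into the past event D, after which the
    law of one step and [mixture_kernel_cons] bring the kernel back from time n + 1 to time n. *)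
Lemma step_event_mixture n st (D : set T) : history L I A n D -> measurable_steps st ->
  P (D `&` step_event n st) = \int[P]_w ((\1_D w)%:E * mixture_kernel st (quantities n w)).
Proof.
elim: st n D => [|[j B] st IH] n D hD mst /=.
  have mD := measurable_history hmodel hD.
  transitivity (\int[P]_w (\1_D w)%:E); first by rewrite integral_indic.
  apply: ae_eq_integral => //.
  - exact/measurable_EFinP/measurable_indic.
  - apply: emeasurable_funM; first exact/measurable_EFinP/measurable_indic.
    exact: measurable_kernel_quantities.
  apply: filterS (ae_positive_at hmodel n) => w pw _.
  by rewrite mixture_kernel_nil ?mule1// => i; rewrite tnth_mktuple.
have mB : measurable B by apply: (mst (j, B)); rewrite mem_head.
have mst' : measurable_steps st by move=> p pst; apply: mst; rewrite in_cons pst orbT.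
pose D' := D `&` (I n.+1 @^-1` [set j] `&` A n.+1 @^-1` B).
have hn1 : (1 <= n.+1 <= n.+1)%N by rewrite leqnn.
have hD' : history L I A n.+1 D'.
  have h1 : @measurable _ (history_type n.+1) D by exact: history_mono (leqnSn n) hD.
  have h2 : @measurable _ (history_type n.+1) (I n.+1 @^-1` [set j]) by exact: history_index.
  have h3 : @measurable _ (history_type n.+1) (A n.+1 @^-1` B).
    by have := @history_addition _ _ _ _ _ L I A _ _ hn1 measurableT B mB; rewrite setTI.
  exact: (measurableI _ _ h1 (measurableI _ _ h2 h3)).
rewrite (_ : D `&` _ = D' `&` step_event n.+1 st); last by rewrite /D' !setIA.
rewrite (IH _ _ hD' mst').
pose f (z : history_type n * R) : \bar R :=
  (\1_D z.1 * \1_B z.2)%R%:E * mixture_kernel st (add_at j z.2 (quantities n z.1)).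
have f0 z : 0 <= f z by rewrite mule_ge0 ?mixture_kernel_ge0// lee_fin mulr_ge0 ?indicE.
have mf : measurable_fun setT f.
  apply: emeasurable_funM.
    apply/measurable_EFinP; apply: measurable_funM.
      have h1 : @measurable _ (history_type n) D by exact: hD.
      exact: (measurableT_comp (measurable_indic h1)).
    exact: (measurableT_comp (measurable_indic mB)).
  apply: (measurableT_comp (measurable_mixture_kernel mst')).
  apply: measurable_add_at => //.
  exact: (measurableT_comp (@history_quantities n)).
transitivity (\int[P]_w ((\1_(I n.+1 @^-1` [set j]) w)%:E * f (w, A n.+1 w))).
  apply: eq_integral => w _; rewrite /f/= quantities_step !indicE /D' !in_setI.
  rewrite (_ : (w \in A n.+1 @^-1` B) = (A n.+1 w \in B)); last by apply/idP/idP; rewrite !inE.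
  rewrite (_ : (w \in I n.+1 @^-1` [set j]) = (I n.+1 w == j)); last first.
    by apply/idP/eqP; rewrite inE.
  case: eqVneq => [->|_]; last by rewrite andbF mul0e mul0e.
  by case: (w \in D); case: (_ \in B); rewrite ?(mulr1,mulr0,mul0r,mul0e,mul1e).
rewrite (step_integral hmodel j mf f0); apply: ae_eq_integral => //.
- apply: emeasurable_funM.
    by apply/measurable_EFinP; apply: (history_fun hmodel); exact: (history_selection_weight hmodel _ (leqnn n)).
  by apply: (history_fun hmodel); exact: measurable_weight_average.
- apply: emeasurable_funM.
    by apply/measurable_EFinP/measurable_indic; exact: (measurable_history hmodel hD).
  exact: measurable_kernel_quantities.
apply: filterS (ae_positive_at hmodel n) => w pw _.
rewrite -(mixture_kernel_cons j mB mst'); last by move=> i; rewrite tnth_mktuple.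
rewrite sum_quantities tnth_mktuple /selection_weight indicE mem_set// mul1r.
rewrite muleCA; congr (_ * _); rewrite -ge0_integralZl//; first last.
- move=> a _; rewrite !mule_ge0 ?mixture_kernel_ge0 ?lee_fin ?guarded_weight_ge0//.
- apply: emeasurable_funM.
    by apply/measurable_EFinP; exact: measurable_guarded_weight1.
  apply: emeasurable_funM; first exact/measurable_EFinP/measurable_indic.
  apply: (measurableT_comp (measurable_mixture_kernel mst')).
  exact: measurable_add_at.
by apply: eq_integral => a _; rewrite [RHS]muleCA /f/= EFinM !muleA.
Qed.

Definition initial_event (B0 : 'I_m -> set R) : set T := [set w | forall i, B0 i (L i 0%N w)].

Lemma history_initial_event B0 n : (forall i, measurable (B0 i)) -> history L I A n (initial_event B0).
Proof.
move=> mB0; rewrite (_ : initial_event B0 = \bigcap_(i in [set: 'I_m]) (L i 0%N @^-1` B0 i)).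
  apply: (@fin_bigcap_measurable _ (history_type n)) => [//|i _].
  by have := history_quantity hmodel i (leq0n n) measurableT (mB0 i); rewrite setTI.
by apply/seteqP; split => w /= H i; [move=> _; exact: H|exact: H].
Qed.

Lemma mixture_law (B0 : 'I_m -> set R) st : (forall i, measurable (B0 i)) -> measurable_steps st ->
  P (initial_event B0 `&` step_event 0 st) =
  \int[lebn k.+1]_s ((dirichlet_density (fun=> 1 / 2)%R (simplex_point m s))%:E *
    \prod_(i < m) ((tnth (simplex_point m s) i ^+ size (selected i st))%:E *
      chain (B0 i :: selected i st) (tnth (simplex_point m s) i) 0)).
Proof.
move=> mB0 mst; rewrite step_event_mixture//; last exact: history_initial_event.
rewrite -integral_initial_mixture// -(initial_law hmodel); first last.
- move=> l; rewrite mule_ge0 ?mixture_kernel_ge0// lee_fin.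
  by apply: prodr_ge0 => i _; rewrite indicE.
- apply: emeasurable_funM; last exact: measurable_mixture_kernel.
  apply/measurable_EFinP; apply: measurable_prod => i _.
  exact: (measurableT_comp (measurable_indic (mB0 i)) (measurable_tnth i)).
apply: eq_integral => w _; congr (_%:E * _).
case: (pselect (initial_event B0 w)) => h.
  rewrite indicE mem_set// big1// => i _; rewrite tnth_mktuple indicE mem_set//; exact: h.
rewrite indicE memNset//; move/existsNP : h => [i hi].
by rewrite (bigD1 i)//= tnth_mktuple indicE memNset// mul0r.
Qed.

End mixture.

(** * Jump times of the Poisson process *)

Section path_density.
Context {R : realType}.
Local Notation leb := (@lebesgue_measure R).
Local Notation lebn := (@lebesgue_tuple R).

(** In terms of the jump times s instead of the gaps: exp (- l^2 / 2) times the density of the first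
    jumps after l of the process with hazard y at y, on the event that the gaps lie in Bs. *)
Fixpoint path_density (Bs : seq (set R)) (l : R) (s : seq R) : R :=
  match Bs, s with
  | B :: Bs', y :: s' => if l < y then \1_B (y - l) * y * path_density Bs' y s' else 0
  | _, _ => expR (- (l ^+ 2 / 2))
  end.

Lemma path_density_ge0 Bs l s : 0 <= l -> 0 <= path_density Bs l s.
Proof.
elim: Bs l s => [|B Bs IH] l [|y s] l0 /=; rewrite ?expR_ge0//.
case: ifPn => // ly; have y0 : 0 <= y by rewrite (le_trans l0)// ltW.
by rewrite !mulr_ge0 ?indicE ?IH.
Qed.

Lemma measurable_path_density Bs : (forall B, B \in Bs -> measurable B) ->
  measurable_fun setT (fun z : R * (size Bs).-tuple R => path_density Bs z.1 z.2).
Proof.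
elim: Bs => [|B Bs IH] mB /=.
  apply: measurableT_comp => //; apply: measurableT_comp => //.
  by apply: measurable_funM => //; apply: measurable_funX.
have mB1 : measurable B by apply: mB; rewrite mem_head.
have {}IH := IH (fun D hD => mB D (mem_behead (s := B :: Bs) hD)).
pose th (z : R * (size Bs).+1.-tuple R) : R := tnth z.2 ord0.
have mth : measurable_fun setT th by exact: (measurableT_comp (measurable_tnth _)).
have mbh : measurable_fun setT (fun z : R * (size Bs).+1.-tuple R => (th z, [tuple of behead z.2])).
  apply: measurable_fun_pair => //.
  exact: (measurableT_comp (@measurable_behead _ _ _)).
rewrite (_ : (fun _ => _) = fun z => if z.1 < th z then
    \1_B (th z - z.1) * th z * path_density Bs (th z) [tuple of behead z.2] else 0); last first.
  by apply/funext => -[l s]; rewrite /th; case/tupleP : s => y s.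
apply: measurable_fun_ifT => //.
  exact: measurable_fun_ltr.
apply: measurable_funM; last exact: (measurableT_comp IH mbh).
apply: measurable_funM => //.
by apply: (measurableT_comp (measurable_indic mB1)); exact: measurable_funB.
Qed.

Lemma chain_path_density Bs l : (forall B, B \in Bs -> measurable B) -> 0 <= l ->
  (chain Bs 1 l = \int[lebn (size Bs)]_s (path_density Bs l s)%:E)%E.
Proof.
elim: Bs l => [|B Bs IH] l mB l0.
  rewrite integral_lebesgue_tuple0//= /chain/= /chain_base mulr1//.
have mB1 : measurable B by apply: mB; rewrite mem_head.
have mBs D : D \in Bs -> measurable D.
  by move=> hD; apply: mB; rewrite in_cons hD orbT.
have mp y : measurable_fun setT (fun s : (size Bs).-tuple R => (path_density Bs y s)%:E).
  apply/measurable_EFinP.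
  exact: (measurableT_comp (measurable_path_density mBs) (pair1_measurable y)).
rewrite [size _]/= integral_lebesgue_tupleS//; first last.
- by move=> s; rewrite lee_fin path_density_ge0.
- apply/measurable_EFinP.
  exact: (measurableT_comp (measurable_path_density mB) (pair1_measurable l)).
transitivity (\int[leb]_y (if (l < y)%R then ((\1_B (y - l) * y)%:E * chain Bs 1 y) else 0%R))%E; last first.
  apply: eq_integral => y _ /=; case: ifPn => ly; last by rewrite integral0_eq.
  rewrite IH//; last by rewrite (le_trans l0)// ltW.
  rewrite -ge0_integralZl//.
  - by move=> s _; rewrite lee_fin path_density_ge0// (le_trans l0)// ltW.
  - by rewrite lee_fin mulr_ge0 ?indicE// (le_trans l0)// ltW.
have mc : measurable_fun setT (fun y : R => if (l < y)%R then ((\1_B (y - l) * y)%:E * chain Bs 1 y)%E else 0%E).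
  rewrite (_ : (fun _ => _) = (fun y : R => if (l < y)%R then ((\1_B (y - l) * y)%:E *
    (if (0 < (1%R : R, y).1)%R && (0 <= (1%R : R, y).2)%R then chain Bs (1%R : R, y).1 (1%R : R, y).2 else 0))%E else 0%E)); last first.
    apply/funext => y; case: ifPn => // ly /=; rewrite ltr01/= (le_trans l0)//; exact: ltW.
  apply: measurable_fun_ifT => //; first exact: measurable_fun_ltr.
  apply: emeasurable_funM.
    apply/measurable_EFinP; apply: measurable_funM => //.
    by apply: (measurableT_comp (measurable_indic mB1)); exact: measurable_funB.
  exact: (measurableT_comp (measurable_chain mBs) (pair1_measurable (1 : R))).
rewrite (@ge0_integral_affine _ 1 l)//; last first.
  move=> y; case: ifPn => // ly; have y0 : 0 <= y by rewrite (le_trans l0)// ltW.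
  by rewrite mule_ge0 ?chain_ge0// lee_fin mulr_ge0// indicE.
rewrite /chain/= mul1e integral_mkcond; apply: eq_integral => a _.
rewrite patchE mem_pos mule1 mul1r ltrDr addrK (addrC a); case: ifP => // _.
by rewrite divr1.
Qed.

Lemma path_densityT n l s : size s = n ->
  path_density (nseq n setT) l s =
  if path <%R l s then (\prod_(y <- s) y) * expR (- ((last l s) ^+ 2 / 2)) else 0.
Proof.
elim: n l s => [|n IH] l [|y s]//= ; first by rewrite big_nil mul1r.
move=> [sn]; rewrite IH// indicT mul1r; case: (l < y) => //=.
by case: ifP; rewrite ?mulr0// big_cons mulrA.
Qed.

Lemma path_density_indic Bs l s : size s = size Bs ->
  path_density Bs l s =
  path_density (nseq (size Bs) setT) l s *
  \prod_(i < size Bs) \1_(nth setT Bs i) (nth 0 s i - nth 0 (l :: s) i).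
Proof.
elim: Bs l s => [|B Bs IH] l [|y s]//=; first by rewrite big_ord0 mulr1.
move=> [sn]; case: ifP; rewrite ?mul0r// => ly; rewrite indicT mul1r IH// big_ord_recl/=.
rewrite (_ : \prod_(i < size Bs) \1_(nth setT Bs (0 + i)) _ =
  \prod_(i < size Bs) \1_(nth setT Bs i) (nth 0 s i - nth 0 (y :: s) i))//.
set p := \prod_(i < _) _; set q := path_density _ _ _; set r := \1_B _.
by ring.
Qed.

End path_density.

Lemma measure_full_setI d (X : measurableType d) (R : realType)
    (mu : {measure set X -> \bar R}) (D E : set X) : measurable D -> measurable E ->
  mu setT = 1%E -> mu D = 1%E -> mu E = mu (D `&` E).
Proof.
move=> mD mE muT muD.
have D0 : mu (~` D) = 0%E.
  have : (mu D + mu (~` D) = 1)%E.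
    by rewrite -measureU ?setUv//; [exact: measurableC|rewrite setICr].
  rewrite muD; have := measure_ge0 mu (~` D); case: (mu (~` D)) => [r| |]//= _.
  by rewrite -EFinD => -[] /(canRL (addKr _)) ->; rewrite addNr.
rewrite -[in LHS](setIT E) -(setUv D) setIUr measureU0 1?setIC//.
- exact: measurableI.
- by apply: measurableI => //; exact: measurableC.
- apply/eqP; rewrite -measure_le0 -D0 le_measure// ?inE//.
    by apply: measurableI => //; exact: measurableC.
  exact: measurableC.
Qed.

Section separated_boxes.
Context {R : realType}.
Variable n : nat.
Local Notation leb := (@lebesgue_measure R).
Local Notation lebn := (@lebesgue_tuple R).

Definition box (a b : nat -> R) : set (n.+1.-tuple R) :=
  [set s | forall i : 'I_n.+1, a i < tnth s i <= b i].

Definition separated (a b : nat -> R) : Prop :=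
  [/\ 0 <= a 0%N, forall i, (i <= n)%N -> a i <= b i &
    forall i, (i < n)%N -> b i <= a i.+1].

(* The law of the jump times is accessible only on these boxes: having the i-th
   jump in ]a i, b i] for all i is then an event on the counts at a i and b i.
   They form a pi-system that generates the Borel subsets of increasing_paths. *)
Definition separated_box : set (set (n.+1.-tuple R)) :=
  [set S | [\/ S = setT, S = set0 | exists a b, separated a b /\ S = box a b]].

Definition increasing_paths : set (n.+1.-tuple R) := [set s | path <%R 0 s].

Lemma separated_ge0 a b i : separated a b -> (i <= n)%N -> 0 <= a i.
Proof.
move=> [a0 ab ba]; elim: i => // i IH ni.
by apply: (le_trans (IH (ltnW ni))); apply: (le_trans (ab _ (ltnW ni))); exact: ba.
Qed.

Lemma setI_closed_separated_box : setI_closed separated_box.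
Proof.
move=> S1 S2 [->|->|[a [b [sab ->]]]].
- by rewrite setTI.
- by move=> _; rewrite set0I; apply: Or32.
move=> [->|->|[c [e [sce ->]]]].
- by rewrite setIT; apply: Or33; exists a, b.
- by rewrite setI0; apply: Or32.
case: (pselect (forall i, (i <= n)%N -> Num.max (a i) (c i) <= Num.min (b i) (e i))) => h; last first.
  apply: Or32; apply/seteqP; split => // s [s1 s2]; apply: h => i ni.
  have := s1 (Ordinal (ni : (i < n.+1)%N)); have := s2 (Ordinal (ni : (i < n.+1)%N)).
  move=> /= /andP[h1 h2] /andP[h3 h4].
  rewrite ge_max !le_min (le_trans (ltW h3) h4) (le_trans (ltW h3) h2).
  by rewrite (le_trans (ltW h1) h4) (le_trans (ltW h1) h2).
apply: Or33; exists (fun i => Num.max (a i) (c i)), (fun i => Num.min (b i) (e i)); split.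
  case: sab => [a0 ab ba]; case: sce => [c0 ce ec]; split => //.
    by rewrite le_max a0.
  by move=> i ni; rewrite ge_min; apply/orP; left; rewrite le_max ba.
apply/seteqP; split => s /=.
  move=> [s1 s2] i; have /andP[h1 h2] := s1 i; have /andP[h3 h4] := s2 i.
  by rewrite gt_max le_min h1 h2 h3 h4.
by move=> H; split => i; have := H i; rewrite gt_max le_min => /andP[/andP[h1 h2] /andP[h3 h4]]; rewrite ?h1 ?h2 ?h3 ?h4.
Qed.

Lemma measurable_box a b : measurable (box a b).
Proof.
rewrite (_ : box a b = \bigcap_(i in [set: 'I_n.+1]) ((@tnth n.+1 R)^~ i @^-1` `]a i, b i])).
  apply: fin_bigcap_measurable => // i _.
  by apply: measurable_preimage => //; exact: measurable_tnth.
apply/seteqP; split => s /= H i; first by move=> _; rewrite /= in_itv/=; exact: H.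
by have := H i Logic.I; rewrite /= in_itv.
Qed.

Lemma measurable_separated_box : separated_box `<=` measurable.
Proof.
move=> S [->|->|[a [b [_ ->]]]]; [exact: measurableT|exact: measurable0|exact: measurable_box].
Qed.

Let U := g_sigma_algebraType separated_box.

Let previous (u : n.+1.-tuple rat) (i : nat) : R := ratr (nth 0 (0 :: u) i).
Let current (u : n.+1.-tuple rat) (i : nat) : R := ratr (nth 0 u i).

(** Rationals strictly between consecutive coordinates separate an increasing path: each is the
    right end of one side and the left end of the next, so countably many separated boxes suffice.
    Choosing the rational of index j below c keeps the box inside the slice. *)
Lemma increasing_paths_slice (j : 'I_n.+1) c :
  @measurable _ U (increasing_paths `&` [set s | tnth s j < c]).
Proof.
pose F (u : n.+1.-tuple rat) : set (n.+1.-tuple R) :=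
  if `[< separated (previous u) (current u) /\ current u j < c >]
  then box (previous u) (current u) else set0.
rewrite (_ : _ `&` _ = \bigcup_u F u).
  apply: (@countable_bigcupT_measurable _ U) => [|u]; first exact: countableP.
  apply: sub_sigma_algebra; rewrite /F; case: asboolP => [[h _]|_].
    by apply: Or33; exists (previous u), (current u).
  exact: Or32.
apply/seteqP; split => s /=; last first.
  move=> [u _]; rewrite /F; case: asboolP => // -[[h1 h2 h3] h4] hs; split.
    apply/(pathP 0) => i; rewrite size_tuple => ni.
    have /andP[si1 _] := hs (Ordinal ni); rewrite (tnth_nth 0)/= in si1.
    case: i ni si1 => [|i] ni /=; first by rewrite /previous/= rmorph0.
    have /andP[_ si0] := hs (Ordinal (ltnW ni)); rewrite (tnth_nth 0)/= in si0.
    by move=> si1; rewrite (le_lt_trans si0)// (le_lt_trans _ si1).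
  by have /andP[_ sj] := hs j; rewrite /= (le_lt_trans sj).
move=> [sp sc]; have si i : (i <= n)%N -> nth 0 (0 :: s) i < nth 0 s i.
  by move=> ni; move/(pathP 0) : sp; apply; rewrite size_tuple.
have H (i : 'I_n.+1) : exists q : rat, tnth s i < ratr q < Num.min
    (if (i < n)%N then nth 0 s i.+1 else tnth s i + 1) (if i == j then c else tnth s i + 1).
  have := @rat_in_itvoo R (tnth s i) (Num.min
    (if (i < n)%N then nth 0 s i.+1 else tnth s i + 1) (if i == j then c else tnth s i + 1)).
  rewrite lt_min => H; case: H => [|q].
    apply/andP; split.
      by case: ifP => ni; [have := si i.+1 ni; rewrite (tnth_nth 0)|rewrite ltrDl].
    by case: eqP => [->//|_]; rewrite ltrDl.
  by rewrite in_itv/= => h; exists q.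
pose u := [tuple sval (cid (H i)) | i < n.+1].
have uE (i : 'I_n.+1) : current u i = ratr (sval (cid (H i))).
  by rewrite /current -(tnth_nth 0 u i) tnth_mktuple.
have u1 (i : 'I_n.+1) : tnth s i < current u i by rewrite uE; case: cid => q /= /andP[].
have u2 i : (i < n)%N -> current u i < nth 0 s i.+1.
  move=> ni; have := uE (Ordinal (ltnW ni : (i < n.+1)%N)); rewrite /= => ->.
  by case: cid => q /= /andP[_]; rewrite ni lt_min => /andP[].
have u3 : current u j < c.
  by rewrite uE; case: cid => q /= /andP[_]; rewrite eqxx lt_min => /andP[].
have p1 (i : 'I_n.+1) : previous u i < tnth s i.
  case: i => -[|i] ni /=.
    by rewrite /previous/= rmorph0; have := si 0%N (leq0n _); rewrite (tnth_nth 0).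
  by rewrite (tnth_nth 0)/=; exact: u2.
exists u => //; rewrite /F; case: asboolP => [_ i|[]]; first by rewrite p1 ltW.
split => //; split.
- by rewrite /previous/= rmorph0.
- move=> i ni; have := p1 (Ordinal (ni : (i < n.+1)%N)); have := u1 (Ordinal (ni : (i < n.+1)%N)).
  by move=> /= h1 h2; rewrite ltW// (lt_trans h2).
- by move=> i ni; rewrite /previous.
Qed.

Lemma increasing_paths_measurable : @measurable _ U increasing_paths.
Proof.
rewrite (_ : increasing_paths = \bigcup_(k : nat) (increasing_paths `&` [set s | tnth s ord0 < k%:R])).
  apply: (@bigcupT_measurable _ U) => k; exact: increasing_paths_slice.
apply/seteqP; split => s /=; last by move=> [k _ []].
move=> sp; exists (Num.truncn (tnth s ord0)).+1 => //; split => //=.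
by rewrite truncnS_gt.
Qed.

(** Sending every other path to the zero path makes the coordinates measurable for the boxes, since
    the slices of [increasing_paths] are; the Borel set is then pulled back along this map. *)
Lemma increasing_paths_trace E : measurable E -> @measurable _ U (increasing_paths `&` E).
Proof.
move=> mE; pose r (s : U) : n.+1.-tuple R := if path <%R 0 s then s else [tuple of nseq n.+1 0].
suff mr : measurable_fun setT r.
  have -> : increasing_paths `&` E = increasing_paths `&` r @^-1` E.
    by apply/seteqP; split => s [h1 h2]; split => //; move: h2; rewrite /r /preimage/= h1.
  apply: measurableI; first exact: increasing_paths_measurable.
  exact: (measurable_preimage mr).
apply/measurable_fun_tnthP => j; apply: (measurability (@RGenInftyO.G R)).
  exact: RGenInftyO.measurableE.
move=> S [_ [c ->] <-]; rewrite setTI.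
have -> : ((@tnth n.+1 R)^~ j \o r) @^-1` `]-oo, c[ =
    (increasing_paths `&` [set s | tnth s j < c]) `|` (~` increasing_paths `&` [set _ | 0 < c]).
  apply/seteqP; split => s /=; rewrite in_itv/= /r.
    case: ifPn => h hc; first by left.
    by right; split; [exact/negP|rewrite (tnth_nth 0) nth_nseq ltn_ord in hc].
  move=> [[h hc]|[/negP h hc]]; first by rewrite h.
  by rewrite (negbTE h) (tnth_nth 0) nth_nseq ltn_ord.
apply: measurableU; first exact: increasing_paths_slice.
apply: measurableI; first by apply: measurableC; exact: increasing_paths_measurable.
by case: (ltP 0 c) => c0; [rewrite (_ : [set _ | _] = setT)|rewrite (_ : [set _ | _] = set0)] => //;
  apply/seteqP; split.
Qed.

Definition path_weight (s : n.+1.-tuple R) : R :=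
  if path <%R 0 s then (\prod_(i < n.+1) tnth s i) * expR (- (tnth s ord_max ^+ 2 / 2)) else 0.

Lemma increasing_path_gt0 (s : n.+1.-tuple R) i : increasing_paths s -> 0 < tnth s i.
Proof.
move=> /(order_path_min lt_trans) /allP H; apply: H; exact: mem_tnth.
Qed.

Lemma path_weight_ge0 s : 0 <= path_weight s.
Proof.
rewrite /path_weight; case: ifPn => // sp; rewrite mulr_ge0 ?expR_ge0 ?prodr_ge0// => i _.
exact/ltW/increasing_path_gt0.
Qed.

Lemma path_weightE s : path_weight s = path_density (nseq n.+1 setT) 0 s.
Proof.
rewrite path_densityT ?size_tuple// /path_weight big_tuple; case: ifP => // _.
congr (_ * expR (- (_ ^+ 2 / 2))).
by rewrite (tnth_nth 0)/= -nth_last size_tuple/=; apply: set_nth_default; rewrite size_tuple.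
Qed.

Lemma measurable_path_weight : measurable_fun setT path_weight.
Proof.
apply: measurable_fun_ifT => //.
  apply: (@measurable_fun_bool _ _ _ _ true).
  rewrite setTI (_ : _ @^-1` _ = increasing_paths); last by [].
  have : smallest (sigma_algebra setT) separated_box `<=` measurable.
    apply: smallest_sub; first exact: sigma_algebra_measurable.
    exact: measurable_separated_box.
  by apply; exact: increasing_paths_measurable.
apply: measurable_funM; first by apply: measurable_prod => i _; exact: measurable_tnth.
apply: measurableT_comp => //; apply: measurableT_comp => //; apply: measurable_funM => //.
by apply: measurable_funX; exact: measurable_tnth.
Qed.

Definition path_law := weighted_law (lebn n.+1) path_weight_ge0 measurable_path_weight
  (@measurable_id _ _ setT).

Definition increments_in (Bs : seq (set R)) : set (n.+1.-tuple R) :=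
  [set s | forall i : 'I_n.+1, nth setT Bs i (tnth s i - nth 0 (0 :: s) i)].

Lemma measurable_increments_in Bs : (forall B, B \in Bs -> measurable B) ->
  measurable (increments_in Bs).
Proof.
move=> mB; rewrite (_ : increments_in Bs = \bigcap_(i in [set: 'I_n.+1])
    (fun s : n.+1.-tuple R => tnth s i - nth 0 (0 :: s) i) @^-1` (nth setT Bs i)).
  apply: fin_bigcap_measurable => // i _; apply: measurable_preimage.
    apply: measurable_funB; first exact: measurable_tnth.
    case: i => -[|i] ni //=; exact: measurable_nth_tuple.
  have [iB|Bi] := ltnP i (size Bs); first by apply: mB; exact: mem_nth.
  by rewrite nth_default.
by apply/seteqP; split => s /= H i; [move=> _; exact: H|exact: H].
Qed.

Lemma path_law_increments Bs : (forall B, B \in Bs -> measurable B) -> size Bs = n.+1 ->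
  path_law (increments_in Bs) = chain Bs 1 0.
Proof.
move=> mB sB; rewrite chain_path_density// /path_law /weighted_law.
rewrite integral_mkcond.
transitivity (\int[lebn n.+1]_s (path_density Bs 0 s)%:E)%E; last first.
  by move: sB; generalize (size Bs) => p ->.
apply: eq_integral => s _; rewrite patchE path_weightE (@path_density_indic _ Bs) ?size_tuple// sB.
case: ifPn => [|]; rewrite ?inE ?notin_setE /preimage/= => h.
  rewrite big1 ?mulr1// => i _; rewrite indicE mem_set//.
  by have := h i; rewrite (tnth_nth 0).
move/existsNP : h => [i hi]; rewrite (bigD1 i)//= indicE memNset ?mul0r ?mulr0//.
by rewrite -(tnth_nth 0).
Qed.

Lemma path_law_setT : path_law setT = 1%E.
Proof.
rewrite (_ : setT = increments_in (nseq n.+1 setT)).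
  rewrite path_law_increments ?size_nseq//; last by move=> B /nseqP[->].
  by rewrite -[nseq _ _]cat0s chain_cat_setT// /chain/= /chain_base expr0n/= mul0r oppr0 expR0.
by apply/seteqP; split => // s _ i; rewrite nth_nseq if_same.
Qed.

(** The probability, for rate t, of no jump before a 0 nor between b i and a (i + 1), exactly one in
    ]a i, b i] for i < n, and at least one in ]a n, b n]. The exponentials of the successive
    intervals telescope. *)
Definition box_mass (a b : nat -> R) : R :=
  (\prod_(i < n) ((b i ^+ 2 - a i ^+ 2) / 2)) * (expR (- (a n ^+ 2 / 2)) - expR (- (b n ^+ 2 / 2))).

Lemma path_law_box a b : separated a b -> path_law (box a b) = (box_mass a b)%:E.
Proof.
move=> sab; have [a0 ab ba] := sab.
pose h (i : 'I_n.+1) (y : R) : \bar R := (\1_(`]a i, b i] : set R) y *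
  (y * (if i == ord_max then expR (- (y ^+ 2 / 2)) else 1)))%:E.
have mh i : measurable_fun setT (h i).
  apply/measurable_EFinP; apply: measurable_funM; first exact: measurable_indic.
  apply: measurable_funM => //; case: (i == ord_max) => //.
  apply: measurableT_comp => //; apply: measurableT_comp => //; apply: measurable_funM => //.
have h0 i y : (0 <= h i y)%E.
  rewrite lee_fin indicE; case: (boolP (y \in _)) => [|_]; rewrite ?mul0r// inE/= in_itv/= => /andP[ay _].
  rewrite mul1r mulr_ge0//; last by case: ifP; rewrite ?expR_ge0.
  by apply: (le_trans _ (ltW ay)); apply: separated_ge0 sab _; rewrite -ltnS.
transitivity (\int[lebn n.+1]_s \prod_(i < n.+1) h i (tnth s i))%E.
  rewrite /path_law /weighted_law integral_mkcond; apply: eq_integral => s _.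
  rewrite patchE prodEFin; case: ifPn => [|]; rewrite ?inE ?notin_setE /preimage/= => hs.
    congr EFin; rewrite /path_weight ifT; last first.
      apply/(pathP 0) => i; rewrite size_tuple => ni.
      have /andP[si1 _] := hs (Ordinal ni); rewrite (tnth_nth 0)/= in si1.
      case: i ni si1 => [|i] ni /= si1; first by rewrite (le_lt_trans a0).
      have /andP[_ si0] := hs (Ordinal (ltnW ni)); rewrite (tnth_nth 0)/= in si0.
      by rewrite (le_lt_trans si0)// (le_lt_trans (ba _ _) si1).
    under [RHS]eq_bigr => i _ do rewrite indicE mem_set/= ?in_itv/= ?hs// mul1r.
    rewrite big_split/=; congr (_ * _).
    by rewrite (bigD1 ord_max)//= eqxx big1 ?mulr1// => i /negbTE ->.
  move/existsNP : hs => [i /negP hi].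
  by rewrite (bigD1 i)//= indicE memNset ?mul0r//= in_itv/=; exact/negP.
rewrite integral_lebesgue_tuple_prod// big_ord_recr/=.
have dsq (x : R) : is_derive x 1 (fun y => y ^+ 2 / 2) x.
  by apply: is_derive_eq; rewrite /GRing.scale/=; field.
rewrite /box_mass EFinM; congr (_ * _)%E.
  rewrite -prodEFin; apply: eq_bigr => i _; rewrite /h.
  transitivity (\int[leb]_(y in `]a i, b i]) y%:E)%E.
    rewrite [RHS]integral_mkcond; apply: eq_integral => y _; rewrite patchE indicE/=.
    rewrite (_ : (_ == ord_max) = false); last first.
      by apply/negbTE; rewrite -val_eqE/= ltn_eqF.
    by rewrite mulr1; case: ifP; rewrite ?mul1r ?mul0r.
  rewrite (@integral_derivative_itv R (fun y => y ^+ 2 / 2) id)//.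
  - by rewrite mulrBl.
  - by apply: ab; exact: ltnW.
  - by move=> y _; exact: cvg_id.
transitivity (\int[leb]_(y in `]a n, b n]) (y * expR (- (y ^+ 2 / 2)))%:E)%E.
  rewrite [RHS]integral_mkcond; apply: eq_integral => y _; rewrite patchE /h/=.
  by rewrite eqxx indicE; case: ifP; rewrite ?mul1r ?mul0r.
have dE (y : R) : is_derive y 1 (fun x : R => - expR (- (x ^+ 2 / 2))) (y * expR (- (y ^+ 2 / 2))).
  have d1 : is_derive y 1 (fun x : R => - (x ^+ 2 / 2)) (- y) by apply: is_deriveN.
  have d2 := @is_derive1_comp R expR (fun x : R => - (x ^+ 2 / 2)) y _ _ (is_derive_expR _) d1.
  by apply: is_derive_eq; rewrite mulrN opprK mulrC.
have cE (y : R) : {for y, continuous (fun y : R => y * expR (- (y ^+ 2 / 2)))}.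
  apply: continuousM; first exact: cvg_id.
  apply: continuous_comp; last exact: continuous_expR.
  apply: continuousN; apply: continuousM; last exact: cst_continuous.
  exact: exprn_continuous.
rewrite (integral_derivative_itv (ab n (leqnn n)) (fun y _ => dE y) (fun y _ => cE y)).
by rewrite opprK addrC.
Qed.

(** Separated boxes do not generate the Borel sets of the whole space. They do decide that both
    measures give mass 1 to the increasing paths, and the trace of a Borel set there is in their
    sigma-algebra. *)
Lemma path_law_unique (mu : {measure set (n.+1.-tuple R) -> \bar R}) :
  mu setT = 1%E ->
  (forall a b, separated a b -> mu (box a b) = (box_mass a b)%:E) ->
  forall E, measurable E -> mu E = path_law E.
Proof.
move=> muT mub.
have H E : <<s separated_box >> E -> mu E = path_law E.
  apply: (@g_sigma_algebra_measure_unique _ _ _ separated_box measurable_separated_box (fun=> setT)) => //.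
  - by move=> i; apply: Or31.
  - by rewrite bigcup_const//; exists 0%N.
  - exact: setI_closed_separated_box.
  - move=> S [->|->|[a [b [sab ->]]]]; first by rewrite muT [RHS]path_law_setT.
      by rewrite !measure0.
    by rewrite mub// [RHS]path_law_box.
  - by move=> k; rewrite muT ltry.
move=> E mE.
have inc := increasing_paths_measurable.
have lawT : path_law increasing_paths = 1%E.
  rewrite -path_law_setT /path_law /weighted_law integral_mkcond [RHS]integral_mkcond.
  apply: eq_integral => s _; rewrite !patchE mem_setT/=.
  case: ifPn => //; rewrite notin_setE /preimage/= => h; rewrite /path_weight.
  by case: ifP.
have minc : measurable increasing_paths.
  by have := increasing_paths_trace measurableT; rewrite setIT => ?; move: inc; apply: smallest_sub;
    [exact: sigma_algebra_measurable|exact: measurable_separated_box].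
rewrite (measure_full_setI minc mE muT); last by rewrite H.
rewrite [RHS](measure_full_setI minc mE path_law_setT lawT).
by apply: H; exact: increasing_paths_trace.
Qed.

End separated_boxes.

Section poisson_jumps.
Context {d' : measure_display} {T' : measurableType d'} {R : realType}.
Variable Q : probability T' R.
Variable N : R -> T' -> nat.
Hypothesis hN : poisson_process Q (fun t : R => t) N.
Local Notation leb := (@lebesgue_measure R).
Local Notation lebn := (@lebesgue_tuple R).

Let jumps k w := [set t : R | 0 <= t /\ (k < N t w)%N].

Let jumps_lb k w : has_lbound (jumps k w).
Proof. by exists 0 => t []. Qed.

Lemma jump_time_le k w t : 0 <= t -> (k < N t w)%N -> jump_time N k w <= t.
Proof. by move=> t0 kN; apply: ge_inf; [exact: jumps_lb|split]. Qed.

Lemma jump_time_reached k w t : 0 <= t -> (exists s, jumps k w s) ->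
  jump_time N k w <= t -> (k < N t w)%N.
Proof.
move=> t0 ex Jt; rewrite ltnNge; apply/negP => Nk.
have [e e0 He] : exists2 e, 0 < e & forall s, t < s -> s < t + e -> N s w = N t w.
  have := pp_right_continuous hN w t0; rewrite near_withinE => /nbhs_ballP[e /= e0 He].
  exists e => // s ts ste; apply: He => //.
  by rewrite /ball/= ltr0_norm ?subr_lt0// opprB ltrBlDl.
have : t + e <= jump_time N k w.
  apply: lb_le_inf => // s [s0 ks]; rewrite leNgt; apply/negP => se.
  have [st|ts] := leP s t.
    by have := leq_trans (leq_trans ks (pp_nondecreasing hN w s0 st)) Nk; rewrite ltnn.
  by have := leq_trans ks (leq_trans (eq_leq (He s ts se)) Nk); rewrite ltnn.
by rewrite leNgt (le_lt_trans Jt)// ltrDl.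
Qed.

Lemma jump_time_ge0 k w : 0 <= jump_time N k w.
Proof.
case: (pselect (exists s, jumps k w s)) => [ex|nex].
  by apply: lb_le_inf => // s [].
rewrite /jump_time (_ : [set _ | _] = set0) ?inf0//.
by apply/seteqP; split => // s hs; apply: nex; exists s.
Qed.

(** The infimum is reached by right continuity. As a >= 0, the strict inequality excludes the value
    0 that the infimum of the empty set takes by default. *)
Lemma jump_time_itv k w a b : 0 <= a -> 0 <= b ->
  (a < jump_time N k w <= b) = (N a w <= k < N b w)%N.
Proof.
move=> a0 b0; apply/idP/idP => /andP[h1 h2].
  have ex : exists s, jumps k w s.
    apply: contrapT => nex; move: h1.
    rewrite /jump_time (_ : [set _ | _] = set0) ?inf0 ?ltNge ?a0//.
    by apply/seteqP; split => // s hs; apply: nex; exists s.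
  rewrite (jump_time_reached b0 ex h2) andbT leqNgt; apply/negP => h.
  by move: h1; rewrite ltNge (jump_time_le a0 h).
rewrite (jump_time_le b0 h2) andbT ltNge; apply/negP => h.
have ex : exists s, jumps k w s by exists b.
by have := leq_trans (jump_time_reached a0 ex h) h1; rewrite ltnn.
Qed.

Lemma measurable_count t k : 0 <= t -> measurable [set w | (k < N t w)%N].
Proof.
move=> t0; rewrite (_ : [set w | _] = \bigcup_(j in [set j | (k < j)%N]) [set w | N t w = j]).
  by apply: bigcup_measurable => j _; exact: pp_measurable hN _ _ t0.
by apply/seteqP; split => w /=; [move=> kN; exists (N t w)|move=> [j /= kj ->]].
Qed.

Lemma measurable_jump_time k : measurable_fun setT (jump_time N k).
Proof.
apply: (measurability (@RGenOInfty.G R)); first exact: RGenOInfty.measurableE.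
move=> S [_ [c ->] <-]; rewrite setTI.
have [c0|c0] := ltP c 0.
  rewrite (_ : _ @^-1` _ = setT)//; apply/seteqP; split => // w _ /=.
  by rewrite in_itv/= andbT (lt_le_trans c0)// jump_time_ge0.
rewrite (_ : _ @^-1` _ = \bigcup_(n : nat) (~` [set w | (k < N c w)%N] `&` [set w | (k < N n%:R w)%N])).
  apply: bigcupT_measurable => n; apply: measurableI.
    by apply: measurableC; exact: measurable_count.
  exact: measurable_count.
apply/seteqP; split => w /=; rewrite in_itv/= andbT.
  move=> cJ; exists (Num.truncn (jump_time N k w)).+1 => //.
  have /= : c < jump_time N k w <= (Num.truncn (jump_time N k w)).+1%:R.
    by rewrite cJ/= ltW// truncnS_gt.
  by rewrite jump_time_itv// => /andP[h1 h2]; split => //=; apply/negP; rewrite -leqNgt.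
move=> [n _ [/negP h1 h2]]; have : (N c w <= k < N n%:R w)%N by rewrite h2 andbT leqNgt.
by rewrite -jump_time_itv// => /andP[].
Qed.

Lemma poisson_increment s t k : 0 <= s -> s <= t ->
  Q [set w | (N t w - N s w)%N = k] =
  (((t ^+ 2 - s ^+ 2) / 2) ^+ k / k`!%:R * expR (- ((t ^+ 2 - s ^+ 2) / 2)))%:E.
Proof.
move=> s0 st; rewrite (pp_poisson hN)//.
have -> : \int[leb]_(u in `[s, t]) u = (t ^+ 2 - s ^+ 2) / 2.
  rewrite /Rintegral -integral_itv_obnd_cbnd; last by apply/measurable_EFinP.
  have dsq (x : R) : is_derive x 1 (fun y => y ^+ 2 / 2) x.
    by apply: is_derive_eq; rewrite /GRing.scale/=; field.
  have cid (x : R) : {for x, continuous (@id R)} by exact: cvg_id.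
  by rewrite (integral_derivative_itv st (fun x _ => dsq x) (fun x _ => cid x))/= mulrBl.
set r := (_ / 2); have r0 : 0 <= r.
  by rewrite divr_ge0// subr_ge0 lerXn2r ?nnegrE// (le_trans s0).
rewrite /poisson_prob; case: ifPn => [r1|].
  by rewrite esum_set1 ?lee_fin ?poisson_pmf_ge0// /poisson_pmf r1.
(* For parameter 0 [poisson_prob] is the Dirac mass at 0, in agreement with the formula since 0^0 =
   1. *)
rewrite -leNgt => r1; have -> : r = 0 by apply/le_anti/andP.
rewrite oppr0 expR0 mulr1 /dirac indicE.
rewrite (_ : (0%N \in [set k]) = (k == 0%N)); last by apply/idP/eqP; rewrite inE.
by case: k => [|k]; rewrite expr0n/= ?divr1 ?mul0r.
Qed.

(* The sequence 0, a 0, b 0, a 1, b 1, ... *)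
Definition interlace (a b : nat -> R) (j : nat) : R :=
  if j is i.+1 then (if odd i then b i./2 else a i./2) else 0.

Arguments interlace : simpl never.

Lemma interlace_le n a b j : separated n a b -> (j < n.*2.+2)%N ->
  interlace a b j <= interlace a b j.+1.
Proof.
move=> sab; have [a0 ab ba] := sab; case: j => [|i] //; rewrite !ltnS => ni.
have io := odd_double_half i.
rewrite /interlace/= uphalf_half; case: (odd i) io => /= io.
  by rewrite add1n; apply: ba; lia.
by rewrite add0n; apply: ab; lia.
Qed.

Lemma interlace_mono n a b j l : separated n a b -> (j <= l)%N -> (l <= n.*2.+2)%N ->
  interlace a b j <= interlace a b l.
Proof.
move=> sab; elim: l => [|l IH]; first by rewrite leqn0 => /eqP ->.
rewrite leq_eqVlt => /orP[/eqP->//|jl] ln.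
by rewrite (le_trans (IH jl (ltnW ln)))//; exact: interlace_le sab ln.
Qed.

Lemma interlace_a a b i : interlace a b i.*2.+1 = a i.
Proof. by rewrite /interlace/= odd_double doubleK. Qed.

Lemma interlace_b a b i : interlace a b i.*2.+2 = b i.
Proof. by rewrite /interlace/= odd_double/= uphalf_double. Qed.

(** In the order of [interlace], intervals between sides and sides of the box alternate: the former
    contain no jump, the latter exactly one, so that [odd j] is the required count. Only the last
    side may contain several jumps, as later jumps are not constrained. *)
Lemma box_event n a b w : separated n a b ->
  (forall i : 'I_n.+1, a i < jump_time N i w <= b i) <->
  (forall j, (j < n.*2.+1)%N -> (N (interlace a b j.+1) w - N (interlace a b j) w)%N = odd j) /\
  (N (b n) w - N (a n) w != 0)%N.
Proof.
move=> sab; have [a0 ab ba] := sab.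
have ge0 j : (j <= n.*2.+2)%N -> 0 <= interlace a b j.
  by move=> jn; have := interlace_mono sab (leq0n j) jn.
have mono j l : (j <= l)%N -> (l <= n.*2.+2)%N -> (N (interlace a b j) w <= N (interlace a b l) w)%N.
  move=> jl ln; apply: (pp_nondecreasing hN); first by apply: ge0; exact: leq_trans ln.
  exact: interlace_mono sab jl ln.
have an i : (i <= n)%N -> 0 <= a i by exact: separated_ge0 sab.
have bn i : (i <= n)%N -> 0 <= b i.
  by move=> ni; rewrite (le_trans (an _ ni))// ab.
have E : (forall i : 'I_n.+1, a i < jump_time N i w <= b i) <->
    (forall i, (i <= n)%N -> (N (a i) w <= i < N (b i) w)%N).
  split => H i.
    move=> ni; have := H (Ordinal (ni : (i < n.+1)%N)).
    by rewrite jump_time_itv ?an ?bn.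
  by rewrite jump_time_itv ?an ?bn -1?ltnS//; apply: H; rewrite -ltnS.
rewrite E; split => [H|[H Hn] i ni]; last first.
  have Hj j : (j <= n.*2.+1)%N -> N (interlace a b j) w = j./2.
    elim: j => [|j IH] jn; first by rewrite (pp_zero hN).
    have := H j jn; have := mono j j.+1 (leqnSn j) (leqW jn); rewrite IH ?(ltnW jn)//.
    by move=> h1 h2; rewrite [j.+1./2]uphalf_half -h2 subnK.
  have := Hj i.*2.+1; rewrite interlace_a /= uphalf_double => ->; last by lia.
  rewrite leqnn/=; move: ni; rewrite leq_eqVlt => /orP[/eqP ->|ni].
    have := Hj n.*2.+1; rewrite interlace_a /= uphalf_double => /(_ (leqnn _)) h.
    have := mono n.*2.+1 n.*2.+2 (leqnSn _) (leqnn _); rewrite interlace_a interlace_b.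
    by move: Hn h; lia.
  by have := Hj i.*2.+2; rewrite interlace_b -doubleS doubleK => ->//; lia.
have Na i : (i <= n)%N -> N (a i) w = i.
  case: i => [|i] ni; first by have := H 0%N ni; lia.
  have := H i.+1 ni; have := H i (ltnW ni).
  have := mono i.*2.+2 i.+1.*2.+1; rewrite interlace_b interlace_a => m1.
  have m2 : (N (b i) w <= N (a i.+1) w)%N by apply: m1; lia.
  by move=> *; lia.
have Nb i : (i < n)%N -> N (b i) w = i.+1.
  move=> ni; have := Na i.+1 ni; have := H i (ltnW ni).
  have := mono i.*2.+2 i.+1.*2.+1; rewrite interlace_b interlace_a => m1.
  have m2 : (N (b i) w <= N (a i.+1) w)%N by apply: m1; lia.
  by move=> *; lia.
split; last by have := H n (leqnn n); have := Na n (leqnn n); lia.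
move=> j jn; have io := odd_double_half j.
case: (odd j) io => /= io.
  have -> : j = j./2.*2.+1 by rewrite -[LHS]io.
  by rewrite interlace_a interlace_b Na ?Nb ?subSnn//; lia.
have jE : j = j./2.*2 by rewrite -[LHS]io.
case: (posnP j./2) => [j0|j0].
  have -> : j = 0%N by rewrite jE j0.
  by rewrite (pp_zero hN) (interlace_a a b 0) Na.
have jE' : j = j./2.-1.*2.+2 by lia.
have -> : interlace a b j = b j./2.-1 by rewrite jE' interlace_b -jE'.
have -> : interlace a b j.+1 = a j./2 by rewrite jE interlace_a -jE.
by rewrite Na ?Nb//; lia.
Qed.

Let jump_tuple n w : n.+1.-tuple R := [tuple jump_time N i w | i < n.+1].

Let measurable_jump_tuple n : measurable_fun setT (jump_tuple n).
Proof.
apply/measurable_fun_tnthP => i.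
rewrite (_ : _ \o _ = jump_time N i); first exact: measurable_jump_time.
by apply/funext => w; rewrite /= tnth_mktuple.
Qed.

(** Independence of increments asks for times that are nondecreasing along the whole sequence, and
    [interlace] is monotone only up to its last relevant index: hence the cap. *)
Let increments n a b p (v : nat -> nat) := [set w | forall j, (j < p)%N ->
  (N (interlace a b (minn j.+1 n.*2.+2)) w - N (interlace a b (minn j n.*2.+2)) w)%N = v j].

Let prob_increments n a b p v : separated n a b -> (p <= n.*2.+2)%N ->
  Q (increments n a b p v) =
  (\prod_(j < p) ((((interlace a b j.+1) ^+ 2 - (interlace a b j) ^+ 2) / 2) ^+ v j / (v j)`!%:R *
    expR (- (((interlace a b j.+1) ^+ 2 - (interlace a b j) ^+ 2) / 2))))%:E.
Proof.
move=> sab pn.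
have mono j l : (j <= l)%N -> interlace a b (minn j n.*2.+2) <= interlace a b (minn l n.*2.+2).
  by move=> jl; apply: (interlace_mono sab); lia.
rewrite (@pp_independent_increments _ _ _ _ _ _ hN p (fun j => interlace a b (minn j n.*2.+2)) v)//; first last.
- by move=> j; apply: mono.
rewrite -prodEFin; apply: eq_bigr => j _.
rewrite poisson_increment; last 2 first.
- by have := mono 0%N j (leq0n _); rewrite min0n.
- exact: mono.
by have jp := ltn_ord j; rewrite !(minn_idPl _)//; lia.
Qed.

Let prod_increments n a b p : separated n a b -> (p <= n)%N ->
  \prod_(j < p.*2.+1) ((((interlace a b j.+1) ^+ 2 - (interlace a b j) ^+ 2) / 2) ^+ odd j / (odd j)`!%:R *
    expR (- (((interlace a b j.+1) ^+ 2 - (interlace a b j) ^+ 2) / 2))) =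
  (\prod_(i < p) ((b i ^+ 2 - a i ^+ 2) / 2)) * expR (- (a p ^+ 2 / 2)).
Proof.
move=> sab; elim: p => [|p IH] pn.
  by rewrite big_ord_recl !big_ord0 /= (interlace_a a b 0) expr0 divr1 expr0n subr0 mulr1 !mul1r.
rewrite doubleS 2!big_ord_recr IH ?(ltnW pn)// [in RHS]big_ord_recr.
rewrite /= -doubleS !interlace_a !interlace_b /= odd_double/= expr1 expr0 (_ : (1`! = 1)%N)// (_ : (0`! = 1)%N)//.
rewrite !divr1 mul1r.
transitivity (\prod_(i < p) ((b i ^+ 2 - a i ^+ 2) / 2) * ((b p ^+ 2 - a p ^+ 2) / 2) *
  (expR (- (a p ^+ 2 / 2)) * expR (- ((b p ^+ 2 - a p ^+ 2) / 2)) *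
   expR (- ((a p.+1 ^+ 2 - b p ^+ 2) / 2)))); first by rewrite /=; ring.
by rewrite -!expRD; congr (_ * expR _); field.
Qed.

Lemma jump_times_law n E : measurable E ->
  Q [set w | E [tuple jump_time N i w | i < n.+1]] = @path_law R n E.
Proof.
move=> mE; pose X : {mfun T' >-> n.+1.-tuple R} := HB.pack (jump_tuple n)
  (isMeasurableFun.Build _ _ _ _ (jump_tuple n) (@measurable_jump_tuple n)).
rewrite -[LHS]/(distribution Q X E).
apply: (path_law_unique (mu := distribution Q X)) mE => [|a b sab].
  exact: probability_setT.
transitivity (Q (jump_tuple n @^-1` box a b)); first by [].
(* At least one jump in the last side is the complement of none: from the event prescribing all
   counts but the last, the event where the last count is moreover 0 is removed. *)
pose v1 j := nat_of_bool (odd j); pose v2 j := if (j < n.*2.+1)%N then v1 j else 0%N.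
rewrite (_ : _ @^-1` _ = increments n a b n.*2.+1 v1 `\` increments n a b n.*2.+2 v2); last first.
  apply/seteqP; split => w.
    move=> /= h; have {}h : forall i : 'I_n.+1, a i < jump_time N i w <= b i.
      by move=> i; have := h i; rewrite tnth_mktuple.
    have [h1 h2] := (box_event w sab).1 h; split.
      by move=> j jn; rewrite !(minn_idPl _) ?h1//; lia.
    move=> /(_ n.*2.+1 (ltnSn _)); rewrite /v2 ltnn !(minn_idPl _)// interlace_a interlace_b.
    by move/eqP; exact/negP.
  move=> [h1 h2] i /=; rewrite tnth_mktuple; apply: (box_event w sab).2 => //; split.
    by move=> j jn; have := h1 j jn; rewrite !(minn_idPl _)//; lia.
  apply/negP => /eqP h; apply: h2 => j; rewrite ltnS leq_eqVlt => /orP[/eqP ->|jn].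
    by rewrite /v2 ltnn !(minn_idPl _)// interlace_a interlace_b.
  by rewrite /v2 jn; exact: h1.
have mI p v : measurable (increments n a b p v).
  rewrite (_ : increments n a b p v = \bigcap_(j in [set j | (j < p)%N])
      [set w | (N (interlace a b (minn j.+1 n.*2.+2)) w - N (interlace a b (minn j n.*2.+2)) w)%N = v j]).
    apply: fin_bigcap_measurable => [|j _]; first exact: finite_II.
    have ge0 l : 0 <= interlace a b (minn l n.*2.+2).
      by have := interlace_mono sab (leq0n (minn l n.*2.+2)) (geq_minr _ _).
    rewrite (_ : [set w | _] = \bigcup_q ([set w | N (interlace a b (minn j n.*2.+2)) w = q] `&`
        \bigcup_(r in [set r | (r - q)%N = v j]) [set w | N (interlace a b (minn j.+1 n.*2.+2)) w = r])).
      apply: bigcupT_measurable => q; apply: measurableI; first exact: pp_measurable hN _ _ (ge0 _).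
      by apply: bigcup_measurable => r _; exact: pp_measurable hN _ _ (ge0 _).
    apply/seteqP; split => w /=; last by move=> [q _ [/= -> [r /= <- ->]]].
    by move=> h; eexists; [by []|split; [reflexivity|eexists; [exact: h|]]].
  by apply/seteqP; split => w h j; exact: h.
rewrite measureD//; last by rewrite (le_lt_trans (probability_le1 _ _))// ltry.
rewrite setIidr; last first.
  move=> w h j jn; have := h j (leqW jn); by rewrite /v2 jn.
rewrite [X in (X - _)%E](prob_increments v1 sab (leqnSn _)).
rewrite [X in (_ - X)%E](prob_increments v2 sab (leqnn _)) [\prod_(j < n.*2.+2) _]big_ord_recr/=.
have -> : (\prod_(i < n.*2.+1) (((interlace a b i.+1 ^+ 2 - interlace a b i ^+ 2) / 2) ^+ v2 i / (v2 i)`!%:R *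
    expR (- ((interlace a b i.+1 ^+ 2 - interlace a b i ^+ 2) / 2)))) =
    (\prod_(i < n) ((b i ^+ 2 - a i ^+ 2) / 2)) * expR (- (a n ^+ 2 / 2)).
  rewrite -(prod_increments sab)//; apply: eq_bigr => j _; rewrite /v2 ltn_ord//.
have -> : (\prod_(i < n.*2.+1) (((interlace a b i.+1 ^+ 2 - interlace a b i ^+ 2) / 2) ^+ v1 i / (v1 i)`!%:R *
    expR (- ((interlace a b i.+1 ^+ 2 - interlace a b i ^+ 2) / 2)))) =
    (\prod_(i < n) ((b i ^+ 2 - a i ^+ 2) / 2)) * expR (- (a n ^+ 2 / 2)).
  by rewrite -(prod_increments sab).
rewrite -[interlace a b n.*2.+1]/(interlace a b n.*2.+1) interlace_a interlace_b.
rewrite /v2 ltnn expr0 fact0 divr1 mul1r -EFinB; congr EFin.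
by rewrite /box_mass -mulrA -mulrBr -expRD; congr (_ * (_ - expR _)); field.
Qed.

(** Dividing by sqrt x turns the hazard s / x into the hazard s: this is where the rescaling by the
    root of the limit proportion comes from. *)
Lemma chain_scale (Bs : seq (set R)) (x l : R) : 0 < x -> 0 <= l ->
  (forall B, B \in Bs -> measurable B) ->
  chain Bs x l = chain [seq [set y | B (Num.sqrt x * y)] | B <- Bs] 1 (l / Num.sqrt x).
Proof.
move=> x0; have s0 : 0 < Num.sqrt x by rewrite sqrtr_gt0.
elim: Bs l => [|B Bs IH] l l0 mB.
  rewrite /chain/= /chain_base mulr1 expr_div_n sqr_sqrtr ?ltW//; congr (expR _)%:E.
  by field; rewrite gt_eqF.
have mB1 : measurable B by apply: mB; rewrite mem_head.
have mBs D : D \in Bs -> measurable D.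
  by move=> hD; apply: mB; rewrite in_cons hD orbT.
have mstep : measurable_fun ([set` `]0%R, +oo[] : set R) (fun a : R =>
    (\1_B a * ((l + a) / x))%:E * chain Bs x (l + a)%R)%E.
  apply: (eq_measurable_fun (fun a : R => (\1_B a * ((l + a) / x))%:E *
      (if (0 < (x, l + a).1)%R && (0 <= (x, (l + a)%R).2)%R then chain Bs (x, (l + a)%R).1 (x, (l + a)%R).2 else 0))%E).
    move=> a; rewrite inE/= in_itv/= andbT => a0.
    by rewrite x0/= addr_ge0// ltW.
  apply: measurable_funTS; apply: emeasurable_funM.
    apply/measurable_EFinP; apply: measurable_funM; first exact: measurable_indic.
    by apply: measurable_funM => //; exact: measurable_funD.
  have mla : measurable_fun setT (fun a : R => (x, l + a)).
    by apply: measurable_fun_pair => //; exact: measurable_funD.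
  exact: (measurableT_comp (measurable_chain mBs) mla).
rewrite /chain/= !mul1e -!/(chain _ _ _) integral_mkcond [RHS]integral_mkcond.
rewrite (ge0_integral_affine (k := Num.sqrt x) 0)//; first last.
- move=> a; rewrite patchE mem_pos; case: ifPn => // a0.
  have la0 : 0 <= l + a by rewrite addr_ge0// ltW.
  by rewrite mule_ge0 ?chain_ge0// lee_fin mulr_ge0 ?indicE// divr_ge0// ltW.
- by apply/(measurable_restrictT _ _).1.
apply: eq_integral => a _; rewrite addr0 !patchE !mem_pos pmulr_rgt0//.
case: ifPn => a0; last by rewrite mul0e.
rewrite -!/(chain _ _ _) IH//; last by rewrite addr_ge0// mulr_ge0// ltW.
rewrite muleAC -EFinM; congr (_%:E * chain _ _ _)%E; last by field; rewrite gt_eqF.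
rewrite !indicE (_ : (a \in [set y | B (Num.sqrt x * y)]) = (Num.sqrt x * a \in B)); last first.
  by apply/idP/idP; rewrite !inE.
rewrite -[X in (_ + _) / X](sqr_sqrtr (ltW x0)).
by field; rewrite gt_eqF.
Qed.

Lemma interjump_chain n (Bs : seq (set R)) x : 0 < x -> size Bs = n.+1 ->
  (forall B, B \in Bs -> measurable B) ->
  Q [set w | forall i, (i <= n)%N -> nth setT Bs i (Num.sqrt x * interjump_time N i w)] = chain Bs x 0.
Proof.
move=> x0 sB mB; rewrite chain_scale// mul0r.
set Cs := map _ Bs.
have mC D : D \in Cs -> measurable D.
  move=> /mapP[B BB ->]; apply: (measurable_preimage (f := fun y => Num.sqrt x * y)); last exact: mB.
  exact: measurable_funM.
have sC : size Cs = n.+1 by rewrite size_map.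
rewrite -(path_law_increments mC sC) -jump_times_law; last exact: measurable_increments_in.
congr (Q _); apply/seteqP; split => w /= h.
  move=> i; have := h i (ltn_ord i); rewrite (nth_map setT) ?sB// tnth_mktuple /=.
  case: i => -[|i] ni /=; first by rewrite subr0.
  by rewrite (nth_map ord0) ?size_enum_ord ?(ltnW ni)// nth_enum_ord// ltnW.
move=> i ni; have := h (Ordinal (ni : (i < n.+1)%N)); rewrite (nth_map setT) ?sB// tnth_mktuple /=.
case: i ni => [|i] ni /=; first by rewrite subr0.
have ni' : (i < n.+1)%N by rewrite ltnW.
by rewrite (nth_map ord0) ?size_enum_ord// nth_enum_ord.
Qed.

Lemma measurable_interjump_time k : measurable_fun setT (interjump_time N k).
Proof.
case: k => [|k] /=; first exact: measurable_jump_time.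
by apply: measurable_funB; exact: measurable_jump_time.
Qed.

End poisson_jumps.

(** * Convergence of the proportions *)

Section variance.
Context {d : measure_display} {T : measurableType d} {R : realType}.
Variable P : probability T R.
Variable k : nat.
Local Notation m := k.+2.
Variables (L : 'I_m -> nat -> {RV P >-> R}) (I : nat -> T -> 'I_m)
  (A : nat -> {RV P >-> R}).
Hypothesis hmodel : urn_model L I A.
Local Notation leb := (@lebesgue_measure R).
Local Notation C := (total L).
Local Notation history_type := (history_type L I A).

Lemma sum_selection_weight n w : positive_at L n w ->
  \sum_j selection_weight L j n w = 1.
Proof.
move=> pw; have C0 := positive_total I pw.
under eq_bigr do rewrite /selection_weight indicE mem_set// mul1r.
by rewrite -mulr_suml divff// gt_eqF.
Qed.

Lemma step_integral_sum n (f : 'I_m -> history_type n * R -> \bar R) :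
  (forall j, measurable_fun setT (f j)) -> (forall j z, 0 <= f j z)%E ->
  (\int[P]_w f (I n.+1 w) (w, A n.+1 w) =
   \int[P]_w \sum_j ((selection_weight L j n w)%:E *
     \int[leb]_a ((guarded_weight (C n w) a)%:E * f j (w, a))))%E.
Proof.
move=> mf f0.
have mpair : measurable_fun setT (fun w : T => (w : history_type n, A n.+1 w)).
  by apply: measurable_fun_pair => //; exact: (measurable_to_history hmodel (n := n)).
have msw j : measurable_fun setT (fun w => (selection_weight L j n w)%:E).
  by apply/measurable_EFinP; apply: (history_fun hmodel); exact: (history_selection_weight hmodel _ (leqnn n)).
rewrite ge0_integral_sum//; first last.
- move=> j w _; rewrite mule_ge0 ?lee_fin ?selection_weight_ge0//.
  by apply: integral_ge0 => a _; rewrite mule_ge0// lee_fin guarded_weight_ge0.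
- move=> j; apply: emeasurable_funM => //.
  by apply: (history_fun hmodel); exact: measurable_weight_average.
under [RHS]eq_bigr => j _ do rewrite -(step_integral hmodel j (mf j) (f0 j)).
rewrite -ge0_integral_sum//; first last.
- by move=> j w _; rewrite mule_ge0// lee_fin indicE.
- move=> j; apply: emeasurable_funM; last exact: (measurableT_comp (mf j) mpair).
  exact/measurable_EFinP/measurable_indic/(measurable_index hmodel).
apply: eq_integral => w _; rewrite (bigD1 (I n.+1 w))//= indicE mem_set// mul1e.
rewrite big1 ?adde0// => j jI; rewrite indicE memNset ?mul0e// => /= E.
by rewrite E eqxx in jI.
Qed.

Lemma measurable_weight_shift (h : R -> \bar R) : measurable_fun setT h -> (forall c, 0 <= h c)%E ->
  measurable_fun setT (fun c : R => \int[leb]_a ((guarded_weight c a)%:E * h (c + a)%R))%E.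
Proof.
move=> mh h0.
pose g (z : R * measurableTypeR R) : \bar R := ((guarded_weight z.1 z.2)%:E * h (z.1 + (z.2 : R))%R)%E.
have mg : measurable_fun setT g.
  apply: emeasurable_funM.
    apply/measurable_EFinP.
    have mp : measurable_fun setT (fun z : R * measurableTypeR R => (z.1, z.2 : R)).
      exact: measurable_fun_pair.
    exact: (measurableT_comp measurable_guarded_weight mp).
  by apply: (measurableT_comp mh); exact: measurable_funD.
have g0 z : (0 <= g z)%E by rewrite mule_ge0// lee_fin guarded_weight_ge0.
exact: (@measurable_fun_fubini_tonelli_F _ _ _ _ _ leb g mg g0).
Qed.

Lemma integral_power_itv j (s : R) : 0 < s ->
  (\int[leb]_(c in `]0%R, s[) (c ^+ j)%:E = (s ^+ j.+1 / j.+1%:R)%:E)%E.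
Proof.
move=> s0; rewrite integral_itv_bndo_bndc; last first.
  by apply/measurable_EFinP; apply: measurable_funTS; exact: measurable_funX.
have dE (x : R) : is_derive x 1 (fun c : R => c ^+ j.+1 / j.+1%:R) (x ^+ j).
  have dX : is_derive x 1 ((@id R) ^+ j.+1) (j.+1%:R *: x ^+ j *: (1 : R)).
    exact: is_deriveX.
  have -> : (fun c : R => c ^+ j.+1 / j.+1%:R) = j.+1%:R^-1 \*: ((@id R) ^+ j.+1).
    by apply/funext => c; rewrite /= fctE mulrC.
  apply: is_derive_eq.
  by rewrite /GRing.scale/= mulr1 mulrA mulVf ?mul1r// pnatr_eq0.
have cE (x : R) : {for x, continuous (fun c : R => c ^+ j)} by exact: exprn_continuous.
rewrite (integral_derivative_itv (ltW s0) (fun x _ => dE x) (fun x _ => cE x)).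
by rewrite expr0n/= mul0r subr0.
Qed.

(** Half the squared total increases by a standard exponential variable, so the chi law gains two
    degrees of freedom. In the proof the new total becomes the variable and the old one is
    integrated out below it. *)
Lemma radial_step j (h : R -> \bar R) : measurable_fun setT h -> (forall c, 0 <= h c)%E ->
  (\int[leb]_c ((radial j c)%:E * \int[leb]_a ((guarded_weight c a)%:E * h (c + a)%R)) =
   \int[leb]_s ((radial j.+2 s)%:E * h s))%E.
Proof.
move=> mh h0.
pose g (c s : R) : \bar R := ((if (0 < c) && (c < s) then c ^+ j * s * expR (- (s ^+ 2 / 2)) / Mgauss j else 0)%:E * h s)%E.
have g0 c s : (0 <= g c s)%E.
  rewrite mule_ge0// lee_fin; case: ifPn => // /andP[c0 cs].
  apply: divr_ge0; last exact/ltW/Mgauss_gt0.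
  by rewrite !mulr_ge0 ?expR_ge0 ?exprn_ge0 ?ltW// (lt_trans c0).
have mg : measurable_fun setT (fun z : measurableTypeR R * measurableTypeR R => g z.1 z.2).
  apply: emeasurable_funM; last exact: (measurableT_comp mh).
  apply/measurable_EFinP; apply: measurable_fun_ifT => //.
    apply: measurable_and; first exact: (@measurable_fun_ltr _ _ R setT (cst 0) fst).
    exact: (@measurable_fun_ltr _ _ R setT fst snd).
  apply: measurable_funM => //; apply: measurable_funM.
    by apply: measurable_funM => //; apply: measurable_funX.
  apply: measurableT_comp => //; apply: measurableT_comp => //.
  by apply: measurable_funM => //; apply: measurable_funX.
transitivity (\int[leb]_c \int[leb]_s g c s)%E.
  apply: eq_integral => c _.
  have mgc : measurable_fun setT (g c) by exact: (measurableT_comp mg (pair1_measurable (c : measurableTypeR R))).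
  rewrite [RHS](@ge0_integral_affine _ 1 c)//.
  rewrite -ge0_integralZl//; first last.
  - by rewrite lee_fin radial_ge0.
  - by move=> a _; rewrite mule_ge0// lee_fin guarded_weight_ge0.
  - apply: emeasurable_funM; first by apply/measurable_EFinP; exact: measurable_guarded_weight1.
    by apply: (measurableT_comp mh); exact: measurable_funD.
  apply: eq_integral => a _; rewrite mule1 mul1r /g (addrC a) ltrDl muleA.
  rewrite -EFinM; congr (_%:E * _)%E; rewrite /radial /guarded_weight.
  case: (ltP 0 c) => c0 /=; last by rewrite mul0r.
  case: ifP => a0; last by rewrite mulr0.
  rewrite /addition_weight mulNr expRD !expRN (addrC a).
  by field; rewrite !gt_eqF ?expR_gt0 ?Mgauss_gt0.
rewrite (fubini_tonelli (m1 := leb) (m2 := leb) _ mg (fun z => g0 z.1 z.2))/=.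
apply: eq_integral => s _; rewrite /g /radial; case: ltP => s0; last first.
  rewrite mul0e integral0_eq// => c _; case: ifPn => [/andP[c0 cs]|]; last by rewrite mul0e.
  by move: (lt_trans c0 cs); rewrite ltNge s0.
transitivity (\int[leb]_(c in `]0%R, s[) ((s * expR (- (s ^+ 2 / 2)) / Mgauss j)%:E * h s * (c ^+ j)%:E))%E.
  rewrite [RHS]integral_mkcond; apply: eq_integral => c _; rewrite patchE.
  rewrite (_ : (c \in `]0, s[%classic) = (0 < c) && (c < s)); last first.
    by apply/idP/idP; rewrite inE/= in_itv.
  case: ifP => _; last by rewrite mul0e.
  rewrite muleAC -EFinM; congr (_%:E * _)%E; ring.
rewrite ge0_integralZl//; first last.
- rewrite mule_ge0// lee_fin; apply: divr_ge0; last exact/ltW/Mgauss_gt0.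
  by rewrite mulr_ge0 ?expR_ge0// ltW.
- by move=> c /=; rewrite in_itv/= => /andP[c0 _]; rewrite lee_fin exprn_ge0// ltW.
- by apply/measurable_EFinP; apply: measurable_funTS; exact: measurable_funX.
rewrite integral_power_itv// muleAC -EFinM; congr (_%:E * _)%E.
have M0 := @Mgauss_gt0 R j; have j0 : j.+1%:R != 0 :> R by rewrite pnatr_eq0.
rewrite MgaussSS (exprS s j.+1); move: (s ^+ j.+1) => q; move: (Mgauss j) M0 => M M0; move: (j.+1%:R) j0 => J J0.
by field; rewrite J0 gt_eqF.
Qed.

Lemma total_law n (h : R -> \bar R) : measurable_fun setT h -> (forall c, 0 <= h c)%E ->
  (\int[P]_w h (C n w) = \int[leb]_c ((radial (k.+2 + n.*2) c)%:E * h c))%E.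
Proof.
elim: n h => [|n IH] h mh h0; first by rewrite (integral_total0 hmodel mh h0) addn0.
have CE w : C n.+1 w = C n w + A n.+1 w.
  rewrite /total (bigD1 (I n.+1 w))//= (urn_step hmodel) eqxx [in RHS](bigD1 (I n.+1 w))//=.
  rewrite [RHS]addrAC; congr (_ + _); apply: eq_bigr => i iI.
  by rewrite (urn_step hmodel) (negbTE iI).
pose f (_ : 'I_m) (z : history_type n * R) := h (C n z.1 + z.2).
have mf j : measurable_fun setT (f j).
  apply: (measurableT_comp mh); apply: measurable_funD => //.
  exact: (measurableT_comp (history_total hmodel (leqnn n))).
transitivity (\int[P]_w f (I n.+1 w) (w, A n.+1 w))%E.
  by apply: eq_integral => w _; rewrite /f/= -CE.
rewrite (step_integral_sum mf (fun j z => h0 _)).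
have mH := measurable_weight_shift mh h0.
transitivity (\int[P]_w (\int[leb]_a ((guarded_weight (C n w) a)%:E * h (C n w + a)%R)))%E.
  apply: ae_eq_integral => //.
  - apply: emeasurable_sum => j; apply: emeasurable_funM.
      by apply/measurable_EFinP; apply: (history_fun hmodel); exact: (history_selection_weight hmodel _ (leqnn n)).
    apply: (history_fun hmodel).
    exact: (@measurable_weight_average _ _ _ _ _ _ _ _ hmodel n (f j) (mf j) (fun z => h0 _)).
  - exact: (measurableT_comp mH (@measurable_total _ _ _ _ _ _ _ _ hmodel n)).
  apply: filterS (ae_positive_at hmodel n) => w pw _.
  rewrite /f/= -ge0_sume_distrl; last by move=> j _; rewrite lee_fin selection_weight_ge0.
  by rewrite sumEFin sum_selection_weight// mul1e.
rewrite (IH (fun c => \int[leb]_a ((guarded_weight c a)%:E * h (c + a)%R))%E)//; last first.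
  by move=> c; apply: integral_ge0 => a _; rewrite mule_ge0// lee_fin guarded_weight_ge0.
by rewrite (radial_step _ mh h0) doubleS !addnS.
Qed.

(** With j + 4 the index of the chi density, the moment is the ratio M_j / M_(j + 4) = 1 / ((j + 1)
    (j + 3)). At n = 0 with two colors it would be infinite. *)
Lemma integral_total_inv4 n : (0 < n)%N ->
  (\int[P]_w ((C n w) ^- 4)%:E <= (n%:R ^- 2)%:E)%E.
Proof.
move=> n0.
pose h (c : R) : \bar R := (if 0 < c then c ^- 4 else 0)%:E.
have mh : measurable_fun setT h.
  apply/measurable_EFinP; apply: measurable_fun_ifT => //; first exact: measurable_fun_ltr.
  by apply: (measurableT_comp measurable_inv); exact: measurable_funX.
have h0 c : (0 <= h c)%E.
  by rewrite lee_fin; case: ifPn => // c0; rewrite invr_ge0 exprn_ge0// ltW.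
have -> : (\int[P]_w ((C n w) ^- 4)%:E = \int[P]_w h (C n w))%E.
  apply: ae_eq_integral => //.
  - apply/measurable_EFinP; apply: (measurableT_comp measurable_inv); apply: measurable_funX.
    exact: (@measurable_total _ _ _ _ _ _ _ _ hmodel n).
  - exact: (measurableT_comp mh (@measurable_total _ _ _ _ _ _ _ _ hmodel n)).
  by apply: filterS (ae_positive_at hmodel n) => w pw _; rewrite /h (positive_total I pw).
rewrite (total_law n mh h0).
have [j jE] : exists j, (k.+2 + n.*2 = j.+4)%N by exists (k.+2 + n.*2 - 4)%N; lia.
have jn : (n.*2 <= j.+2)%N by lia.
rewrite jE.
have M0 := @Mgauss_gt0 R j.
have -> : (\int[leb]_c ((radial j.+4 c)%:E * h c) = ((Mgauss j.+4)^-1)%:E * gauss_moment j)%E.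
  rewrite /gauss_moment -ge0_integralZl//; first last.
  - by rewrite lee_fin invr_ge0 ltW// Mgauss_gt0.
  - move=> c /=; rewrite in_itv/= andbT => c0; rewrite lee_fin mulr_ge0 ?expR_ge0//.
    by rewrite exprn_ge0// ltW.
  - by apply: measurable_funTS; exact: measurable_gauss_moment.
  rewrite [RHS]integral_mkcond; apply: eq_integral => c _; rewrite patchE mem_pos /h /radial.
  case: ifPn => c0; last by rewrite mul0e.
  rewrite -!EFinM; congr EFin; rewrite (exprD c 4 j).
  have M4 := @Mgauss_gt0 R j.+4; move: (Mgauss j.+4) M4 => M M4.
  by field; rewrite !gt_eqF ?exprn_gt0.
rewrite MgaussE -EFinM lee_fin 2!MgaussSS.
have -> : (j.+3%:R * (j.+1%:R * Mgauss j))^-1 * Mgauss j = (j.+3 * j.+1)%:R^-1 :> R.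
  by rewrite natrM; field; rewrite ?gt_eqF// ?pnatr_eq0.
rewrite -natrX lef_pV2 ?posrE ?ltr0n ?muln_gt0 ?expn_gt0 ?n0//.
by rewrite ler_nat; nia.
Qed.

Lemma proportion_step i n w : positive_at L n w -> positive_at L n.+1 w ->
  proportion L i n.+1 w = proportion L i n w +
    A n.+1 w / (C n w + A n.+1 w) * ((i == I n.+1 w)%:R - proportion L i n w).
Proof.
move=> p0 p1.
have CE : C n.+1 w = C n w + A n.+1 w.
  rewrite /total (bigD1 (I n.+1 w))//= (urn_step hmodel) eqxx [in RHS](bigD1 (I n.+1 w))//=.
  rewrite [RHS]addrAC; congr (_ + _); apply: eq_bigr => l lI.
  by rewrite (urn_step hmodel) (negbTE lI).
have C0 := positive_total I p0; have := positive_total I p1; rewrite CE => C1.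
rewrite /proportion CE (urn_step hmodel).
by case: (i == I n.+1 w); rewrite ?mulr1n ?mulr0n; field; rewrite !gt_eqF.
Qed.

(** The martingale property of the proportions: the cross term has mean 0, and the remaining
    variance r^2 p_i (1 - p_i) is at most r^2. *)
Lemma sum_square_mean (p : 'I_m -> R) i (x r : R) : (forall j, 0 <= p j) -> \sum_j p j = 1 ->
  \sum_j (p j * (x + r * ((i == j)%:R - p i)) ^+ 2) <= x ^+ 2 + r ^+ 2.
Proof.
move=> p0 p1; rewrite (bigD1 i)//= eqxx.
have -> : \sum_(j < m | j != i) (p j * (x + r * ((i == j)%:R - p i)) ^+ 2) =
    (1 - p i) * (x - r * p i) ^+ 2.
  have -> : 1 - p i = \sum_(j < m | j != i) p j by rewrite -[X in X - _]p1 (bigD1 i)//= addrAC subrr add0r.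
  rewrite mulr_suml; apply: eq_bigr => j ji.
  by rewrite [i == j]eq_sym (negbTE ji) sub0r mulrN.
have pi1 : p i <= 1 by rewrite -p1 (bigD1 i)//= lerDl sumr_ge0.
have -> : p i * (x + r * (1%:R - p i)) ^+ 2 + (1 - p i) * (x - r * p i) ^+ 2 =
  x ^+ 2 + r ^+ 2 * (p i * (1 - p i)) by ring.
rewrite lerD2l ler_piMr ?sqr_ge0//.
by have := p0 i; nra.
Qed.

(** With y the exponential variable of the step, b / (c + b) <= y / c^2 and y^2 <= 16 exp (y / 2),
    the latter from y / 4 <= exp (y / 4). An exponential bound is chosen because its mean is known
    from [integral_guarded_weight_exp] with k = 1 / 2. *)
Lemma square_ratio_le (b c : R) : 0 < b -> 0 < c ->
  (b / (c + b)) ^+ 2 <= 16 * c ^- 4 * expR (2^-1 * (((b + c) ^+ 2 - c ^+ 2) / 2)).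
Proof.
move=> b0 c0; set y := ((b + c) ^+ 2 - c ^+ 2) / 2.
have y0 : 0 <= y by rewrite /y; nra.
have h1 : b / (c + b) <= y / c ^+ 2.
  rewrite ler_pdivrMr ?addr_gt0// mulrAC ler_pdivlMr ?exprn_gt0// /y; nra.
have h2 : y ^+ 2 <= 16 * expR (2^-1 * y).
  have -> : 2^-1 * y = y / 4 + y / 4 by field.
  rewrite expRD; have : y / 4 <= expR (y / 4).
    by rewrite (le_trans _ (expR_ge1Dx _))// lerDr.
  move=> h; have := ler_pM (divr_ge0 y0 (ler0n _ 4)) (divr_ge0 y0 (ler0n _ 4)) h h; nra.
apply: (@le_trans _ _ ((y / c ^+ 2) ^+ 2)).
  by rewrite lerXn2r ?nnegrE// divr_ge0 ?addr_ge0 ?exprn_ge0// ltW.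
by rewrite expr_div_n -exprM ler_pdivrMr ?exprn_gt0// mulrAC divfK ?gt_eqF ?exprn_gt0.
Qed.

(** The new increment is orthogonal to the deviation accumulated since step a, so second moments add
    up. The constant 32 is the 16 of [square_ratio_le] times the mean 2 of exp (y / 2), and the mean
    of C_n^(-4) is at most n^(-2). *)
Lemma variance_step a n i : (0 < n)%N -> (a <= n)%N ->
  (\int[P]_w ((proportion L i n.+1 w - proportion L i a w) ^+ 2)%:E <=
   \int[P]_w ((proportion L i n w - proportion L i a w) ^+ 2)%:E + (32 / n%:R ^+ 2)%:E)%E.
Proof.
move=> n0 an.
pose p := proportion L i n; pose q w := p w - proportion L i a w.
pose del (j : 'I_m) (z : history_type n * R) : R := z.2 / (C n z.1 + z.2) * ((i == j)%:R - p z.1).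
pose f (j : 'I_m) (z : history_type n * R) : \bar R := ((q z.1 + del j z) ^+ 2)%:E.
have mC : measurable_fun setT (fun z : history_type n * R => C n z.1).
  exact: (measurableT_comp (history_total hmodel (leqnn n))).
have mp : measurable_fun setT (fun z : history_type n * R => p z.1).
  exact: (measurableT_comp (history_proportion hmodel i (leqnn n))).
have mq : measurable_fun setT (fun z : history_type n * R => q z.1).
  apply: measurable_funB => //.
  exact: (measurableT_comp (history_proportion hmodel i an)).
have mf j : measurable_fun setT (f j).
  apply/measurable_EFinP; apply: measurable_funX; apply: measurable_funD => //.
  apply: measurable_funM; last exact: measurable_funB.
  apply: measurable_funM => //; apply: (measurableT_comp measurable_inv).
  exact: measurable_funD.
have f0 j z : (0 <= f j z)%E by rewrite lee_fin sqr_ge0.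
have mpair : measurable_fun setT (fun w : T => (w : history_type n, A n.+1 w)).
  by apply: measurable_fun_pair => //; exact: (measurable_to_history hmodel (n := n)).
have mpr l b := @measurable_proportion _ _ _ _ _ _ _ _ hmodel l b.
have -> : (\int[P]_w ((proportion L i n.+1 w - proportion L i a w) ^+ 2)%:E =
    \int[P]_w f (I n.+1 w) (w, A n.+1 w))%E.
  have fE w : f (I n.+1 w) (w, A n.+1 w) =
      (\sum_j ((\1_(I n.+1 @^-1` [set j]) w)%:E * f j (w, A n.+1 w)))%E.
    rewrite (bigD1 (I n.+1 w))//= indicE mem_set// mul1e.
    rewrite big1 ?adde0// => j jI; rewrite indicE memNset ?mul0e// => /= E.
    by rewrite E eqxx in jI.
  apply: ae_eq_integral => //.
  - apply/measurable_EFinP; apply: measurable_funX; exact: measurable_funB.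
  - rewrite (funext fE); apply: emeasurable_sum => j; apply: emeasurable_funM.
      exact/measurable_EFinP/measurable_indic/(measurable_index hmodel).
    exact: (measurableT_comp (mf j) mpair).
  have := ae_positive_at hmodel n.+1; apply: filterS2 (ae_positive_at hmodel n) => w p0 p1 _.
  by rewrite (proportion_step i p0 p1) /f /del /q /= addrAC.
rewrite step_integral_sum//.
pose g w : \bar R := (((q w) ^+ 2)%:E + (32%:R * (C n w) ^- 4)%:E)%E.
have mq' : measurable_fun setT (fun w => ((q w) ^+ 2)%:E).
  by apply/measurable_EFinP; apply: measurable_funX; apply: measurable_funB; exact: mpr.
have mC' : measurable_fun setT (fun w => (32%:R * (C n w) ^- 4)%:E).
  apply/measurable_EFinP; apply: measurable_funM => //; apply: (measurableT_comp measurable_inv).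
  by apply: measurable_funX; exact: (@measurable_total _ _ _ _ _ _ _ _ hmodel n).
have c40 w : 0 <= 32%:R * (C n w) ^- 4 by rewrite mulr_ge0// invr_ge0 (exprM _ 2 2) sqr_ge0.
apply: (@le_trans _ _ (\int[P]_w g w)%E); last first.
  rewrite ge0_integralD//; first last.
  - by move=> w _; rewrite lee_fin ?c40 ?sqr_ge0.
  - by move=> w _; rewrite lee_fin ?c40 ?sqr_ge0.
  apply: leeD => //.
  under eq_integral do rewrite EFinM.
  rewrite ge0_integralZl//; first last.
  - by move=> w _; rewrite lee_fin invr_ge0 (exprM _ 2 2) sqr_ge0.
  - apply/measurable_EFinP; apply: (measurableT_comp measurable_inv).
    by apply: measurable_funX; exact: (@measurable_total _ _ _ _ _ _ _ _ hmodel n).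
  by rewrite EFinM lee_pmul2l// integral_total_inv4.
apply: ae_ge0_le_integral => //.
- move=> w _; apply: sume_ge0 => j _; rewrite mule_ge0 ?lee_fin ?selection_weight_ge0//.
  by apply: integral_ge0 => b _; rewrite mule_ge0// lee_fin guarded_weight_ge0.
- apply: emeasurable_sum => j; apply: emeasurable_funM.
    by apply/measurable_EFinP; apply: (history_fun hmodel); exact: (history_selection_weight hmodel _ (leqnn n)).
  apply: (history_fun hmodel).
  exact: (@measurable_weight_average _ _ _ _ _ _ _ _ hmodel n (f j) (mf j) (f0 j)).
- by move=> w _; rewrite adde_ge0// lee_fin ?sqr_ge0 ?c40.
- exact: emeasurable_funD.
apply: filterS (ae_positive_at hmodel n) => w pw _.
have C0 := positive_total I pw.
have swE j : selection_weight L j n w = proportion L j n w.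
  by rewrite /selection_weight indicE mem_set// mul1r.
have sw1 := sum_selection_weight pw.
have mfw j : measurable_fun setT (fun b : R => f j (w, b)).
  exact: (measurableT_comp (mf j) (pair1_measurable (w : history_type n))).
have mgw : measurable_fun setT (fun b => (guarded_weight (C n w) b)%:E).
  by apply/measurable_EFinP; exact: measurable_guarded_weight1.
have gw0 b : (0 <= (guarded_weight (C n w) b)%:E)%E by rewrite lee_fin guarded_weight_ge0.
have -> : (\sum_j ((selection_weight L j n w)%:E *
     \int[leb]_b ((guarded_weight (C n w) b)%:E * f j (w, b))) =
    \int[leb]_b ((guarded_weight (C n w) b)%:E * \sum_j ((selection_weight L j n w)%:E * f j (w, b))))%E.
  transitivity (\sum_j \int[leb]_b ((selection_weight L j n w)%:E *
      ((guarded_weight (C n w) b)%:E * f j (w, b))))%E.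
    apply: eq_bigr => j _; rewrite -ge0_integralZl//.
    - exact: (emeasurable_funM mgw (mfw j)).
    - by move=> b _; rewrite mule_ge0.
    - by rewrite lee_fin selection_weight_ge0.
  rewrite -ge0_integral_sum//; first last.
  - by move=> j b _; rewrite !mule_ge0// lee_fin selection_weight_ge0.
  - by move=> j; apply: emeasurable_funM => //; exact: (emeasurable_funM mgw (mfw j)).
  apply: eq_integral => b _; rewrite ge0_sume_distrr; last first.
    by move=> j _; rewrite mule_ge0// lee_fin selection_weight_ge0.
  by apply: eq_bigr => j _; rewrite muleCA.
have m3 : measurable_fun setT (fun b : R => ((b + C n w) * expR (- (2^-1 * ((b + C n w) ^+ 2 - (C n w) ^+ 2) / 2)))%:E).
  apply/measurable_EFinP; apply: measurable_funM; first exact: measurable_funD.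
  apply: measurableT_comp => //; apply: measurableT_comp => //; apply: measurable_funM => //.
  apply: measurable_funM => //; apply: measurable_funB => //.
  by apply: measurable_funX; exact: measurable_funD.
have m1 : measurable_fun setT (fun b : R => ((q w) ^+ 2)%:E * (guarded_weight (C n w) b)%:E)%E.
  exact: emeasurable_funM.
have m2 : measurable_fun setT (fun b : R => (16 * (C n w) ^- 4)%:E *
    ((b + C n w) * expR (- (2^-1 * ((b + C n w) ^+ 2 - (C n w) ^+ 2) / 2)))%:E)%E.
  exact: emeasurable_funM.
have mrhs := emeasurable_funD m1 m2.
(* The weight vanishes off ]0, +oo[, and [square_ratio_le] is available for b > 0 only. *)
apply: (@le_trans _ _ (\int[leb]_(b in `]0%R, +oo[) (((q w) ^+ 2)%:E * (guarded_weight (C n w) b)%:E +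
   (16 * (C n w) ^- 4)%:E * ((b + C n w) * expR (- (2^-1 * ((b + C n w) ^+ 2 - (C n w) ^+ 2) / 2)))%:E))%E).
  rewrite [leRHS]integral_mkcond; apply: ge0_le_integral => //.
  - move=> b _; rewrite mule_ge0//; apply: sume_ge0 => j _.
    by rewrite mule_ge0// lee_fin selection_weight_ge0.
  - apply: emeasurable_funM => //; apply: emeasurable_sum => j.
    exact: (emeasurable_funM (measurable_cst _) (mfw j)).
  - apply/(measurable_restrictT _ _).1 => //; apply: measurable_funTS; exact: mrhs.
  move=> b _; rewrite patchE mem_pos; case: ifPn => b0; last first.
    by rewrite /guarded_weight (negbTE b0) andbF mul0e.
  have -> : (\sum_j ((selection_weight L j n w)%:E * f j (w, b)) =
      (\sum_j (proportion L j n w * (q w + b / (C n w + b) * ((i == j)%:R - proportion L i n w)) ^+ 2))%:E)%E.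
    by rewrite -sumEFin; apply: eq_bigr => j _; rewrite swE -EFinM.
  rewrite -!EFinM -EFinD lee_fin /guarded_weight C0 b0/=.
  have W0 : 0 <= addition_weight (C n w) b by rewrite mulr_ge0 ?expR_ge0// addr_ge0// ltW.
  have P0 j : 0 <= proportion L j n w by rewrite -swE selection_weight_ge0.
  have P1 : \sum_j proportion L j n w = 1 by rewrite -sw1; apply: eq_bigr => j _; rewrite swE.
  apply: (le_trans (ler_wpM2l W0 (sum_square_mean i (q w) (b / (C n w + b)) P0 P1))).
  rewrite mulrDr (mulrC _ (q w ^+ 2)) lerD2l.
  have -> : (b + C n w) * expR (- (2^-1 * ((b + C n w) ^+ 2 - (C n w) ^+ 2) / 2)) =
      addition_weight (C n w) b * expR (2^-1 * (((b + C n w) ^+ 2 - (C n w) ^+ 2) / 2)).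
    rewrite /addition_weight -[RHS]mulrA -expRD; congr (_ * expR _).
    by move: (b + C n w) (C n w) => y c; field.
  rewrite [leRHS]mulrCA; apply: ler_wpM2l => //.
  exact: square_ratio_le.
rewrite ge0_integralD//; first last.
- by apply: measurable_funTS; exact: m2.
- by move=> b /=; rewrite in_itv/= andbT => b0; rewrite -EFinM lee_fin !mulr_ge0 ?expR_ge0 ?invr_ge0 ?exprn_ge0 ?addr_ge0 ?ltW.
- by apply: measurable_funTS; exact: m1.
- by move=> b _; rewrite mule_ge0// lee_fin sqr_ge0.
rewrite /g; apply: leeD.
  rewrite ge0_integralZl ?lee_fin ?sqr_ge0//; last exact: measurable_funTS.
  rewrite -[leRHS]mule1 lee_wpmul2l ?lee_fin ?sqr_ge0//.
  by rewrite -(integral_guarded_weight C0); exact: ge0_subset_integral.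
rewrite ge0_integralZl//; first last.
- by rewrite lee_fin mulr_ge0// invr_ge0 exprn_ge0// ltW.
- by move=> b /=; rewrite in_itv/= andbT => b0; rewrite lee_fin mulr_ge0 ?expR_ge0// addr_ge0// ltW.
- exact: measurable_funTS.
rewrite integral_guarded_weight_exp// invrK -EFinM lee_fin le_eqVlt; apply/orP; left; apply/eqP; ring.
Qed.

End variance.

Lemma cvg_series_bounded (R : realType) (v : R^nat) (M : R) :
  (forall k, 0 <= v k) -> (forall n, series v n <= M) -> cvgn (series v).
Proof.
move=> v0 vM; apply: nondecreasing_is_cvgn.
  by apply/nondecreasing_seqP => n; rewrite seriesSr lerDl.
by exists M => _ [n _ <-].
Qed.

Lemma cvg_telescope_dominated (R : realType) (y v : R^nat) (M : R) :
  (forall k, `|y k.+1 - y k| <= v k) -> (forall n, series v n <= M) -> cvgn y.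
Proof.
move=> yv vM.
have v0 k : 0 <= v k := le_trans (normr_ge0 _) (yv k).
have cv := cvg_series_bounded v0 vM.
have cw : cvgn (series (fun k => telescope y k + v k)).
  apply: (@cvg_series_bounded _ _ (M + M)).
    by move=> k; have := yv k; rewrite ler_norml => /andP[H _]; rewrite /telescope/= -lerBlDr sub0r.
  move=> n; rewrite /series/= big_split/=; apply: lerD; last exact: vM.
  apply: le_trans (vM n); apply: ler_sum => k _; exact: le_trans (ler_norm _) (yv k).
have ct : cvgn (series (telescope y)).
  rewrite (_ : series _ = (fun n => series (fun k => telescope y k + v k) n - series v n)).
    exact: is_cvgB.
  by apply/funext => n; rewrite {2}/series/= big_split/= addrK.
rewrite (_ : y = (fun n => y 0%N + series (telescope y) n)); last first.
  by apply/funext => n; exact: eq_sum_telescope.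
by apply: is_cvgD => //; exact: is_cvg_cst.
Qed.

Lemma between_cubes (n : nat) : (0 < n)%N -> exists k, (k.+1 ^ 3 <= n < k.+2 ^ 3)%N.
Proof.
case: n => // n _; elim: n => [|n [k /andP[kn nk]]]; first by exists 0%N.
have [H|H] := ltnP n.+2 (k.+2 ^ 3); first by exists k; rewrite (leq_trans kn).
exists k.+1; rewrite H/=; apply: (leq_ltn_trans nk).
by rewrite ltn_exp2r.
Qed.

(** One summable sequence controls both the steps from a cube to the next and the oscillation within
    a block. The constant 7 comes from (k + 2)^3 - (k + 1)^3 = 3 (k + 1)^2 + 3 (k + 1) + 1. *)
Lemma block_cvg (R : realType) (p v : R^nat) (M : R) :
  (forall k l, (l <= 7 * k.+1 ^ 2)%N -> (p (k.+1 ^ 3 + l)%N - p (k.+1 ^ 3)%N) ^+ 2 <= v k) ->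
  (forall k, `|p (k.+2 ^ 3)%N - p (k.+1 ^ 3)%N| <= v k) ->
  (forall n, series v n <= M) -> cvgn p.
Proof.
move=> pv yv vM; pose y k := p (k.+1 ^ 3)%N.
have v0 k : 0 <= v k := le_trans (normr_ge0 _) (yv k).
have cy : cvgn y by exact: (@cvg_telescope_dominated _ y v M).
have cv : v @ \oo --> 0 := cvg_series_cvg_0 (cvg_series_bounded v0 vM).
apply/cvg_ex; exists (limn y); apply/cvgrPdist_lt => e e0.
have e2 : 0 < e / 2 by rewrite divr_gt0.
move/cvgrPdist_lt : cy => /(_ _ e2)[N1 _ H1].
have e22 : 0 < (e / 2) ^+ 2 by rewrite exprn_gt0.
move/cvgrPdist_lt : cv => /(_ _ e22)[N2 _ H2].
(* Past this cube, the block that contains n has an index at least N1 and N2. *)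
exists ((maxn N1 N2).+2 ^ 3)%N => // n /= Hn.
have n0 : (0 < n)%N by apply: leq_trans Hn; rewrite expn_gt0.
have [k /andP[kn nk]] := between_cubes n0.
have Nk : (maxn N1 N2 <= k)%N.
  by apply: ltnW; rewrite -ltnS -ltnS -(@ltn_exp2r _ _ 3)//; exact: leq_ltn_trans Hn nk.
have h1 := H1 k (leq_trans (leq_maxl _ _) Nk).
have h2 := H2 k (leq_trans (leq_maxr _ _) Nk).
rewrite /= sub0r normrN ger0_norm// in h2.
have kl : (n - k.+1 ^ 3 <= 7 * k.+1 ^ 2)%N.
  rewrite leq_subLR; apply: ltnW; apply: (leq_trans nk); rewrite !expnS expn0 !muln1; nia.
have := le_lt_trans (pv _ _ kl) h2; rewrite subnKC// => h3.
have h4 : `|p n - y k| < e / 2.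
  by rewrite -(@ltr_pXn2r _ 2)// ?nnegrE ?(ltW e2)// real_normK// num_real.
have -> : limn y - p n = (limn y - y k) - (p n - y k) by ring.
by apply: (le_lt_trans (ler_normB _ _)); rewrite [ltRHS]splitr ltrD.
Qed.

Lemma sum_inv_sqr_le (R : realType) n : \sum_(0 <= k < n) (k.+1%:R ^- 2 : R) <= 2.
Proof.
suff H l : \sum_(0 <= k < l.+1) (k.+1%:R ^- 2 : R) <= 2 - l.+1%:R^-1.
  by case: n => [|n]; [rewrite big_geq|apply: le_trans (H n) _; rewrite gerBl].
elim: l => [|l IH]; first by rewrite big_nat1 expr1n invr1; lra.
rewrite big_nat_recr//=; apply: (le_trans (lerD IH (lexx _))).
set a : R := l.+1%:R; have a0 : 0 < a by rewrite ltr0n.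
have -> : l.+2%:R = a + 1 :> R by rewrite /a -natr1.
rewrite -addrA lerD2l -subr_ge0.
have -> : - (a + 1)^-1 - (- a^-1 + (a + 1) ^- 2) = (a * (a + 1) ^+ 2)^-1.
  by field; rewrite !gt_eqF// addr_gt0.
by rewrite invr_ge0 mulr_ge0 ?(ltW a0)// sqr_ge0.
Qed.

Lemma ae_bounded_series d (T : measurableType d) (R : realType) (mu : measure T R)
    (f : nat -> T -> R) (c : R) :
  (forall k, measurable_fun setT (f k)) -> (forall k w, 0 <= f k w) ->
  (forall k, \int[mu]_w (f k w)%:E <= (c * k.+1%:R ^- 2)%:E)%E ->
  {ae mu, forall w, exists M, forall n, series (fun k => f k w) n <= M}.
Proof.
move=> mf f0 fc.
have c0 : 0 <= c.
  have : (0 <= \int[mu]_w (f 0%N w)%:E)%E by apply: integral_ge0 => w _; rewrite lee_fin.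
  by move=> /le_trans/(_ (fc 0%N)); rewrite lee_fin expr1n invr1 mulr1.
have mF k : measurable_fun setT (fun w => (f k w)%:E) by exact/measurable_EFinP.
have F0 k w : (0 <= (f k w)%:E)%E by rewrite lee_fin.
pose g w := (\sum_(0 <= k <oo) (f k w)%:E)%E.
have g0 w : (0 <= g w)%E by apply: nneseries_ge0.
have mg : measurable_fun setT g.
  by apply: ge0_emeasurable_sum => k *; [exact: F0|exact: mF].
have Ig : mu.-integrable setT g.
  apply/integrableP; split => //.
  rewrite (_ : (\int[mu]_x `|g x|)%E = (\int[mu]_x g x)%E); last first.
    by apply: eq_integral => w _; rewrite gee0_abs.
  rewrite integral_nneseries//.
  apply: (@le_lt_trans _ _ (c * 2)%:E); last exact: ltry.
  apply: lime_le; first by apply: is_cvg_nneseries => k _ _; exact: integral_ge0.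
  apply: nearW => n; apply: (@le_trans _ _ (\sum_(0 <= k < n) (c * k.+1%:R ^- 2)%:E)%E).
    by apply: lee_sum => k _; exact: fc.
  rewrite sumEFin lee_fin -mulr_sumr; apply: ler_wpM2l => //; exact: sum_inv_sqr_le.
have := integrable_ae measurableT Ig; apply: filterS => w /(_ Logic.I) gw.
exists (fine (g w)) => n; rewrite -lee_fin fineK// /series/= -sumEFin.
by apply: nneseries_lim_ge.
Qed.

Section proportions_cvg.
Context {d : measure_display} {T : measurableType d} {R : realType}.
Variable P : probability T R.
Variable k : nat.
Local Notation m := k.+2.
Variables (L : 'I_m -> nat -> {RV P >-> R}) (I : nat -> T -> 'I_m)
  (A : nat -> {RV P >-> R}).
Hypothesis hmodel : urn_model L I A.

Lemma variance_bound a l i : (0 < a)%N ->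
  (\int[P]_w ((proportion L i (a + l)%N w - proportion L i a w) ^+ 2)%:E <=
   (32 * l%:R * a%:R ^- 2)%:E)%E.
Proof.
move=> a0; elim: l => [|l IH].
  rewrite integral0_eq ?mulr0 ?mul0r// => w _.
  by rewrite addn0 subrr expr0n.
rewrite addnS; have al0 : (0 < a + l)%N by rewrite addn_gt0 a0.
apply: (le_trans (variance_step hmodel i al0 (leq_addr _ _))).
apply: (le_trans (leeD IH (lexx _))).
rewrite -EFinD lee_fin -(@natr1 _ l) [in leRHS]mulrDr mulr1 [in leRHS]mulrDl lerD2l.
rewrite ler_pM2l// lef_pV2 ?posrE ?exprn_gt0 ?ltr0n//.
by rewrite lerXn2r ?nnegrE// ler_nat leq_addr.
Qed.

(** A union bound replaces a maximal inequality: the squared deviations from the left end of a block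
    are bounded by their sum. With a variance of at most 32 l a^(-2), a = (j + 1)^3 and l <= 7 (j +
    1)^2, each has mean at most 224 (j + 1)^(-4), and a block has order (j + 1)^2 terms: the block
    sums are summable. *)
Lemma proportion_cvg i : {ae P, forall w, cvgn (fun n => proportion L i n w)}.
Proof.
pose sq (a l : nat) w := (proportion L i (a + l)%N w - proportion L i a w) ^+ 2.
pose b (j : nat) := (j.+2 ^ 3 - j.+1 ^ 3)%N.
(* The last two terms dominate the absolute value y of the step between two cubes, as y <= c y^2 + 1
   / c with c = (j + 1)^2; telescoping needs this first power. *)
pose f (j : nat) w := \sum_(l < (7 * j.+1 ^ 2).+1) sq (j.+1 ^ 3)%N l w +
  (j.+1%:R ^+ 2 * sq (j.+1 ^ 3)%N (b j) w + j.+1%:R ^- 2).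
have sq0 a l w : 0 <= sq a l w by exact: sqr_ge0.
have s0 j w : 0 <= \sum_(l < (7 * j.+1 ^ 2).+1) sq (j.+1 ^ 3)%N l w by exact: sumr_ge0.
have t0 j w : 0 <= j.+1%:R ^+ 2 * sq (j.+1 ^ 3)%N (b j) w by rewrite mulr_ge0// exprn_ge0.
have i0 j : 0 <= j.+1%:R ^- 2 :> R by rewrite invr_ge0 exprn_ge0.
have mpr := @measurable_proportion _ _ _ _ _ _ _ _ hmodel i.
have msq a l : measurable_fun setT (sq a l).
  by apply: measurable_funX; exact: measurable_funB.
have ms j : measurable_fun setT (fun w => \sum_(l < (7 * j.+1 ^ 2).+1) sq (j.+1 ^ 3)%N l w).
  by apply: measurable_sum => l.
have mt j : measurable_fun setT (fun w => j.+1%:R ^+ 2 * sq (j.+1 ^ 3)%N (b j) w).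
  exact: measurable_funM.
have mti j : measurable_fun setT (fun w => j.+1%:R ^+ 2 * sq (j.+1 ^ 3)%N (b j) w + j.+1%:R ^- 2).
  exact: measurable_funD.
have b7 j : (b j <= 7 * j.+1 ^ 2)%N.
  by rewrite /b leq_subLR !expnS expn0 !muln1; nia.
have sqb j l : (l <= 7 * j.+1 ^ 2)%N ->
    (\int[P]_w (sq (j.+1 ^ 3)%N l w)%:E <= (224 * j.+1%:R ^- 4)%:E)%E.
  have j0 : (0 < j.+1 ^ 3)%N by rewrite expn_gt0.
  move=> l7; apply: (le_trans (variance_bound l i j0)); rewrite lee_fin.
  have l7' : l%:R <= 7 * j.+1%:R ^+ 2 :> R by rewrite -natrX -natrM ler_nat.
  apply: (@le_trans _ _ (32 * (7 * j.+1%:R ^+ 2) * (j.+1 ^ 3)%:R ^- 2)).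
    by rewrite ler_wpM2r ?invr_ge0 ?exprn_ge0// ler_wpM2l.
  rewrite natrX le_eqVlt; apply/orP; left; apply/eqP.
  have : j.+1%:R != 0 :> R by [].
  by move: (j.+1%:R : R) => c c0; rewrite !exprS !expr0; field.
(* The sum over the block has 7 (j + 1)^2 + 1 terms and contributes at most 1568 + 224, the weighted
   step 224 and the last term 1. *)
have fc j : (\int[P]_w (f j w)%:E <= (2017 * j.+1%:R ^- 2)%:E)%E.
  rewrite /f; under eq_integral do rewrite EFinD.
  rewrite ge0_integralD//; first last.
  - exact/measurable_EFinP.
  - by move=> w _; rewrite lee_fin addr_ge0.
  - exact/measurable_EFinP.
  - by move=> w _; rewrite lee_fin.
  under [X in (_ + X)%E]eq_integral do rewrite EFinD.
  rewrite ge0_integralD//; first last.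
  - exact/measurable_EFinP.
  - by move=> w _; rewrite lee_fin.
  have -> : (\int[P]_w (j.+1%:R ^- 2)%:E = (j.+1%:R ^- 2)%:E)%E.
    rewrite integral_cst// -[RHS]mule1; congr (_ * _)%E.
    exact: probability_setT.
  have -> : (\int[P]_w (\sum_(l < (7 * j.+1 ^ 2).+1) sq (j.+1 ^ 3)%N l w)%:E =
      \sum_(l < (7 * j.+1 ^ 2).+1) \int[P]_w (sq (j.+1 ^ 3)%N l w)%:E)%E.
    rewrite -ge0_integral_sum//; first last.
    - by move=> l w _; rewrite lee_fin.
    - by move=> l; exact/measurable_EFinP.
    by apply: eq_integral => w _; rewrite sumEFin.
  under [X in (_ + (X + _) <= _)%E]eq_integral do rewrite EFinM.
  rewrite ge0_integralZl//; first last.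
  - by move=> w _; rewrite lee_fin.
  - exact/measurable_EFinP.
  apply: (@le_trans _ _ ((\sum_(l < (7 * j.+1 ^ 2).+1) (224 * j.+1%:R ^- 4))%:E +
    ((j.+1%:R ^+ 2 * (224 * j.+1%:R ^- 4))%:E + (j.+1%:R ^- 2)%:E))%E).
    apply: leeD; last apply: leeD => //.
      by rewrite -sumEFin; apply: lee_sum => l _; apply: sqb; rewrite -ltnS.
    by rewrite [leRHS]EFinM lee_wpmul2l ?lee_fin ?exprn_ge0//; exact: sqb.
  rewrite -!EFinD lee_fin sumr_const card_ord -[X in X + _ <= _]mulr_natr.
  have -> : (7 * j.+1 ^ 2).+1%:R = 7 * j.+1%:R ^+ 2 + 1 :> R by rewrite -natrX -natrM natr1.
  have : 1 <= j.+1%:R :> R by rewrite ler1n.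
  move: (j.+1%:R : R) => c c1; have c0 : 0 < c by exact: lt_le_trans c1.
  rewrite -subr_ge0.
  have -> : 2017 * c ^- 2 - (224 * c ^- 4 * (7 * c ^+ 2 + 1) + (c ^+ 2 * (224 * c ^- 4) + c ^- 2)) =
      224 * (c ^+ 2 - 1) / c ^+ 4.
    by rewrite (exprD c 2 2); field; rewrite gt_eqF.
  by rewrite mulr_ge0 ?invr_ge0 ?exprn_ge0 ?(ltW c0)// mulr_ge0// subr_ge0 exprn_ege1.
have f0 j w : 0 <= f j w by rewrite !addr_ge0.
have mf j : measurable_fun setT (f j) by exact: measurable_funD.
apply: filterS (ae_bounded_series mf f0 fc) => w [M fM].
apply: (@block_cvg _ _ (fun j => f j w) M) => // j.
- move=> l l7; rewrite /f.
  have l7' : (l < (7 * j.+1 ^ 2).+1)%N by rewrite ltnS.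
  rewrite (bigD1 (Ordinal l7'))//= -/(sq _ _ _) -addrA lerDl.
  by rewrite !addr_ge0 ?sumr_ge0.
- rewrite /f; apply: le_trans (_ : j.+1%:R ^+ 2 * sq (j.+1 ^ 3)%N (b j) w + j.+1%:R ^- 2 <= _); last by rewrite lerDr.
  rewrite /sq /b subnKC ?leq_exp2r//; move: (_ - _) => x.
  have c0 : 0 < j.+1%:R ^+ 2 :> R by rewrite exprn_gt0.
  move: (j.+1%:R ^+ 2 : R) c0 => c c0.
  rewrite -(real_normK (num_real x)); move: (normr_ge0 x); move: `|x| => y y0.
  rewrite -subr_ge0 (_ : _ - y = c^-1 * ((c * y - 1) ^+ 2 + c * y)); last by field; rewrite gt_eqF.
  by rewrite mulr_ge0 ?invr_ge0 ?(ltW c0)// addr_ge0 ?sqr_ge0// mulr_ge0// ltW.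
Qed.

End proportions_cvg.

(** * Law of the limit and of the selections *)

Section step_polynomials.
Context {R : realType}.

(* The degree and the exponent are such that x ^ 2n times the exponent tends to 0
   for x < t and to infinity for t <= x. *)
Definition step_poly (t : R) (n : nat) (x : R) : R :=
  (1 - x ^+ (2 * n)) ^+ Num.truncn (n%:R * t ^- (2 * n)).

Lemma step_poly_itv t n x : 0 <= x <= 1 -> 0 <= step_poly t n x <= 1.
Proof.
move=> /andP[x0 x1]; have h : 0 <= 1 - x ^+ (2 * n) by rewrite subr_ge0 exprn_ile1.
by rewrite /step_poly exprn_ge0//= exprn_ile1// gerBl exprn_ge0.
Qed.

Lemma bernoulli_le (y : R) N : 0 <= y <= 1 -> 1 - N%:R * y <= (1 - y) ^+ N.
Proof.
move=> /andP[y0 y1]; elim: N => [|N IH]; first by rewrite mul0r subr0 expr0.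
have h : 0 <= 1 - y by rewrite subr_ge0.
rewrite exprS; apply: le_trans (ler_wpM2l h IH).
rewrite -natr1 -subr_ge0.
have -> : (1 - y) * (1 - N%:R * y) - (1 - (N%:R + 1) * y) = N%:R * y ^+ 2 by ring.
by rewrite mulr_ge0// sqr_ge0.
Qed.

Lemma natr_mul_exprn_le (r : R) n : 0 <= r < 1 -> n%:R * r ^+ n <= (1 - r)^-1.
Proof.
move=> /andP[r0 r1]; have h : 0 < 1 - r by rewrite subr_gt0.
rewrite -[leRHS]mul1r ler_pdivlMr//.
suff H : n%:R * r ^+ n * (1 - r) <= 1 - r ^+ n.
  by apply: le_trans H _; rewrite gerBl exprn_ge0.
elim: n => [|n IH]; first by rewrite !mul0r expr0 subrr.
have h1 : r ^+ n.+1 * (1 - r) <= 1 - r.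
  by rewrite ler_piMl ?(ltW h)// exprn_ile1// ltW.
have -> : n.+1%:R * r ^+ n.+1 * (1 - r) = r * (n%:R * r ^+ n * (1 - r)) + r ^+ n.+1 * (1 - r).
  by rewrite -natr1 exprS; ring.
apply: (le_trans (lerD (ler_wpM2l r0 IH) (lexx _))); rewrite exprS in h1 *; nra.
Qed.

Lemma step_poly_cvg t x : 0 < t -> 0 <= x <= 1 ->
  step_poly t n x @[n --> \oo] --> ((x < t)%R%:R : R).
Proof.
move=> t0 x01; have /andP[x0 x1] := x01.
have [xt|tx] := ltP x t.
  pose r := x / t.
  have r0 : 0 <= r by rewrite divr_ge0// ltW.
  have r1 : r < 1 by rewrite ltr_pdivrMr// mul1r.
  have hr : 0 < 1 - r by rewrite subr_gt0.
  (* Bernoulli's inequality bounds the defect by n (x / t)^(2 n), the product of n r^n with r^n, and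
     n r^n stays below 1 / (1 - r). *)
  apply: (@squeeze_cvgr _ _ _ _ (fun n => 1 - (1 - r)^-1 * r ^+ n) (cst (1 : R))).
  - apply: nearW => n; rewrite /cst/=; have /andP[_ ->] := step_poly_itv t n x01.
    rewrite andbT; have y01 : 0 <= x ^+ (2 * n) <= 1 by rewrite exprn_ge0//= exprn_ile1.
    apply: le_trans (bernoulli_le _ y01); rewrite lerD2l lerN2.
    have tn0 : 0 <= t ^- (2 * n) by rewrite invr_ge0 exprn_ge0// ltW.
    apply: (@le_trans _ _ (n%:R * t ^- (2 * n) * x ^+ (2 * n))).
      by apply: ler_wpM2r; [case/andP: y01|rewrite Num.Theory.truncn_le mulr_ge0].
    have -> : n%:R * t ^- (2 * n) * x ^+ (2 * n) = n%:R * r ^+ n * r ^+ n.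
      by rewrite /r -mulrA -mulrA -exprD addnn -mul2n exprMn exprVn [in RHS]mulrC; ring.
    apply: ler_wpM2r; first exact: exprn_ge0.
    by apply: natr_mul_exprn_le; rewrite r0.
  - rewrite -[X in _ --> X]subr0; apply: cvgB; first exact: cvg_cst.
    rewrite -[X in _ --> X](mulr0 (1 - r)^-1); apply: cvgM; first exact: cvg_cst.
    by apply: cvg_expr; rewrite ger0_norm.
  - exact: cvg_cst.
have t1 : t <= 1 by exact: le_trans x1.
(* The exponent N exceeds n t^(-2 n) - 1, so 1 - t^(2 n) <= exp (- t^(2 n)) bounds the power by exp
   (1 - n). *)
apply: (@squeeze_cvgr _ _ _ _ (cst (0 : R)) (fun n => expR 1 * expR (-1) ^+ n)).
- apply: nearW => n; rewrite /cst/=; have /andP[-> _] := step_poly_itv t n x01.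
  rewrite /step_poly/=; set N := Num.truncn _.
  have tn0 : 0 < t ^+ (2 * n) by rewrite exprn_gt0.
  apply: (@le_trans _ _ (expR (- (t ^+ (2 * n))) ^+ N)).
    apply: lerXn2r; rewrite ?nnegrE ?expR_ge0 ?subr_ge0 ?exprn_ile1//.
    apply: le_trans (expR_ge1Dx _); rewrite lerD2l lerN2.
    by apply: lerXn2r; rewrite ?nnegrE// ltW.
  rewrite -!expRM_natl -expRD ler_expR.
  have : n%:R * t ^- (2 * n) < N.+1%:R by exact: Num.Theory.truncnS_gt.
  rewrite ltr_pdivrMr// -natr1 mulrDl mul1r => H.
  have h1 : t ^+ (2 * n) <= 1 by rewrite exprn_ile1// ltW.
  lra.
- exact: cvg_cst.
- rewrite -[X in _ --> X](mulr0 (expR 1)); apply: cvgM; first exact: cvg_cst.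
  by apply: cvg_expr; rewrite ger0_norm ?expR_ge0// expR_lt1 oppr_lt0.
Qed.

End step_polynomials.

(** * Measures on the unit cube are determined by their moments *)

Section moment_determinacy.
Context {R : realType} {m : nat}.
Local Notation tup := (m.-tuple R).

Definition unit_cube : set tup := [set x | forall i, 0 <= tnth x i <= 1].

Definition monomial (u : seq 'I_m) (x : tup) : R := \prod_(j <- u) tnth x j.

(** Bounds are listed, with repetitions allowed, so that intersection is concatenation. They are
    strict because [step_poly] tends to 0 at the threshold itself. *)
Definition lower_box (s : seq ('I_m * R)) : set tup :=
  [set x | forall p, p \in s -> tnth x p.1 < p.2].

Lemma measurable_monomial u : measurable_fun setT (monomial u).
Proof. by apply: measurable_prod => j _; exact: measurable_tnth. Qed.

Lemma measurable_unit_cube : measurable unit_cube.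
Proof.
rewrite (_ : unit_cube = \bigcap_(j in [set: 'I_m]) ((@tnth m R)^~ j @^-1` `[0, 1])).
  apply: fin_bigcap_measurable => // j _.
  by have := @measurable_tnth _ R m j measurableT _ (measurable_itv `[0%R, 1%R]); rewrite setTI.
apply/seteqP; split => w /= H j; first by move=> _; rewrite /= in_itv/=; exact: H.
by have := H j Logic.I; rewrite /= in_itv.
Qed.

Lemma monomial_itv u x : unit_cube x -> 0 <= monomial u x <= 1.
Proof.
move=> xc; elim: u => [|j u IH]; rewrite /monomial ?big_nil ?ler01 ?lexx// big_cons.
have /andP[a0 a1] := xc j; have /andP[b0 b1] := IH.
by rewrite mulr_ge0//= mulr_ile1.
Qed.

Lemma lower_box_cons p s : lower_box (p :: s) = [set x | tnth x p.1 < p.2] `&` lower_box s.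
Proof.
apply/seteqP; split => [x H|x [H1 H2] q].
  by split; [apply: H; rewrite mem_head|move=> q qs; apply: H; rewrite in_cons qs orbT].
by rewrite in_cons => /predU1P[->//|]; exact: H2.
Qed.

Lemma measurable_lower_box s : measurable (lower_box s).
Proof.
elim: s => [|p s IH]; last first.
  rewrite lower_box_cons; apply: measurableI => //.
  rewrite (_ : [set x | _] = (@tnth m R)^~ p.1 @^-1` `]-oo, p.2[).
    exact: (measurable_preimage (measurable_tnth _) (measurable_itv _)).
  by apply/seteqP; split => x /=; rewrite in_itv.
by rewrite (_ : lower_box [::] = setT)//; apply/seteqP; split.
Qed.

Lemma lower_box_generates : measurable = <<s range lower_box >>.
Proof.
apply/seteqP; split; last first.
  apply: smallest_sub; first exact: sigma_algebra_measurable.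
  by move=> _ [s _ <-]; exact: measurable_lower_box.
move=> S mS; pose U := g_sigma_algebraType (range lower_box).
suff mid : measurable_fun setT (id : U -> tup).
  by have := mid measurableT S mS; rewrite setTI.
apply/measurable_fun_tnthP => i.
apply: (measurability (@RGenInftyO.G R)); first exact: RGenInftyO.measurableE.
move=> _ [_ [c ->] <-]; rewrite setTI; apply: sub_sigma_algebra.
exists [:: (i, c)] => //; apply/seteqP; split => x /=.
  by move=> H; rewrite in_itv/=; apply: (H (i, c)); rewrite mem_head.
by rewrite in_itv/= => H p; rewrite inE => /eqP ->.
Qed.

Variables mu nu : {finite_measure set tup -> \bar R}.
Hypothesis moments : forall u,
  (\int[mu]_(x in unit_cube) (monomial u x)%:E = \int[nu]_(x in unit_cube) (monomial u x)%:E)%E.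

Let unit_valued (g : tup -> R) : Prop :=
  measurable_fun setT g /\ (forall x, unit_cube x -> 0 <= g x <= 1).

(** Testing against all monomials at once makes the property stable under multiplication by a
    coordinate; with differences and bounded limits it reaches the indicators of lower boxes. *)
Let same_moments (g : tup -> R) : Prop := forall u,
  (\int[mu]_(x in unit_cube) (g x * monomial u x)%:E =
   \int[nu]_(x in unit_cube) (g x * monomial u x)%:E)%E.

Let integrable_unit (la : {finite_measure set tup -> \bar R}) g : unit_valued g ->
  la.-integrable unit_cube (EFin \o g).
Proof.
move=> [mg g01]; apply: (@le_integrable _ _ _ _ _ _ _ (EFin \o cst 1)).
- exact: measurable_unit_cube.
- by apply: measurable_funTS; exact/measurable_EFinP.
- move=> x xc; have /andP[g0 g1] := g01 x xc.
  by rewrite /= lee_fin ger0_norm// normr1.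
- by apply: finite_measure_integrable_cst; exact: measurable_unit_cube.
Qed.

Let unit_valuedM g h : unit_valued g -> unit_valued h -> unit_valued (fun x => g x * h x).
Proof.
move=> [mg g01] [mh h01]; split; first exact: measurable_funM.
move=> x xc; have /andP[g0 g1] := g01 x xc; have /andP[h0 h1] := h01 x xc.
by rewrite mulr_ge0//= mulr_ile1.
Qed.

Let unit_monomial u : unit_valued (monomial u).
Proof. by split; [exact: measurable_monomial|exact: monomial_itv]. Qed.

Let unit_pow i n : unit_valued (fun x => tnth x i ^+ n).
Proof.
split; first by apply: measurable_funX; exact: measurable_tnth.
by move=> x /(_ i)/andP[x0 x1]; rewrite exprn_ge0//= exprn_ile1.
Qed.

Let unit_subr g : unit_valued g -> unit_valued (fun x => 1 - g x).
Proof.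
move=> [mg g01]; split; first exact: measurable_funB.
by move=> x xc; have /andP[g0 g1] := g01 x xc; rewrite subr_ge0 g1 gerBl.
Qed.

Let same_moments_pow g i n : same_moments g -> same_moments (fun x => g x * tnth x i ^+ n).
Proof.
move=> sg u; have := sg (nseq n i ++ u); congr (_ = _); apply: eq_integral => x _; congr EFin;
  by rewrite /monomial big_cat/= big_nseq iter_mulr_1 mulrA.
Qed.

Let same_moments_subr g h : unit_valued g -> unit_valued h ->
  same_moments g -> same_moments (fun x => g x * h x) -> same_moments (fun x => g x * (1 - h x)).
Proof.
move=> ug uh sg sgh u.
have E (la : {finite_measure set tup -> \bar R}) :
    (\int[la]_(x in unit_cube) (g x * (1 - h x) * monomial u x)%:E =
     \int[la]_(x in unit_cube) (g x * monomial u x)%:E -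
     \int[la]_(x in unit_cube) (g x * h x * monomial u x)%:E)%E.
  have i1 := integrable_unit la (unit_valuedM ug (unit_monomial u)).
  have i2 := integrable_unit la (unit_valuedM (unit_valuedM ug uh) (unit_monomial u)).
  rewrite -integralB//; last exact: measurable_unit_cube.
  by apply: eq_integral => x _; rewrite -EFinB; congr EFin; ring.
by rewrite !E sg sgh.
Qed.

Let same_moments_step_poly g t i n : unit_valued g -> same_moments g ->
  unit_valued (fun x => g x * step_poly t n (tnth x i)) /\
  same_moments (fun x => g x * step_poly t n (tnth x i)).
Proof.
move=> ug sg; rewrite /step_poly; elim: (Num.truncn _) => [|N [uN sN]].
  by rewrite (_ : (fun x => _) = g)//; apply/funext => x; rewrite expr0 mulr1.
have up := unit_pow i (2 * n).
rewrite (_ : (fun x => _) = fun x => g x * (1 - tnth x i ^+ (2 * n)) ^+ N * (1 - tnth x i ^+ (2 * n))).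
  split; first exact: (unit_valuedM uN (unit_subr up)).
  by apply: same_moments_subr => //; exact: same_moments_pow.
by apply/funext => x; rewrite exprSr mulrA.
Qed.

Let same_moments_limit (g_ : nat -> tup -> R) (g : tup -> R) : (forall n, unit_valued (g_ n)) -> measurable_fun setT g ->
  (forall n, same_moments (g_ n)) ->
  (forall x, unit_cube x -> g_ n x @[n --> \oo] --> g x) -> same_moments g.
Proof.
move=> ug mg sg cg u.
have E (la : {finite_measure set tup -> \bar R}) :
    (\int[la]_(x in unit_cube) (g_ n x * monomial u x)%:E @[n --> \oo] -->
     \int[la]_(x in unit_cube) (g x * monomial u x)%:E)%E.
  apply: (@dominated_cvg _ _ _ _ _ _ _ _ (EFin \o cst 1)).
  - exact: measurable_unit_cube.
  - move=> n; apply: measurable_funTS; apply/measurable_EFinP.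
    by apply: measurable_funM; [case: (ug n)|exact: measurable_monomial].
  - move=> x xc; apply: cvg_EFin; first exact: nearW.
    by apply: cvgM; [exact: cg|exact: cvg_cst].
  - by [].
  - by apply: finite_measure_integrable_cst; exact: measurable_unit_cube.
  - move=> n x xc /=; rewrite lee_fin.
    have [_ /(_ x xc)/andP[h0 h1]] := unit_valuedM (ug n) (unit_monomial u).
    by rewrite ger0_norm.
have := E nu; under eq_fun do rewrite -sg.
by move=> /cvg_lim <-//; apply/esym/cvg_lim => //; exact: E.
Qed.

Let box_moments s : unit_valued (\1_(lower_box s)) /\ same_moments (\1_(lower_box s)).
Proof.
have us s' : unit_valued (\1_(lower_box s')).
  split; first by apply: measurable_indic; exact: measurable_lower_box.
  by move=> x _; rewrite indicE; case: (_ \in _); rewrite ?lexx ler01.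
split; first exact: us.
elim: s => [|[i t] s IH].
  move=> u; have := moments u; congr (_ = _); apply: eq_integral => x _;
  by rewrite indicE mem_set ?mul1r.
have ind x : \1_(lower_box ((i, t) :: s)) x = \1_(lower_box s) x * (tnth x i < t)%R%:R :> R.
  rewrite lower_box_cons !indicE in_setI/= mulrC -natrM mulnb.
  by rewrite [in LHS](_ : (x \in [set x0 | _]) = (tnth x i < t)%R)//; apply/idP/idP; rewrite inE.
have [t0|t0] := ltP 0 t; last first.
  move=> u; rewrite !integral0_eq// => x xc; rewrite ind.
    by rewrite ltNge (le_trans t0) ?mulr0 ?mul0r//; case/andP: (xc i).
  by rewrite ltNge (le_trans t0) ?mulr0 ?mul0r//; case/andP: (xc i).
apply: (@same_moments_limit (fun n x => \1_(lower_box s) x * step_poly t n (tnth x i))).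
- by move=> n; have [] := same_moments_step_poly t i n (us s) IH.
- by case: (us ((i, t) :: s)).
- by move=> n; have [] := same_moments_step_poly t i n (us s) IH.
- move=> x xc; rewrite ind; apply: cvgM; first exact: cvg_cst.
  exact: step_poly_cvg.
Qed.

(** Explicit polynomials take the place of Weierstrass approximation: multiplying by [step_poly] in
    one coordinate after another and passing to bounded limits gives the indicators of lower boxes,
    a pi-system that generates the Borel sets. *)
Lemma moment_determinacy S : measurable S ->
  mu (S `&` unit_cube) = nu (S `&` unit_cube).
Proof.
have mc := measurable_unit_cube.
have Hbox s : mu (lower_box s `&` unit_cube) = nu (lower_box s `&` unit_cube).
  have [_ /(_ [::])] := box_moments s.
  have E (la : {finite_measure set tup -> \bar R}) :
    (\int[la]_(x in unit_cube) (\1_(lower_box s) x * monomial [::] x)%:E =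
     la (lower_box s `&` unit_cube))%E.
    rewrite -integral_indic//; last exact: measurable_lower_box.
    by apply: eq_integral => x _; rewrite /monomial big_nil mulr1.
  by rewrite !E.
apply: (@eq_measure_on_generator _ _ _ (range lower_box) (mrestr mu mc) (mrestr nu mc)).
- exact: lower_box_generates.
- move=> _ _ [s _ <-] [s' _ <-]; exists (s ++ s') => //.
  apply/seteqP; split => [x H|x [H1 H2] p].
    by split => p ps; apply: H; rewrite mem_cat ps ?orbT.
  by rewrite mem_cat => /orP[]; [exact: H1|exact: H2].
- by rewrite /mrestr -ge0_fin_numE// fin_num_measure//; exact: measurableI.
- rewrite /mrestr; have := Hbox [::]; rewrite (_ : lower_box [::] = setT)//.
  by apply/seteqP; split.
- by move=> _ [s _ <-]; exact: Hbox.
Qed.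

End moment_determinacy.

Lemma finite_measure_of d (X : measurableType d) (R : realType) (mu : {measure set X -> \bar R}) :
  (mu setT < +oo)%E -> exists nu : {finite_measure set X -> \bar R}, forall S, nu S = mu S.
Proof.
move=> h; exists (mfrestr measurableT h) => S.
by rewrite -[in RHS](setIT S).
Qed.

Section half_dirichlet.
Context {R : realType} {k : nat}.
Local Notation m := k.+2.
Local Notation lebn := (@lebesgue_tuple R).
Local Notation tup := (m.-tuple R).

Definition half_density (s : k.+1.-tuple R) : R :=
  dirichlet_density (fun=> 1 / 2) (simplex_point m s).

Lemma half_density_ge0 s : 0 <= half_density s.
Proof. exact: dirichlet_density_ge0. Qed.

Lemma measurable_half_density : measurable_fun setT half_density.
Proof.
exact: (measurableT_comp (@measurable_dirichlet_density R m _) (@measurable_simplex_point R m)).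
Qed.

Definition half_dirichlet := weighted_law (lebn k.+1) half_density_ge0 measurable_half_density
  (@measurable_simplex_point R m).

Definition open_simplex : set tup := [set x | (forall i, 0 < tnth x i) /\ \sum_i tnth x i = 1].

Lemma measurable_open_simplex : measurable open_simplex.
Proof.
rewrite (_ : open_simplex = @simplex_interior R m `&` (fun x => \sum_i tnth x i) @^-1` [set 1]).
  apply: measurableI; first exact: measurable_simplex_interior.
  exact: (measurable_preimage (@measurable_tuple_total R m) (measurable_set1 1)).
by apply/seteqP; split => x [].
Qed.

Lemma sum_simplex_point (s : k.+1.-tuple R) : \sum_i tnth (simplex_point m s) i = 1.
Proof.
rewrite big_ord_recr/= tnth_mktuple/= nth_default ?size_tuple// addrC.
rewrite [X in _ + X](_ : _ = \sum_(y <- s) y) ?subrK//.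
rewrite [RHS](big_nth 0) size_tuple big_mkord; apply: eq_bigr => i _.
by rewrite tnth_mktuple/= (set_nth_default 0)// size_tuple.
Qed.

Lemma open_simplex_point s : half_density s != 0 -> open_simplex (simplex_point m s).
Proof.
rewrite /half_density /dirichlet_density; case: ifPn => [/forallP x0 _|_]; last by rewrite eqxx.
by split; [exact: x0|exact: sum_simplex_point].
Qed.

Lemma open_simplex_cube : open_simplex `<=` unit_cube.
Proof.
move=> x [x0 x1] i; rewrite (ltW (x0 i))/= -x1 (bigD1 i)//= lerDl.
by apply: sumr_ge0 => j _; exact: ltW.
Qed.

Lemma half_dirichlet_integral (f : tup -> \bar R) : measurable_fun open_simplex f ->
  (forall x, open_simplex x -> (0 <= f x)%E) ->
  (\int[half_dirichlet]_(x in open_simplex) f x =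
   \int[lebn k.+1]_s ((half_density s)%:E * f (simplex_point m s)))%E.
Proof.
move=> mf f0; rewrite integral_mkcond weighted_law_integral; first last.
- by move=> x; rewrite patchE; case: ifPn => //; rewrite inE; exact: f0.
- by apply/(measurable_restrictT _ _).1 => //; exact: measurable_open_simplex.
apply: eq_integral => s _; rewrite patchE.
have [->|ns] := eqVneq (half_density s) 0; first by rewrite !mul0e.
by rewrite mem_set//; exact: open_simplex_point.
Qed.

End half_dirichlet.

Section limit_point.
Context {d : measure_display} {T : measurableType d} {R : realType}.
Variable P : probability T R.
Variable k : nat.
Local Notation m := k.+2.
Variables (L : 'I_m -> nat -> {RV P >-> R}) (I : nat -> T -> 'I_m)
  (A : nat -> {RV P >-> R}).
Hypothesis hmodel : urn_model L I A.
Local Notation leb := (@lebesgue_measure R).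
Local Notation history_type := (history_type L I A).

(** An upper limit is measurable without any exceptional set, and the clamping puts the point in the
    unit cube everywhere; almost everywhere it is the true limit. *)
Definition limit_coord (i : 'I_m) (w : T) : R :=
  Num.max 0 (Num.min 1 (fine (limn_esup (fun n => (proportion L i n w)%:E)))).

Definition limit_point (w : T) : m.-tuple R := [tuple limit_coord i w | i < m].

Lemma measurable_limit_point : measurable_fun setT limit_point.
Proof.
apply/measurable_fun_tnthP => i; rewrite (_ : _ \o _ = limit_coord i); last first.
  by apply/funext => w; rewrite /= tnth_mktuple.
apply: measurable_maxr => //; apply: measurable_minr => //.
apply: measurableT_comp => //; apply: measurable_fun_limn_esup => n.
by apply/measurable_EFinP; exact: (measurable_proportion hmodel).
Qed.

Lemma limit_point_cube w : unit_cube (limit_point w).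
Proof. by move=> i; rewrite tnth_mktuple /limit_coord le_max lexx/= ge_max ler01 ge_min lexx. Qed.

Lemma selection_weight_le1 j n w : selection_weight L j n w <= 1.
Proof.
rewrite /selection_weight indicE; case: (boolP (w \in _)) => [|_]; last by rewrite mul0r.
rewrite inE mul1r => pw; rewrite ler_pdivrMr ?mul1r; last exact: (positive_total I pw).
by rewrite /total (bigD1 j)//= lerDl sumr_ge0// => i _; exact/ltW/pw.
Qed.

Lemma ae_positive : {ae P, forall w, forall n, positive_at L n w}.
Proof. by apply: ae_foralln => n; exact: (ae_positive_at hmodel). Qed.

Lemma ae_proportion_cvg : {ae P, forall w, forall i,
  proportion L i n w @[n --> \oo] --> tnth (limit_point w) i}.
Proof.
have H i : {ae P, forall w, proportion L i n w @[n --> \oo] --> tnth (limit_point w) i}.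
  apply: filterS2 ae_positive (proportion_cvg hmodel i) => w pw cw.
  have p01 n : 0 <= proportion L i n w <= 1.
    have := selection_weight_ge0 L i n w; have := selection_weight_le1 i n w.
    by rewrite /selection_weight indicE mem_set// mul1r => -> ->.
  have l0 : 0 <= limn (fun n => proportion L i n w).
    by apply: limr_ge => //; apply: nearW => n; case/andP: (p01 n).
  have l1 : limn (fun n => proportion L i n w) <= 1.
    by apply: limr_le => //; apply: nearW => n; case/andP: (p01 n).
  rewrite tnth_mktuple /limit_coord.
  have -> : limn_esup (fun n => (proportion L i n w)%:E) = (limn (fun n => proportion L i n w))%:E.
    have [_ ->//] : (limn_einf (fun n => (proportion L i n w)%:E) = (limn (fun n => proportion L i n w))%:E) *
        (limn_esup (fun n => (proportion L i n w)%:E) = (limn (fun n => proportion L i n w))%:E).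
    by apply: cvg_limn_einf_sup; apply: cvg_EFin; [exact: nearW|exact: cw].
  by rewrite /= (min_idPr l1) (max_idPr l0).
(* The exceptional sets of the colors are gathered by indexing them with all naturals, so that
   [ae_foralln] applies. *)
have : {ae P, forall w, forall l : nat, forall i : 'I_m, i = l :> nat ->
    proportion L i n w @[n --> \oo] --> tnth (limit_point w) i}.
  apply: ae_foralln => l; have [lm|lm] := ltnP l m.
    by apply: filterS (H (Ordinal lm)) => w cw i il; rewrite (_ : i = Ordinal lm)//; exact: val_inj.
  by apply: aeW => w i il; have := ltn_ord i; rewrite il ltnNge lm.
by apply: filterS => w cw i; exact: (cw i).
Qed.

Lemma ae_selection_weight_cvg : {ae P, forall w, forall i,
  selection_weight L i n w @[n --> \oo] --> tnth (limit_point w) i}.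
Proof.
apply: filterS2 ae_positive ae_proportion_cvg => w pw cw i.
rewrite (_ : (fun n => _) = (fun n => proportion L i n w)); first exact: cw.
by apply/funext => n; rewrite /selection_weight indicE mem_set// mul1r.
Qed.

Definition weight_product (u : seq 'I_m) (n : nat) (w : T) : R :=
  \prod_(j <- u) selection_weight L j n w.

Lemma weight_product_itv u n w : 0 <= weight_product u n w <= 1.
Proof.
elim: u => [|j u IH]; rewrite /weight_product ?big_nil ?ler01 ?lexx// big_cons.
have /andP[b0 b1] := IH; have a0 := selection_weight_ge0 L j n w.
by rewrite mulr_ge0//= mulr_ile1// selection_weight_le1.
Qed.

Lemma history_weight_product u n : measurable_fun setT (weight_product u n : history_type n -> R).
Proof. by apply: measurable_prod => j _; exact: (history_selection_weight hmodel). Qed.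

Lemma measurable_weight_product u n : measurable_fun setT (weight_product u n).
Proof. apply: (history_fun hmodel); exact: history_weight_product. Qed.

Lemma ae_weight_product_cvg : {ae P, forall w, forall u,
  weight_product u n w @[n --> \oo] --> monomial u (limit_point w)}.
Proof.
apply: filterS ae_selection_weight_cvg => w cw u; elim: u => [|j u IH].
  rewrite /monomial big_nil (_ : (fun n => _) = cst 1); first exact: cvg_cst.
  by apply/funext => n; rewrite /weight_product big_nil.
rewrite /monomial big_cons (_ : (fun n => _) =
    (fun n => selection_weight L j n w * weight_product u n w)); last first.
  by apply/funext => n; rewrite /weight_product big_cons.
by apply: cvgM; [exact: cw|exact: IH].
Qed.

(** Given the history, the selection of j at step n + 1 may be traded for its conditional
    probability, one more letter in the word u. *)
Lemma selection_step n j (E : set T) (u : seq 'I_m) : history L I A n E ->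
  (\int[P]_w (\1_(E `&` I n.+1 @^-1` [set j]) w * weight_product u n w)%:E =
   \int[P]_w (\1_E w * weight_product (j :: u) n w)%:E)%E.
Proof.
move=> hE; have hE' : @measurable _ (history_type n) E by exact: hE.
have w0 w : 0 <= weight_product u n w by case/andP: (weight_product_itv u n w).
pose f (z : history_type n * R) : \bar R := (\1_E z.1 * weight_product u n z.1)%:E.
have f0 z : (0 <= f z)%E by rewrite lee_fin mulr_ge0// indicE.
have mf : measurable_fun setT f.
  apply/measurable_EFinP; apply: measurable_funM.
    exact: (measurableT_comp (measurable_indic hE')).
  exact: (measurableT_comp (@history_weight_product u n)).
have := step_integral hmodel j mf f0; rewrite /f/= => H.
transitivity (\int[P]_w ((\1_(I n.+1 @^-1` [set j]) w)%:E * (\1_E w * weight_product u n w)%:E))%E.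
  by apply: eq_integral => w _; rewrite indicI/= -EFinM; congr EFin; ring.
rewrite H; apply: eq_integral => w _; rewrite /weight_product big_cons -/(weight_product u n w).
have -> : (\1_E w * (selection_weight L j n w * weight_product u n w))%:E =
    ((selection_weight L j n w)%:E * (\1_E w * weight_product u n w)%:E)%E.
  by rewrite -EFinM; congr EFin; ring.
rewrite /selection_weight indicE; case: (boolP (w \in positive_at L n)) => [|_].
  rewrite inE => pw; congr (_ * _)%E; rewrite ge0_integralZr//.
  - by rewrite integral_guarded_weight ?mul1e//; exact: (positive_total I pw).
  - by apply/measurable_EFinP; exact: measurable_guarded_weight1.
  - by move=> a _; rewrite lee_fin guarded_weight_ge0.
  - exact: (f0 (w, 0)).
by rewrite !mul0r !mul0e.
Qed.

End limit_point.

Lemma measure_moment_determinacy (R : realType) m (mu nu : {measure set m.-tuple R -> \bar R}) :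
  (mu setT < +oo)%E -> (nu setT < +oo)%E ->
  (forall u, (\int[mu]_(x in unit_cube) (monomial u x)%:E =
    \int[nu]_(x in unit_cube) (monomial u x)%:E)%E) ->
  forall S, measurable S -> mu (S `&` unit_cube) = nu (S `&` unit_cube).
Proof.
move=> /finite_measure_of[mu' mu'E] /finite_measure_of[nu' nu'E] H S mS.
rewrite -mu'E -nu'E; apply: moment_determinacy => // u.
transitivity (\int[mu]_(x in unit_cube) (monomial u x)%:E)%E.
  by apply: eq_measure_integral => B _ _; exact: mu'E.
by rewrite H; apply: eq_measure_integral => B _ _; exact/esym/nu'E.
Qed.

Section limit_law.
Context {d : measure_display} {T : measurableType d} {R : realType}.
Variable P : probability T R.
Variable k : nat.
Local Notation m := k.+2.
Local Notation tup := (m.-tuple R).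
Variables (L : 'I_m -> nat -> {RV P >-> R}) (I : nat -> T -> 'I_m)
  (A : nat -> {RV P >-> R}).
Hypothesis hmodel : urn_model L I A.
Local Notation X := (limit_point L).
Local Notation "\D" := (@half_dirichlet R k).
Local Open Scope ereal_scope.

Definition draws (u : seq 'I_m) : seq ('I_m * set R) := [seq (j, setT) | j <- u].

Lemma measurable_draws u : measurable_steps (draws u).
Proof. by move=> p /mapP[j _ ->]; exact: measurableT. Qed.

(* Given a limit point x, the event E of the first n steps has conditional
   probability ka x, and the indices selected later are i.i.d. with law x. *)
Record predicts (n : nat) (E : set T) (ka : tup -> \bar R) : Prop := {
  predicts_measurable : measurable_fun open_simplex ka ;
  predicts_ge0 : forall x, open_simplex x -> 0 <= ka x ;
  predicts_history : history L I A n E ;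
  predicts_draws : forall u, P (E `&` step_event I A n (draws u)) =
    \int[\D]_(x in open_simplex) (ka x * (monomial u x)%:E)
}.

Lemma monomial_ge0 u (x : tup) : open_simplex x -> (0 <= monomial u x)%R.
Proof. by move=> /open_simplex_cube/(monomial_itv u)/andP[]. Qed.

Lemma measurable_monomial_in u : measurable_fun open_simplex (fun x : tup => (monomial u x)%:E).
Proof. by apply: measurable_funTS; apply/measurable_EFinP; exact: measurable_monomial. Qed.

Lemma index_partition n F : measurable F -> P F = \sum_(j : 'I_m) P (F `&` I n @^-1` [set j]).
Proof.
move=> mF; have mI j : measurable (F `&` I n @^-1` [set j]).
  by apply: measurableI => //; exact: (measurable_index hmodel).
rewrite [X in P X](_ : F = \bigcup_(j in [set: 'I_m]) (F `&` I n @^-1` [set j])); last first.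
  by apply/seteqP; split => [w Fw|w [j _ []]//]; exists (I n w).
rewrite [LHS]measure_fin_bigcup//; first last.
- apply/trivIsetP => i j _ _ ij; apply/seteqP; split => // w [[_ /= E1] [_ /= E2]].
  by move/eqP: ij; rewrite -E1 -E2.
- exact: finite_finset.
rewrite -big_enum/= (fsbig_seq _ _ (enum_uniq _)) (_ : [set` enum 'I_m] = setT)//.
by apply/seteqP; split => j //= _; rewrite mem_enum.
Qed.

Lemma predicts_step n E ka j : predicts n E ka ->
  predicts n.+1 (E `&` I n.+1 @^-1` [set j]) (fun x => ka x * (tnth x j)%:E).
Proof.
case=> mk k0 hE hu; have n1 : (1 <= n.+1 <= n.+1)%N by rewrite leqnn.
split.
- apply: emeasurable_funM => //; apply: measurable_funTS; apply/measurable_EFinP.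
  exact: measurable_tnth.
- by move=> x xs; rewrite mule_ge0 ?k0// lee_fin ltW//; case: xs.
- have h1 : @measurable _ (history_type L I A n.+1) E by exact: history_mono (leqnSn n) hE.
  have h2 : @measurable _ (history_type L I A n.+1) (I n.+1 @^-1` [set j]) by exact: history_index.
  exact: (measurableI _ _ h1 h2).
- move=> u; have := hu (j :: u); rewrite /= preimage_setT setIT setIA => ->.
  by apply: eq_integral => x _; rewrite /monomial big_cons EFinM muleA.
Qed.

(** The color of the unobserved step is summed over, and the coordinates of a point of the open
    simplex add up to 1. *)
Lemma predicts_skip n E ka : predicts n E ka -> predicts n.+1 E ka.
Proof.
move=> H; have [mk k0 hE hu] := H; split => // [|u].
  exact: history_mono (leqnSn n) hE.
have mE := measurable_history hmodel hE.
have mu := measurable_step_event hmodel n.+1 (@measurable_draws u).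
rewrite [LHS](@index_partition n.+1); last exact: measurableI.
transitivity (\sum_(j : 'I_m) P (E `&` I n.+1 @^-1` [set j] `&` step_event I A n.+1 (draws u))).
  by apply: eq_bigr => j _; rewrite setIAC.
transitivity (\sum_(j : 'I_m) \int[\D]_(x in open_simplex) (ka x * (tnth x j)%:E * (monomial u x)%:E)).
  by apply: eq_bigr => j _; have [_ _ _] := predicts_step j H; apply.
have t0 (x : tup) j : open_simplex x -> (0 <= tnth x j)%R by case=> x0 _; exact: ltW.
rewrite -ge0_integral_sum//; first last.
- by move=> j x xs; rewrite !mule_ge0 ?k0// lee_fin ?monomial_ge0// t0.
- move=> j; apply: emeasurable_funM; last exact: measurable_monomial_in.
  by have [] := predicts_step j H.
- exact: measurable_open_simplex.
apply: eq_integral => x; rewrite inE => xs.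
transitivity (\sum_(j < m) (ka x * (monomial u x)%:E * (tnth x j)%:E)).
  by apply: eq_bigr => j _; rewrite muleAC.
rewrite -ge0_sume_distrr; last by move=> j _; rewrite lee_fin t0.
by rewrite sumEFin; case: xs => _ ->; rewrite mule1.
Qed.

Lemma predicts_later n t E ka : (n <= t)%N -> predicts n E ka -> predicts t E ka.
Proof.
move=> /subnK <-; elim: (t - n)%N => // l IH H; rewrite addSn.
by apply: predicts_skip; exact: IH.
Qed.

(** For j :: u, the left side is the limit of the integrals over E of the weights at step n + t, and
    the weight of j there is the conditional probability of selecting j at the next step. Adding
    this selection to E gives an event that is again predicted; the induction hypothesis then shows
    that, with the limit in place of the weights of u, the integral is the right side for every
    t. *)
Lemma limit_moments n E ka u : predicts n E ka ->
  \int[P]_w (\1_E w * monomial u (X w))%:E =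
  \int[\D]_(x in open_simplex) (ka x * (monomial u x)%:E).
Proof.
have mX v : measurable_fun setT (fun w => monomial v (X w)).
  exact: (measurableT_comp (measurable_monomial v) (@measurable_limit_point _ _ _ _ _ _ _ _ hmodel)).
have X01 v w := monomial_itv v (limit_point_cube L w).
elim: u n E ka => [|j u IH] n E ka H.
  have mE := measurable_history hmodel (predicts_history H).
  have := predicts_draws H [::]; rewrite /= setIT => <-.
  transitivity (\int[P]_w (\1_E w)%:E); last by rewrite integral_indic// setIT.
  by apply: eq_integral => w _; rewrite /monomial big_nil mulr1.
set c := RHS.
pose E_ t := E `&` I (n + t).+1 @^-1` [set j].
have mE := measurable_history hmodel (predicts_history H).
have mE_ t : measurable (E_ t).
  by apply: measurableI => //; exact: (measurable_index hmodel).
have Hc t : \int[P]_w (\1_(E_ t) w * monomial u (X w))%:E = c.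
  rewrite (IH _ _ _ (predicts_step j (predicts_later (leq_addr t n) H))).
  by apply: eq_integral => x _; rewrite /monomial big_cons EFinM muleA.
(* The error made in replacing the weights of step n + t by their limit; it tends to 0 in mean by
   dominated convergence. *)
pose dl t w : R := (`|weight_product L u (n + t) w - monomial u (X w)|)%R.
have mdl t : measurable_fun setT (dl t).
  apply: measurableT_comp => //; apply: measurable_funB => //.
  exact: (@measurable_weight_product _ _ _ _ _ _ _ _ hmodel).
have ws t w : (0 <= weight_product L u (n + t) w <= 1)%R by exact: weight_product_itv.
have shift (v : seq 'I_m) w : weight_product L v n w @[n --> \oo] --> monomial v (X w) ->
    weight_product L v (n + t)%N w @[t --> \oo] --> monomial v (X w).
  move=> cv; rewrite (_ : (fun t => _) = (fun t => weight_product L v (t + n)%N w)).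
    by rewrite (cvg_shiftn n (fun t => weight_product L v t w)).
  by apply/funext => t; rewrite addnC.
have integrable1 : P.-integrable setT (EFin \o cst (1%R : R)).
  by apply: finite_measure_integrable_cst.
have cdl : \int[P]_w (dl t w)%:E @[t --> \oo] --> 0.
  have [||||| _ _] := @dominated_convergence _ _ _ P setT measurableT (fun t w => (dl t w)%:E)
    (cst 0) (EFin \o cst 1%R).
  - by move=> t; exact/measurable_EFinP.
  - exact: measurable_cst.
  - apply: filterS (ae_weight_product_cvg hmodel) => w cw _; apply: cvg_EFin; first exact: nearW.
    rewrite -(normr0 R^o) -(subrr (monomial u (X w))).
    by apply: cvg_norm; apply: cvgB; [exact/shift/cw|exact: cvg_cst].
  - by [].
  - apply: aeW => w t _ /=; rewrite lee_fin normr_id ler_norml.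
    by have := ws t w; have := X01 u w; lra.
  - by rewrite integral0.
have ca : \int[P]_w (\1_(E_ t) w * weight_product L u (n + t) w)%:E @[t --> \oo] -->
    \int[P]_w (\1_E w * monomial (j :: u) (X w))%:E.
  rewrite (_ : (fun t => _) = (fun t => \int[P]_w (\1_E w * weight_product L (j :: u) (n + t) w)%:E)); last first.
    apply/funext => t; apply: (selection_step hmodel).
    exact: (predicts_history (predicts_later (leq_addr t n) H)).
  have [||||| _ _] := @dominated_convergence _ _ _ P setT measurableT
    (fun t w => (\1_E w * weight_product L (j :: u) (n + t) w)%:E)
    (fun w => (\1_E w * monomial (j :: u) (X w))%:E) (EFin \o cst 1%R).
  - move=> t; apply/measurable_EFinP; apply: measurable_funM; first exact: measurable_indic.
    exact: (@measurable_weight_product _ _ _ _ _ _ _ _ hmodel).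
  - by apply/measurable_EFinP; apply: measurable_funM.
  - apply: filterS (ae_weight_product_cvg hmodel) => w cw _; apply: cvg_EFin; first exact: nearW.
    by apply: cvgM; [exact: cvg_cst|exact/shift/cw].
  - by [].
  - apply: aeW => w t _ /=; rewrite lee_fin.
    have /andP[p0 p1] := weight_product_itv L I (j :: u) (n + t) w.
    by rewrite indicE; case: (_ \in _); rewrite ?mul1r ?mul0r ?normr0 ?ler01// ger0_norm.
  - by [].
have i01 t w : (0 <= (\1_(E_ t) w : R) <= 1)%R.
  by rewrite indicE; case: (_ \in _); rewrite ?lexx ler01.
have c_fin : c \is a fin_num.
  rewrite -(Hc 0%N) ge0_fin_numE; last first.
    by apply: integral_ge0 => w _; rewrite lee_fin mulr_ge0//; case/andP: (X01 u w).
  apply: (@le_lt_trans _ _ (\int[P]_w (cst 1 w))).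
    apply: ge0_le_integral => //.
    - by move=> w _; rewrite lee_fin mulr_ge0//; case/andP: (X01 u w).
    - by apply/measurable_EFinP; apply: measurable_funM.
    - move=> w _; rewrite lee_fin; have := i01 0%N w; have := X01 u w; nra.
  rewrite integral_cst// mul1e; apply: (le_lt_trans (probability_le1 P measurableT)); exact: ltry.
have m1 t : measurable_fun setT (fun w => (\1_(E_ t) w * weight_product L u (n + t) w)%:E).
  apply/measurable_EFinP; apply: measurable_funM; first exact: measurable_indic.
  exact: (@measurable_weight_product _ _ _ _ _ _ _ _ hmodel).
have m2 t : measurable_fun setT (fun w => (\1_(E_ t) w * monomial u (X w))%:E).
  by apply/measurable_EFinP; apply: measurable_funM.
have m3 t : measurable_fun setT (fun w => (dl t w)%:E) by exact/measurable_EFinP.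
have g1 t w : 0 <= (\1_(E_ t) w * weight_product L u (n + t) w)%:E.
  by rewrite lee_fin mulr_ge0//; case/andP: (ws t w).
have g2 t w : 0 <= (\1_(E_ t) w * monomial u (X w))%:E.
  by rewrite lee_fin mulr_ge0//; case/andP: (X01 u w).
have g3 t w : 0 <= (dl t w)%:E by rewrite lee_fin normr_ge0.
have le1 t : \int[P]_w (\1_(E_ t) w * weight_product L u (n + t) w)%:E <= c + \int[P]_w (dl t w)%:E.
  rewrite -(Hc t) -ge0_integralD//; apply: ge0_le_integral => //.
  - exact: emeasurable_funD.
  - move=> w _; rewrite -EFinD lee_fin /dl; have := i01 t w.
    have := ler_norm (weight_product L u (n + t) w - monomial u (X w)).
    have := normr_ge0 (weight_product L u (n + t) w - monomial u (X w))%R.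
    by rewrite indicE; case: (_ \in _); rewrite ?mul1r ?mul0r; lra.
have le2 t : c <= \int[P]_w (\1_(E_ t) w * weight_product L u (n + t) w)%:E + \int[P]_w (dl t w)%:E.
  rewrite -(Hc t) -ge0_integralD//; apply: ge0_le_integral => //.
  - exact: emeasurable_funD.
  - move=> w _; rewrite -EFinD lee_fin /dl; have := i01 t w.
    have := ler_norm (- (weight_product L u (n + t) w - monomial u (X w))).
    rewrite normrN; have := normr_ge0 (weight_product L u (n + t) w - monomial u (X w))%R.
    by rewrite indicE; case: (_ \in _); rewrite ?mul1r ?mul0r; lra.
apply/eqP; rewrite eq_le; apply/andP; split.
  have cc : c + \int[P]_w (dl t w)%:E @[t --> \oo] --> c.
    rewrite -[X in _ --> X]adde0; apply: cvgeD; [exact: fin_num_adde_defl|exact: cvg_cst|exact: cdl].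
  rewrite -(cvg_lim _ ca)// -(cvg_lim _ cc)//; apply: lee_lim.
  - by apply/cvg_ex; eexists; exact: ca.
  - by apply/cvg_ex; eexists; exact: cc.
  - exact: nearW.
have cb : \int[P]_w (\1_(E_ t) w * weight_product L u (n + t) w)%:E + \int[P]_w (dl t w)%:E
    @[t --> \oo] --> \int[P]_w (\1_E w * monomial (j :: u) (X w))%:E.
  by rewrite -[X in _ --> X]adde0; apply: cvgeD; [exact: fin_num_adde_defl|exact: ca|exact: cdl].
by apply: (cvge_ge _ cb); exact: nearW.
Qed.

(** The law of the limit point on E and the measure with density [ka] with respect to
    [half_dirichlet] are finite and have the same moments on the unit cube, by [limit_moments]. *)
Lemma limit_law n E ka S : predicts n E ka -> measurable S ->
  P (E `&` X @^-1` S) = \int[\D]_(x in open_simplex) (ka x * (\1_S x)%:E).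
Proof.
move=> H mS; have [mk k0 hE _] := H.
have mE := measurable_history hmodel hE.
have mX := @measurable_limit_point _ _ _ _ _ _ _ _ hmodel.
have ind0 w : (0 <= \1_E w :> R)%R by rewrite indicE.
have mind : measurable_fun setT (\1_E : T -> R) by exact: measurable_indic.
pose mu := weighted_law P ind0 mind mX.
have os := @measurable_open_simplex R k.
have Ek : \int[\D]_(x in open_simplex) ka x = P E.
  have := predicts_draws H [::]; rewrite /= setIT => ->.
  by apply: eq_integral => x _; rewrite /monomial big_nil mule1.
have PE : P E < +oo by apply: (le_lt_trans (probability_le1 P mE)); exact: ltry.
have ika : (\D : {measure set tup -> \bar R}).-integrable open_simplex ka.
  apply/integrableP; split => //.
  rewrite [ltLHS](_ : _ = P E)// -Ek; apply: eq_integral => x; rewrite inE => xs.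
  by rewrite gee0_abs// k0.
(* [ka] may take infinite values, but its integral is P E, so that it equals this real density
   almost everywhere on the simplex. *)
pose w x : R := fine ((ka \_ open_simplex) x).
have w0 x : (0 <= w x)%R.
  by rewrite fine_ge0// patchE; case: ifPn => //; rewrite inE; exact: k0.
have mw : measurable_fun setT w.
  by apply: measurableT_comp => //; apply/(measurable_restrictT _ _).1.
have mid : measurable_fun setT (id : tup -> tup) by exact: measurable_id.
pose nu := weighted_law \D w0 mw mid.
have int_ka (f : tup -> R) : measurable_fun setT f -> (forall x, unit_cube x -> (0 <= f x)%R) ->
    \int[nu]_(x in unit_cube) (f x)%:E = \int[\D]_(x in open_simplex) (ka x * (f x)%:E).
  move=> mf f0; rewrite integral_mkcond weighted_law_integral; first last.
  - by move=> x; rewrite patchE; case: ifPn => //; rewrite inE lee_fin; exact: f0.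
  - apply/(measurable_restrictT _ _).1; first exact: measurable_unit_cube.
    by apply: measurable_funTS; exact/measurable_EFinP.
  rewrite [RHS]integral_mkcond; apply: ae_eq_integral => //.
  - apply: emeasurable_funM; first exact/measurable_EFinP.
    apply/(measurable_restrictT _ _).1; first exact: measurable_unit_cube.
    by apply: measurable_funTS; exact/measurable_EFinP.
  - apply/(measurable_restrictT _ _).1 => //; apply: emeasurable_funM => //.
    by apply: measurable_funTS; exact/measurable_EFinP.
  apply: filterS (integrable_ae os ika) => x fx _; rewrite /w !patchE.
  case: ifPn => [|_]; last by rewrite mul0e.
  rewrite inE => xs; rewrite fineK; last exact: fx.
  by rewrite mem_set//; exact: open_simplex_cube.
have int_mu (f : tup -> R) : measurable_fun setT f -> (forall x, unit_cube x -> (0 <= f x)%R) ->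
    \int[mu]_(x in unit_cube) (f x)%:E = \int[P]_z (\1_E z * f (X z))%:E.
  move=> mf f0; rewrite integral_mkcond weighted_law_integral; first last.
  - by move=> x; rewrite patchE; case: ifPn => //; rewrite inE lee_fin; exact: f0.
  - apply/(measurable_restrictT _ _).1; first exact: measurable_unit_cube.
    by apply: measurable_funTS; exact/measurable_EFinP.
  by apply: eq_integral => z _; rewrite patchE mem_set//; exact: limit_point_cube.
have cube0 u (x : tup) : unit_cube x -> (0 <= monomial u x)%R by case/(monomial_itv u)/andP.
have ind_cube0 (x : tup) : unit_cube x -> (0 <= \1_S x :> R)%R by rewrite indicE.
have mS' : measurable_fun setT (\1_S : tup -> R) by exact: measurable_indic.
have muT : mu setT < +oo.
  rewrite [ltLHS](_ : _ = P E)// /mu /weighted_law preimage_setT.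
  by rewrite integral_indic// setIT.
have nuT : nu setT < +oo.
  rewrite [ltLHS](_ : _ = P E)// -Ek /nu /weighted_law preimage_setT.
  rewrite [RHS]integral_mkcond; apply: ae_eq_integral => //.
  - exact/measurable_EFinP.
  - exact/(measurable_restrictT _ _).1.
  apply: filterS (integrable_ae os ika) => x fx _; rewrite /w !patchE.
  by case: ifPn => // ; rewrite inE => xs; rewrite fineK//; exact: fx.
have moments u : \int[mu]_(x in unit_cube) (monomial u x)%:E =
    \int[nu]_(x in unit_cube) (monomial u x)%:E.
  rewrite int_mu; [|exact: measurable_monomial|exact: cube0].
  rewrite int_ka; [|exact: measurable_monomial|exact: cube0].
  exact: limit_moments H.
transitivity (mu (S `&` unit_cube)).
  transitivity (\int[mu]_(x in unit_cube) (\1_S x)%:E).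
    rewrite int_mu//; transitivity (\int[P]_z (\1_(E `&` X @^-1` S) z)%:E); last first.
      by apply: eq_integral => z _; rewrite indicI.
    rewrite integral_indic ?setIT//; apply: measurableI => //.
    exact: measurable_preimage.
  by rewrite integral_indic//; exact: measurable_unit_cube.
rewrite [LHS](measure_moment_determinacy muT nuT moments mS) -int_ka//.
by rewrite integral_indic//; exact: measurable_unit_cube.
Qed.

End limit_law.

Section conditional_law.
Context {d : measure_display} {T : measurableType d} {R : realType}.
Variable P : probability T R.
Variable k : nat.
Local Notation m := k.+2.
Local Notation tup := (m.-tuple R).
Variables (L : 'I_m -> nat -> {RV P >-> R}) (I : nat -> T -> 'I_m)
  (A : nat -> {RV P >-> R}).
Hypothesis hmodel : urn_model L I A.
Local Notation X := (limit_point L).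
Local Notation "\D" := (@half_dirichlet R k).
Local Open Scope ereal_scope.

Lemma measurable_simplex_chain Bs i : (forall B, B \in Bs -> measurable B) ->
  measurable_fun open_simplex (fun x : tup => chain Bs (tnth x i) 0).
Proof.
move=> mBs; have mp : measurable_fun setT (fun x : tup => (tnth x i, 0%R : R)).
  by apply: measurable_fun_pair => //; exact: measurable_tnth.
have := measurable_funTS (D := open_simplex) (measurableT_comp (measurable_chain mBs) mp).
apply: eq_measurable_fun => x; rewrite inE => -[x0 _] /=.
by rewrite x0 lexx.
Qed.

(** The exponents are kept apart from the lengths of the chains: [pending_kernel] prescribes gaps
    whose selections have not been observed. *)
Definition chain_kernel (e : 'I_m -> nat) (Cs : 'I_m -> seq (set R)) (x : tup) : \bar R :=
  \prod_(i < m) ((tnth x i ^+ e i)%:E * chain (Cs i) (tnth x i) 0).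

Lemma chain_kernel_ge0 e Cs x : open_simplex x -> 0 <= chain_kernel e Cs x.
Proof.
move=> [x0 _]; apply: prode_ge0 => i _; rewrite mule_ge0 ?chain_ge0//.
by rewrite lee_fin exprn_ge0// ltW.
Qed.

Lemma measurable_chain_kernel e Cs : (forall i B, B \in Cs i -> measurable B) ->
  measurable_fun open_simplex (chain_kernel e Cs).
Proof.
move=> mCs; rewrite /chain_kernel; elim: (index_enum _) => [|i s IH].
  by under eq_fun do rewrite big_nil; exact: measurable_cst.
under eq_fun do rewrite big_cons; apply: emeasurable_funM => //.
apply: emeasurable_funM; last exact: measurable_simplex_chain (mCs i).
apply: measurable_funTS; apply/measurable_EFinP; apply: measurable_funX.
exact: measurable_tnth.
Qed.

Definition step_kernel (B0 : 'I_m -> set R) (st : seq ('I_m * set R)) : tup -> \bar R :=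
  chain_kernel (fun i => size (selected i st)) (fun i => B0 i :: selected i st).

Lemma predicts_ext n E (ka ka' : tup -> \bar R) : predicts L I A n E ka ->
  (forall x, open_simplex x -> ka x = ka' x) -> predicts L I A n E ka'.
Proof.
case=> mk k0 hE hu E'; split => //.
- by apply: eq_measurable_fun mk => x; rewrite inE => /E'.
- by move=> x xs; rewrite -E'// k0.
- by move=> u; rewrite hu; apply: eq_integral => x; rewrite inE => /E' ->.
Qed.

Lemma step_event_cat n st st' :
  step_event I A n (st ++ st') = step_event I A n st `&` step_event I A (n + size st) st'.
Proof.
elim: st n => [|[j B] st IH] n /=; first by rewrite setTI addn0.
by rewrite IH addSn addnS setIA.
Qed.

Lemma history_step_event n st : measurable_steps st ->
  history L I A (n + size st) (step_event I A n st).
Proof.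
elim: st n => [|[j B] st IH] n mst /=.
  exact: (@measurableT _ (history_type L I A (n + 0))).
have mB : measurable B by apply: (mst (j, B)); rewrite mem_head.
have n1 : (1 <= n.+1 <= n + (size st).+1)%N by rewrite /= addnS ltnS leq_addr.
have h1 : @measurable _ (history_type L I A (n + (size st).+1)) (I n.+1 @^-1` [set j]).
  exact: history_index.
have h2 : @measurable _ (history_type L I A (n + (size st).+1)) (A n.+1 @^-1` B).
  by have := @history_addition _ _ _ _ _ L I A _ _ n1 measurableT B mB; rewrite setTI.
have h3 : @measurable _ (history_type L I A (n + (size st).+1)) (step_event I A n.+1 st).
  by rewrite addnS -addSn; apply: IH => p pst; apply: mst; rewrite in_cons pst orbT.
exact: (measurableI _ _ (measurableI _ _ h1 h2) h3).
Qed.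

Lemma selected_cat i (st st' : seq ('I_m * set R)) :
  selected i (st ++ st') = selected i st ++ selected i st'.
Proof. by rewrite /selected filter_cat map_cat. Qed.

Lemma selected_draws (i : 'I_m) u : selected i (draws u) = nseq (count_mem i u) (setT : set R).
Proof. by elim: u => //= j u IH; rewrite {1}/selected/=; case: eqP => //= _; rewrite -IH. Qed.

Lemma monomial_count u (x : tup) : monomial u x = (\prod_(i < m) tnth x i ^+ count_mem i u)%R.
Proof.
rewrite /monomial; elim: u => [|j u IH].
  by rewrite big_nil big1// => i _; rewrite expr0.
rewrite big_cons IH [in RHS](bigD1 j)//= eqxx exprS -mulrA; congr (_ * _)%R.
rewrite (bigD1 j)//=; congr (_ * _)%R; apply: eq_bigr => i ij.
by rewrite eq_sym (negbTE ij).
Qed.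

(** Further draws leave their additions free: by [chain_cat_setT] they do not change the chains, and
    they raise the exponents by exactly those of the monomial of u. *)
Lemma predicts_initial (B0 : 'I_m -> set R) st : (forall i, measurable (B0 i)) -> measurable_steps st ->
  predicts L I A (size st) (initial_event L B0 `&` step_event I A 0 st) (step_kernel B0 st).
Proof.
move=> mB0 mst.
have mBs i B : B \in B0 i :: selected i st -> measurable B.
  by rewrite in_cons => /predU1P[->//|]; exact: measurable_selected.
have mk : measurable_fun open_simplex (step_kernel B0 st) by exact: measurable_chain_kernel.
have k0 x : open_simplex x -> 0 <= step_kernel B0 st x by exact: chain_kernel_ge0.
split => //.
  have h1 : @measurable _ (history_type L I A (size st)) (initial_event L B0).
    by apply: (history_initial_event hmodel).
  have h2 : @measurable _ (history_type L I A (size st)) (step_event I A 0 st).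
    by have := @history_step_event 0 st mst; rewrite add0n.
  exact: (measurableI _ _ h1 h2).
move=> u; rewrite -setIA -step_event_cat mixture_law//; last first.
  by move=> p; rewrite mem_cat => /orP[/mst//|/measurable_draws].
rewrite half_dirichlet_integral; first last.
- by move=> x xs; rewrite mule_ge0 ?k0// lee_fin monomial_ge0.
- by apply: emeasurable_funM => //; exact: measurable_monomial_in.
apply: eq_integral => s _; rewrite -/(half_density s).
have [->|/open_simplex_point[x0 _]] := eqVneq (half_density s) 0%R; first by rewrite !mul0e.
congr (_ * _); rewrite /step_kernel /chain_kernel monomial_count -prodEFin -big_split.
apply: eq_bigr => i _; rewrite selected_cat selected_draws size_cat size_nseq exprD.
by rewrite -cat_cons chain_cat_setT// EFinM muleAC.
Qed.

Lemma predicts_setT : predicts L I A 0 setT (cst 1).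
Proof.
have mT (i : 'I_m) : measurable (setT : set R) by exact: measurableT.
have := predicts_initial (B0 := fun=> setT) (st := [::]) mT => /(_ _)/predicts_ext.
rewrite /= setIT (_ : initial_event L _ = setT); last by apply/seteqP; split.
apply => // x [x0 _]; rewrite /step_kernel /chain_kernel big1// => i _.
have := @chain_cat_setT R (tnth x i) 0%R [::] 1 (x0 i) (lexx _); rewrite /= => ->.
by rewrite /chain/= expr0 mul1e /chain_base expr0n mul0r oppr0 expR0.
Qed.

Lemma limit_point_dirichlet : is_dirichlet P (fun=> 1 / 2)%R X.
Proof.
move=> S mS; have := limit_law hmodel predicts_setT mS; rewrite setTI => ->.
have mS1 : measurable_fun setT (fun x : tup => (\1_S x)%:E : \bar R).
  by apply/measurable_EFinP; exact: measurable_indic.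
rewrite half_dirichlet_integral; first last.
- by move=> x xs; rewrite mul1e lee_fin indicE.
- apply: emeasurable_funM => //; exact: measurable_funTS.
rewrite iterated_integralE//; first last.
- by move=> s; rewrite lee_fin mulr_ge0 ?indicE// half_density_ge0.
- apply/measurable_EFinP; apply: measurable_funM; last exact: measurable_half_density.
  by apply: (measurableT_comp (measurable_indic mS)); exact: measurable_simplex_point.
by apply: eq_integral => s _; rewrite mul1e -EFinM mulrC.
Qed.

Lemma limit_integral (g : tup -> \bar R) : measurable_fun setT g -> (forall x, 0 <= g x) ->
  \int[P]_w g (X w) = \int[\D]_(x in open_simplex) g x.
Proof.
move=> mg g0; rewrite half_dirichlet_integral//; last exact: measurable_funTS.
rewrite (is_dirichlet_integral limit_point_dirichlet)//.
exact: (measurable_limit_point hmodel).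
Qed.

(** For an event predicted by a finite function, [limit_law] is the defining identity of the
    conditional probability given the limit point. *)
Lemma cond_prob_limit n E (ka : tup -> \bar R) (g : tup -> R) : predicts L I A n E ka ->
  measurable_fun setT g -> (forall x, open_simplex x -> ka x = (g x)%:E) ->
  (forall x, unit_cube x -> 0 <= g x)%R ->
  is_cond_prob P (sigma_of X) E (fun w => g (X w)).
Proof.
move=> H mg kg g0; split.
  move=> B mB; exists (g @^-1` B); last by rewrite setTI.
  exact: measurable_preimage.
move=> _ [S mS <-]; rewrite setTI (limit_law hmodel H mS).
have mX := measurable_limit_point hmodel.
(* [g] is known to be nonnegative on the cube, whereas [limit_integral] asks for it everywhere; on
   the cube the absolute value changes nothing. *)
transitivity (\int[P]_w (\1_S (X w) * `|g (X w)|)%:E).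
  rewrite (limit_integral (g := fun x => (\1_S x * `|g x|)%:E)).
  - apply: eq_integral => x; rewrite inE => xs; rewrite kg// -EFinM mulrC; congr (_ * _)%:E.
    by rewrite ger0_norm// g0//; exact: open_simplex_cube.
  - apply/measurable_EFinP; apply: measurable_funM; first exact: measurable_indic.
    exact: measurableT_comp.
  - by move=> x; rewrite lee_fin mulr_ge0// indicE.
rewrite [RHS]integral_mkcond; apply: eq_integral => w _; rewrite patchE indicE.
rewrite (_ : (w \in X @^-1` S) = (X w \in S)); last by apply/idP/idP; rewrite !inE.
case: ifP => _; rewrite ?mul0r// mul1r ger0_norm// g0//; exact: limit_point_cube.
Qed.

(** Steps are read one by one up to N: those with index in J are observed, the others skipped. *)
Lemma predicts_indices (J : seq nat) (v : nat -> 'I_m) N : uniq J -> all (leq 1) J ->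
  predicts L I A N [set w | forall l, l \in J -> (l <= N)%N -> I l w = v l]
    (fun x => (\prod_(l <- J | (l <= N)%N) tnth x (v l))%:E).
Proof.
move=> uJ J1; elim: N => [|N IH].
  rewrite (_ : [set w | _] = setT).
    apply: predicts_ext predicts_setT _ => x _; congr EFin.
    rewrite big_seq_cond big1// => l /andP[lJ]; rewrite leqn0 => /eqP l0.
    by move/allP: J1 => /(_ l lJ); rewrite l0.
  apply/seteqP; split => // w _ l lJ; rewrite leqn0 => /eqP l0.
  by move/allP: J1 => /(_ l lJ); rewrite l0.
have [NJ|NJ] := boolP (N.+1 \in J).
  have := predicts_step (v N.+1) IH.
  rewrite (_ : _ `&` _ = [set w | forall l, l \in J -> (l <= N.+1)%N -> I l w = v l]); last first.
    apply/seteqP; split => w /=.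
      by move=> [H1 H2] l lJ; rewrite leq_eqVlt => /predU1P[->//|]; exact: H1.
    move=> H; split; last exact: H.
    by move=> l lJ lN; apply: H => //; exact: leqW.
  move/predicts_ext; apply => x _; rewrite -EFinM; congr EFin.
  rewrite [RHS]big_mkcond (bigD1_seq N.+1)//= leqnn mulrC; congr (_ * _)%R.
  rewrite big_mkcond [RHS]big_mkcond; apply: eq_bigr => l _.
  by rewrite [(l <= N.+1)%N]leq_eqVlt ltnS; case: (eqVneq l N.+1) => [->|_]; rewrite ?ltnn.
have := predicts_skip hmodel IH.
rewrite (_ : [set w | _] = [set w | forall l, l \in J -> (l <= N.+1)%N -> I l w = v l]); last first.
  apply/seteqP; split => w /= H l lJ.
    by rewrite leq_eqVlt => /predU1P[E|]; [move: lJ; rewrite E (negbTE NJ)|exact: H].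
  by move=> lN; apply: H => //; exact: leqW.
move/predicts_ext; apply => x _; congr EFin.
rewrite big_seq_cond [RHS]big_seq_cond; apply: eq_bigl => l.
case: (boolP (l \in J)) => //= lJ; rewrite [in RHS]leq_eqVlt.
by case: eqVneq => // E; move: lJ; rewrite E (negbTE NJ).
Qed.

Lemma limit_cond_iid : cond_iid P (sigma_of X) I (fun i w => tnth (X w) i).
Proof.
move=> J uJ J1 v; pose N := \max_(l <- J) l.
have lN l : l \in J -> (l <= N)%N by move=> lJ; exact: (@leq_bigmax_seq _ J xpredT id l lJ isT).
have := predicts_indices v N uJ J1.
rewrite (_ : [set w | _] = [set w | forall l, l \in J -> I l w = v l]); last first.
  by apply/seteqP; split => w /= H l lJ; [apply: H => //; exact: lN|move=> _; exact: H].
move=> H; have := @cond_prob_limit _ _ _ (monomial [seq v l | l <- J]) H.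
rewrite (_ : (fun w => monomial _ (X w)) = (fun w => \prod_(l <- J) tnth (X w) (v l))%R).
  apply; first exact: measurable_monomial.
  - move=> x _; congr EFin; rewrite /monomial big_map big_seq_cond [RHS]big_seq.
    by apply: eq_bigl => l; case: (boolP (l \in J)) => //= /lN ->.
  - by move=> x /(monomial_itv [seq v l | l <- J])/andP[].
by apply/funext => w; rewrite /monomial big_map.
Qed.

End conditional_law.

(** * Law of the additions *)

Section success.
Context {R : realType}.

(* The probability of at least r successes in n trials of parameter x. *)
Fixpoint success (n r : nat) (x : R) : R :=
  match r, n with
  | 0%N, _ => 1
  | _.+1, 0%N => 0
  | r'.+1, n'.+1 => x * success n' r' x + (1 - x) * success n' r x
  end.

Lemma success_itv n r x : 0 <= x <= 1 -> 0 <= success n r x <= 1.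
Proof.
move=> /andP[x0 x1]; elim: n r => [|n IH] [|r] /=; rewrite ?lexx ?ler01//.
by have := IH r; have := IH r.+1; nra.
Qed.

Lemma measurable_success n r : measurable_fun setT (success n r).
Proof.
elim: n r => [|n IH] [|r] //=; apply: measurable_funD; apply: measurable_funM => //.
exact: measurable_funB.
Qed.

(** Markov's inequality for 2 to the power minus the number of successes, whose mean is (1 - x /
    2)^n. *)
Lemma failure_le n r x : 0 <= x <= 1 -> 1 - success n r x <= 2 ^+ r * (1 - x / 2) ^+ n.
Proof.
move=> x01; have /andP[x0 x1] := x01; have q0 : 0 <= 1 - x / 2 by lra.
elim: n r => [|n IH] [|r] /=.
- by rewrite !expr0 mulr1; lra.
- by rewrite expr0 subr0 mulr1 exprn_ege1//; lra.
- by rewrite subrr expr0 mul1r exprn_ge0.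
have h1 := IH r; have h2 := IH r.+1.
have -> : 1 - (x * success n r x + (1 - x) * success n r.+1 x) =
    x * (1 - success n r x) + (1 - x) * (1 - success n r.+1 x) by ring.
have y0 : 0 <= 1 - x by lra.
apply: (le_trans (lerD (ler_wpM2l x0 h1) (ler_wpM2l y0 h2))).
by rewrite le_eqVlt; apply/orP; left; apply/eqP; rewrite !exprS; field.
Qed.

Lemma success_cvg r x : 0 < x <= 1 -> success n r x @[n --> \oo] --> (1 : R).
Proof.
move=> /andP[x0 x1]; have x01 : 0 <= x <= 1 by rewrite (ltW x0).
apply: (@squeeze_cvgr _ _ _ _ (fun n => 1 - 2 ^+ r * (1 - x / 2) ^+ n) (cst (1 : R))).
- apply: nearW => n; have /andP[_ ->] := success_itv n r x01; rewrite andbT.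
  by have := failure_le n r x01; lra.
- rewrite -[X in _ --> X]subr0; apply: cvgB; first exact: cvg_cst.
  rewrite -[X in _ --> X](mulr0 (2 ^+ r)); apply: cvgM; first exact: cvg_cst.
  by apply: cvg_expr; rewrite ger0_norm; lra.
- exact: cvg_cst.
Qed.

End success.

Arguments additions : simpl never.
Arguments chain : simpl never.

Section additions_law.
Context {d : measure_display} {T : measurableType d} {R : realType}.
Variable P : probability T R.
Variable k : nat.
Local Notation m := k.+2.
Local Notation tup := (m.-tuple R).
Variables (L : 'I_m -> nat -> {RV P >-> R}) (I : nat -> T -> 'I_m)
  (A : nat -> {RV P >-> R}).
Hypothesis hmodel : urn_model L I A.
Variable i : 'I_m.
Local Notation X := (limit_point L).
Local Notation "\D" := (@half_dirichlet R k).
Local Open Scope ereal_scope.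

(* The first additions to color i after step t fall in the successive sets of
   Bs, all of them at one of the steps t + 1, ..., t + n. *)
Fixpoint hit (n t : nat) (Bs : seq (set R)) (w : T) : Prop :=
  match Bs, n with
  | [::], _ => True
  | _ :: _, 0%N => False
  | B :: Bs', n'.+1 => if I t.+1 w == i then B (A t.+1 w) /\ hit n' t.+1 Bs' w
                       else hit n' t.+1 Bs w
  end.

Lemma measurable_hit n t Bs : (forall B, B \in Bs -> measurable B) -> measurable (hit n t Bs).
Proof.
elim: n t Bs => [|n IH] t [|B Bs] mBs.
- exact: measurableT.
- exact: measurable0.
- exact: measurableT.
have mB : measurable B by apply: mBs; rewrite mem_head.
have mI := measurable_index hmodel t.+1 i.
rewrite (_ : hit _ _ _ = (I t.+1 @^-1` [set i] `&` (A t.+1 @^-1` B `&` hit n t.+1 Bs)) `|`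
    (~` (I t.+1 @^-1` [set i]) `&` hit n t.+1 (B :: Bs))); last first.
  apply/seteqP; split => w /=; case: eqP => E; [by left|by right|by case=> -[]|by case=> -[]].
apply: measurableU; apply: measurableI => //.
- apply: measurableI; first exact: measurable_preimage.
  by apply: IH => D hD; apply: mBs; rewrite in_cons hD orbT.
- exact: measurableC.
- exact: IH.
Qed.

Lemma hit_mono n t Bs : hit n t Bs `<=` hit n.+1 t Bs.
Proof.
elim: n t Bs => [|n IH] t [|B Bs] //= w; case: ifP => _; last exact: IH.
by move=> [Bw /IH].
Qed.

Definition count (t : nat) (w : T) : nat := \sum_(1 <= l < t.+1) (I l w == i).

Lemma countS t w : count t.+1 w = (count t w + (I t.+1 w == i))%N.
Proof. by rewrite /count big_nat_recr. Qed.

Lemma count_mono t n w : (count t w <= count (t + n) w)%N.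
Proof. by elim: n => [|n IH]; rewrite ?addn0// addnS countS (leq_trans IH)// leq_addr. Qed.

(** The count increases strictly at each selection of color i, so the step that [xget] looks for is
    unique. *)
Lemma addition_at t w : I t.+1 w = i -> additions L I A i (count t w).+1 w = A t.+1 w.
Proof.
move=> Ii; rewrite /additions; apply: xget_unique.
  by exists t.+1; split => //; rewrite -/(count t.+1 w) countS Ii eqxx addn1.
move=> a [[|n] [n0 In nk ->]]; first by [].
have nE : (count n w).+1 = (count t w).+1.
  by rewrite -nk -/(count n.+1 w) countS In eqxx addn1.
have lt_count a' b : (a' < b)%N -> I a'.+1 w = i -> (count a' w < count b w)%N.
  move=> ab Ia; apply: leq_trans (_ : (count a'.+1 w <= _)%N).
    by rewrite countS Ia eqxx addn1.
  by rewrite -(subnKC ab); exact: count_mono.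
case: (ltngtP n t) => [/lt_count/(_ In)|/lt_count/(_ Ii)|->//].
  by case: nE => ->; rewrite ltnn.
by case: nE => ->; rewrite ltnn.
Qed.

(** Relates the scan of the steps to the sequence of additions. The condition on the counts ensures
    that none of the terms read is the default value 0. *)
Lemma hitP n t Bs w : hit n t Bs w <-> ((count t w + size Bs <= count (t + n) w)%N /\
  forall l, (l < size Bs)%N -> nth setT Bs l (additions L I A i (count t w + l).+1 w)).
Proof.
elim: n t Bs => [|n IH] t [|B Bs] /=.
- by rewrite !addn0; split.
- by rewrite !addn0 addnS ltnNge leq_addr; split => // -[].
- by split => // _; split => //; rewrite addn0; exact: count_mono.
rewrite [(t + n.+1)%N]addnS -[(t + n).+1]addSn; case: (eqVneq (I t.+1 w) i) => Ii; last first.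
  by rewrite (IH t.+1 (B :: Bs)) countS (negbTE Ii) addn0.
rewrite (IH t.+1 Bs) countS Ii eqxx addn1 [((count t w).+1 + size Bs)%N]addSnnS; split.
  move=> [Bw [h1 h2]]; split => // -[_|l lB]; first by rewrite addn0 addition_at.
  by have := h2 l lB; rewrite addSn addnS.
move=> [h1 h2]; split.
  by have := h2 0%N isT; rewrite addn0 addition_at.
by split => // l lB; have := h2 l.+1 lB; rewrite addnS addSn.
Qed.

Lemma measurable_count_color t : measurable_fun setT (fun w => (count t w)%:R : R).
Proof.
elim: t => [|t IH].
  by rewrite (_ : (fun w => _) = cst 0%R)//; apply/funext => w; rewrite /count big_geq.
rewrite (_ : (fun w => _) = (fun w => (count t w)%:R + \1_(I t.+1 @^-1` [set i]) w)%R).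
  by apply: measurable_funD => //; exact/measurable_indic/(measurable_index hmodel).
apply/funext => w; rewrite countS natrD indicE; congr (_ + _%:R)%R; congr nat_of_bool.
by apply/eqP/idP; rewrite inE.
Qed.

Lemma measurable_additions l : measurable_fun setT (additions L I A i l).
Proof.
case: l => [|l]; first exact: measurable_funP.
pose G n := I n.+1 @^-1` [set i] `&` (fun w => (count n w)%:R : R) @^-1` [set l%:R%R].
have mG n : measurable (G n).
  apply: measurableI; first exact: (measurable_index hmodel).
  exact: (measurable_preimage (measurable_count_color n) (measurable_set1 _)).
have GE n w : G n w -> I n.+1 w = i /\ additions L I A i l.+1 w = A n.+1 w.
  move=> [/= In /eqP]; rewrite eqr_nat => /eqP <-; split => //.
  exact: addition_at.
move=> _ B mB; rewrite setTI.
rewrite (_ : _ @^-1` B = (\bigcup_n (G n `&` A n.+1 @^-1` B)) `|`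
    (~` (\bigcup_n G n) `&` [set _ | B 0%R])).
  apply: measurableU.
    by apply: bigcupT_measurable => n; apply: measurableI => //; exact: measurable_preimage.
  apply: measurableI; first by apply: measurableC; exact: bigcupT_measurable.
  by case: (pselect (B 0%R)) => h; [rewrite (_ : [set _ | _] = setT)|rewrite (_ : [set _ | _] = set0)];
    rewrite //; apply/seteqP; split.
have none w : ~ (\bigcup_n G n) w -> additions L I A i l.+1 w = 0%R.
  move=> nG; apply: xgetPN => a [[|n] [n0 In nl _]]; first by [].
  apply: nG; exists n => //; split => //=; congr (_%:R).
  by move: nl; rewrite -/(count n.+1 w) countS In eqxx addn1 => -[].
apply/seteqP; split => w /=.
  case: (pselect ((\bigcup_n G n) w)) => [[n _ Gn] Bw|nG Bw].
    by left; exists n => //; split => //=; have [_ <-] := GE _ _ Gn.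
  by right; split => //; rewrite -(none w nG).
case=> [[n _ [Gn /=]]|[nG B0w]]; first by have [_ ->] := GE _ _ Gn.
by rewrite (none w nG).
Qed.

Variable B0 : 'I_m -> set R.
Hypothesis mB0 : forall j, measurable (B0 j).

(* Steps st have been observed, and the next additions to color i fall in Bs,
   whatever the steps at which they occur. *)
Definition pending_kernel (st : seq ('I_m * set R)) (Bs : seq (set R)) : tup -> \bar R :=
  chain_kernel (fun j => size (selected j st))
    (fun j => B0 j :: selected j st ++ (if j == i then Bs else [::])).

Lemma measurable_pending_kernel st Bs : measurable_steps st -> (forall B, B \in Bs -> measurable B) ->
  measurable_fun open_simplex (pending_kernel st Bs).
Proof.
move=> mst mBs; apply: measurable_chain_kernel => j B.
rewrite in_cons mem_cat => /predU1P[->//|/orP[]]; first exact: measurable_selected.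
by case: ifP => // _; exact: mBs.
Qed.

(** When color i is selected, B constrains this addition and is used up; when another color is, the
    addition is free and every set stays pending. *)
Let next_set (B : set R) j := if j == i then B else setT.
Let next_sets (B : set R) Bs j := if j == i then Bs else B :: Bs.

Let selected_last (l j : 'I_m) (C : set R) st :
  selected l (st ++ [:: (j, C)]) = selected l st ++ (if j == l then [:: C] else [::]).
Proof. by rewrite selected_cat {2}/selected/=; case: ifP. Qed.

(** A selection of color j costs a factor x_j. For j = i the set B only moves from the pending part
    of the chain to the observed part; for another color the free gap disappears by
    [chain_cat_setT]. *)
Lemma pending_kernel_step st B Bs j x : open_simplex x ->
  pending_kernel (st ++ [:: (j, next_set B j)]) (next_sets B Bs j) x =
  (tnth x j)%:E * pending_kernel st (B :: Bs) x.
Proof.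
move=> [x0 _]; rewrite /pending_kernel /chain_kernel.
rewrite (bigD1 j)//= [in RHS](bigD1 j)//= [RHS]muleA; congr (_ * _); last first.
  apply: eq_bigr => l lj; rewrite selected_last [j == l]eq_sym (negbTE lj) cats0.
  by case: (eqVneq l i) => [li|//]; rewrite /next_sets -li [j == l]eq_sym (negbTE lj).
rewrite selected_last eqxx size_cat addn1 exprS EFinM -[LHS]muleA; congr (_ * (_ * _)).
rewrite /next_set /next_sets; case: (eqVneq j i) => _; first by rewrite -catA.
by rewrite !cats0 -cat_cons -(chain_cat_setT (B0 j :: selected j st) 1 (x0 j) (lexx _)).
Qed.

Lemma sum_next_success n B Bs (x : tup) : open_simplex x ->
  (\sum_j tnth x j * success n (size (next_sets B Bs j)) (tnth x i) =
   success n.+1 (size Bs).+1 (tnth x i))%R.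
Proof.
move=> [_ x1]; rewrite (bigD1 i)//= /next_sets eqxx; congr (_ + _)%R.
have -> : (1 - tnth x i = \sum_(j | j != i) tnth x j)%R by rewrite -x1 (bigD1 i)//= addrAC subrr add0r.
rewrite mulr_suml; apply: eq_bigr => j ji; by rewrite (negbTE ji).
Qed.

(** Given x, the values of the additions are independent of the times at which color i is selected,
    whence a product. Splitting according to the color of the next step reproduces the recursion
    that defines [success]. *)
Lemma hit_law n st Bs S : measurable_steps st -> (forall B, B \in Bs -> measurable B) -> measurable S ->
  P (initial_event L B0 `&` step_event I A 0 st `&` X @^-1` S `&` hit n (size st) Bs) =
  \int[\D]_(x in open_simplex)
     (pending_kernel st Bs x * (success n (size Bs) (tnth x i) * \1_S x)%:E).
Proof.
move=> + + mS; elim: n st Bs => [|n IH] st [|B Bs] mst mBs.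
- rewrite (_ : hit _ _ _ = setT) ?setIT; last by apply/seteqP; split.
  rewrite (limit_law hmodel (predicts_initial hmodel mB0 mst) mS); apply: eq_integral => x _.
  rewrite mul1r /pending_kernel; congr (chain_kernel _ _ _ * _).
  by apply/funext => j; rewrite if_same cats0.
- rewrite (_ : hit _ _ _ = set0) ?setI0 ?measure0; last by apply/seteqP; split.
  by rewrite integral0_eq// => x _; rewrite mul0r mule0.
- rewrite (_ : hit _ _ _ = setT) ?setIT; last by apply/seteqP; split.
  rewrite (limit_law hmodel (predicts_initial hmodel mB0 mst) mS); apply: eq_integral => x _.
  rewrite mul1r /pending_kernel; congr (chain_kernel _ _ _ * _).
  by apply/funext => j; rewrite if_same cats0.
have mB : measurable B by apply: mBs; rewrite mem_head.
have mBs' D : D \in Bs -> measurable D by move=> hD; apply: mBs; rewrite in_cons hD orbT.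
have mns j : measurable_steps (st ++ [:: (j, next_set B j)]).
  move=> p; rewrite mem_cat inE => /orP[/mst//|/eqP ->].
  by rewrite /= /next_set; case: ifP.
have mnb j D : D \in next_sets B Bs j -> measurable D.
  by rewrite /next_sets; case: ifP => _; [exact: mBs'|exact: mBs].
have mX := measurable_limit_point hmodel.
rewrite (index_partition hmodel (size st).+1); last first.
  apply: measurableI; last exact: measurable_hit.
  apply: measurableI; last exact: measurable_preimage.
  apply: measurableI; last exact: (measurable_step_event hmodel).
  by apply: (measurable_history hmodel (n := 0)); apply: (history_initial_event hmodel).
transitivity (\sum_(j < m) \int[\D]_(x in open_simplex)
    (pending_kernel st (B :: Bs) x * ((tnth x j * success n (size (next_sets B Bs j)) (tnth x i)) * \1_S x)%:E)).
  apply: eq_bigr => j _.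
  transitivity (P (initial_event L B0 `&` step_event I A 0 (st ++ [:: (j, next_set B j)]) `&`
      X @^-1` S `&` hit n (size (st ++ [:: (j, next_set B j)])) (next_sets B Bs j))).
    congr (P _); rewrite step_event_cat add0n size_cat addn1.
    apply/seteqP; split => w /=.
      move=> [[[[h1 h2] h3] h4] E]; move: h4; rewrite E /next_set /next_sets.
      case: (pselect (j = i)) => [->|/eqP/negbTE ji]; rewrite ?eqxx ?ji; first by tauto.
      by have hT : [set: R] (A (size st).+1 w) by []; tauto.
    rewrite /next_set /next_sets.
    move=> [[[h1 [h2 [[E h5] _]]] h3] h4]; rewrite E.
    by move: h5 h4; case: (pselect (j = i)) => [->|/eqP/negbTE ji]; rewrite ?eqxx ?ji; tauto.
  rewrite [LHS](IH _ _ (mns j) (mnb j)); apply: eq_integral => x; rewrite inE => xs.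
  rewrite pending_kernel_step// muleAC [RHS]muleC -mulrA EFinM muleA; congr (_ * _).
  by rewrite -!EFinM mulrA.
have x01 (x : tup) : open_simplex x -> (0 <= tnth x i <= 1)%R by move=> /open_simplex_cube; apply.
rewrite -ge0_integral_sum//; first last.
- move=> j x xs; rewrite mule_ge0 ?chain_kernel_ge0// lee_fin mulr_ge0 ?indicE// mulr_ge0//.
    by apply: ltW; case: xs.
  by have /andP[] := success_itv n (size (next_sets B Bs j)) (x01 x xs).
- move=> j; apply: emeasurable_funM; first exact: measurable_pending_kernel.
  apply: measurable_funTS; apply/measurable_EFinP.
  apply: measurable_funM; last exact: measurable_indic.
  apply: measurable_funM; first exact: measurable_tnth.
  exact: (measurableT_comp (measurable_success _ _) (measurable_tnth i)).
- exact: measurable_open_simplex.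
apply: eq_integral => x; rewrite inE => xs.
rewrite -ge0_sume_distrr; last first.
  move=> j _; rewrite lee_fin mulr_ge0 ?indicE// mulr_ge0//; first by apply: ltW; case: xs.
  by have /andP[] := success_itv n (size (next_sets B Bs j)) (x01 x xs).
by rewrite sumEFin -mulr_suml sum_next_success.
Qed.

(** On the open simplex x_i is positive, so the probability of enough selections tends to 1 as n
    grows. The bound on the kernel provides the domination. *)
Lemma hits_law Bs S : (forall B, B \in Bs -> measurable B) -> measurable S ->
  (forall x, open_simplex x -> pending_kernel [::] Bs x <= 1) ->
  P (\bigcup_n (initial_event L B0 `&` X @^-1` S `&` hit n 0 Bs)) =
  \int[\D]_(x in open_simplex) (pending_kernel [::] Bs x * (\1_S x)%:E).
Proof.
move=> mBs mS q1; pose F n := initial_event L B0 `&` X @^-1` S `&` hit n 0 Bs.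
have mst : measurable_steps ([::] : seq ('I_m * set R)) by [].
have mF n : measurable (F n).
  apply: measurableI; last exact: measurable_hit.
  apply: measurableI; last exact: (measurable_preimage (measurable_limit_point hmodel)).
  by apply: (measurable_history hmodel (n := 0)); apply: (history_initial_event hmodel).
have cF : P (F n) @[n --> \oo] --> P (\bigcup_n F n).
  apply: nondecreasing_cvg_mu => //; first exact: bigcupT_measurable.
  apply/nondecreasing_seqP => n; apply/subsetPset => w [h1 h2]; split => //.
  exact: hit_mono.
have os := @measurable_open_simplex R k.
have q0 (x : tup) : open_simplex x -> 0 <= pending_kernel [::] Bs x by exact: chain_kernel_ge0.
have x01 (x : tup) : open_simplex x -> (0 < tnth x i <= 1)%R.
  by move=> xs; have /andP[_ ->] := open_simplex_cube xs i; rewrite andbT; case: xs.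
have [||||| _ _] := @dominated_convergence _ _ _ (\D : {measure set tup -> \bar R}) open_simplex os
  (fun n x => pending_kernel [::] Bs x * (success n (size Bs) (tnth x i) * \1_S x)%:E)
  (fun x => pending_kernel [::] Bs x * (\1_S x)%:E) (cst 1).
- move=> n; apply: emeasurable_funM; first exact: measurable_pending_kernel.
  apply: measurable_funTS; apply/measurable_EFinP; apply: measurable_funM; last exact: measurable_indic.
  exact: (measurableT_comp (measurable_success _ _) (measurable_tnth i)).
- apply: emeasurable_funM; first exact: measurable_pending_kernel.
  by apply: measurable_funTS; apply/measurable_EFinP; exact: measurable_indic.
- apply: aeW => x xs; apply: cvgeZl.
    by rewrite ge0_fin_numE ?q0// (le_lt_trans (q1 x xs))// ltry.
  apply: cvg_EFin; first exact: nearW.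
  rewrite -[X in _ --> X]mul1r; apply: cvgM; last exact: cvg_cst.
  by apply: success_cvg; exact: x01.
- apply/integrableP; split; first exact: measurable_cst.
  rewrite (_ : (fun x => `|cst 1 x|) = cst 1); last by apply/funext => x /=; rewrite normr1.
  rewrite -(limit_integral hmodel (g := cst 1))//.
  rewrite integral_cst// mul1e; apply: (le_lt_trans (probability_le1 P measurableT)); exact: ltry.
- apply: aeW => x n xs; have /andP[x0 x1] := x01 x xs.
  have /andP[s0 s1] : (0 <= success n (size Bs) (tnth x i) <= 1)%R by apply: success_itv; rewrite (ltW x0).
  have s01 : (0 <= success n (size Bs) (tnth x i) * \1_S x <= 1)%R.
    by rewrite indicE; case: (_ \in _); rewrite ?mulr1 ?mulr0 ?s0 ?s1 ?lexx ?ler01.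
  have /andP[t0 t1] := s01.
  rewrite gee0_abs; last by rewrite mule_ge0 ?q0.
  apply: le_trans (q1 x xs); rewrite -[leRHS]mule1; apply: lee_wpmul2l; first exact: q0.
  by rewrite lee_fin.
move=> cI; apply: (cvg_unique _ cF); first exact: ereal_hausdorff.
rewrite (_ : (fun n => P (F n)) = (fun n => \int[\D]_(x in open_simplex)
  (pending_kernel [::] Bs x * (success n (size Bs) (tnth x i) * \1_S x)%:E))); first exact: cI.
apply/funext => n; rewrite -(hit_law n mst mBs mS); congr (P _).
by rewrite /F /= setIT.
Qed.

End additions_law.

(** * From boxes to all events on the sequence of additions *)

Section sequence_space.
Context {R : realType}.

Definition seq_coordinates : set (set (nat -> R)) :=
  [set E | exists (k : nat) (B : set R), measurable B /\ E = [set x | B (x k)]].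

(** Its measurable sets are those of [seq_measurable] by conversion, which makes sequences available
    as values of measurable maps. *)
Definition seq_space := g_sigma_algebraType seq_coordinates.

Lemma measurable_to_seq d (X : measurableType d) (f : nat -> X -> R) :
  (forall l, measurable_fun setT (f l)) ->
  measurable_fun setT (fun x => (fun l => f l x) : seq_space).
Proof.
move=> mf; apply: (@measurability _ _ _ seq_space _ _ seq_coordinates) => // _ [_ [l [B [mB ->]]] <-].
exact: mf.
Qed.

Definition seq_box (r : nat) (Bf : nat -> set R) : set seq_space :=
  [set x | forall l, (l <= r)%N -> Bf l (x l)].

Definition seq_boxes : set (set seq_space) :=
  [set E | exists r Bf, (forall l, measurable (Bf l)) /\ E = seq_box r Bf].

Lemma seq_boxes_generate : @measurable _ seq_space = <<s seq_boxes >>.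
Proof.
apply/seteqP; split.
  apply: smallest_sub; first exact: smallest_sigma_algebra.
  move=> _ [l [B [mB ->]]]; apply: sub_sigma_algebra.
  exists l, (fun j => if j == l then B else setT); split; first by move=> j; case: ifP.
  apply/seteqP; split => x /=; first by move=> Bx j _; case: eqP => [->|].
  by move/(_ l (leqnn l)); rewrite eqxx.
apply: smallest_sub; first exact: sigma_algebra_measurable.
move=> _ [r [Bf [mBf ->]]].
rewrite (_ : seq_box r Bf = \bigcap_(l in `I_r.+1) [set x | Bf l (x l)]).
  apply: (@fin_bigcap_measurable _ seq_space) => [|l _]; first exact: finite_II.
  by apply: sub_sigma_algebra; exists l, (Bf l).
by apply/seteqP; split => x /= H l; exact: H.
Qed.

Lemma setI_closed_seq_boxes : setI_closed seq_boxes.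
Proof.
move=> _ _ [r1 [B1 [m1 ->]]] [r2 [B2 [m2 ->]]].
exists (maxn r1 r2), (fun l => (if (l <= r1)%N then B1 l else setT) `&` (if (l <= r2)%N then B2 l else setT)).
split; first by move=> l; apply: measurableI; case: ifP.
apply/seteqP; split => x /=.
  by move=> [H1 H2] l _; split; case: ifP => // h; [exact: H1|exact: H2].
move=> H; split => l lr.
  by have [] := H l (leq_trans lr (leq_maxl _ _)); rewrite lr.
by have [_] := H l (leq_trans lr (leq_maxr _ _)); rewrite lr.
Qed.

End sequence_space.

Section additions_conditional_law.
Context {d : measure_display} {T : measurableType d} {R : realType}.
Variable P : probability T R.
Variable k : nat.
Local Notation m := k.+2.
Local Notation tup := (m.-tuple R).
Variables (L : 'I_m -> nat -> {RV P >-> R}) (I : nat -> T -> 'I_m)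
  (A : nat -> {RV P >-> R}).
Hypothesis hmodel : urn_model L I A.
Context {d' : measure_display} {T' : measurableType d'}.
Variables (Q : probability T' R) (N : R -> T' -> nat).
Hypothesis hN : poisson_process Q (fun t : R => t) N.
Variable i : 'I_m.
Local Notation X := (limit_point L).
Local Notation "\D" := (@half_dirichlet R k).
Local Open Scope ereal_scope.

Definition scaled_interjumps (z : tup * T') : seq_space :=
  fun l => (Num.sqrt (tnth z.1 i) * interjump_time N l z.2)%R.

Definition interjump_prob (B : set (nat -> R)) (x : tup) : \bar R :=
  Q [set w' | B (scaled_interjumps (x, w'))].

Lemma measurable_scaled_interjumps : measurable_fun setT scaled_interjumps.
Proof.
apply: measurable_to_seq => l; apply: measurable_funM.
  apply: (measurableT_comp (@measurable_sqrt R)).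
  exact: (measurableT_comp (measurable_tnth i)).
exact: (measurableT_comp (measurable_interjump_time hN l)).
Qed.

Lemma interjump_prob_xsection B x :
  interjump_prob B x = Q (xsection (scaled_interjumps @^-1` B) x).
Proof. by congr (Q _); apply/seteqP; split => w; rewrite /xsection/= inE. Qed.

Lemma measurable_interjump_prob B : seq_measurable B -> measurable_fun setT (interjump_prob B).
Proof.
move=> mB; rewrite (_ : interjump_prob B = Q \o xsection (scaled_interjumps @^-1` B)).
  by apply: measurable_fun_xsection; apply: (measurable_preimage measurable_scaled_interjumps).
by apply/funext => x; exact: interjump_prob_xsection.
Qed.

Lemma measurable_interjump_set B x : seq_measurable B ->
  measurable [set w' | B (scaled_interjumps (x, w'))].
Proof.
move=> mB; apply: (@measurable_preimage _ _ _ seq_space) mB.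
exact: (measurableT_comp measurable_scaled_interjumps (pair1_measurable x)).
Qed.

(** [hits_law] gives the law together with the event that color i is selected at least r times.
    Applied with all sets equal to [setT], it shows that this event has probability 1, so that
    default values in [additions] are negligible. *)
Lemma additions_box_law r Bf S : (forall l, measurable (Bf l)) -> measurable S ->
  P ([set w | seq_box r Bf (fun l => additions L I A i l w)] `&` X @^-1` S) =
  \int[\D]_(x in open_simplex) (interjump_prob (seq_box r Bf) x * (\1_S x)%:E).
Proof.
(* Only color i is constrained; the chains of the other colors consist of one free gap and have mass
   1. *)
have kernelE (Cf : nat -> set R) (x : tup) : (forall l, measurable (Cf l)) -> open_simplex x ->
    pending_kernel i (fun j => if j == i then Cf 0%N else setT) [::] (mkseq (fun l => Cf l.+1) r) x =
    interjump_prob (seq_box r Cf) x.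
  move=> mCf [x0 _]; rewrite /pending_kernel /chain_kernel (bigD1 i)//= eqxx expr0 mul1e.
  rewrite big1 ?mule1; last first.
    move=> j /negbTE ->; rewrite expr0 mul1e.
    have := @chain_cat_setT R (tnth x j) 0%R [::] 1 (x0 j) (lexx _); rewrite /= => ->.
    by rewrite /chain/= /chain_base expr0n mul0r oppr0 expR0.
  rewrite -(interjump_chain hN (n := r) (x0 i)); first last.
  - by move=> B; rewrite in_cons => /predU1P[->//|/mapP[l _ ->]].
  - by rewrite /= size_mkseq.
  congr (Q _); apply/seteqP; split => w H l lr.
    by have := H l lr; case: l lr => [|l] lr //=; rewrite nth_mkseq.
  by have := H l lr; case: l lr => [|l] lr //=; rewrite nth_mkseq.
have hitsE (Cf : nat -> set R) S' : (forall l, measurable (Cf l)) -> measurable S' ->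
    P (\bigcup_n (initial_event L (fun j => if j == i then Cf 0%N else setT) `&` X @^-1` S' `&`
      hit I A i n 0 (mkseq (fun l => Cf l.+1) r))) =
    \int[\D]_(x in open_simplex) (interjump_prob (seq_box r Cf) x * (\1_S' x)%:E).
  move=> mCf mS'; rewrite (hits_law hmodel)//.
  - by apply: eq_integral => x; rewrite inE => xs; rewrite kernelE.
  - by move=> j; case: ifP.
  - by move=> B /mapP[l _ ->]; exact: mCf.
  - move=> x xs; rewrite kernelE//; apply: probability_le1; apply: measurable_interjump_set.
    by rewrite -[seq_measurable]/(@measurable _ seq_space) seq_boxes_generate;
      apply: sub_sigma_algebra; exists r, Cf.
move=> mBf mS.
pose G := \bigcup_n hit I A i n 0 (nseq r (setT : set R)).
have mG : measurable G.
  apply: bigcupT_measurable => n; apply: (measurable_hit hmodel) => B /nseqP[-> _].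
  exact: measurableT.
have PG : P G = 1.
  have := hitsE (fun=> setT) setT (fun=> measurableT) measurableT.
  rewrite (_ : \bigcup_n _ = G); last first.
    have E : mkseq (fun=> setT) r = nseq r (setT : set R).
      by apply: (@eq_from_nth _ setT) => [|l]; rewrite size_mkseq ?size_nseq// => lr; rewrite nth_mkseq// nth_nseq lr.
    rewrite E; apply: eq_bigcup => // n _; apply/seteqP; split => w; first by case.
    by move=> h; split => //; split => // j; case: ifP.
  move=> ->; rewrite (_ : seq_box r _ = setT); last by apply/seteqP; split.
  transitivity (\int[\D]_(x in open_simplex) cst 1 x).
    apply: eq_integral => x _; rewrite indicE mem_set// mule1.
    exact: probability_setT.
  rewrite -(limit_integral hmodel (g := cst 1))// integral_cst// mul1e.
  exact: probability_setT.
have mE : measurable ([set w | seq_box r Bf (fun l => additions L I A i l w)] `&` X @^-1` S).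
  apply: measurableI; last exact: (measurable_preimage (measurable_limit_point hmodel)).
  apply: (@measurable_preimage _ _ _ seq_space (fun w => (fun l => additions L I A i l w) : seq_space)).
    by apply: measurable_to_seq => l; exact: (measurable_additions hmodel).
  by rewrite seq_boxes_generate; apply: sub_sigma_algebra; exists r, Bf.
rewrite [LHS](measure_full_setI mG mE (probability_setT P) PG) -hitsE//; congr (P _).
have c0 w : count I i 0 w = 0%N by rewrite /count big_geq.
apply/seteqP; split => w.
  move=> [[n _ /(hitP L)[cn _]] [Ew Sw]]; exists n => //; split.
    by split => // j; case: eqP => // ->; exact: (Ew 0%N).
  apply/(hitP L); rewrite size_mkseq; rewrite size_nseq in cn; split => // l lr.
  by rewrite nth_mkseq// c0; exact: Ew.
move=> [n _ [[iw Sw] /(hitP L)[cn h]]]; rewrite size_mkseq in cn h; split.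
  exists n => //; apply/(hitP L); rewrite size_nseq; split => // l lr.
  by rewrite nth_nseq lr.
split => // -[_|l lr] /=; first by have := iw i; rewrite eqxx.
by have := h l lr; rewrite nth_mkseq// c0.
Qed.

(** For a fixed event on the limit point, both sides are finite measures in B; the second is the
    image of a product, the law of the limit point on that event times Q. They agree on boxes, a
    pi-system that generates the product sigma-algebra. *)
Lemma additions_cond_prob B : seq_measurable B ->
  is_cond_prob P (sigma_of X) [set w | B (fun l => additions L I A i l w)]
    (fun w => fine (interjump_prob B (X w))).
Proof.
move=> mB; have mX := measurable_limit_point hmodel; split.
  move=> C mC; exists ((fun x => fine (interjump_prob B x)) @^-1` C); last by rewrite setTI.
  apply: measurable_preimage mC; apply: measurableT_comp => //.
  exact: measurable_interjump_prob.
move=> _ [S mS <-]; rewrite setTI.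
have mD : measurable (X @^-1` S) by exact: measurable_preimage.
pose Psi w : seq_space := fun l => additions L I A i l w.
have mPsi : measurable_fun setT Psi.
  by apply: measurable_to_seq => l; exact: (measurable_additions hmodel).
have ind0 w : (0 <= \1_(X @^-1` S) w :> R)%R by rewrite indicE.
have mind : measurable_fun setT (\1_(X @^-1` S) : T -> R) by exact: measurable_indic.
pose la := weighted_law P ind0 mind mX.
pose mu := pushforward (mrestr P mD) Psi.
pose nu := pushforward (la \x Q) scaled_interjumps.
have nuE C : seq_measurable C ->
    nu C = \int[P]_w ((\1_(X @^-1` S) w)%:E * interjump_prob C (X w)).
  move=> mC; transitivity (\int[la]_x interjump_prob C x).
    by apply: eq_integral => x _; rewrite interjump_prob_xsection.
  by rewrite weighted_law_integral//; exact: measurable_interjump_prob.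
have box_meas r (Bf : nat -> set R) : (forall l, measurable (Bf l)) -> seq_measurable (seq_box r Bf).
  move=> mBf; rewrite -[seq_measurable]/(@measurable _ seq_space) seq_boxes_generate.
  by apply: sub_sigma_algebra; exists r, Bf.
have munu r Bf : (forall l, measurable (Bf l)) -> mu (seq_box r Bf) = nu (seq_box r Bf).
  move=> mBf; rewrite nuE; last exact: box_meas.
  rewrite [LHS](additions_box_law r mBf mS).
  rewrite -(limit_integral hmodel (g := fun x => interjump_prob (seq_box r Bf) x * (\1_S x)%:E)).
  - by apply: eq_integral => w _; rewrite muleC.
  - apply: emeasurable_funM; first by apply: measurable_interjump_prob; exact: box_meas.
    by apply/measurable_EFinP; exact: measurable_indic.
  - by move=> x; rewrite mule_ge0 ?lee_fin ?indicE.
have -> : P ([set w | B (fun l => additions L I A i l w)] `&` X @^-1` S) = nu B.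
  rewrite -[LHS]/(mu B).
  apply: (@eq_measure_on_generator _ seq_space _ seq_boxes mu nu) => //.
  - exact: measurable_scaled_interjumps.
  - exact: seq_boxes_generate.
  - exact: setI_closed_seq_boxes.
  - apply: (@le_lt_trans _ _ 1); last exact: ltry.
    rewrite -[leLHS]/(P (Psi @^-1` setT `&` X @^-1` S)); apply: probability_le1.
    by rewrite preimage_setT setTI.
  - move=> h; rewrite -[LHS]/(mu setT) -[RHS]/(nu setT).
    by rewrite (_ : setT = seq_box 0 (fun=> setT)) ?munu//; apply/seteqP; split.
  - by move=> h _ [r [Bf [mBf ->]]]; exact: munu.
rewrite nuE// [RHS]integral_mkcond; apply: eq_integral => w _; rewrite patchE indicE.
case: ifP => _; rewrite ?mul0e// mul1e fineK// fin_num_measure//.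
exact: measurable_interjump_set.
Qed.

End additions_conditional_law.

Theorem theorem21 (R : realType) (d : measure_display) (T : measurableType d)
    (P : probability T R) (m : nat) (hm : (2 <= m)%N)
    (L : 'I_m -> nat -> {RV P >-> R}) (I : nat -> T -> 'I_m)
    (A : nat -> {RV P >-> R}) (hmodel : urn_model L I A) :
  exists Plim : {RV P >-> m.-tuple R},
    [/\ {ae P, forall w, forall i : 'I_m,
          (fun n : nat => proportion L i n w) @ \oo --> tnth (Plim w) i},
        is_dirichlet P (fun _ : 'I_m => 1 / 2) Plim,
        cond_iid P (sigma_of Plim) I (fun i w => tnth (Plim w) i) &
        forall (d' : measure_display) (T' : measurableType d')
          (Q : probability T' R) (N : R -> T' -> nat),
          poisson_process Q (fun t : R => t) N ->
          forall (i : 'I_m) (B : set (nat -> R)), seq_measurable B ->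
            is_cond_prob P (sigma_of Plim)
              [set w | B (fun k => additions L I A i k w)]
              (fun w => fine (Q [set w' |
                 B (fun k => Num.sqrt (tnth (Plim w) i) *
                             interjump_time N k w')]))].
Proof.
case: m hm L I hmodel => [|[|k]]// _ L I hmodel.
pose X : {RV P >-> k.+2.-tuple R} := HB.pack (limit_point L)
  (isMeasurableFun.Build _ _ _ _ (limit_point L) (measurable_limit_point hmodel)).
exists X; split.
- exact: (ae_proportion_cvg hmodel).
- exact: (limit_point_dirichlet hmodel).
- exact: (limit_cond_iid hmodel).
- move=> d' T' Q N hN i B mB.
  exact: (additions_cond_prob hmodel hN i mB).
Qed.
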